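(* Let $p$ be a prime, $K_0/\mathbb{Q}_p$ a finite extension with uniformizer $\pi$, $K/K_0$ a finite unramified extension, $L/K$ a finite extension, and $M/L$ a finite unramified extension with Galois group $G=\mathrm{Gal}(M/L)$ of order $p^m$, generated by $\sigma$. Let $F$ be a Honda formal group over $\mathcal{O}_K$ relative to $K/K_0$ and $\pi$, of height $h$, and put $n=[L:K_0]$. Suppose that $W_F\cap F(\mathfrak{p}_L)=W_F\cap F(\mathfrak{p}_M)=W^s_F$ for some $s\geq 1$. Then $h\leq n$, and the $\mathcal{O}_{K_0}[G]$-module $F(\mathfrak{p}_M)$ has a system of generators $\theta_j$ ($1\le j\le n-h$), $\xi_i,\omega_i$ ($1\le i\le h$) whose only defining relations are $$[\pi^s]_F(\xi_i)=\sigma(\omega_i)\underset{F}{-}\omega_i,\qquad 1\leq i\leq h.$$ That is, these $n+h$ elements generate $F(\mathfrak{p}_M)$ as an $\mathcal{O}_{K_0}[G]$-module, and the kernel of the surjection $\mathcal{O}_{K_0}[G]^{n+h}\to F(\mathfrak{p}_M)$ sending the standard basis vectors to these generators is the $\mathcal{O}_{K_0}[G]$-submodule generated by the $h$ elements $\pi^s e_{\xi_i}-(\sigma-1)e_{\omega_i}$.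
   Context: Honda formal groups: let $q=|k_0|$ where $k_0$ is the residue field of $K_0$, and let $\varphi$ be the Frobenius automorphism of $K/K_0$ (acting on power series coefficientwise). $\mathcal{O}_{K,\varphi}[[T]]$ is the noncommutative power series ring with $Ta=\varphi(a)T$ for $a\in\mathcal{O}_K$, acting on $K[[X]]$ by $T*g(X)=g^{\varphi}(X^q)$. A type is $u=\pi+\sum_{i\ge1}a_iT^i$ with $a_i\in\mathcal{O}_K$; its height $h$ is the least $i$ with $a_i$ a unit. A one-dimensional formal group $F$ over $\mathcal{O}_K$ with logarithm $f$ is a Honda formal group relative to $K/K_0$ of type $u$ if $u*f\equiv 0 \pmod{\pi}$ coefficientwise; the height of $F$ is the height of $u$. There is a ring embedding $\mathcal{O}_{K_0}\hookrightarrow\mathrm{End}_{\mathcal{O}_K}(F)$, $a\mapsto [a]_F$, with $f\circ[a]_F=af$. For a finite extension $E/K$, $F(\mathfrak{p}_E)$ denotes the maximal ideal $\mathfrak{p}_E$ of $\mathcal{O}_E$ with group law $x\underset{F}{+}y=F(x,y)$; it is an $\mathcal{O}_{K_0}$-module via $a\cdot x=[a]_F(x)$ and, for $E=M$, an $\mathcal{O}_{K_0}[G]$-module with $G$ acting naturally. $W^k_F=\{x\in\mathfrak{p}_{K^{\mathrm{alg}}}:[\pi^k]_F(x)=0\}$ and $W_F=\bigcup_{k\ge1}W^k_F$. *)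

(* Defs.v *)
From HB Require Import structures.
From mathcomp Require Import all_boot all_order all_fingroup all_algebra.
From mathcomp Require Import all_solvable all_field.
From mathcomp Require Import mpoly boolp.

Set Implicit Arguments.
Unset Strict Implicit.
Unset Printing Implicit Defensive.

Import GRing.Theory.
Local Open Scope ring_scope.

(* Z_p as the inverse limit of the Z/p^n: the class mod p^n is represented by
   its least nonnegative residue. *)
Record padic_int (p : nat) (p_pr : prime p) := PadicInt {
  padic_res :> nat -> nat;
  padic_resP : forall n, padic_res n = (padic_res n.+1 %% p ^ n)%N }.

Section PadicIntRing.
Variables (p : nat) (p_pr : prime p).
Local Notation Zp := (padic_int p_pr).
Implicit Types a b c : Zp.

HB.instance Definition _ := gen_eqMixin Zp.
HB.instance Definition _ := gen_choiceMixin Zp.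

Lemma padic_int_eq a b : (forall n, a n = b n) -> a = b.
Proof.
case: a b => [a aP] [b bP] /= /funext eab; case: _ / eab bP => bP.
by congr PadicInt; apply: Prop_irrelevance.
Qed.

Lemma padic_res_mod a n k : (a (n + k) %% p ^ n)%N = a n.
Proof.
elim: k => [|k IH]; first by rewrite addn0 padic_resP modn_mod.
rewrite addnS -IH [a (n + k)%N]padic_resP modn_dvdm //.
by rewrite expnD dvdn_mulr.
Qed.

Lemma padic_res_modn a n : (a n %% p ^ n)%N = a n.
Proof. by rewrite -{1}[n]addn0 padic_res_mod. Qed.

Lemma modn_exp_step x n : (x %% p ^ n = x %% p ^ n.+1 %% p ^ n)%N.
Proof. by rewrite modn_dvdm // expnS dvdn_mull. Qed.

Definition padic_of_nat x : Zp := @PadicInt p p_pr _ (modn_exp_step x).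

Fact padic_add_subproof a b n :
  ((a n + b n) %% p ^ n = (a n.+1 + b n.+1) %% p ^ n.+1 %% p ^ n)%N.
Proof. by rewrite -modn_exp_step -[RHS]modnDm -!padic_resP. Qed.

Definition padic_add a b := @PadicInt p p_pr _ (padic_add_subproof a b).

Fact padic_mul_subproof a b n :
  ((a n * b n) %% p ^ n = (a n.+1 * b n.+1) %% p ^ n.+1 %% p ^ n)%N.
Proof. by rewrite -modn_exp_step -[RHS]modnMm -!padic_resP. Qed.

Definition padic_mul a b := @PadicInt p p_pr _ (padic_mul_subproof a b).

Fact padic_opp_subproof a n :
  ((p ^ n - a n) %% p ^ n = (p ^ n.+1 - a n.+1) %% p ^ n.+1 %% p ^ n)%N.
Proof.
have lea k : (a k <= p ^ k)%N.
  by rewrite -(padic_res_modn a k) ltnW // ltn_mod expn_gt0 prime_gt0.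
rewrite -modn_exp_step; apply/eqP.
rewrite -(eqn_modDr (a n)) subnK // modnn [X in (_ + X)%N]padic_resP.
by rewrite modnDmr subnK // expnS modnMl.
Qed.

Definition padic_opp a := @PadicInt p p_pr _ (padic_opp_subproof a).

Fact padic_addA : associative padic_add.
Proof. by move=> a b c; apply: padic_int_eq => n /=; rewrite modnDmr modnDml addnA. Qed.

Fact padic_addC : commutative padic_add.
Proof. by move=> a b; apply: padic_int_eq => n /=; rewrite addnC. Qed.

Fact padic_add0 : left_id (padic_of_nat 0) padic_add.
Proof. by move=> a; apply: padic_int_eq => n /=; rewrite mod0n add0n padic_res_modn. Qed.

Fact padic_addN : left_inverse (padic_of_nat 0) padic_opp padic_add.
Proof.
move=> a; apply: padic_int_eq => n /=; rewrite modnDml subnK ?modnn ?mod0n //.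
by rewrite -(padic_res_modn a n) ltnW // ltn_mod expn_gt0 prime_gt0.
Qed.

HB.instance Definition _ :=
  GRing.isZmodule.Build Zp padic_addA padic_addC padic_add0 padic_addN.

Fact padic_mulA : associative padic_mul.
Proof. by move=> a b c; apply: padic_int_eq => n /=; rewrite modnMmr modnMml mulnA. Qed.

Fact padic_mulC : commutative padic_mul.
Proof. by move=> a b; apply: padic_int_eq => n /=; rewrite mulnC. Qed.

Fact padic_mul1 : left_id (padic_of_nat 1) padic_mul.
Proof. by move=> a; apply: padic_int_eq => n /=; rewrite modnMml mul1n padic_res_modn. Qed.

Fact padic_mulDl : left_distributive padic_mul padic_add.
Proof.
by move=> a b c; apply: padic_int_eq => n /=; rewrite modnMml modnDm mulnDl.
Qed.

Fact padic_1neq0 : padic_of_nat 1 != 0 :> Zp.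
Proof.
apply/eqP => /(congr1 (fun a : Zp => a 1%N)) /=.
by rewrite expn1 mod0n modn_small ?prime_gt1.
Qed.

HB.instance Definition _ := GRing.Zmodule_isComNzRing.Build Zp
  padic_mulA padic_mulC padic_mul1 padic_mulDl padic_1neq0.

Definition padic_unit : pred Zp := fun a => `[< exists b, b * a = 1 >].

Definition padic_inv a : Zp :=
  if pselect (exists b, b * a = 1) is left ex_b then projT1 (cid ex_b) else a.

Fact padic_mulVr : {in padic_unit, left_inverse 1 padic_inv *%R}.
Proof.
move=> a /asboolP ua; rewrite /padic_inv; case: pselect => // ex_b.
by case: (cid ex_b).
Qed.

Fact padic_unitP a b : b * a = 1 -> padic_unit a.
Proof. by move=> ba1; apply/asboolP; exists b. Qed.

Fact padic_inv_out : {in [predC padic_unit], padic_inv =1 id}.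
Proof.
by move=> a /asboolPn nua; rewrite /padic_inv; case: pselect => // ex_b.
Qed.

HB.instance Definition _ := GRing.ComNzRing_hasMulInverse.Build Zp
  padic_mulVr padic_unitP padic_inv_out.

Fact padic_domain : GRing.integral_domain_axiom Zp.
Proof.
have nz a : a != 0 -> exists i, forall k, ~~ (p ^ i %| a (i + k))%N.
  move=> /eqP a0; have [i ai] : exists i, a i <> 0%N.
    apply/not_existsP => a0'; apply: a0; apply: padic_int_eq => n /=.
    by rewrite mod0n; apply: contrapT (a0' n).
  by exists i => k; rewrite /dvdn padic_res_mod; apply/eqP.
move=> a b ab0; apply/norP => -[/nz[i ai] /nz[j bj]].
have /= := congr1 (fun c : Zp => c (i + j)%N) ab0.
rewrite mod0n => /eqP; move: (ai j) (bj i); rewrite (addnC j i).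
set x := a _; set y := b _ => nx ny; rewrite -[_ == _]/(_ %| _)%N.
have pos z k : ~~ (p ^ k %| z)%N -> (0 < z)%N by case: z; rewrite ?dvdn0.
have [x0 y0] := (pos _ _ nx, pos _ _ ny).
rewrite pfactor_dvdn // in nx; rewrite pfactor_dvdn // in ny.
rewrite pfactor_dvdn ?muln_gt0 ?x0 // lognM //.
rewrite -!ltnNge in nx ny; apply/negP; rewrite -ltnNge -addSn.
by rewrite leq_add // ltnW.
Qed.

HB.instance Definition _ :=
  GRing.ComUnitRing_isIntegral.Build Zp padic_domain.

End PadicIntRing.

Definition padic (p : nat) (p_pr : prime p) := {fraction padic_int p_pr}.
HB.instance Definition _ p (p_pr : prime p) := GRing.Field.on (padic p_pr).

(* Series are given by their coefficients.  Each coefficient of a substitution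
   of series without constant term is computed on truncations, as it only
   depends on coefficients of no greater degree. *)

Definition fps (R : Type) := nat -> R.
Definition mfps (k : nat) (R : Type) := 'X_{1..k} -> R.

Section FormalPowerSeries.
Variable R : comNzRingType.

Definition fps_trunc (d : nat) (g : fps R) : {poly R} := \poly_(i < d) g i.

Definition fps_comp (f g : fps R) : fps R :=
  fun d => (fps_trunc d.+1 f \Po fps_trunc d.+1 g)`_d.

Definition mfps_trunc k (d : nat) (G : mfps k R) : {mpoly R[k]} :=
  \sum_(m : 'X_{1..k < d}) G m *: 'X_[m].

Definition mfps_comp n k (F : mfps n R) (G : n.-tuple (mfps k R)) : mfps k R :=
  fun m => let d := (mdeg m).+1 in
  (mfps_trunc d F \mPo [tuple of map (mfps_trunc d) G])@_m.

Definition fps_mcomp k (f : fps R) (G : mfps k R) : mfps k R :=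
  mfps_comp (fun m : 'X_{1..1} => f (mdeg m)) [tuple G].

Definition mfps0 k : mfps k R := fun=> 0.
Definition mfpsX k (i : 'I_k) : mfps k R := fun m => (m == U_(i)%MM)%:R.

(* The truncations of the inverse of f = X + ... under composition: if g is
   correct below degree d, the coefficient of 'X^d in f o (g + c 'X^d) is that
   of f o g plus c. *)
Fixpoint fps_inv_trunc (f : fps R) (d : nat) : {poly R} :=
  if d is d'.+1 then
    let g := fps_inv_trunc f d' in
    g + ('X`_d' - (fps_trunc d f \Po g)`_d')%:P * 'X^d'
  else 0.

Definition fps_inv (f : fps R) : fps R := fun d => (fps_inv_trunc f d.+1)`_d.

Definition is_formal_group (F : mfps 2 R) :=
  let X := mfpsX 0 : mfps 1 R in let O := @mfps0 1 in
  let X0 := mfpsX 0 : mfps 2 R in let X1 := mfpsX 1 : mfps 2 R in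
  let Y0 := mfpsX 0 : mfps 3 R in let Y1 := mfpsX 1 : mfps 3 R in
  let Y2 := mfpsX (inord 2) : mfps 3 R in
  [/\ mfps_comp F [tuple X; O] =1 X,
      mfps_comp F [tuple O; X] =1 X,
      mfps_comp F [tuple X1; X0] =1 F &
      mfps_comp F [tuple mfps_comp F [tuple Y0; Y1]; Y2]
        =1 mfps_comp F [tuple Y0; mfps_comp F [tuple Y1; Y2]]].

Definition is_logarithm (F : mfps 2 R) (f : fps R) :=
  [/\ f 0%N = 0, f 1%N = 1 &
      forall m, fps_mcomp f F m =
                fps_mcomp f (mfpsX 0) m + fps_mcomp f (mfpsX 1) m].

(* [a]_F = f^-1 (a f(X)), for f the logarithm of F. *)
Definition fg_mul (f : fps R) (a : R) : fps R :=
  fps_comp (fps_inv f) (fun d => a * f d).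

(* The action of the noncommutative series u = \sum_i u_i T^i, where
   T * g = g^phi('X^q).  For d > 0, T^i * g has no term of degree d if i > d
   (q > 1); the action is only used on series g without constant term. *)
Definition honda_T (q : nat) (phi : R -> R) (g : fps R) : fps R :=
  fun d => if (q %| d)%N then phi (g (d %/ q)%N) else 0.

Definition honda_act (q : nat) (phi : R -> R) (u g : fps R) : fps R :=
  fun d => \sum_(i < d.+1) u i * iter i (honda_T q phi) g d.

End FormalPowerSeries.

Section Integers.
Variables (p : nat) (p_pr : prime p) (E : fieldType).
(* The structure map of E as a Z_p-algebra; the ring of integers of E is the
   integral closure of Z_p. *)
Variable j : padic_int p_pr -> E.

Definition integer (x : E) : Prop := integralOver j x.

Definition integer_unit (x : E) : Prop :=
  integer x /\ exists2 y, integer y & x * y = 1.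

Definition maxideal (x : E) : Prop := integer x /\ ~ integer_unit x.

Definition padic_cvg (w : nat -> E) (l : E) : Prop :=
  forall N, exists k0, forall k, (k0 <= k)%N ->
    exists2 z, integer z & w k - l = p%:R ^+ N * z.

Definition padic_lim (w : nat -> E) : E :=
  if pselect (exists l, padic_cvg w l) is left ex_l then projT1 (cid ex_l)
  else 0.

Definition fps_eval (g : fps E) (x : E) : E :=
  padic_lim (fun d => (fps_trunc d g).[x]).

Definition mfps_eval k (G : mfps k E) (x : k.-tuple E) : E :=
  padic_lim (fun d => (mfps_trunc d G).@[tnth x]).

End Integers.

Section SubfieldIntegers.
Variables (p : nat) (p_pr : prime p) (Omega : fieldExtType (padic p_pr)).

Definition padic_int_in (a : padic_int p_pr) : Omega := (tofrac a : padic p_pr)%:A.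

Implicit Types E : {subfield Omega}.

Definition integer_of E (x : Omega) := x \in E /\ integer padic_int_in x.
Definition unit_of E (x : Omega) := x \in E /\ integer_unit padic_int_in x.
Definition maxideal_of E (x : Omega) := x \in E /\ maxideal padic_int_in x.

Definition is_uniformizer E (pi : Omega) :=
  forall x, maxideal_of E x <-> exists2 y, integer_of E y & x = pi * y.

(* Ramification index 1: p_E' is generated by the (principal) ideal p_E;
   residue field extensions are always separable here. *)
Definition unramified E E' :=
  forall x, maxideal_of E' x <->
    exists y z, [/\ maxideal_of E y, integer_of E' z & x = y * z].

(* O_E / p_E has q elements: r is a complete system of representatives. *)
Definition residue_card E (q : nat) :=
  exists r : 'I_q -> Omega,
    (forall i, integer_of E (r i)) /\
    (forall x, integer_of E x -> exists! i, maxideal_of E (x - r i)).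

End SubfieldIntegers.

Section Honda.
Variables (p : nat) (p_pr : prime p) (Omega : splittingFieldType (padic p_pr)).
Implicit Types (K : {subfield Omega}) (x y pi : Omega) (F : mfps 2 Omega).
Implicit Types (f u : fps Omega).

Definition is_frobenius K0 K (q : nat) (phi : gal_of K) :=
  phi \in ('Gal(K / K0))%g /\
  forall x, integer_of K x -> maxideal_of K (phi x - x ^+ q).

Definition is_honda_type K pi u :=
  u 0%N = pi /\ forall i, (0 < i)%N -> integer_of K (u i).

Definition type_height K u (h : nat) :=
  [/\ (0 < h)%N, unit_of K (u h) &
      forall i, (0 < i < h)%N -> ~ unit_of K (u i)].

(* F is a Honda formal group over O_K of type u, with logarithm f in K[[X]]. *)
Definition is_honda_group K pi (q : nat) (phi : gal_of K) u F f :=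
  [/\ is_formal_group F, (forall m, integer_of K (F m)),
      is_logarithm F f, (forall d, f d \in K) &
      forall d, exists2 y, integer_of K y & honda_act q phi u f d = pi * y].

Local Notation O := (@padic_int_in p p_pr Omega).

(* The group law of F(p_E), and [a]_F(x), for F with logarithm f. *)
Definition fg_add F x y : Omega := mfps_eval O F [tuple x; y].
Definition fg_act f (a x : Omega) : Omega := fps_eval O (fg_mul f a) x.

(* W_F^k, in an algebraic closure C. *)
Definition fg_torsion (C : fieldType) (iota : {rmorphism Omega -> C})
    f pi (k : nat) (z : C) : Prop :=
  maxideal (iota \o O) z /\
  fps_eval (iota \o O) (iota \o fg_mul f (pi ^+ k)) z = 0.

Definition fg_torsion_all (C : fieldType) (iota : {rmorphism Omega -> C})
    f pi (z : C) : Prop :=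
  exists2 k, (1 <= k)%N & fg_torsion iota f pi k z.

End Honda.

Section GroupRing.
Variables (R : nzRingType) (gT : finGroupType).
Implicit Types a b : {ffun gT -> R}.

(* An element \sum_g a_g g of R[gT] is the function g |-> a_g. *)
Definition gr_monom (c : R) (g : gT) : {ffun gT -> R} :=
  [ffun x => if x == g then c else 0].

Definition gr_mul a b : {ffun gT -> R} :=
  [ffun g => \sum_t a t * b (t^-1 * g)%g].

(* a lies in A[G], for A a subring of R. *)
Definition in_group_ring (A : R -> Prop) (G : {set gT}) a :=
  forall g, A (a g) /\ (g \notin G -> a g = 0).

Definition gr_basis (I : finType) (i : I) a : {ffun I -> {ffun gT -> R}} :=
  [ffun k => if k == i then a else 0].

End GroupRing.

Section GaloisModule.
Variables (p : nat) (p_pr : prime p) (Omega : splittingFieldType (padic p_pr)).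
Variables (M : {subfield Omega}) (G : {set gal_of M}).
Variables (F : mfps 2 Omega) (f : fps Omega).

(* (\sum_g a_g g) . x = \sum_g [a_g]_F (g x), the outer sum being for F; as
   (g * g') x = g' (g x), this is a left action only for commutative G. *)
Definition fg_gact (a : {ffun gal_of M -> Omega}) (x : Omega) : Omega :=
  \big[fg_add F/0]_(g in G) fg_act f (a g) (g x).

Definition fg_lincomb (I : finType) (c : {ffun I -> {ffun gal_of M -> Omega}})
    (x : I -> Omega) : Omega :=
  \big[fg_add F/0]_i fg_gact (c i) (x i).

End GaloisModule.

(* The indices of the generators theta_j (1 <= j <= r), xi_i and omega_i
   (1 <= i <= h). *)
Definition gen_index (r h : nat) : finType := ('I_r + ('I_h + 'I_h))%type.
Definition xi_index r h (i : 'I_h) : gen_index r h := inr (inl i).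
Definition omega_index r h (i : 'I_h) : gen_index r h := inr (inr i).

Definition gens (T : Type) r h (theta : 'I_r -> T) (xi omega : 'I_h -> T)
    (i : gen_index r h) : T :=
  match i with
  | inl k => theta k
  | inr (inl k) => xi k
  | inr (inr k) => omega k
  end.

(* pi^s e_(xi_i) - (sigma - 1) e_(omega_i) *)
Definition gen_rel (R : nzRingType) (gT : finGroupType) r h
    (pi : R) (s : nat) (sigma : gT) (i : 'I_h) :
    {ffun gen_index r h -> {ffun gT -> R}} :=
  gr_basis (xi_index r i) (gr_monom (pi ^+ s) 1%g)
  - gr_basis (omega_index r i) (gr_monom 1 sigma - gr_monom 1 1%g).

(* Main.v *)
From HB Require Import structures.
Require Import Defs.
From mathcomp Require Import all_boot all_order all_fingroup all_algebra.
From mathcomp Require Import all_solvable all_field.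
From mathcomp Require Import mpoly boolp ring zify.

(* Write R for the ring of integers of K0, A for F(p_M), B for F(p_L), which is
   the submodule of A fixed by sigma, and N for the norm of A over B.  As M/L is
   unramified, O_M has an element of trace one, and successive approximation
   along the powers of the maximal ideal shows that N(A) = B and that the kernel
   of N is (sigma - 1)A.  Since [pi^k](x) is close to pi^k x for small x, B has
   rank n over R.  The type of F gives the shape of [pi](X), and Weierstrass
   preparation for [pi](X) - y shows that the fibers of [pi] over the points
   killed by pi^(s-1) have q^h elements, all of them in L; hence the torsion of A
   is (R/pi^s)^h, with a basis zeta_i.  Valuations of a nonzero point killed by
   pi give h <= n.

   Choose xi_i with N(xi_i) = zeta_i.  As N(pi^s xi_i) = 0, there is omega_i with
   pi^s xi_i = (sigma - 1) omega_i.  The norms of the omega_i are independent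
   modulo pi and the torsion, hence they are completed by norms of elements
   theta_j to a basis of B modulo its torsion.  These elements generate A modulo
   sigma - 1, and every relation between them is a combination of the given ones
   modulo sigma - 1.  This lifts to A because sigma has order a power of p, so
   that a power of sigma - 1 is divisible by pi. *)

Set Implicit Arguments.
Unset Strict Implicit.
Unset Printing Implicit Defensive.

Import GRing.Theory.
Local Open Scope ring_scope.

(** * Complete discrete valuation rings *)

Lemma bounded_choice (T : Type) (x0 : T) (P : nat -> T -> Prop) n :
    (forall i, (i < n)%N -> exists x, P i x) ->
  exists f : nat -> T, forall i, (i < n)%N -> P i (f i).
Proof.
move=> exP; have /choice[f fP] : forall i, exists x, (i < n)%N -> P i x.
  by move=> i; have [/exP[x Px]|_] := ltnP i n; [exists x|exists x0].
by exists f.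
Qed.

Section Divisibility.
Variable R : comNzRingType.
Implicit Types a b c w : R.

Definition divides w a := exists b, a = w * b.
Definition has_inverse a := exists b, a * b = 1.

Lemma divides0 w : divides w 0.
Proof. by exists 0; rewrite mulr0. Qed.

Lemma divides_mulr w a b : divides w a -> divides w (a * b).
Proof. by case=> c ->; exists (c * b); rewrite mulrA. Qed.

Lemma divides_mull w a b : divides w b -> divides w (a * b).
Proof. by rewrite mulrC; apply: divides_mulr. Qed.

Lemma dividesD w a b : divides w a -> divides w b -> divides w (a + b).
Proof. by case=> a' -> [b' ->]; exists (a' + b'); rewrite mulrDr. Qed.

Lemma dividesB w a b : divides w a -> divides w b -> divides w (a - b).
Proof. by case=> a' -> [b' ->]; exists (a' - b'); rewrite mulrBr. Qed.

Lemma divides_sum w (J : Type) (r : seq J) (P : pred J) (F : J -> R) :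
  (forall j, P j -> divides w (F j)) -> divides w (\sum_(j <- r | P j) F j).
Proof. by move=> wF; elim/big_ind: _ => //; [exact: divides0|exact: dividesD]. Qed.

End Divisibility.

Record cdvr (R : comNzRingType) (w : R) : Prop := Cdvr {
  cdvr_divides_or_inverse : forall a, divides w a \/ has_inverse a;
  cdvr_separated : forall a, (forall k, divides (w ^+ k) a) -> a = 0;
  cdvr_complete : forall a : nat -> R, exists l, forall k, exists b,
    l = \sum_(i < k) a i * w ^+ i + w ^+ k * b;
  cdvr_regular : forall a, w * a = 0 -> a = 0;
  cdvr_nonunit : forall b, w * b <> 1 }.

Lemma domain_dependence (R : comNzRingType) :
    (forall a b : R, a * b = 0 -> a = 0 \/ b = 0) ->
  forall n (v : 'I_n.+1 -> 'I_n -> R), exists a : 'I_n.+1 -> R,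
    (exists i, a i <> 0) /\ forall j, \sum_i a i * v i j = 0.
Proof.
move=> dom; elim=> [|n IH] v.
  exists (fun=> 1); split; last by case.
  by exists ord0; apply/eqP; rewrite oner_eq0.
have [[i0 v0]|allz] := pselect (exists i, v i ord0 <> 0); last first.
  have z i : v i ord0 = 0 by apply: contrapT => vi; apply: allz; exists i.
  have [a [[i ai] aP]] := IH (fun i j => v (lift ord0 i) (lift ord0 j)).
  exists (fun i => oapp a 0 (unlift ord0 i)); split.
    by exists (lift ord0 i); rewrite liftK.
  move=> j; case: (unliftP ord0 j) => [j'|] ->; last first.
    by apply: big1 => k _; rewrite z mulr0.
  rewrite big_ord_recl unlift_none mul0r add0r -[RHS](aP j').
  by apply: eq_bigr => k _; rewrite liftK.
have [a [[i ai] aP]] := IH (fun i j => v i0 ord0 * v (lift i0 i) (lift ord0 j)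
   - v (lift i0 i) ord0 * v i0 (lift ord0 j)).
exists (fun i => oapp (fun k => v i0 ord0 * a k)
   (- \sum_k a k * v (lift i0 k) ord0) (unlift i0 i)); split.
  by exists (lift i0 i); rewrite liftK /= => /dom[].
move=> j; rewrite (bigD1_ord i0) //= unlift_none /=.
under [X in _ + X]eq_bigr do rewrite liftK /=.
case: (unliftP ord0 j) => [j'|] ->; last first.
  by rewrite mulNr mulr_suml addrC -sumrB big1 // => k _; ring.
rewrite mulNr mulr_suml addrC -sumrB -[RHS](aP j').
by apply: eq_bigr => k _; ring.
Qed.

Section Cdvr.
Variables (R : comNzRingType) (w : R) (cd : cdvr w).

Lemma cdvr_factor a : a <> 0 -> exists k u, a = w ^+ k * u /\ has_inverse u.
Proof.
move=> a0; apply: contrapT => no_factor; apply: a0; apply: (cdvr_separated cd).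
elim=> [|k [b ab]]; first by exists a; rewrite mul1r.
have [[c bc]|ub] := cdvr_divides_or_inverse cd b.
  by exists c; rewrite ab bc exprSr mulrA.
by case: no_factor; exists k, b.
Qed.

Lemma cdvr_regularX k a : w ^+ k * a = 0 -> a = 0.
Proof.
elim: k => [|k IH]; first by rewrite mul1r.
by rewrite exprS -mulrA => /(cdvr_regular cd).
Qed.

Lemma cdvr_domain (a b : R) : a * b = 0 -> a = 0 \/ b = 0.
Proof.
have [->|/eqP a0] := eqVneq a 0; first by left.
have [k [u [-> [v uv]]]] := cdvr_factor a0 => ab0; right.
have /cdvr_regularX ub : w ^+ k * (u * b) = 0 by rewrite mulrA.
by rewrite -[b]mul1r -uv mulrAC ub mul0r.
Qed.

Lemma cdvr_inverseN a : has_inverse a -> ~ divides w a.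
Proof.
by case=> b ab [c aE]; apply: (cdvr_nonunit cd (b := c * b)); rewrite mulrA -aE.
Qed.

Lemma cdvr_primitive (a : nat -> R) n i : (i < n)%N -> a i <> 0 ->
  exists k a', (forall j, (j < n)%N -> a j = w ^+ k * a' j) /\
    exists2 j, (j < n)%N & has_inverse (a' j).
Proof.
move=> ltin ai; apply: contrapT => not_primitive; apply: ai.
apply: (cdvr_separated cd) => k.
suff: exists a', forall j, (j < n)%N -> a j = w ^+ k * a' j.
  by case=> a' /(_ i ltin) ->; exists (a' i).
elim: k => [|k [a' aE]]; first by exists a => j _; rewrite mul1r.
have [|a'' a'E] := @bounded_choice _ 0 (fun j c => a' j = w * c) n.
  move=> j ltj; have [//|ua'] := cdvr_divides_or_inverse cd (a' j).
  by case: not_primitive; exists k, a'; split=> //; exists j.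
by exists a'' => j ltj; rewrite aE // a'E // exprSr mulrA.
Qed.

Lemma cdvr_dependence n (v : nat -> nat -> R) : exists a : nat -> R,
  (exists2 i, (i <= n)%N & a i <> 0) /\
  forall j, (j < n)%N -> \sum_(i < n.+1) a i * v i j = 0.
Proof.
have [a [[i ai] aP]] := domain_dependence cdvr_domain
  (fun (i : 'I_n.+1) (j : 'I_n) => v i j).
exists (fun k => a (inord k)); split.
  by exists i; rewrite ?inord_val // -ltnS.
move=> j ltj; rewrite -[RHS](aP (Ordinal ltj)).
by apply: eq_bigr => k _; rewrite inord_val.
Qed.

(* If the elements of each [Vf k] are combinations of the [v j] with coefficients
   divisible by [w ^+ k], up to [Vf k.+1], then those of [Vf 0] are limits of
   combinations; [c] is the tail of the coefficients [a]. *)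
Lemma complete_generation (V : lmodType R) r (v : nat -> V)
    (Vf : nat -> V -> Prop) :
    (forall k x, Vf k x -> exists a : nat -> R,
       Vf k.+1 (x - \sum_(j < r) (a j * w ^+ k) *: v j)) ->
  forall x, Vf 0%N x -> exists a : nat -> R, forall k, exists c : nat -> R,
    Vf k (x - \sum_(j < r) a j *: v j + w ^+ k *: \sum_(j < r) c j *: v j).
Proof.
move=> step x x0.
have step_total (kx : nat * V) : exists a : nat -> R, Vf kx.1 kx.2 ->
    Vf kx.1.+1 (kx.2 - \sum_(j < r) (a j * w ^+ kx.1) *: v j).
  have [/step[a aV]|not_V] := pselect (Vf kx.1 kx.2); first by exists a.
  by exists (fun=> 0) => /not_V.
have [al alP] := choice step_total.
pose rem := fix rem k := if k is k'.+1 then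
  rem k' - \sum_(j < r) (al (k', rem k') j * w ^+ k') *: v j else x.
have Vrem k : Vf k (rem k) by elim: k => //= k /(alP (k, rem k)).
have remE k : rem k =
    x - \sum_(j < r) (\sum_(i < k) al (val i, rem i) j * w ^+ i) *: v j.
  elim: k => [|k IH] /=.
    by rewrite big1 ?subr0 // => j _; rewrite big_ord0 scale0r.
  rewrite {1}IH -addrA -opprD -big_split /=; congr (_ - _).
  by apply: eq_bigr => j _; rewrite big_ord_recr /= scalerDl.
have [a aP] := choice (fun j => cdvr_complete cd (fun i => al (i, rem i) j)).
exists a => k; have [c cP] := choice (fun j => aP j k); exists c.
congr (Vf k _): (Vrem k); rewrite remE -addrA; congr (_ + _).
rewrite scaler_sumr addrC -sumrB -sumrN.
apply: eq_bigr => j _; rewrite (cP j) scalerA -scalerBl -scaleNr.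
by congr (_ *: _); ring.
Qed.

End Cdvr.

Section SeriesProduct.
Variable R : comNzRingType.
Implicit Types a b c : fps R.

Definition fps_mul a b : fps R := fun d => \sum_(i < d.+1) a i * b (d - i)%N.

Lemma fps_mul_coefM a b (P Q : {poly R}) d :
    (forall i, (i <= d)%N -> P`_i = a i) -> (forall i, (i <= d)%N -> Q`_i = b i) ->
  (P * Q)`_d = fps_mul a b d.
Proof.
move=> PE QE; rewrite coefM; apply: eq_bigr => i _.
by rewrite PE ?QE ?leq_subr // -ltnS.
Qed.

Lemma coef_fps_trunc d a i : (fps_trunc d a)`_i = if (i < d)%N then a i else 0.
Proof. exact: coef_poly. Qed.

Lemma fps_mul_trunc a b d e : (d < e)%N ->
  (fps_trunc e a * fps_trunc e b)`_d = fps_mul a b d.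
Proof.
move=> lt_de; apply: fps_mul_coefM => i le_id;
  by rewrite coef_fps_trunc (leq_ltn_trans le_id lt_de).
Qed.

Lemma fps_mulA a b c : fps_mul a (fps_mul b c) = fps_mul (fps_mul a b) c.
Proof.
apply/funext => d; pose tr := fps_trunc (R := R) d.+1.
have trE g i : (i <= d)%N -> (tr g)`_i = g i by rewrite coef_fps_trunc ltnS => ->.
rewrite -(@fps_mul_coefM a _ (tr a) (tr b * tr c)) => [|i /trE //|i led]; last exact: fps_mul_trunc.
by rewrite mulrA; apply: fps_mul_coefM => i led; [apply: fps_mul_trunc|apply: trE].
Qed.

Lemma fps_mul_subl a b c d : fps_mul (fun i => a i - b i) c d = fps_mul a c d - fps_mul b c d.
Proof. by rewrite /fps_mul -sumrB; apply: eq_bigr => i _; rewrite mulrBl. Qed.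

Lemma fps_mul_scalel x a b d : fps_mul (fun i => x * a i) b d = x * fps_mul a b d.
Proof. by rewrite /fps_mul mulr_sumr; apply: eq_bigr => i _; rewrite mulrA. Qed.

Lemma fps_mul1 a : fps_mul (fun i => (i == 0%N)%:R) a = a.
Proof.
apply/funext => d; rewrite /fps_mul big_ord_recl subn0 mul1r big1 ?addr0 // => i _.
by rewrite mul0r.
Qed.

End SeriesProduct.

Section Weierstrass.
Variables (R : comNzRingType) (w : R).
Implicit Types (a c g : fps R) (D P : {poly R}).

Definition weierstrass_degree g N :=
  (forall i, (i < N)%N -> divides w (g i)) /\ has_inverse (g N).

Definition distinguished D N :=
  [/\ D \is monic, size D = N.+1 & forall i, (i < N)%N -> divides w D`_i].

Section Division.
Variables (cd : cdvr w) (g : fps R) (N : nat) (gN : weierstrass_degree g N).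

Lemma fps_mul_weierstrass_split a e :
  divides w (fps_mul a g (N + e)%N - \sum_(i < e.+1) a i * g (N + (e - i))%N).
Proof.
rewrite /fps_mul (_ : (N + e).+1 = e.+1 + N)%N; last by lia.
rewrite big_split_ord /= (eq_bigr (fun i : 'I_e.+1 => a i * g (N + (e - i))%N)) => [|i _].
  rewrite addrAC subrr add0r; apply: divides_sum => j _; apply/divides_mull/(proj1 gN).
  by have := ltn_ord j; lia.
by rewrite addnBA // -ltnS.
Qed.

Lemma triangular_solve c :
  exists a : fps R, forall e, \sum_(i < e.+1) a i * g (N + (e - i))%N = c e.
Proof.
have [_ [v gv]] := gN.
pose lst := fix lst n := if n is n'.+1 then let s := lst n' in
  rcons s (v * (c n' - \sum_(i < n') s`_i * g (N + (n' - i))%N)) else [::].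
have size_lst n : size (lst n) = n by elim: n => //= n IH; rewrite size_rcons IH.
have nth_lst n i : (i < n)%N -> (lst n)`_i = (lst i.+1)`_i.
  elim: n => // n IH; rewrite ltnS leq_eqVlt => /orP[/eqP-> //|lt_in].
  by rewrite [lst n.+1]/= nth_rcons size_lst lt_in IH.
exists (fun e => (lst e.+1)`_e) => e; rewrite big_ord_recr /=.
rewrite [(rcons _ _)`_e]nth_rcons size_lst ltnn eqxx subnn addn0 mulrAC [v * _]mulrC gv mul1r.
rewrite (_ : \sum_(i < e) _ = \sum_(i < e) (lst e)`_i * g (N + (e - i))%N).
  by rewrite addrCA subrr addr0.
by apply: eq_bigr => i _; rewrite (nth_lst e i).
Qed.

(* Solving modulo [w], then for the error divided by [w], and so on. *)
Lemma weierstrass_division c : exists a, forall e, fps_mul a g (N + e)%N = c e.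
Proof.
have /choice[sol solP] c' : exists ar : fps R * fps R,
    forall e, fps_mul ar.1 g (N + e)%N = c' e - w * ar.2 e.
  have [a aE] := triangular_solve c'.
  have [r rE] := choice (fps_mul_weierstrass_split a).
  exists (a, fun e => - r e) => e /=.
  by rewrite mulrN opprK -rE aE addrCA subrr addr0.
pose err := fix err k := if k is k'.+1 then (sol (err k')).2 else c.
have [a aP] := choice (fun i => cdvr_complete cd (fun k => (sol (err k)).1 i)).
exists a => e; apply/eqP; rewrite -subr_eq0; apply/eqP/(cdvr_separated cd) => k.
pose part k i := \sum_(l < k) (sol (err l)).1 i * w ^+ l.
have partE : fps_mul (part k) g (N + e)%N = c e - w ^+ k * err k e.
  elim: k => [|k IH].
    by rewrite mul1r subrr /fps_mul big1 // => i _; rewrite /part big_ord0 mul0r.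
  have -> : part k.+1 = fun i => part k i - - (w ^+ k) * (sol (err k)).1 i.
    by apply/funext => i; rewrite /part big_ord_recr mulNr opprK mulrC /= mulrC.
  rewrite fps_mul_subl fps_mul_scalel solP IH exprSr /=; ring.
have [b bE] := choice (fun i => aP i k).
have -> : a = fun i => part k i - - (w ^+ k) * b i.
  by apply/funext => i; rewrite bE mulNr opprK.
rewrite fps_mul_subl fps_mul_scalel partE.
by exists (fps_mul b g (N + e)%N - err k e); ring.
Qed.

Lemma weierstrass_uniqueness a :
  (forall e, fps_mul a g (N + e)%N = 0) -> forall i, a i = 0.
Proof.
have divisible a' : (forall e, fps_mul a' g (N + e)%N = 0) -> forall i, divides w (a' i).
  move=> a'g; elim/ltn_ind => i IH; have [v gv] := proj2 gN.
  have := fps_mul_weierstrass_split a' i.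
  rewrite a'g sub0r big_ord_recr /= subnn addn0 opprD addrC => wa.
  have {}wa : divides w (- (a' i * g N)).
    rewrite -[X in divides w X](addrK (- \sum_(j < i) a' j * g (N + (i - j))%N)).
    apply: dividesB => //; rewrite -sumrN; apply: divides_sum => j _.
    by rewrite -mulNr; apply/divides_mulr; rewrite -mulN1r; apply/divides_mull/IH.
  have -> : a' i = - (a' i * g N) * - v by rewrite mulrNN -mulrA gv mulr1.
  exact: divides_mulr.
move=> ag i; apply: (cdvr_separated cd) => k.
suff [a' [_ aE]] : exists a' : fps R, (forall e, fps_mul a' g (N + e)%N = 0) /\
    a = fun i => w ^+ k * a' i by exists (a' i); rewrite aE.
elim: k => [|k [a' [a'g ->]]]; first by exists a; split=> //; apply/funext => j; rewrite mul1r.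
have [b bE] := choice (divisible a' a'g); exists b; split=> [e|].
  have {}bE : a' = fun i => w * b i by apply/funext.
  by apply: (cdvr_regular cd); rewrite -fps_mul_scalel -bE.
by apply/funext => j; rewrite bE exprSr mulrA.
Qed.

Lemma weierstrass_preparation : exists (Q : fps R) D,
  [/\ distinguished D N, forall d, D`_d = fps_mul Q g d & has_inverse (Q 0%N)].
Proof.
have [Q QgE] := weierstrass_division (fun e => (e == 0%N)%:R).
pose D := \poly_(d < N.+1) fps_mul Q g d.
have DE d : D`_d = fps_mul Q g d.
  by rewrite coef_poly; case: ltnP => // /subnKC <-; rewrite addSnnS QgE.
have DN : D`_N = 1 by rewrite DE -[N in fps_mul _ _ N]addn0 QgE.
have lead1 : fps_mul Q g N != 0 by rewrite -DE DN oner_neq0.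
exists Q, D; split=> //.
  split=> [||d ltd]; [by rewrite monicE lead_coef_poly // -DE DN|exact: size_poly_eq|].
  rewrite DE; apply: divides_sum => i _; apply/divides_mull/(proj1 gN).
  exact: leq_ltn_trans (leq_subr _ _) ltd.
have [wQ|//] := cdvr_divides_or_inverse cd (Q 0%N).
have [b wb] : divides w 1; last by case: (cdvr_nonunit cd (b := b)).
rewrite -DN DE /fps_mul big_ord_recl; apply: dividesD; first exact: divides_mulr.
apply: divides_sum => i _; apply/divides_mull/(proj1 gN).
by rewrite lift0; have := ltn_ord i; lia.
Qed.

End Division.

Lemma weierstrass_factor (P : {poly R}) N : cdvr w ->
  weierstrass_degree (fun i => P`_i) N -> exists D S, P = D * S /\ distinguished D N.
Proof.
move=> cd PN; have [Q [D [distD DE _]]] := weierstrass_preparation cd PN.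
have [monD sizeD _] := distD.
pose S := Pdiv.Ring.rdivp P D; pose rem := Pdiv.Ring.rmodp P D.
have PE : P = S * D + rem by exact: Pdiv.RingMonic.rdivp_eq.
have rem_high d : (N <= d)%N -> rem`_d = 0.
  move=> led; apply: nth_default; rewrite (leq_trans _ led) // -ltnS -sizeD.
  by rewrite Pdiv.Ring.ltn_rmodp monic_neq0.
(* [1 - S Q] times [P] is the remainder, which vanishes from degree [N] on. *)
pose cofactor i := (i == 0%N)%:R - fps_mul (fun i => S`_i) Q i.
have cofactorP : fps_mul cofactor (fun i => P`_i) = fun d => rem`_d.
  apply/funext => d; rewrite /cofactor fps_mul_subl fps_mul1 -fps_mulA.
  rewrite -(funext DE) -(@fps_mul_coefM _ _ _ S D) // {1}PE coefD addrAC subrr.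
  by rewrite add0r.
have cofactor0 : cofactor = fun=> 0.
  apply/funext; apply: (weierstrass_uniqueness cd PN) => e.
  by rewrite cofactorP rem_high // leq_addr.
exists D, S; split=> //; rewrite {1}PE mulrC -[RHS]addr0; congr (_ + _).
apply/polyP => d; rewrite coef0 -[LHS]/((fun d => rem`_d) d) -cofactorP cofactor0 /fps_mul.
by rewrite big1 // => i _; rewrite mul0r.
Qed.

End Weierstrass.

(** * Modules over a complete discrete valuation ring *)

Section Submodules.
Variables (R : comNzRingType) (V : lmodType R).
Implicit Types (B D T : V -> Prop) (x y : nat -> V) (a c : nat -> R).

Definition submod B := B 0 /\ forall (a : R) u v, B u -> B v -> B (a *: u + v).

Lemma submod_zero : submod (fun u : V => u = 0).
Proof. by split=> // a u v -> ->; rewrite scaler0 addr0. Qed.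

Lemma submodD B u v : submod B -> B u -> B v -> B (u + v).
Proof. by case=> _ BD Bu Bv; rewrite -[u]scale1r; apply: BD. Qed.

Lemma submodZ B (a : R) u : submod B -> B u -> B (a *: u).
Proof. by case=> B0 BD Bu; rewrite -[_ *: _]addr0; apply: BD. Qed.

Lemma submodN B u : submod B -> B u -> B (- u).
Proof. by move=> BS Bu; rewrite -scaleN1r; apply: submodZ. Qed.

Lemma submodB B u v : submod B -> B u -> B v -> B (u - v).
Proof. by move=> BS Bu Bv; apply: submodD => //; apply: submodN. Qed.

Lemma submod_sum B n a x : submod B -> (forall i, (i < n)%N -> B (x i)) ->
  B (\sum_(i < n) a i *: x i).
Proof.
move=> BS Bx; elim/big_ind: _ => [|u v|i _]; first by case: BS.
  exact: submodD.
by apply: submodZ => //; apply: Bx.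
Qed.

Definition indep_mod T r x := forall a, T (\sum_(i < r) a i *: x i) ->
  forall i, (i < r)%N -> a i = 0.

Definition generated_mod B T r x := forall u, B u ->
  exists a, T (u - \sum_(i < r) a i *: x i).

Definition multiples_mod (c : R) B T u := exists2 v, B v & T (u - c *: v).

Definition has_rank_mod B T n :=
  (exists2 x, forall i, (i < n)%N -> B (x i) & indep_mod T n x) /\
  forall x, (forall i, (i <= n)%N -> B (x i)) -> ~ indep_mod T n.+1 x.

Lemma indep_mod_le T r n x : (r <= n)%N -> indep_mod T n x -> indep_mod T r x.
Proof.
move=> le_rn ind a Ta i lt_ir; pose a' j := if (j < r)%N then a j else 0.
have := ind a' _ i (leq_trans lt_ir le_rn); rewrite /a' lt_ir; apply.
rewrite (big_ord_widen_cond _ xpredT (fun i => a i *: x i) le_rn) in Ta.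
congr T: Ta; rewrite big_mkcond /=; apply: eq_bigr => j _.
by case: ifP; rewrite ?scale0r.
Qed.

Lemma submod_multiples (c : R) B T : submod B -> submod T -> submod (multiples_mod c B T).
Proof.
move=> BS TS; split; first by exists 0; [case: BS|rewrite scaler0 subr0; case: TS].
move=> a u v [u' Bu Tu] [v' Bv Tv]; exists (a *: u' + v'); first by case: BS => _; apply.
have -> : a *: u + v - c *: (a *: u' + v') = a *: (u - c *: u') + (v - c *: v').
  by rewrite scalerDr scalerBr !scalerA mulrC opprD addrACA.
by case: TS => _; apply.
Qed.

Definition rcons_family r x u i := if (i < r)%N then x i else u.

Lemma sum_rcons_family r x u a :
  \sum_(i < r.+1) a i *: rcons_family r x u i = \sum_(i < r) a i *: x i + a r *: u.
Proof.
rewrite big_ord_recr /= {2}/rcons_family ltnn; congr (_ + _).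
by apply: eq_bigr => i _; rewrite /rcons_family ltn_ord.
Qed.

End Submodules.

Definition representatives (T : Type) (B : T -> Prop) (E : T -> T -> Prop) N (z : nat -> T) :=
  [/\ forall i, (i < N)%N -> B (z i), forall x, B x -> exists2 i, (i < N)%N & E x (z i) &
      forall i j, (i < N)%N -> (j < N)%N -> E (z i) (z j) -> i = j].

Definition residue_system (R : comNzRingType) (w : R) :=
  representatives (fun=> True) (fun a b => divides w (a - b)).

Section CdvrModules.
Variables (R : comNzRingType) (w : R) (cd : cdvr w) (V : lmodType R).
Implicit Types (B D T : V -> Prop) (x y : nat -> V) (a c : nat -> R).

(* When [D] contains [w B], this is independence of the images in the vector
   space [B / D] over the residue field. *)
Definition residually_indep D r x := forall a, D (\sum_(i < r) a i *: x i) ->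
  forall i, (i < r)%N -> divides w (a i).

Lemma residually_indep_rcons D r x u : submod D -> D (w *: u) ->
    residually_indep D r x -> ~ (exists a, D (u - \sum_(i < r) a i *: x i)) ->
  residually_indep D r.+1 (rcons_family r x u).
Proof.
move=> DS wu indx ngen a; rewrite sum_rcons_family => Da.
have [wa|[b ab]] := cdvr_divides_or_inverse cd (a r).
  move=> i; rewrite ltnS leq_eqVlt => /orP[/eqP->//|].
  apply: indx; rewrite -[X in D X](addrK (a r *: u)); apply: submodB Da _ => //.
  by case: wa => b ->; rewrite mulrC -scalerA; apply: submodZ.
case: ngen; exists (fun i => - (b * a i)).
rewrite -[X in X - _]scale1r -ab mulrC -scalerA -sumrN.
rewrite (_ : _ + _ = b *: (\sum_(i < r) a i *: x i + a r *: u)); last first.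
  rewrite scalerDr addrC scaler_sumr; congr (_ + _).
  by apply: eq_bigr => i _; rewrite scaleNr opprK scalerA.
exact: submodZ.
Qed.

Lemma extend_residually_indep B D h x n : submod D ->
    (forall u, B u -> D (w *: u)) ->
    (forall i, (i < h)%N -> B (x i)) -> residually_indep D h x ->
    (forall r y, (forall i, (i < r)%N -> B (y i)) -> residually_indep D r y -> (r <= n)%N) ->
  exists r y, [/\ (h <= r)%N, forall i, (i < h)%N -> y i = x i,
    forall i, (i < r)%N -> B (y i), residually_indep D r y & generated_mod B D r y].
Proof.
move=> DS wBD Bx indx bound.
pose P r := exists y, [/\ (h <= r)%N, forall i, (i < h)%N -> y i = x i,
  forall i, (i < r)%N -> B (y i) & residually_indep D r y].
have boundP r : `[< P r >] -> (r <= n)%N.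
  by move=> /asboolP[y [_ _ By indy]]; apply: bound By indy.
have [|r /asboolP[y [le_hr yx By indy]] rmax] := ex_maxnP _ boundP.
  by exists h; apply/asboolP; exists x.
exists r, y; split=> // u Bu; apply: contrapT => ngen.
suff : P r.+1 by move=> /asboolP/rmax; rewrite ltnn.
exists (rcons_family r y u); split; first exact: leqW.
- by move=> i lt_ih; rewrite /rcons_family (leq_trans lt_ih le_hr) yx.
- by move=> i _; rewrite /rcons_family; case: ifP => // /By.
by apply: residually_indep_rcons => //; apply: wBD.
Qed.

(* Says that [B / (B :&: T)] is torsion-free and separated. *)
Record lattice_mod B T : Prop := LatticeMod {
  lattice_mod_sub : submod B;
  lattice_mod_ker : submod T;
  lattice_mod_torsion_free : forall u, B u -> T (w *: u) -> T u;
  lattice_mod_separated : forall u, B u ->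
    (forall k, multiples_mod (w ^+ k) B T u) -> T u }.

Section Lattice.
Variables (B T : V -> Prop) (lat : lattice_mod B T).
Let BS := lattice_mod_sub lat.
Let TS := lattice_mod_ker lat.
Let D := multiples_mod w B T.

Lemma residually_indep_free r x : (forall i, (i < r)%N -> B (x i)) ->
  residually_indep D r x -> indep_mod T r x.
Proof.
move=> Bx indx a Ta i lt_ir; apply: contrapT => ai.
have [k [a' [aE [j lt_jr ua']]]] := cdvr_primitive cd lt_ir ai.
have Ta' : T (\sum_(i < r) a' i *: x i).
  have: T (w ^+ k *: \sum_(i < r) a' i *: x i).
    rewrite scaler_sumr; congr T: Ta; apply: eq_bigr => l _.
    by rewrite aE // scalerA.
  elim: k {aE} => [|k IH]; first by rewrite scale1r.
  rewrite exprS -scalerA => Tw; apply: IH.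
  by apply: (lattice_mod_torsion_free lat) Tw; apply: (submodZ _ BS); exact: submod_sum BS Bx.
apply: (cdvr_inverseN cd ua'); apply: (indx a') => //.
by exists 0; [case: BS|rewrite scaler0 subr0].
Qed.

Lemma nakayama r x : (forall i, (i < r)%N -> B (x i)) ->
  generated_mod B D r x -> generated_mod B T r x.
Proof.
move=> Bx genD u Bu.
have step k v : multiples_mod (w ^+ k) B T v -> exists a,
    multiples_mod (w ^+ k.+1) B T (v - \sum_(j < r) (a j * w ^+ k) *: x j).
  case=> v' Bv Tv; have [a [v'' Bv'' Tv'']] := genD _ Bv.
  exists a, v'' => //.
  rewrite (_ : _ - _ = (v - w ^+ k *: v') +
      w ^+ k *: (v' - \sum_(i < r) a i *: x i - w *: v'')).
    by apply: submodD => //; apply: submodZ.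
  rewrite !scalerBr scaler_sumr exprSr scalerA.
  under eq_bigr do rewrite mulrC -scalerA.
  by rewrite !addrA subrK.
have [|a aP] := complete_generation cd step (x := u).
  by exists u => //; rewrite scale1r subrr; case: TS.
exists a; apply: (lattice_mod_separated lat).
  by apply: submodB => //; apply: (submod_sum a BS Bx).
move=> k; have [c [v Bv Tv]] := aP k.
exists (v - \sum_(j < r) c j *: x j).
  by apply: submodB => //; apply: (submod_sum c BS Bx).
by rewrite scalerBr opprB addrCA addrA [w ^+ k *: _ + _]addrC; congr T: Tv; rewrite addrAC.
Qed.

Lemma indep_le_generated n y r x : (forall i, (i < n)%N -> B (y i)) ->
  indep_mod T n y -> generated_mod B T r x -> (n <= r)%N.
Proof.
move=> By indy gen; rewrite leqNgt; apply/negP => lt_rn.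
have [v vP] := bounded_choice (fun=> 0) (fun i lt_in => gen _ (By i lt_in)).
have [a [[i le_ir ai] av]] := cdvr_dependence cd r v.
apply: ai; apply: (indep_mod_le lt_rn indy) => //.
have -> : \sum_(j < r.+1) a j *: y j =
    \sum_(j < r.+1) a j *: (y j - \sum_(l < r) v j l *: x l).
  under [RHS]eq_bigr do rewrite scalerBr scaler_sumr.
  rewrite sumrB exchange_big /= [X in _ - X]big1 ?subr0 // => l _.
  under eq_bigr do rewrite scalerA.
  by rewrite -scaler_suml av // scale0r.
apply: (submod_sum a (x := fun j => y j - \sum_(l < r) v j l *: x l)) => // j lt_jr.
by apply: vP; apply: leq_trans lt_rn.
Qed.

Lemma free_extension n h x : has_rank_mod B T n ->
    (forall i, (i < h)%N -> B (x i)) -> residually_indep D h x ->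
  exists y, [/\ forall i, (i < h)%N -> y i = x i, forall i, (i < n)%N -> B (y i),
    indep_mod T n y & generated_mod B T n y].
Proof.
move=> [[y0 By0 indy0] no_more] Bx indx.
have wBD u : B u -> D (w *: u) by exists u => //; rewrite subrr; case: TS.
have bound r y : (forall i, (i < r)%N -> B (y i)) -> residually_indep D r y -> (r <= n)%N.
  move=> By /(residually_indep_free By) indy; rewrite leqNgt; apply/negP => lt_nr.
  apply: (no_more y) (indep_mod_le lt_nr indy) => i le_in.
  by apply: By; apply: leq_ltn_trans lt_nr.
have DS : submod D by apply: submod_multiples.
have [r [y [_ yx By indy genD]]] := extend_residually_indep DS wBD Bx indx bound.
have gen := nakayama By genD.
have rn : r = n by apply/eqP; rewrite eqn_leq (bound r y) // (indep_le_generated By0 indy0 gen).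
by rewrite {}rn in By indy gen; exists y; split=> //; apply: residually_indep_free By indy.
Qed.

End Lattice.

Section ClassCount.
Variables (B D : V -> Prop) (BS : submod B) (DS : submod D).
Hypothesis wBD : forall u, B u -> D (w *: u).
Variables (q N : nat) (rho : nat -> R) (z : nat -> V).
Hypothesis rhoP : residue_system w q rho.
Hypothesis zP : representatives B (fun u v => D (u - v)) N z.
Hypothesis q_gt1 : (1 < q)%N.

Definition digit_sum r y (f : {ffun 'I_r -> 'I_q}) := \sum_(i < r) rho (f i) *: y i.

Lemma digit_sum_class r y : (forall i, (i < r)%N -> B (y i)) ->
  exists d : {ffun 'I_r -> 'I_q} -> 'I_N, forall f, D (digit_sum y f - z (d f)).
Proof.
move=> By; have [_ zB _] := zP.
have /choice[d dP] (f : {ffun 'I_r -> 'I_q}) : exists k : 'I_N, D (digit_sum y f - z k).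
  have [|k lt_kN Dk] := zB (digit_sum y f); last by exists (Ordinal lt_kN).
  rewrite /digit_sum; elim/big_ind: _ => [|u v|i _]; [by case: BS|exact: submodD|].
  by apply: submodZ => //; apply: By.
by exists d.
Qed.

Lemma digit_sum_inj r y (f f' : {ffun 'I_r -> 'I_q}) : residually_indep D r y ->
  D (digit_sum y f - digit_sum y f') -> f = f'.
Proof.
move=> indy Dff'; apply/ffunP => i; apply: val_inj; have [_ _ rho_inj] := rhoP.
pose a n := oapp (fun j => rho (f j) - rho (f' j)) 0 (insub n).
have aE (j : 'I_r) : a j = rho (f j) - rho (f' j) by rewrite /a valK.
have wa : divides w (a i).
  by apply: indy => //; under eq_bigr do rewrite aE scalerBl; rewrite sumrB.
by rewrite aE in wa; apply: rho_inj wa.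
Qed.

Lemma exists_digit_sum r y u : generated_mod B D r y -> (forall i, (i < r)%N -> B (y i)) ->
  B u -> exists f : {ffun 'I_r -> 'I_q}, D (digit_sum y f - u).
Proof.
move=> gen By Bu; have [a Da] := gen _ Bu; have [_ rho_all _] := rhoP.
have /choice[f fP] n : exists i : 'I_q, divides w (a n - rho i).
  by have [i lt_iq wa] := rho_all (a n) I; exists (Ordinal lt_iq).
have [b bP] := choice fP; exists [ffun i : 'I_r => f i].
have -> : digit_sum y [ffun i : 'I_r => f i] =
    \sum_(i < r) a i *: y i - w *: \sum_(i < r) b i *: y i.
  rewrite scaler_sumr -sumrB; apply: eq_bigr => i _; rewrite ffunE /= scalerA.
  by rewrite -scalerBl -bP opprB addrCA subrr addr0.
rewrite addrAC; apply: submodB (wBD (submod_sum b BS By)) => //.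
by rewrite -opprB; apply: submodN.
Qed.

Lemma class_count : exists r y,
  [/\ N = (q ^ r)%N, forall i, (i < r)%N -> B (y i), residually_indep D r y &
      generated_mod B D r y].
Proof.
have card_digits r : #|{: {ffun 'I_r -> 'I_q}}| = (q ^ r)%N.
  by rewrite card_ffun !card_ord.
have le_classes r y : (forall i, (i < r)%N -> B (y i)) -> residually_indep D r y ->
    (q ^ r <= N)%N.
  move=> By indy; have [d dP] := digit_sum_class By.
  rewrite -card_digits -[X in (_ <= X)%N](card_ord N); apply: (leq_card d) => f f' dff'.
  apply: (digit_sum_inj indy); have := submodB DS (dP f) (dP f').
  by rewrite dff' opprB addrA subrK.
have bound r y : (forall i, (i < r)%N -> B (y i)) -> residually_indep D r y -> (r <= N)%N.
  by move=> By indy; apply: leq_trans (le_classes r y By indy); rewrite ltnW // ltn_expl.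
have [//|//|r [y [_ _ By indy gen]]] :=
  extend_residually_indep (h := 0) (x := fun=> 0) DS wBD _ _ bound.
exists r, y; split=> //; apply/eqP; rewrite eqn_leq (le_classes r y) // andbT.
have [zB _ z_inj] := zP.
have /choice[c cP] (k : 'I_N) : exists f : {ffun 'I_r -> 'I_q}, D (digit_sum y f - z k).
  exact: exists_digit_sum gen By (zB _ (ltn_ord k)).
rewrite -card_digits -{1}(card_ord N); apply: (leq_card c) => k k' ckk'; apply: val_inj.
apply: (z_inj _ _ (ltn_ord k) (ltn_ord k')); have := submodB DS (cP k') (cP k).
by rewrite ckk' opprB addrC addrA subrK.
Qed.

End ClassCount.
End CdvrModules.

(** * Filtered rings *)

Section IteratedMorphisms.

Fact iter_zmod_morphism (V : zmodType) (f : {additive V -> V}) k : zmod_morphism (iter k f).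
Proof. by elim: k => // k IH x y; rewrite !iterS IH raddfB. Qed.

HB.instance Definition _ (V : zmodType) (f : {additive V -> V}) k :=
  GRing.isZmodMorphism.Build V V (iter k f) (iter_zmod_morphism f k).

Fact iter_monoid_morphism (S : pzRingType) (f : {rmorphism S -> S}) k :
  monoid_morphism (iter k f).
Proof.
elim: k => [|k [IH1 IHM]]; first by split.
by split=> [|x y]; rewrite !iterS ?IH1 ?rmorph1 // IHM rmorphM.
Qed.

HB.instance Definition _ (S : pzRingType) (f : {rmorphism S -> S}) k :=
  GRing.isMonoidMorphism.Build S S (iter k f) (iter_monoid_morphism f k).

Fact iter_scalable (R : pzRingType) (V : lmodType R) (f : {linear V -> V}) k :
  scalable (iter k f).
Proof. by elim: k => // k IH a x; rewrite !iterS IH linearZ. Qed.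

HB.instance Definition _ (R : pzRingType) (V : lmodType R) (f : {linear V -> V}) k :=
  GRing.isScalable.Build R V V *:%R (iter k f) (iter_scalable f k).

Lemma iter_fixed (T : Type) (f : T -> T) k x : f x = x -> iter k f x = x.
Proof. by move=> fx; elim: k => //= k ->. Qed.

Lemma orbit_sum_fixed (V : zmodType) (f : {additive V -> V}) Q x : iter Q f x = x ->
  f (\sum_(i < Q) iter i f x) = \sum_(i < Q) iter i f x.
Proof.
case: Q => [|Q] fQ; first by rewrite !big_ord0 raddf0.
by rewrite raddf_sum big_ord_recr [RHS]big_ord_recl [RHS]addrC /=; congr (_ + _).
Qed.

End IteratedMorphisms.

Record filtration (S : comNzRingType) (I : nat -> S -> Prop) : Prop := Filtration {
  fil0 : forall d, I d 0;
  filB : forall d x y, I d x -> I d y -> I d (x - y);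
  filM : forall a b x y, I a x -> I b y -> I (a + b)%N (x * y);
  filS : forall d x, I d.+1 x -> I d x;
  fil1 : I 0%N 1 }.

Section Filtration.
Variables (S : comNzRingType) (I : nat -> S -> Prop) (fI : filtration I).

Lemma filN d x : I d x -> I d (- x).
Proof. by move=> Ix; rewrite -sub0r; apply: filB => //; apply: fil0. Qed.

Lemma filD d x y : I d x -> I d y -> I d (x + y).
Proof. by move=> Ix Iy; rewrite -[y]opprK; apply: filB => //; apply: filN. Qed.

Lemma fil_nat n : I 0%N n%:R.
Proof.
elim: n => [|n IH]; first exact: fil0.
by rewrite -natr1; apply: filD => //; apply: fil1.
Qed.

Lemma fil_le d e x : (d <= e)%N -> I e x -> I d x.
Proof.
move=> /subnKC <-; elim: (e - d)%N => [|k IH]; first by rewrite addn0.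
by rewrite addnS => /(filS fI).
Qed.

Lemma filMr d x y : I d x -> I 0%N y -> I d (x * y).
Proof. by move=> Ix Iy; rewrite -[d]addn0; apply: filM. Qed.

Lemma filMl d x y : I 0%N x -> I d y -> I d (x * y).
Proof. by move=> Ix Iy; rewrite mulrC; apply: filMr. Qed.

Lemma filX e x n : I e x -> I (n * e)%N (x ^+ n).
Proof.
move=> Ix; elim: n => [|n IH]; first exact: fil1.
by rewrite exprS mulSn; apply: filM.
Qed.

Lemma filX0 x n : I 0%N x -> I 0%N (x ^+ n).
Proof. by move=> /(@filX _ _ n); rewrite muln0. Qed.

Lemma filX1 x n : I 1%N x -> I n (x ^+ n).
Proof. by move=> /(@filX _ _ n); rewrite muln1. Qed.

Lemma fil_sum d (T : Type) (r : seq T) (P : pred T) (F : T -> S) :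
  (forall i, P i -> I d (F i)) -> I d (\sum_(i <- r | P i) F i).
Proof. by move=> IF; elim/big_ind: _ => //; [apply: fil0|apply: filD]. Qed.

Lemma fil_prod0 (T : Type) (r : seq T) (P : pred T) (F : T -> S) :
  (forall i, P i -> I 0%N (F i)) -> I 0%N (\prod_(i <- r | P i) F i).
Proof. by move=> IF; elim/big_ind: _ => //; [apply: fil1|move=> x y; apply: filMl]. Qed.

Lemma fil_subX d x y n : I 0%N x -> I 0%N y -> I d (x - y) -> I d (x ^+ n - y ^+ n).
Proof.
move=> Ix Iy Ixy; rewrite subrXX; apply: filMr => //; apply: fil_sum => i _.
by apply: filMl; apply: filX0.
Qed.

Lemma fil_trans d y x z : I d (x - y) -> I d (y - z) -> I d (x - z).
Proof. by move=> Ixy Iyz; have := filD Ixy Iyz; rewrite addrA subrK. Qed.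

Lemma fil_sym d x y : I d (x - y) -> I d (y - x).
Proof. by move=> /filN; rewrite opprB. Qed.

Lemma fil_near d e x y : (d <= e)%N -> I d x -> I e (x - y) -> I d y.
Proof.
by move=> le_de Ix /(fil_le le_de) Ixy; rewrite -[y](subKr x); apply: filB.
Qed.

Lemma filtration_scale i : filtration (fun d => I (d * i)%N).
Proof.
split=> [d|d x y|a b x y Ix Iy|d x|]; first exact: fil0.
- exact: filB.
- by rewrite mulnDl; apply: filM.
- by apply: fil_le; rewrite leq_mul.
by rewrite mul0n; apply: fil1.
Qed.

Definition coef_fil d (P : {poly S}) := forall i, I d P`_i.

Lemma coef_filtration : filtration coef_fil.
Proof.
split=> [d i|d P Q IP IQ i|a b P Q IP IQ i|d P IP i|i].
- by rewrite coef0; apply: fil0.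
- by rewrite coefB; apply: filB.
- by rewrite coefM; apply: fil_sum => j _; apply: filM.
- by apply: filS.
by rewrite coef1; apply: fil_nat.
Qed.

Lemma coef_filC d c : I d c -> coef_fil d c%:P.
Proof. by move=> Ic i; rewrite coefC; case: eqP => // _; apply: fil0. Qed.

Lemma coef_filX : coef_fil 0 'X.
Proof. by move=> i; rewrite coefX; apply: fil_nat. Qed.

Lemma fil_exp_primeD p x y : prime p -> I 1%N p%:R -> I 0%N x -> I 0%N y ->
  I 1%N ((x + y) ^+ p - (x ^+ p + y ^+ p)).
Proof.
move=> p_pr Ip Ix Iy; case: p p_pr Ip => // q q_pr Iq.
rewrite exprDn big_ord_recl big_ord_recr /= /bump /=.
rewrite subn0 bin0 expr0 mulr1 mulr1n add1n subnn expr0 mul1r binn mulr1n.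
set s := \sum_(i < q) _; rewrite (_ : _ - _ = s); last by ring.
apply: fil_sum => i _; rewrite -mulr_natr; apply: filMl.
  by apply: filMl; apply: filX0.
have /dvdnP[k ->] : (q.+1 %| 'C(q.+1, 1 + i))%N by rewrite prime_dvd_bin //= ltnS.
by rewrite natrM; apply: filMl => //; apply: fil_nat.
Qed.

Lemma fil_exp_prime_powerD p m x y : prime p -> I 1%N p%:R -> I 0%N x -> I 0%N y ->
  I 1%N ((x + y) ^+ (p ^ m) - (x ^+ (p ^ m) + y ^+ (p ^ m))).
Proof.
move=> p_pr Ip Ix Iy; elim: m => [|m IH]; first by rewrite !expr1 subrr; apply: fil0.
rewrite expnSr !exprM; apply: (fil_trans (y := (x ^+ (p ^ m) + y ^+ (p ^ m)) ^+ p)).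
  apply: fil_subX => //; first by apply: filX0; apply: filD.
  by apply: filD; apply: filX0.
by apply: fil_exp_primeD => //; apply: filX0.
Qed.

Lemma fil_sub_exp q r x y : I 1%N q%:R -> (0 < r)%N -> I 0%N x -> I 0%N y ->
  I r (x - y) -> I r.+1 (x ^+ q - y ^+ q).
Proof.
move=> Iq r0 Ix Iy Ixy; rewrite subrXX -addn1; apply: filM => //.
have -> : \sum_(i < q) x ^+ (q.-1 - i) * y ^+ i =
  \sum_(i < q) (x ^+ (q.-1 - i) - y ^+ (q.-1 - i)) * y ^+ i + q%:R * y ^+ q.-1.
  have -> : q%:R * y ^+ q.-1 = \sum_(i < q) y ^+ q.-1.
    by rewrite sumr_const card_ord mulr_natl.
  rewrite -big_split /=; apply: eq_bigr => i _.
  have le_iq : (i <= q.-1)%N by rewrite -ltnS prednK // (leq_ltn_trans _ (ltn_ord i)).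
  by rewrite mulrBl -exprD subnK ?subrK.
apply: filD; last by apply: filMr => //; apply: filX0.
apply: fil_sum => i _; apply: filMr; last exact: filX0.
by apply: (fil_le r0); apply: fil_subX.
Qed.

Lemma fil_sub_exp_power q j x y : I 1%N q%:R -> I 0%N x -> I 0%N y ->
  I 1%N (x - y) -> I j.+1 (x ^+ (q ^ j) - y ^+ (q ^ j)).
Proof.
move=> Iq Ix Iy Ixy; elim: j => [|j IH]; first by rewrite !expr1.
by rewrite expnSr !exprM; apply: fil_sub_exp => //; apply: filX0.
Qed.

(* Multiplication by [c] identifies [I d] with [I (e + d)]. *)
Definition has_order c e := forall d x, I (e + d)%N x <-> exists2 y, I d y & x = c * y.

Lemma has_order_mem c e : has_order c e -> I e c.
Proof.
by move=> ce; rewrite -[e]addn0; apply/ce; exists 1; rewrite ?mulr1 //; apply: fil1.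
Qed.

Lemma has_orderX c e k : has_order c e -> has_order (c ^+ k) (k * e)%N.
Proof.
move=> ce; elim: k => [|k IH] d x.
  by split=> [Ix|[y Iy ->]]; [exists x; rewrite ?mul1r|rewrite mul1r].
rewrite mulSn -addnA; split=> [/ce[y /IH[z Iz ->] ->]|[y Iy ->]].
  by exists z => //; rewrite exprS mulrA.
by apply/ce; exists (c ^+ k * y); [apply/IH; exists y|rewrite exprS mulrA].
Qed.

End Filtration.

Record is_subring (C : comNzRingType) (O : C -> Prop) : Prop := IsSubring {
  subring1 : O 1;
  subringB : forall x y, O x -> O y -> O (x - y);
  subringM : forall x y, O x -> O y -> O (x * y) }.

Section Subrings.
Variables (C : comNzRingType) (O : C -> Prop) (O_subring : is_subring O).

Lemma subring0 : O 0.
Proof. by rewrite -(subrr 1); apply: (subringB O_subring); apply: subring1. Qed.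

Lemma subringN x : O x -> O (- x).
Proof. by move=> Ox; rewrite -sub0r; apply: (subringB O_subring) => //; apply: subring0. Qed.

Lemma subringD x y : O x -> O y -> O (x + y).
Proof. by move=> Ox Oy; rewrite -[y]opprK; apply: (subringB O_subring) => //; apply: subringN. Qed.

Lemma subring_sum (T : Type) (r : seq T) (P : pred T) (F : T -> C) :
  (forall i, P i -> O (F i)) -> O (\sum_(i <- r | P i) F i).
Proof. by move=> OF; elim/big_ind: _; [exact: subring0|exact: subringD|]. Qed.

Lemma subring_nat n : O n%:R.
Proof.
elim: n => [|n On]; first exact: subring0.
by rewrite -addn1 natrD; apply: subringD On (subring1 _).
Qed.

Lemma subringX x n : O x -> O (x ^+ n).
Proof.
move=> Ox; elim: n => [|n On]; first exact: subring1.
by rewrite exprS; apply: (subringM O_subring).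
Qed.

End Subrings.

Section IdealPowers.
Variables (C : comNzRingType) (O : C -> Prop).

Definition ideal_power w d x := exists2 y, O y & x = w ^+ d * y.

Lemma ideal_power0 w x : ideal_power w 0 x <-> O x.
Proof. by split=> [[y Oy ->]|Ox]; [rewrite mul1r|exists x; rewrite ?mul1r]. Qed.

Lemma ideal_power1 w x : ideal_power w 1 x <-> exists2 y, O y & x = w * y.
Proof. by split=> -[y Oy ->]; exists y; rewrite ?expr1. Qed.

Hypothesis O_subring : is_subring O.

Lemma ideal_power_exp w d : ideal_power w d (w ^+ d).
Proof. by exists 1; [exact: subring1|rewrite mulr1]. Qed.

Lemma ideal_power_filtration w : O w -> filtration (ideal_power w).
Proof.
move=> Ow; have [O1 OB OM] := O_subring.
split=> [d|d x y [a Oa ->] [b Ob ->]|m n x y [a Oa ->] [b Ob ->]|d x [a Oa ->]|].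
- by exists 0; rewrite ?mulr0 //; apply: subring0 O_subring.
- by exists (a - b); [apply: OB|rewrite mulrBr].
- by exists (a * b); [apply: OM|rewrite exprD; ring].
- by exists (w * a); [apply: OM|rewrite exprSr mulrA].
by exists 1; rewrite ?mulr1.
Qed.

End IdealPowers.

Lemma ideal_power_order (C : fieldType) (O : C -> Prop) w : w != 0 ->
  has_order (ideal_power O w) w 1.
Proof.
move=> w0 d x; split=> [[y Oy ->]|[_ [y Oy ->] ->]].
  by exists (w ^+ d * y); [exists y|rewrite add1n exprS mulrA].
by exists y; rewrite // add1n exprS mulrA.
Qed.

Lemma has_order_cancel (C : fieldType) (I : nat -> C -> Prop) c e d x : c != 0 ->
  has_order I c e -> I (e + d)%N (c * x) -> I d x.
Proof. by move=> c0 ce /ce[y Iy /(mulfI c0) ->]. Qed.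

Lemma expr_prime_powerD (S : comNzRingType) p m (x y : S) : prime p ->
  exists c, (x + y) ^+ (p ^ m) = x ^+ (p ^ m) + y ^+ (p ^ m) + p%:R * c.
Proof.
move=> p_pr; have fI : filtration (ideal_power (fun _ : S => True) p%:R).
  exact: ideal_power_filtration.
have O1 := ideal_power0 (fun _ : S => True) p%:R.
have [||| c _ /eqP] := @fil_exp_prime_powerD _ _ fI p m x y p_pr; try exact/O1.
  by exists 1; rewrite ?mulr1.
by rewrite expr1 subr_eq => /eqP ->; exists c; rewrite addrC.
Qed.

(** * Modules with a cyclic p-group action *)

Section PolynomialAction.
Variables (R : comNzRingType) (A : lmodType R) (sg : {linear A -> A}).
Implicit Types (P S : {poly R}) (x y : A).

Definition pact P x := \sum_(i < size P) P`_i *: iter i sg x.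

Lemma pact_widen n P x : (size P <= n)%N -> pact P x = \sum_(i < n) P`_i *: iter i sg x.
Proof.
move=> le_Pn; rewrite -(subnKC le_Pn) big_split_ord /= [X in _ + X]big1 ?addr0 // => i _.
by rewrite nth_default ?scale0r // leq_addr.
Qed.

Fact pact_linear P : linear (pact P).
Proof.
move=> a x y; rewrite /pact scaler_sumr -big_split; apply: eq_bigr => i _ /=.
by rewrite linearP scalerDr !scalerA mulrC.
Qed.

HB.instance Definition _ P := GRing.isLinear.Build R A A *:%R (pact P) (pact_linear P).

Lemma pactD P S x : pact (P + S) x = pact P x + pact S x.
Proof.
pose n := maxn (size P) (size S).
rewrite !(@pact_widen n) ?leq_maxl ?leq_maxr ?size_polyD // -big_split.
by apply: eq_bigr => i _; rewrite coefD scalerDl.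
Qed.

Lemma pactZ c P x : pact (c *: P) x = c *: pact P x.
Proof.
rewrite (@pact_widen (size P)) ?size_scale_leq // scaler_sumr.
by apply: eq_bigr => i _; rewrite coefZ scalerA.
Qed.

Lemma pactN P x : pact (- P) x = - pact P x.
Proof. by rewrite -[- P]scaleN1r pactZ scaleN1r. Qed.

Lemma pactC c x : pact c%:P x = c *: x.
Proof. by rewrite (@pact_widen 1) ?size_polyC ?leq_b1 // big_ord1 coefC. Qed.

Lemma pact1 x : pact 1 x = x.
Proof. by rewrite pactC scale1r. Qed.

Lemma pact0 x : pact 0 x = 0.
Proof. by rewrite pactC scale0r. Qed.

Lemma pactMX P x : pact (P * 'X) x = sg (pact P x).
Proof.
rewrite (@pact_widen (size P).+1).
  rewrite big_ord_recl coefMX /= scale0r add0r linear_sum.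
  by apply: eq_bigr => i _; rewrite coefMX /= linearZ.
by rewrite (leq_trans (size_polyMleq _ _)) // size_polyX addnC.
Qed.

Lemma pactM P S x : pact (P * S) x = pact P (pact S x).
Proof.
elim/poly_ind: P => [|P c IH]; first by rewrite mul0r !pact0.
rewrite mulrDl !pactD mulrAC !pactMX IH; congr (_ + _).
by rewrite mul_polyC pactZ pactC.
Qed.

Lemma pactXn n x : pact 'X^n x = iter n sg x.
Proof. by elim: n => [|n IH]; [rewrite pact1|rewrite exprSr pactMX IH]. Qed.

Lemma pactXsub1 x : pact ('X - 1) x = sg x - x.
Proof. by rewrite pactD pactN pact1 -['X]expr1 pactXn. Qed.

Lemma pact_sum n (P : 'I_n -> {poly R}) x : pact (\sum_i P i) x = \sum_i pact (P i) x.
Proof.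
elim: n P => [|n IH] P; first by rewrite !big_ord0 pact0.
by rewrite !big_ord_recl pactD IH.
Qed.

Definition fixed x := sg x = x.

Lemma submod_fixed : submod fixed.
Proof. by split=> [|a x y]; rewrite /fixed ?linear0 // linearP => -> ->. Qed.

Section Norm.
Variable Q : nat.

Definition nrm x := \sum_(i < Q) iter i sg x.
Definition norm_poly : {poly R} := \sum_(i < Q) 'X^i.
Definition cyc P := divides ('X^Q - 1) P.

Lemma nrmE x : nrm x = pact norm_poly x.
Proof. by rewrite pact_sum; apply: eq_bigr => i _; rewrite pactXn. Qed.

Fact nrm_linear : linear nrm.
Proof. by move=> a x y; rewrite !nrmE linearP. Qed.

HB.instance Definition _ := GRing.isLinear.Build R A A *:%R nrm nrm_linear.

Lemma Xsub1_norm_poly : ('X - 1) * norm_poly = 'X^Q - 1.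
Proof. by rewrite subrX1. Qed.

Hypothesis sgQ : forall x, iter Q sg x = x.

Lemma pact_cyc P x : cyc P -> pact P x = 0.
Proof. by case=> S ->; rewrite mulrC pactM pactD pactN pact1 pactXn sgQ subrr linear0. Qed.

Lemma cyc_Xn_sub1 P : cyc (('X^Q - 1) * P).
Proof. by exists P. Qed.

Lemma norm_fixed x : fixed (nrm x).
Proof. exact: orbit_sum_fixed. Qed.

Lemma norm_sg x : nrm (sg x) = nrm x.
Proof.
apply/eqP; rewrite -subr_eq0 -linearB /= nrmE -pactXsub1 -pactM mulrC Xsub1_norm_poly.
by rewrite -[_ - 1]mulr1 (pact_cyc _ (cyc_Xn_sub1 _)).
Qed.

Lemma norm_sub_sg x : nrm (sg x - x) = 0.
Proof. by rewrite linearB /= norm_sg subrr. Qed.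

Lemma norm_pact P x : nrm (pact P x) = P.[1] *: nrm x.
Proof.
rewrite linear_sum horner_coef scaler_suml; apply: eq_bigr => i _ /=.
rewrite linearZ expr1n mulr1 /=; congr (_ *: _).
by elim: (val i) => //= k IH; rewrite norm_sg.
Qed.

End Norm.
End PolynomialAction.

Lemma sum_divn_modn (V : nmodType) (F : nat -> nat -> V) n Q : (0 < Q)%N ->
  \sum_(j < n * Q) F (j %/ Q)%N (j %% Q)%N = \sum_(i < n) \sum_(k < Q) F i k.
Proof.
move=> Q0; elim: n => [|n IH]; first by rewrite mul0n !big_ord0.
rewrite mulSnr big_split_ord big_ord_recr /= IH; congr (_ + _).
by apply: eq_bigr => k _; rewrite divnMDl // modnMDl divn_small // modn_small // addn0.
Qed.

Lemma sum_ord_widen (V : nmodType) (F : nat -> V) k m : (k <= m)%N ->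
    (forall i, (i < m)%N -> (k <= i)%N -> F i = 0) ->
  \sum_(i < m) F i = \sum_(i < k) F i.
Proof.
move=> le_km F0; rewrite -(subnKC le_km) big_split_ord /= [X in _ + X]big1 ?addr0 // => i _.
by rewrite F0 ?leq_addr // -[X in (_ < X)%N](subnKC le_km) ltn_add2l.
Qed.

Section TruncatedGroupRing.
Variables (R : comNzRingType) (w : R) (cd : cdvr w).
Implicit Types P S : {poly R}.

Section Cyc.
Variables (Q : nat) (Q_gt0 : (0 < Q)%N).

Lemma monic_Xn_sub1 : ('X^Q - 1 : {poly R}) \is monic.
Proof. by rewrite -[1]/(1%:P) monicXnsubC. Qed.

Lemma cycP P : cyc Q P <-> Pdiv.Ring.rmodp P ('X^Q - 1) = 0.
Proof.
split=> [[S ->]|mod0].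
  by rewrite mulrC Pdiv.RingMonic.rmodp_mull // monic_Xn_sub1.
exists (Pdiv.Ring.rdivp P ('X^Q - 1)).
by rewrite {1}(Pdiv.RingMonic.rdivp_eq monic_Xn_sub1 P) mod0 addr0 mulrC.
Qed.

Lemma cyc_separated P : (forall k, exists Z, cyc Q (P - w ^+ k *: Z)) -> cyc Q P.
Proof.
move=> approx; apply/cycP/polyP => i; rewrite coef0; apply: (cdvr_separated cd) => k.
have [Z /cycP] := approx k; rewrite Pdiv.RingMonic.rmodpD ?monic_Xn_sub1 //.
rewrite -scaleNr Pdiv.RingMonic.rmodpZ ?monic_Xn_sub1 // scaleNr.
move/eqP; rewrite subr_eq0 => /eqP ->.
by exists (Pdiv.Ring.rmodp Z ('X^Q - 1))`_i; rewrite coefZ.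
Qed.

Lemma cyc_regular k P : cyc Q (w ^+ k *: P) -> cyc Q P.
Proof.
move=> /cycP; rewrite Pdiv.RingMonic.rmodpZ ?monic_Xn_sub1 // => wP0.
apply/cycP/polyP => i; rewrite coef0; apply: (cdvr_regularX cd (k := k)).
by rewrite -coefZ wP0 coef0.
Qed.

End Cyc.

Section Frobenius.
Variables (p m : nat) (p_pr : prime p).
Hypothesis p_neq0 : p%:R <> 0 :> R.
Local Notation Q := (p ^ m)%N.

Lemma Xsub1_frobenius : exists mu nu : {poly R},
  ('X - 1) ^+ Q = 'X^Q - 1 - p%:R *: mu /\ norm_poly R Q = ('X - 1) ^+ Q.-1 + p%:R *: nu.
Proof.
have Q0 : (0 < Q)%N by rewrite expn_gt0 prime_gt0.
have [mu] := @expr_prime_powerD {poly R} p m ('X - 1) 1 p_pr.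
rewrite subrK expr1n -polyC_natr mul_polyC => XQ; exists mu.
have XsubQ : ('X - 1) ^+ Q = 'X^Q - 1 - p%:R *: mu.
  by rewrite XQ addrAC addrK addrK.
have mu1 : mu.[1] = 0.
  have /eqP := congr1 (fun P => P.[1]) XsubQ.
  rewrite !(hornerE, horner_exp) subrr expr0n expr1n subrr sub0r.
  rewrite (gtn_eqF Q0) eq_sym oppr_eq0 => /eqP /(cdvr_domain cd)[//|//].
have /factor_theorem[nu nuE] : root mu 1 by apply/rootP.
exists nu; split=> //.
have regular (P S : {poly R}) : ('X - 1) * P = ('X - 1) * S -> P = S.
  by rewrite -[1]/(1%:P) => /(monic_lreg (monicXsubC 1)).
apply: regular; rewrite Xsub1_norm_poly mulrDr -exprS prednK // XsubQ -scalerAr nuE.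
by rewrite [nu * _]mulrC subrK.
Qed.

End Frobenius.
End TruncatedGroupRing.

Section Torsion.
Variables (R : comNzRingType) (w : R) (A : lmodType R).

Definition torsion (x : A) := exists k, w ^+ k *: x = 0.

Lemma submod_torsion : submod torsion.
Proof.
split=> [|a x y [k kx] [l ly]]; first by exists 0%N; rewrite scaler0.
exists (k + l)%N; rewrite scalerDr exprD -[_ *: y]scalerA ly scaler0 addr0.
by rewrite scalerA mulrAC mulrC -scalerA [in X in _ *: X]mulrC -scalerA kx !scaler0.
Qed.

Lemma torsion_uniformizer x : torsion (w *: x) -> torsion x.
Proof. by case=> k kx; exists k.+1; rewrite exprSr -scalerA. Qed.

(* [zeta] identifies the torsion with [(R / w ^+ s) ^ h]. *)
Record torsion_basis h s (zeta : nat -> A) : Prop := TorsionBasis {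
  torsion_basis_kill : forall i, (i < h)%N -> w ^+ s *: zeta i = 0;
  torsion_basis_span : forall x, torsion x ->
    exists b : nat -> R, x = \sum_(i < h) b i *: zeta i;
  torsion_basis_rel : forall b : nat -> R, \sum_(i < h) b i *: zeta i = 0 ->
    forall i, (i < h)%N -> divides (w ^+ s) (b i) }.

Lemma torsion_basis_torsion h s zeta (b : nat -> R) : torsion_basis h s zeta ->
  torsion (\sum_(i < h) b i *: zeta i).
Proof.
move=> [kill _ _]; exists s; rewrite scaler_sumr big1 // => i _.
by rewrite scalerA mulrC -scalerA kill ?scaler0.
Qed.

Lemma torsion_killed h s zeta x : torsion_basis h s zeta -> torsion x -> w ^+ s *: x = 0.
Proof.
move=> [kill span _] /span[b ->]; rewrite scaler_sumr big1 // => i _.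
by rewrite scalerA mulrC -scalerA kill // scaler0.
Qed.

End Torsion.

(* The exactness fields say that the Tate cohomology of [A] vanishes. *)
Record cyclic_module (R : comNzRingType) (w : R) (A : lmodType R) (sg : {linear A -> A})
    (Q n h s : nat) (zeta : nat -> A) : Prop := CyclicModule {
  cyclic_module_order : forall x, iter Q sg x = x;
  norm_surjective : forall x, fixed sg x -> exists y, x = nrm sg Q y;
  norm_kernel : forall x, nrm sg Q x = 0 -> exists y, x = sg y - y;
  cyclic_module_separated : forall x : A, (forall k, exists y, x = w ^+ k *: y) -> x = 0;
  torsion_fixed : forall x : A, torsion w x -> fixed sg x;
  cyclic_module_torsion_basis : torsion_basis w h s zeta;
  fixed_rank : has_rank_mod (fixed sg) (torsion w (A := A)) n }.

Section CyclicModule.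
Variables (R : comNzRingType) (w : R) (cd : cdvr w).
Variables (A : lmodType R) (sg : {linear A -> A}).
Variables (p m : nat) (p_pr : prime p).
Hypotheses (w_p : divides w p%:R) (p_neq0 : p%:R <> 0 :> R).
Local Notation Q := (p ^ m)%N.
Variables (n h s : nat) (zeta : nat -> A).
Hypotheses (s_gt0 : (0 < s)%N) (hn : (h <= n)%N).
Hypothesis cm : cyclic_module w sg Q n h s zeta.
Local Notation torsion := (torsion w (A := A)).
Local Notation fixed := (fixed sg).
Local Notation N := (nrm sg Q).
Local Notation act := (pact sg).
Implicit Types (P D : nat -> {poly R}) (S : {poly R}) (x y z : A).

Let sgQ := cyclic_module_order cm.
Let tb := cyclic_module_torsion_basis cm.
Let Q_gt0 : (0 < Q)%N. Proof. by rewrite expn_gt0 prime_gt0. Qed.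

Lemma lattice_fixed : lattice_mod w fixed torsion.
Proof.
split; [exact: submod_fixed|exact: submod_torsion| |].
  by move=> x _; apply: torsion_uniformizer.
move=> x _ approx; exists s; apply: (cyclic_module_separated cm) => k.
have [y _ /(torsion_killed tb) xy] := approx k; exists (w ^+ s *: y).
by apply/eqP; rewrite -subr_eq0 scalerA mulrC -scalerA -scalerBr xy.
Qed.

(* [(sg - 1) ^ (Q - 2) eta + (p / w) nu v] is [w]-torsion modulo the torsion, hence
   fixed, and [sg - 1] maps it to [N eta]. *)
Lemma norm_eq0_of_torsion eta v : (0 < m)%N -> w *: eta = sg v - v ->
  torsion (N v) -> N eta = 0.
Proof.
move=> m0 weta Nv; have [r0 p_w] := w_p.
have [_ [nu [_ nuE]]] := Xsub1_frobenius cd m p_pr p_neq0.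
have Q1 : (1 < Q)%N by rewrite -(expn0 p) ltn_exp2l // prime_gt1.
pose t := act (('X - 1) ^+ Q.-2) eta + r0 *: act nu v.
have wt : w *: t = N v.
  rewrite /t scalerDr -linearZ /= weta -pactXsub1 -pactM -exprSr prednK; last first.
    by rewrite -ltnS prednK // ltnW.
  by rewrite scalerA -p_w -pactZ -pactD -nuE nrmE.
have /(torsion_fixed cm) ft : torsion t by apply: torsion_uniformizer; rewrite wt.
transitivity (sg t - t); last by rewrite ft subrr.
rewrite -pactXsub1 /t linearD /= -pactM -exprS prednK; last first.
  by rewrite -ltnS prednK // ltnW.
rewrite linearZ /= -pactM mulrC pactM pactXsub1 -weta linearZ /= scalerA mulrC -p_w.
by rewrite -pactZ -pactD -nuE nrmE.
Qed.

Definition norm_basis (g xi : nat -> A) := [/\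
  indep_mod torsion n (fun i => N (g i)),
  generated_mod fixed torsion n (fun i => N (g i)),
  forall i, (i < h)%N -> w ^+ s *: xi i = sg (g i) - g i &
  forall i, (i < h)%N -> N (xi i) = zeta i].

Lemma omega_norm_indep (xi om : nat -> A) : (0 < m)%N ->
    (forall i, (i < h)%N -> N (xi i) = zeta i) ->
    (forall i, (i < h)%N -> w ^+ s *: xi i = sg (om i) - om i) ->
  residually_indep w (multiples_mod w fixed torsion) h (fun i => N (om i)).
Proof.
move=> m0 xiP omP a [y0 /(norm_surjective cm)[y ->] torNv] i ih.
pose v := \sum_(i < h) a i *: om i - w *: y.
pose eta := \sum_(i < h) (a i * w ^+ s.-1) *: xi i - (sg y - y).
have Neta : N eta = \sum_(i < h) (a i * w ^+ s.-1) *: zeta i.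
  rewrite linearB linear_sum /= (norm_sub_sg sgQ) subr0.
  by apply: eq_bigr => j _; rewrite [N (_ *: _)]linearZ /= xiP.
have weta : w *: eta = sg v - v.
  transitivity (\sum_(i < h) (sg (a i *: om i) - a i *: om i) - (w *: sg y - w *: y)).
    rewrite /eta scalerBr scaler_sumr scalerBr; congr (_ - _); apply: eq_bigr => j _.
    rewrite [sg _]linearZ /= -scalerBr -omP // !scalerA.
    by rewrite mulrCA -exprS prednK.
  rewrite sumrB /v [sg (_ - _)]linearB [sg (\sum_(_ < _) _)]linear_sum [sg (w *: y)]linearZ.
  by rewrite !opprD !opprK addrACA.
have [|b ab] := torsion_basis_rel tb (b := fun i => a i * w ^+ s.-1) _ ih.
  rewrite -Neta; apply: norm_eq0_of_torsion m0 weta _.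
  congr torsion: torNv; rewrite /v [N (_ - _)]linearB /= [N (w *: y)]linearZ.
  rewrite [N (\sum_(_ < _) _)]linear_sum /=.
  by congr (_ - _); apply: eq_bigr => j _; rewrite [N (_ *: _)]linearZ.
exists b; apply/eqP; rewrite -subr_eq0; apply/eqP/(cdvr_regularX cd (k := s.-1)).
by rewrite mulrBr mulrC ab -[in w ^+ s](prednK s_gt0) exprSr mulrA subrr.
Qed.

Lemma norm_basis_trivial : m = 0%N -> exists g xi, norm_basis g xi.
Proof.
move=> m0; have Q1 : Q = 1%N by rewrite m0.
have N_id : N = id by apply/funext => x; rewrite /nrm Q1 big_ord1.
have sg_id x : sg x = x by have := sgQ x; rewrite Q1.
have [||y [_ fy indy geny]] :=
  free_extension cd lattice_fixed (h := 0) (x := fun=> 0) (fixed_rank cm).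
- by [].
- by [].
exists y, zeta; split; rewrite ?N_id // => i ih.
by rewrite sg_id subrr (torsion_basis_kill tb).
Qed.

Lemma norm_basis_nontrivial : (0 < m)%N -> exists g xi, norm_basis g xi.
Proof.
move=> m0; have [kill span rel] := tb.
have zeta_fixed i : (i < h)%N -> fixed (zeta i).
  by move=> /kill killed; apply: (torsion_fixed cm); exists s.
have [xi xiP] := bounded_choice 0 (fun i ih => norm_surjective cm (zeta_fixed i ih)).
have {}xiP i : (i < h)%N -> N (xi i) = zeta i by move=> /xiP.
have ex_om i : (i < h)%N -> exists y, w ^+ s *: xi i = sg y - y.
  by move=> ih; apply: (norm_kernel cm); rewrite linearZ /= xiP ?kill.
have [om omP] := bounded_choice 0 ex_om.
have [|y [yo fy indy geny]] := free_extension cd lattice_fixed (fixed_rank cm) _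
    (omega_norm_indep m0 xiP omP).
  by move=> i _; apply: norm_fixed.
have ex_g i : (i < n)%N -> exists x, N x = y i /\ ((i < h)%N -> x = om i).
  move=> lti; have [ih|hi] := ltnP i h; first by exists (om i); rewrite yo.
  by have [x ->] := norm_surjective cm (fy i lti); exists x.
have [g gP] := bounded_choice 0 ex_g.
have Ng (i : 'I_n) : N (g i) = y i by have [] := gP i (ltn_ord i).
exists g, xi; split=> //.
- by move=> a Ta; apply: indy; congr torsion: Ta; apply: eq_bigr => i _; rewrite Ng.
- by move=> z /geny[a Ta]; exists a; under eq_bigr do rewrite Ng.
by move=> i ih; have [_ ->//] := gP i (leq_trans ih hn); apply: omP.
Qed.

Lemma exists_norm_basis : exists g xi, norm_basis g xi.
Proof. by have [/norm_basis_trivial|/norm_basis_nontrivial] := posnP m. Qed.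

Section Generators.
Variables (g xi : nat -> A) (nb : norm_basis g xi).

Definition gen_family i := if (i < n)%N then g i else xi (i - n).
Local Notation G := gen_family.
Definition gen_comb P := \sum_(i < n + h) act (P i) (G i).

Lemma gen_family_sum (F : nat -> A -> A) : \sum_(i < n + h) F i (G i) =
  \sum_(i < n) F i (g i) + \sum_(i < h) F (n + i)%N (xi i).
Proof.
rewrite big_split_ord /=; congr (_ + _); apply: eq_bigr => i _; rewrite /G.
  by rewrite ltn_ord.
by rewrite ltnNge leq_addr addKn.
Qed.

Lemma gen_combD P P' : gen_comb (fun i => P i + P' i) = gen_comb P + gen_comb P'.
Proof. by rewrite /gen_comb -big_split; apply: eq_bigr => i _; rewrite pactD. Qed.

Lemma gen_combM S P : gen_comb (fun i => S * P i) = act S (gen_comb P).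
Proof. by rewrite /gen_comb linear_sum; apply: eq_bigr => i _; rewrite pactM. Qed.

Lemma gen_combN P : gen_comb (fun i => - P i) = - gen_comb P.
Proof. by rewrite /gen_comb -sumrN; apply: eq_bigr => i _; rewrite pactN. Qed.

Lemma eq_gen_comb P P' : (forall i, (i < n + h)%N -> cyc Q (P i - P' i)) ->
  gen_comb P = gen_comb P'.
Proof.
move=> PP'; apply/eqP; rewrite -subr_eq0 -sumrB big1 // => i _.
by rewrite -pactN -pactD (pact_cyc sgQ _ (PP' i (ltn_ord i))).
Qed.

Lemma gen_comb_Xsub1 x : exists c z, x = gen_comb (fun i => (c i)%:P) + (sg z - z).
Proof.
have [_ gen _ xiP] := nb.
have [a /(torsion_basis_span tb)[b ab]] := gen _ (norm_fixed sgQ x).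
pose c i := if (i < n)%N then a i else b (i - n)%N.
have cE : gen_comb (fun i => (c i)%:P) = \sum_(i < n) a i *: g i + \sum_(i < h) b i *: xi i.
  rewrite /gen_comb (gen_family_sum (fun i => act (c i)%:P)).
  congr (_ + _); apply: eq_bigr => i _; rewrite pactC /c ?ltn_ord //.
  by rewrite ltnNge leq_addr addKn.
have [|z zE] := norm_kernel cm (x := x - gen_comb (fun i => (c i)%:P)); last first.
  by exists c, z; rewrite -zE addrC subrK.
rewrite cE linearB linearD !linear_sum /= opprD addrA.
under eq_bigr do rewrite linearZ /=.
by rewrite ab -sumrB big1 // => i _; rewrite linearZ /= xiP // subrr.
Qed.

Lemma gen_comb_Xsub1X k x : exists P z, x = gen_comb P + act (('X - 1) ^+ k) z.
Proof.
elim: k => [|k [P [z ->]]].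
  by exists (fun=> 0), x; rewrite /gen_comb big1 ?add0r ?pact1 // => i _; rewrite pact0.
have [c [z' ->]] := gen_comb_Xsub1 z.
exists (fun i => P i + ('X - 1) ^+ k * (c i)%:P), z'.
by rewrite gen_combD gen_combM linearD /= -addrA -pactXsub1 -pactM -exprSr.
Qed.

Let translate j := iter (j %% Q) sg (G (j %/ Q)).

Lemma gen_comb_translates (a : nat -> R) :
  \sum_(j < (n + h) * Q) a j *: translate j =
  gen_comb (fun i => \poly_(k < Q) a (i * Q + k)%N).
Proof.
rewrite (eq_bigr (fun j : 'I__ => a (j %/ Q * Q + j %% Q)%N *: translate j)) => [|j _]; last first.
  by rewrite -divn_eq.
rewrite (sum_divn_modn (fun i k => a (i * Q + k)%N *: iter k sg (G i))) //.
apply: eq_bigr => i _; rewrite (@pact_widen _ _ sg Q) ?size_poly //.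
by apply: eq_bigr => k _; rewrite coef_poly ltn_ord.
Qed.

Lemma gen_comb_span P : exists a : nat -> R,
  gen_comb P = \sum_(j < (n + h) * Q) a j *: translate j.
Proof.
pose red i := Pdiv.Ring.rmodp (P i) ('X^Q - 1).
have size_red i : (size (red i) <= Q)%N.
  rewrite -ltnS -(size_XnsubC (1 : R) Q_gt0) polyC1.
  by rewrite Pdiv.Ring.ltn_rmodp monic_neq0 // monic_Xn_sub1.
pose a j := (red (j %/ Q)%N)`_(j %% Q); exists a; rewrite gen_comb_translates.
have redE i : \poly_(k < Q) a (i * Q + k)%N = red i.
  apply/polyP => k; rewrite coef_poly /a; case: ltnP => [ltkQ|geQ].
    by rewrite divnMDl // modnMDl divn_small // modn_small // addn0.
  by rewrite nth_default // (leq_trans (size_red i)).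
apply: eq_gen_comb => i _; rewrite redE; exists (Pdiv.Ring.rdivp (P i) ('X^Q - 1)).
by rewrite {1}(Pdiv.RingMonic.rdivp_eq (monic_Xn_sub1 _ Q_gt0) (P i)) addrK mulrC.
Qed.

(* [(sg - 1) ^ Q] is divisible by [p], hence by [w], on [A]. *)
Lemma gen_comb_uniformizer z : exists P z', z = gen_comb P + w *: z'.
Proof.
have [P [z' ->]] := gen_comb_Xsub1X Q z; have [r0 p_w] := w_p.
have [mu [_ [muE _]]] := Xsub1_frobenius cd m p_pr p_neq0.
exists P, (- (r0 *: act mu z')); congr (_ + _).
rewrite muE pactD pactN pactZ p_w -[_ - 1]mulr1 (pact_cyc sgQ _ (cyc_Xn_sub1 _ _)).
by rewrite add0r scalerN scalerA.
Qed.

Lemma gen_comb_generates x : exists P, x = gen_comb P.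
Proof.
have [||a aP] := complete_generation cd (r := (n + h) * Q) (v := translate)
    (Vf := fun k x => exists z, x = w ^+ k *: z) _ (x := x).
- move=> k _ [z ->]; have [P [z' ->]] := gen_comb_uniformizer z.
  have [a ->] := gen_comb_span P; exists a, z'.
  rewrite scalerDr scaler_sumr exprSr scalerA addrAC -sumrB.
  by rewrite big1 ?add0r // => j _; rewrite scalerA mulrC subrr.
- by exists x; rewrite scale1r.
exists (fun i => \poly_(k < Q) a (i * Q + k)%N); rewrite -gen_comb_translates.
apply/eqP; rewrite -subr_eq0; apply/eqP/(cyclic_module_separated cm) => k.
have [c [z xE]] := aP k; exists (z - \sum_(j < (n + h) * Q) c j *: translate j).
by rewrite scalerBr -xE addrK.
Qed.

(* The coefficients of the relation [\sum_k D k * (w ^+ s xi_k - (X - 1) g_k)]. *)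
Definition rel_coef D i : {poly R} :=
  if (i < h)%N then - (('X - 1) * D i)
  else if (i < n)%N then 0 else w ^+ s *: D (i - n)%N.

Lemma rel_coefD D D' i : rel_coef (fun i => D i + D' i) i = rel_coef D i + rel_coef D' i.
Proof.
rewrite /rel_coef; case: ifP => _; first by rewrite mulrDr opprD.
by case: ifP => _; rewrite ?addr0 // scalerDr.
Qed.

Lemma rel_coefM S D i : rel_coef (fun i => S * D i) i = S * rel_coef D i.
Proof.
rewrite /rel_coef; case: ifP => _; first by rewrite mulrN mulrCA.
by case: ifP => _; rewrite ?mulr0 // scalerAr.
Qed.

Lemma gen_comb_rel_coef D : gen_comb (rel_coef D) = 0.
Proof.
have [_ _ rel _] := nb.
rewrite /gen_comb (gen_family_sum (fun i => act (rel_coef D i))).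
rewrite (sum_ord_widen (F := fun i => act (rel_coef D i) (g i)) hn) => [|i lt_in le_hi]; last first.
  by rewrite /rel_coef ltnNge le_hi /= lt_in pact0.
rewrite -big_split big1 // => i _ /=.
rewrite /rel_coef ltn_ord ltnNge (leq_trans hn) ?leq_addr //= ltnNge leq_addr /= addKn.
by rewrite pactN mulrC pactM pactXsub1 -rel // linearZ pactZ addrC subrr.
Qed.

(* Modulo the given relations, [P] is [delta] times a relation. *)
Definition relation_mod (delta : {poly R}) P := exists D (Z : nat -> {poly R}),
  gen_comb Z = 0 /\ forall i, (i < n + h)%N -> cyc Q (P i - rel_coef D i - delta * Z i).

Lemma relation_values_at1 P : gen_comb P = 0 ->
  (forall i, (i < n)%N -> (P i).[1] = 0) /\
  forall i, (i < h)%N -> divides (w ^+ s) (P (n + i)%N).[1].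
Proof.
move=> P0; have [ind _ _ xiP] := nb.
have norm0 : \sum_(i < n) (P i).[1] *: N (g i) + \sum_(i < h) (P (n + i)%N).[1] *: zeta i = 0.
  have : N (gen_comb P) = 0 by rewrite P0 linear0.
  rewrite linear_sum (gen_family_sum (fun i y => N (act (P i) y))) => Nsum; rewrite -[RHS]Nsum.
  by congr (_ + _); apply: eq_bigr => i _; rewrite /= (norm_pact sgQ) ?xiP.
have at1 i : (i < n)%N -> (P i).[1] = 0.
  apply: (ind (fun i => (P i).[1])); move/eqP: norm0; rewrite addr_eq0 => /eqP ->.
  apply: submodN (submod_torsion w A) _.
  exact: (torsion_basis_torsion (fun i => (P (n + i)%N).[1]) tb).
split=> // i ih; apply: (torsion_basis_rel tb (b := fun i => (P (n + i)%N).[1])) => //.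
by move: norm0; rewrite big1 ?add0r // => j _; rewrite at1 // scale0r.
Qed.

Lemma root1_relation P d i : (i < n + h)%N -> (forall i, (i < n)%N -> (P i).[1] = 0) ->
    (forall i, (i < h)%N -> (P (n + i)%N).[1] = w ^+ s * d i) ->
  root (P i - rel_coef (fun i => (d i)%:P) i) 1.
Proof.
move=> lti at1 dP; rewrite /root hornerD hornerN /rel_coef; case: ifP => ih.
  have x1 : ('X - 1 : {poly R}).[1] = 0 by rewrite !hornerE subrr.
  by rewrite at1 ?(leq_trans ih) // hornerN hornerM x1 mul0r oppr0 subr0.
case: ifP => lin; first by rewrite at1 // horner0 subrr.
rewrite -[in P i](@subnKC n i); last by rewrite leqNgt lin.
rewrite dP; first by rewrite hornerZ hornerC subrr.
by rewrite ltn_subLR // leqNgt lin.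
Qed.

(* [P - rel_coef D] vanishes at 1; its quotient by [X - 1] gives a fixed element, that
   is, a norm, and correcting it yields a relation. *)
Lemma relation_mod_Xsub1 P : gen_comb P = 0 -> relation_mod ('X - 1) P.
Proof.
move=> P0; have [at1 at1_xi] := relation_values_at1 P0.
have [d dP] := bounded_choice 0 at1_xi.
pose D i := (d i)%:P : {poly R}.
have [|C CP] := @bounded_choice _ 0 (fun i C => P i - rel_coef D i = C * ('X - 1)) (n + h).
  move=> i lti; have /factor_theorem[C ->] := root1_relation lti at1 dP.
  by exists C; rewrite polyC1.
have sgC : fixed (gen_comb C).
  apply/eqP; rewrite -subr_eq0 -pactXsub1 -gen_combM.
  rewrite (@eq_gen_comb _ (fun i => P i - rel_coef D i)) => [|i lti].
    by rewrite gen_combD gen_combN gen_comb_rel_coef P0 subrr.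
  by rewrite CP // mulrC subrr; apply: divides0.
have [y Cy] := norm_surjective cm sgC; have [S yS] := gen_comb_generates y.
exists D, (fun i => C i - norm_poly R Q * S i); split.
  by rewrite gen_combD gen_combN gen_combM Cy yS nrmE subrr.
by move=> i lti; rewrite CP //; exists (S i); rewrite -Xsub1_norm_poly; ring.
Qed.

Lemma relation_mod1 P : gen_comb P = 0 -> relation_mod 1 P.
Proof.
move=> P0; exists (fun=> 0), P; split=> // i _.
rewrite mul1r addrAC subrr add0r /rel_coef mulr0 scaler0.
by do 2?case: ifP => _; rewrite ?oppr0; apply: divides0.
Qed.

Lemma relation_modM delta delta' : (forall P, gen_comb P = 0 -> relation_mod delta P) ->
    (forall P, gen_comb P = 0 -> relation_mod delta' P) ->
  forall P, gen_comb P = 0 -> relation_mod (delta * delta') P.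
Proof.
move=> rel rel' P /rel[D [Z [/rel'[D' [Z' [Z'0 Z'P]]] ZP]]].
exists (fun i => D i + delta * D' i), Z'; split=> // i lti.
rewrite rel_coefD rel_coefM.
have := dividesD (ZP i lti) (divides_mull delta (Z'P i lti)).
by congr divides; ring.
Qed.

Lemma relation_modX delta k : (forall P, gen_comb P = 0 -> relation_mod delta P) ->
  forall P, gen_comb P = 0 -> relation_mod (delta ^+ k) P.
Proof.
move=> rel; elim: k => [|k IH] P P0; first exact: relation_mod1.
by rewrite exprS; apply: relation_modM P P0.
Qed.

Lemma relation_mod_uniformizer P : gen_comb P = 0 -> relation_mod w%:P P.
Proof.
move=> /(relation_modX Q relation_mod_Xsub1)[D [Z [Z0 ZP]]].
have [mu [_ [muE _]]] := Xsub1_frobenius cd m p_pr p_neq0; have [r0 p_w] := w_p.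
exists D, (fun i => - r0%:P * mu * Z i); split=> [|i lti].
  by rewrite gen_combM Z0 linear0.
have := dividesD (ZP i lti) (cyc_Xn_sub1 Q (Z i)); congr divides.
by rewrite muE p_w -!mul_polyC !polyCM; ring.
Qed.

Lemma relation_generated P : gen_comb P = 0 -> exists D,
  forall i, (i < n + h)%N -> cyc Q (P i - rel_coef D i).
Proof.
move=> P0; have wP k := relation_modX k relation_mod_uniformizer P0.
have [D [Z [_ ZP]]] := wP s.
exists (fun i => D i + Z (n + i)%N) => i lti; rewrite rel_coefD.
have [ih|hi] := boolP (i < h)%N; last have [lin|nli] := boolP (i < n)%N.
- apply: (@cyc_regular _ _ cd _ Q_gt0 s); apply: (cyc_separated cd Q_gt0) => k.
  have [D' [Z' [_ Z'P]]] := wP k; have lni : (n + i < n + h)%N by rewrite ltn_add2l.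
  exists (w ^+ s *: Z' i + ('X - 1) * Z' (n + i)%N).
  have nih : ((n + i < h)%N = false) * ((n + i < n)%N = false).
    by split; apply/negbTE; rewrite -leqNgt ?(leq_trans hn) ?leq_addr.
  have cyc_i := Z'P i lti; have cyc_ni := Z'P _ lni; have cyc_ni' := ZP _ lni.
  rewrite /rel_coef ih in cyc_i *; rewrite /rel_coef !nih addKn in cyc_ni cyc_ni'.
  have := dividesD (dividesD (divides_mull (w ^+ s)%:P cyc_i) (divides_mull ('X - 1) cyc_ni))
    (divides_mull (- ('X - 1)) cyc_ni').
  by congr divides; rewrite -!mul_polyC !polyC_exp; ring.
- apply: (cyc_separated cd Q_gt0) => k; have [D' [Z' [_ Z'P]]] := wP k.
  exists (Z' i); have := Z'P i lti.
  by rewrite /rel_coef (negPf hi) lin !subr0 addr0 subr0 -polyC_exp mul_polyC.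
have := ZP i lti; rewrite /rel_coef (negPf hi) (negPf nli) subnKC; last by rewrite leqNgt.
by rewrite -polyC_exp mul_polyC opprD addrA.
Qed.

End Generators.
End CyclicModule.

(** * Integers in algebraic extensions of the p-adic numbers *)

Section PadicCdvr.
Variables (p : nat) (p_pr : prime p).
Local Notation Zp := (padic_int p_pr).
Implicit Types a b : Zp.

Lemma padic_addE a b n : (a + b) n = ((a n + b n) %% p ^ n)%N. Proof. by []. Qed.
Lemma padic_mulE a b n : (a * b) n = ((a n * b n) %% p ^ n)%N. Proof. by []. Qed.

Lemma padic_natE k n : (k%:R : Zp) n = (k %% p ^ n)%N.
Proof.
elim: k => [|k IH]; first by rewrite mulr0n.
by rewrite -addn1 natrD padic_addE IH modnDm.
Qed.

Lemma padic_sub_res a b n : a n = b n -> (a - b) n = 0%N.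
Proof.
move=> ab; have : (a - b + b) n = b n by rewrite subrK.
rewrite padic_addE -{2}(padic_res_modn b n) => /eqP.
rewrite -{2}[b n]add0n eqn_modDr mod0n -[(a - b) n](padic_res_modn (a - b)).
by rewrite modn_mod => /eqP.
Qed.

Lemma padic_divides a : a 1%N = 0%N -> divides p%:R a.
Proof.
move=> a1; have pa n : (p %| a n.+1)%N.
  by rewrite /dvdn -[X in (_ %% X)%N]expn1 -[n.+1]add1n padic_res_mod a1.
have co n : (a n.+1 %/ p = (a n.+2 %/ p) %% p ^ n)%N.
  by rewrite modn_divl -expnSr [a n.+1]padic_resP.
exists (PadicInt p_pr co); apply: padic_int_eq => n.
by rewrite padic_mulE padic_natE modnMml /= mulnC divnK // -padic_resP.
Qed.

Lemma padic_dividesX k a : a k = 0%N -> divides (p%:R ^+ k) a.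
Proof.
elim: k a => [|k IH] a ak; first by exists a; rewrite mul1r.
have [|b ab] := padic_divides (a := a).
  by rewrite -(padic_res_mod a 1 k) add1n ak mod0n.
have [|c bc] := IH b; last by exists c; rewrite exprS -mulrA -bc.
have := ak; rewrite ab padic_mulE padic_natE modnMml expnS -muln_modr.
by move/eqP; rewrite muln_eq0 (gtn_eqF (prime_gt0 p_pr)) /= -padic_resP => /eqP.
Qed.

Lemma padic_has_inverse a : a 1%N <> 0%N -> has_inverse a.
Proof.
move=> a1; have cop n : coprime (a n) (p ^ n).
  case: n => [|n]; first by rewrite expn0 coprimen1.
  rewrite coprime_sym coprime_pexpl // prime_coprime //; apply/negP => /eqP pa.
  by apply: a1; rewrite -(padic_res_mod a 1 n) add1n expn1 pa.
have inv n : exists x, (a n * x = 1 %[mod p ^ n])%N.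
  have [an0|an0] := posnP (a n).
    by exists 0%N; have := cop n; rewrite an0 /coprime gcd0n => /eqP ->; rewrite !modn1.
  have [x y bezout _] := egcdnP (p ^ n) an0; exists x.
  by rewrite mulnC bezout (eqP (cop n)) modnMDl.
have [x xP] := choice inv.
have co n : (x n %% p ^ n = (x n.+1 %% p ^ n.+1) %% p ^ n)%N.
  rewrite -modn_exp_step.
  have ax1 : (a n * x n.+1 = 1 %[mod p ^ n])%N.
    rewrite -modnMml [a n]padic_resP modn_mod modnMml.
    by rewrite modn_exp_step xP -modn_exp_step.
  rewrite -[x n]muln1 -modnMmr -ax1 modnMmr mulnA [(x n * _)%N]mulnC.
  by rewrite -modnMml xP modnMml mul1n.
exists (PadicInt p_pr co); apply: padic_int_eq => n.
by rewrite padic_mulE /= modnMmr xP.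
Qed.

Lemma padic_complete (a : nat -> Zp) : exists l, forall k, exists b,
  l = \sum_(i < k) a i * p%:R ^+ i + p%:R ^+ k * b.
Proof.
pose S k : Zp := \sum_(i < k) a i * p%:R ^+ i.
have S_stable n : S n.+1 n = S n n.
  have -> : S n.+1 = S n + a n * p%:R ^+ n by rewrite /S big_ord_recr.
  rewrite padic_addE padic_mulE -natrX padic_natE modnn muln0.
  by rewrite mod0n addn0 padic_res_modn.
have co n : (S n n = S n.+1 n.+1 %% p ^ n)%N by rewrite -padic_resP S_stable.
exists (PadicInt p_pr co) => k.
have [|b lE] := @padic_dividesX k (PadicInt p_pr co - S k); first exact: padic_sub_res.
by exists b; rewrite -/(S k) -lE addrC subrK.
Qed.

Lemma padic_cdvr : cdvr (p%:R : Zp).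
Proof.
split; last 2 first.
- move=> a /eqP; rewrite mulf_eq0 => /orP[/eqP/(congr1 (fun a : Zp => a 2%N))|/eqP//].
  rewrite padic_natE modn_small /= ?mod0n => [p0|].
    by have := prime_gt0 p_pr => /lt0n_neq0/eqP.
  by rewrite -{1}(expn1 p) ltn_exp2l // prime_gt1.
- move=> b /(congr1 (fun a : Zp => a 1%N)).
  rewrite padic_mulE padic_natE expn1 modnn mul0n mod0n -[1]/(1%:R) padic_natE.
  by rewrite expn1 modn_small // prime_gt1.
- move=> a; have [/padic_divides|/padic_has_inverse] := pselect (a 1%N = 0%N);
    by [left|right].
- move=> a p_a; apply: padic_int_eq => n; have [b ->] := p_a n.
  by rewrite -natrX padic_mulE padic_natE modnn mul0n.
exact: padic_complete.
Qed.

Lemma padic_frac (x : padic p_pr) : exists a b, b != 0 /\ x = tofrac a / tofrac b.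
Proof.
elim/quotW: x => r; exists (frac r).1, (frac r).2.
have d0 : (frac r).2 != 0 by case: r.
split=> //; apply: (canRL (mulfK _)); first by rewrite tofrac_eq0.
rewrite !piE; apply/eqP; rewrite piE /= FracField.equivfE /= /FracField.mulf.
by rewrite !numden_Ratio ?mulf_neq0 ?oner_eq0 // !mulr1 mulrC.
Qed.

End PadicCdvr.

Section MonicRoots.
Variables (C : comNzRingType) (O : C -> Prop) (O_subring : is_subring O).

Lemma monic_root_degree (D : {poly C}) N z : D \is monic -> size D = N.+1 -> root D z ->
  (0 < N)%N.
Proof.
move=> mD sD; case: N sD => // sD; rewrite (size1_polyC (eq_leq sD)) rootC.
by move/monicP: mD; rewrite lead_coefE sD => ->; rewrite oner_eq0.
Qed.

Lemma monic_root_exp t z (D : {poly C}) N : O z -> D \is monic -> size D = N.+1 ->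
    (forall i, (i < N)%N -> exists2 b, O b & D`_i = t * b) -> root D z ->
  exists2 y, O y & z ^+ N = t * y.
Proof.
move=> Oz mD sD Dlow rD.
have [b bP] := bounded_choice 0 (P := fun i b => O b /\ D`_i = t * b)
  (fun i lt_iN => let: ex_intro2 b Ob Db := Dlow i lt_iN in ex_intro _ b (conj Ob Db)).
have DN : D`_N = 1 by move/monicP: mD; rewrite lead_coefE sD.
exists (- \sum_(i < N) b i * z ^+ i).
  apply: (subringN O_subring); apply: (subring_sum O_subring) => i _.
  by have [Ob _] := bP i (ltn_ord i); apply: (subringM O_subring) => //; apply: subringX.
move/rootP: rD; rewrite horner_coef sD big_ord_recr /= DN mul1r => /eqP.
rewrite addrC addr_eq0 => /eqP ->; rewrite mulrN mulr_sumr; congr (- _).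
by apply: eq_bigr => i _; have [_ ->] := bP i (ltn_ord i); rewrite mulrA.
Qed.

End MonicRoots.

Section Valuation.
Variables (p : nat) (p_pr : prime p) (C : fieldType).
Local Notation Zp := (padic_int p_pr).
Variable j : {rmorphism Zp -> C}.
Hypothesis j_inj : injective j.
Local Notation int := (integer j).
Implicit Types (x y z : C) (P S D : {poly Zp}).
Let cd := padic_cdvr p_pr.

Lemma integer_subring : is_subring int.
Proof. by split; [exact: integral1|exact: integral_sub|exact: integral_mul]. Qed.

Lemma size_map_j P : size (map_poly j P) = size P.
Proof. by rewrite size_map_inj_poly ?rmorph0. Qed.

Lemma exists_primitive_annihilator x P : P != 0 -> root (map_poly j P) x ->
  exists S, [/\ root (map_poly j S) x, exists i, has_inverse S`_i, (size S <= size P)%N &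
    forall S', S' != 0 -> root (map_poly j S') x -> (size S <= size S')%N].
Proof.
move=> P0 rP.
pose annihilated s := exists S, [/\ S != 0, root (map_poly j S) x & size S = s].
have [|s /asboolP[S [S0 rS sS]] smin] := ex_minnP (P := fun s => `[< annihilated s >]).
  by exists (size P); apply/asboolP; exists P.
have le_s S' : S' != 0 -> root (map_poly j S') x -> (s <= size S')%N.
  by move=> S'0 rS'; apply: smin; apply/asboolP; exists S'.
have s_gt0 : (s.-1 < s)%N by rewrite -sS prednK ?size_poly_gt0.
have lead0 : S`_s.-1 <> 0 by apply/eqP; rewrite -sS lead_coef_eq0.
have [k [a [aE [i lt_is ua]]]] := cdvr_primitive cd (a := fun i => S`_i) s_gt0 lead0.
pose S1 := \poly_(i < s) a i.
have SE : S = (p%:R ^+ k)%:P * S1.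
  apply/polyP => l; rewrite coefCM coef_poly; case: ltnP => [/aE //|le_sl].
  by rewrite mulr0 nth_default // sS.
exists S1; split.
- move: rS; rewrite SE rmorphM /= rootM map_polyC /= rootC => /orP[/eqP pk0|//].
  case: (negP S0); rewrite SE (_ : p%:R ^+ k = 0) ?polyC0 ?mul0r //.
  by apply: j_inj; rewrite pk0 rmorph0.
- by exists i; rewrite coef_poly lt_is.
- exact: leq_trans (size_poly _ _) (le_s P P0 rP).
by move=> S' S'0 rS'; apply: leq_trans (size_poly _ _) (le_s S' S'0 rS').
Qed.

Lemma integer_inv_root x P : root (map_poly j P) x -> has_inverse P`_0 -> int x^-1.
Proof.
move=> rP [v vP]; have [->|x0] := eqVneq x 0; first by rewrite invr0; apply: integral0.
have P0 : P != 0.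
  by apply/eqP => P0; move/eqP: vP; rewrite P0 coef0 mul0r eq_sym oner_eq0.
have s0 : (0 < size P)%N by rewrite size_poly_gt0.
set s := size P in s0; pose coef i := v * P`_(s.-1 - i); pose q := \poly_(i < s) coef i.
have lead_q : coef s.-1 = 1 by rewrite /coef subnn mulrC.
have size_q : size q = s by rewrite size_poly_eq // lead_q oner_neq0.
exists q; first by rewrite monicE lead_coef_poly ?lead_q ?oner_neq0.
have xs : x ^+ s.-1 != 0 by rewrite expf_neq0.
rewrite /root -(mulrI_eq0 _ (mulfI xs)).
rewrite (_ : _ * _ = j v * (map_poly j P).[x]); first by rewrite (rootP rP) mulr0.
rewrite !horner_coef !size_map_j size_q (reindex_inj rev_ord_inj) !mulr_sumr.
apply: eq_bigr => i _ /=; rewrite !coef_map /= [q`_ _]coef_poly rev_ord_proof rmorphM /=.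
have lt_is := ltn_ord i.
have -> : (s.-1 - (s - i.+1) = i)%N by rewrite -/s in lt_is *; lia.
have -> : (s - i.+1 = s.-1 - i)%N by lia.
rewrite -!mulrA mulrCA; congr (_ * _); rewrite mulrCA; congr (_ * _).
by rewrite exprVn -[in x ^+ s.-1](@subnKC i s.-1) ?exprD ?mulfK ?expf_neq0 // -ltnS prednK.
Qed.

(* The distinguished factor of a primitive annihilator of least degree is, up to a unit,
   either [1] or the whole annihilator. *)
Lemma valuation_dichotomy x P : P != 0 -> root (map_poly j P) x ->
  int x^-1 \/ exists n y, [/\ (0 < n < size P)%N, int x, int y & x ^+ n = p%:R * y].
Proof.
move=> P0 rP; have [S [rS [i ui] sSP Smin]] := exists_primitive_annihilator P0 rP.
have [|N /asboolP uN Nmin] := ex_minnP (P := fun i => `[< has_inverse S`_i >]).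
  by exists i; apply/asboolP.
have SN : weierstrass_degree p%:R (fun i => S`_i) N.
  split=> // l lt_lN; have [//|ul] := cdvr_divides_or_inverse cd S`_l.
  by have := Nmin l (introT (asboolP _) ul); rewrite leqNgt lt_lN.
have [D [S' [SE [mD sD lowD]]]] := weierstrass_factor cd SN.
have lt_NS : (N < size S)%N.
  rewrite ltnNge; apply/negP => sN; case: uN => v; rewrite nth_default // mul0r.
  by move/eqP; rewrite eq_sym oner_eq0.
move: (rS); rewrite SE rmorphM rootM => /orP[rD|rS'].
  have ix : int x by exists D.
  have mjD : map_poly j D \is monic by apply: monic_map.
  have sjD : size (map_poly j D) = N.+1 by rewrite size_map_j.
  have [k lt_kN|y iy xN] := monic_root_exp integer_subring (t := p%:R) ix mjD sjD _ rD.
    have [b Db] := lowD k lt_kN; exists (j b); first exact: integral_id.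
    by rewrite coef_map /= Db rmorphM rmorph_nat.
  right; exists N, y; split=> //; rewrite (monic_root_degree mjD sjD rD) /=.
  exact: leq_trans lt_NS sSP.
left; apply: (integer_inv_root rS).
have S'0 : S' != 0.
  by apply: contraTneq lt_NS => S'0; rewrite SE S'0 mulr0 size_poly0.
have := Smin S' S'0 rS'; rewrite SE size_monicM // sD /=.
by rewrite -{2}[size S']add0n leq_add2r leqn0 => /eqP N0; rewrite -SE -N0.
Qed.

Lemma integer_p_inv y : int y -> p%:R * y <> 1.
Proof.
case=> q mq rq py; pose n := (size q).-1.
have size_q : size (map_poly j q) = n.+1.
  by rewrite size_map_j prednK // size_poly_gt0 monic_neq0.
have pyX i : (i <= n)%N -> p%:R ^+ n * y ^+ i = p%:R ^+ (n - i).
  by move=> le_in; rewrite -{1}(subnK le_in) exprD -mulrA -exprMn py expr1n mulr1.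
apply: (cdvr_nonunit cd (b := - \sum_(i < n) q`_i * p%:R ^+ (n - i).-1)); apply: j_inj.
move/rootP: rq; rewrite horner_coef size_q => /(congr1 ( *%R (p%:R ^+ n))).
rewrite mulr0 mulr_sumr big_ord_recr /= coef_map /= -/(lead_coef q) (monicP mq) rmorph1.
rewrite mul1r pyX // subnn expr0 => /eqP; rewrite addr_eq0 => /eqP sumE.
rewrite rmorphM rmorph_nat rmorphN rmorph_sum mulrN mulr_sumr -[RHS]opprK -sumE.
congr (- _); apply: eq_bigr => i _; rewrite coef_map mulrCA pyX 1?ltnW // rmorphM mulrCA.
by rewrite rmorphXn rmorph_nat -exprS prednK ?subn_gt0.
Qed.

(* [c ^ (n - 1) P] is a monic polynomial in [c X], for [c] the leading coefficient. *)
Lemma integer_lead x P : P != 0 -> root (map_poly j P) x -> int (j (lead_coef P) * x).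
Proof.
move=> P0 rP; pose c := lead_coef P; pose n := (size P).-1.
have sP : size P = n.+1 by rewrite prednK // size_poly_gt0.
have n0 : (0 < n)%N.
  rewrite -ltnS -sP -size_map_j; apply: root_size_gt1 rP.
  by rewrite -size_poly_gt0 size_map_j size_poly_gt0.
pose coef i := if i == n then 1 else P`_i * c ^+ (n.-1 - i).
have coef_n : coef n = 1 by rewrite /coef eqxx.
exists (\poly_(i < n.+1) coef i); first by rewrite monicE lead_coef_poly ?coef_n ?oner_neq0.
apply/rootP; rewrite horner_coef size_map_j size_poly_eq /= ?coef_n ?oner_neq0 //.
transitivity (j c ^+ n.-1 * (map_poly j P).[x]); last by rewrite (rootP rP) mulr0.
rewrite horner_coef size_map_j sP mulr_sumr; apply: eq_bigr => i _.
rewrite !coef_map /= coef_poly ltn_ord exprMn mulrA [in RHS]mulrA; congr (_ * _).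
rewrite /coef; case: eqP => [->|/eqP ni].
  by rewrite rmorph1 mul1r -[in LHS](prednK n0) exprSr /c lead_coefE sP.
have le_in : (i <= n.-1)%N by rewrite -ltnS prednK // ltn_neqAle ni -ltnS ltn_ord.
by rewrite rmorphM rmorphXn -mulrA -exprD subnK // mulrC.
Qed.

Lemma prime_neq0 : (p%:R : C) != 0.
Proof.
rewrite -(rmorph_nat j) -(rmorph0 j) (inj_eq j_inj).
apply/eqP => p0; have := cdvr_regular cd (a := 1); rewrite p0 mul0r => /(_ erefl)/eqP.
by rewrite oner_eq0.
Qed.

Lemma padic_integrally_closed x a b : b != 0 -> int x -> x * j b = j a ->
  exists a', x = j a'.
Proof.
move=> b0 ix xb; have [a0|/eqP a0] := eqVneq a 0.
  exists 0; apply/eqP; rewrite rmorph0 -(mulIr_eq0 x (mulIf (_ : j b != 0))) ?xb ?a0 ?rmorph0 //.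
  by rewrite -(rmorph0 j) (inj_eq j_inj).
have [k [u [aE [v uv]]]] := cdvr_factor cd a0.
have [l [u' [bE [v' uv']]]] := cdvr_factor cd (elimN eqP b0).
have [le_lk|lt_kl] := leqP l k.
  exists (p%:R ^+ (k - l) * u * v').
  have jb : j b != 0 by rewrite -(rmorph0 j) (inj_eq j_inj).
  apply: (mulIf jb); rewrite xb -rmorphM aE bE; congr (j _).
  rewrite -{1}(subnK le_lk) exprD.
  have -> : p%:R ^+ (k - l) * u * v' * (p%:R ^+ l * u') =
    p%:R ^+ (k - l) * p%:R ^+ l * u * (u' * v') by ring.
  by rewrite uv' mulr1.
have [e lE] : exists e, l = (k.+1 + e)%N by exists (l - k.+1)%N; rewrite subnKC.
case: (integer_p_inv (y := p%:R ^+ e * x * j u' * j v)).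
  do 3?apply: integral_mul => //; try exact: integral_id.
  exact/(subringX integer_subring)/integral_nat.
have pk : p%:R ^+ k != 0 :> C by rewrite expf_neq0 // prime_neq0.
apply: (mulfI pk); rewrite mulr1; transitivity (x * j b * j v).
  by rewrite bE rmorphM rmorphXn rmorph_nat lE exprD exprS; ring.
by rewrite xb aE -rmorphM -mulrA uv mulr1 rmorphXn rmorph_nat.
Qed.

Definition padic_algebraic := forall z : C, exists P, P != 0 /\ root (map_poly j P) z.

Hypothesis alg : padic_algebraic.

Lemma integer_separated x : (forall N, exists2 z, int z & x = p%:R ^+ N * z) -> x = 0.
Proof.
move=> p_x; apply: contrapT => /eqP x0.
have [P [P0 rP]] := alg x^-1; have := integer_lead P0 rP.
have lc0 : lead_coef P <> 0 by apply/eqP; rewrite lead_coef_eq0.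
have [k [u [-> [v uv]]]] := cdvr_factor cd lc0.
have [z iz xz] := p_x k.+1 => it.
set t := _ * x^-1 in it.
apply: (integer_p_inv (y := z * t * j v)).
  by do 2?apply: integral_mul => //; apply: integral_id.
have pk : (p%:R ^+ k : C) != 0 by rewrite expf_neq0 // prime_neq0.
apply: (mulfI pk); rewrite mulr1 !mulrA -exprSr -xz /t rmorphM rmorphXn rmorph_nat.
by rewrite [x * _]mulrC mulfK // -mulrA -rmorphM uv rmorph1 mulr1.
Qed.

Lemma integer_total x : int x \/ int x^-1.
Proof.
have [P [P0 rP]] := alg x.
by have [|[n [y []]]] := valuation_dichotomy P0 rP; [right|left].
Qed.

Lemma maxideal_power x (P : {poly Zp}) : P != 0 -> root (map_poly j P) x ->
  maxideal j x -> exists n y, [/\ (0 < n < size P)%N, int y & x ^+ n = p%:R * y].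
Proof.
move=> P0 rP [ix nu]; have [ixV|[n [y []]]] := valuation_dichotomy P0 rP; last by exists n, y.
have [x0|x0] := eqVneq x 0; last by case: nu; split=> //; exists x^-1; rewrite ?divff.
exists 1%N, 0; split; [|exact: integral0|by rewrite x0 expr0n mulr0].
rewrite /= -(size_map_inj_poly j_inj (rmorph0 _)).
apply: root_size_gt1 rP.
by rewrite -size_poly_eq0 size_map_j size_poly_eq0.
Qed.

Lemma maxidealP x : maxideal j x <->
  int x /\ exists n y, [/\ (0 < n)%N, int y & x ^+ n = p%:R * y].
Proof.
split=> [mx|[ix [n [y [n0 iy xn]]]]].
  split; first by case: mx.
  have [P [P0 rP]] := alg x.
  by have [n [y [/andP[n0 _] iy xn]]] := maxideal_power P0 rP mx; exists n, y.
split=> // -[_ [z iz xz]].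
apply: (integer_p_inv (y := y * z ^+ n)).
  by apply: integral_mul => //; apply: (subringX integer_subring).
by rewrite mulrA -xn -exprMn xz expr1n.
Qed.

Lemma padic_lim_eq (u : nat -> C) l : padic_cvg j u l -> padic_lim j u = l.
Proof.
move=> ul; rewrite /padic_lim; case: pselect => [ex_l|[]]; last by exists l.
case: cid => l' ul' /=; apply/eqP; rewrite -subr_eq0; apply/eqP/integer_separated => N.
have [k near_l] := ul N; have [k' near_l'] := ul' N.
have [z iz zE] := near_l (maxn k k') (leq_maxl _ _).
have [z' iz' z'E] := near_l' (maxn k k') (leq_maxr _ _).
exists (z - z'); first exact: integral_sub.
by rewrite mulrBr -zE -z'E; ring.
Qed.

End Valuation.

(** * Rings of integers of finite extensions *)

Section PadicFractions.
Variables (p : nat) (p_pr : prime p).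

Definition zfrac (a : padic_int p_pr) : padic p_pr := tofrac a.

Fact zfrac_zmod_morphism : zmod_morphism zfrac.
Proof. exact: tofracB. Qed.
Fact zfrac_monoid_morphism : monoid_morphism zfrac.
Proof. by split; [exact: tofrac1|exact: tofracM]. Qed.

HB.instance Definition _ := GRing.isZmodMorphism.Build _ _ zfrac zfrac_zmod_morphism.
HB.instance Definition _ := GRing.isMonoidMorphism.Build _ _ zfrac zfrac_monoid_morphism.

Lemma zfrac_eq0 a : (zfrac a == 0) = (a == 0).
Proof. exact: tofrac_eq0. Qed.

Lemma zfrac_inj : injective zfrac.
Proof. by move=> a b /eqP; rewrite -subr_eq0 -rmorphB zfrac_eq0 subr_eq0 => /eqP. Qed.

Lemma padic_common_denominator (x : nat -> padic p_pr) n :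
  exists (a : nat -> padic_int p_pr) c, c != 0 /\
    forall i, (i < n)%N -> zfrac (a i) = zfrac c * x i.
Proof.
elim: n => [|n [a [c [c0 ac]]]]; first by exists (fun=> 0), 1; rewrite oner_eq0.
have [a' [b [b0 xn]]] := padic_frac (x n).
exists (fun i => if i == n then a' * c else a i * b), (c * b); split.
  by rewrite mulf_neq0.
move=> i; rewrite ltnS leq_eqVlt; case: eqP => [->|_] /= => [_|lt_in].
  rewrite xn -/(zfrac a') -/(zfrac b) !rmorphM mulrC -mulrA; congr (_ * _).
  by rewrite mulrC mulfVK ?zfrac_eq0.
by rewrite !rmorphM /= ac // mulrAC.
Qed.

Lemma padic_poly_denominators (P : {poly padic p_pr}) :
  exists S c, c != 0 /\ map_poly zfrac S = zfrac c *: P.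
Proof.
have [a [c [c0 ac]]] := padic_common_denominator (fun i => P`_i) (size P).
exists (\poly_(i < size P) a i), c; split=> //; apply/polyP => i.
rewrite coef_map coefZ coef_poly; case: ltnP => [/ac //|le_Pi].
by rewrite [P`_i]nth_default ?mulr0 ?rmorph0 //.
Qed.

End PadicFractions.

Section IntegersOfOmega.
Variables (p : nat) (p_pr : prime p) (Omega : fieldExtType (padic p_pr)).
Local Notation Zp := (padic_int p_pr).
Local Notation O := (@padic_int_in p p_pr Omega).
Local Notation int := (integer O).

Fact padic_int_in_zmod_morphism : zmod_morphism O.
Proof. by move=> a b; rewrite /padic_int_in tofracB scalerBl. Qed.

Fact padic_int_in_monoid_morphism : monoid_morphism O.
Proof.
split=> [|a b]; first by rewrite /padic_int_in tofrac1 scale1r.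
by rewrite /padic_int_in tofracM -scalerAl mul1r scalerA.
Qed.

HB.instance Definition _ := GRing.isZmodMorphism.Build Zp Omega O
  padic_int_in_zmod_morphism.
HB.instance Definition _ := GRing.isMonoidMorphism.Build Zp Omega O
  padic_int_in_monoid_morphism.

Lemma padic_int_in_inj : injective O.
Proof.
move=> a b /eqP; rewrite -subr_eq0 -rmorphB /padic_int_in scaler_eq0 oner_eq0 orbF.
by rewrite tofrac_eq0 subr_eq0 => /eqP.
Qed.

Lemma map_padic_int_in (S : {poly Zp}) :
  map_poly O S = map_poly (in_alg Omega) (map_poly (@zfrac _ _) S).
Proof. by apply/polyP => i; rewrite !coef_map. Qed.

Lemma omega_subring : is_subring int.
Proof. exact: integer_subring. Qed.

Lemma omega_algebraic_bound (x : Omega) : exists P : {poly Zp},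
  [/\ P != 0, root (map_poly O P) x & (size P <= (\dim {:Omega}).+1)%N].
Proof.
have /polyOver1P[q qE] : minPoly 1 x \is a polyOver 1%VS by apply: minPolyOver.
have [S [c [c0 SE]]] := padic_poly_denominators q.
have sS : size S = size q.
  rewrite -(size_scale q (_ : zfrac c != 0)) ?zfrac_eq0 // -SE.
  by rewrite size_map_inj_poly ?rmorph0 //; apply: zfrac_inj.
have sq : size q = (adjoin_degree 1 x).+1.
  by rewrite -(size_minPoly 1 x) qE size_map_poly.
exists S; split.
- by rewrite -size_poly_eq0 sS sq.
- rewrite map_padic_int_in SE map_polyZ /= -qE rootZ ?root_minPoly //.
  by rewrite scaler_eq0 oner_eq0 orbF zfrac_eq0.
by rewrite sS sq ltnS adjoin_degreeE dimv1 divn1 dimvS // subvf.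
Qed.

Lemma omega_algebraic : padic_algebraic O.
Proof. by move=> x; have [P [P0 rP _]] := omega_algebraic_bound x; exists P. Qed.

Lemma omega_denominator (x : Omega) : exists k, int (p%:R ^+ k * x).
Proof.
have [P [P0 rP]] := omega_algebraic x; have := integer_lead padic_int_in_inj P0 rP.
have lc0 : lead_coef P <> 0 by apply/eqP; rewrite lead_coef_eq0.
have [k [u [-> [v uv]]]] := cdvr_factor (padic_cdvr p_pr) lc0; exists k.
have -> : p%:R ^+ k * x = O v * (O (p%:R ^+ k * u) * x).
  rewrite rmorphM mulrA [O v * _]mulrCA -[O v * O u]rmorphM [v * u]mulrC uv.
  by rewrite rmorph1 mulr1 rmorphXn rmorph_nat.
by apply: (subringM omega_subring) => //; apply: integral_id.
Qed.

Lemma omega_denominators (x : nat -> Omega) n : exists k,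
  forall i, (i < n)%N -> int (p%:R ^+ k * x i).
Proof.
have [k kP] := choice (fun i => omega_denominator (x i)).
exists (\sum_(i < n) k i)%N => i lti; rewrite (bigD1 (Ordinal lti)) //= addnC exprD -mulrA.
apply: (subringM omega_subring) => //.
by apply: (subringX omega_subring); apply: (subring_nat omega_subring _).
Qed.

Lemma omega_separated x : (forall N, exists2 z, int z & x = p%:R ^+ N * z) -> x = 0.
Proof. exact: (integer_separated padic_int_in_inj omega_algebraic). Qed.

Lemma omega_total x : int x \/ int x^-1.
Proof. exact: (integer_total padic_int_in_inj omega_algebraic). Qed.

Lemma omega_maxidealP x : maxideal O x <->
  int x /\ exists n y, [/\ (0 < n)%N, int y & x ^+ n = p%:R * y].
Proof. exact: (maxidealP padic_int_in_inj omega_algebraic). Qed.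

Lemma omega_maxideal_power x : maxideal O x ->
  exists2 y, int y & x ^+ \dim {:Omega} = p%:R * y.
Proof.
move=> mx; have [P [P0 rP sP]] := omega_algebraic_bound x.
have [n [y [/andP[_ nP] iy xn]]] := maxideal_power padic_int_in_inj P0 rP mx.
have nd : (n <= \dim {:Omega})%N by rewrite -ltnS (leq_trans nP).
exists (y * x ^+ (\dim {:Omega} - n)).
  by apply: (subringM omega_subring) => //; apply: (subringX omega_subring); case: mx.
by rewrite mulrA -xn -exprD subnKC.
Qed.

Lemma omega_p_inv y : int y -> p%:R * y <> 1 :> Omega.
Proof. exact: (integer_p_inv padic_int_in_inj). Qed.

Lemma omega_p_neq0 : p%:R != 0 :> Omega.
Proof. exact: (prime_neq0 padic_int_in_inj). Qed.

Implicit Types E : {subfield Omega}.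

Lemma integer_of_subring E : is_subring (integer_of E).
Proof.
split=> [|x y [xE ix] [yE iy]|x y [xE ix] [yE iy]]; split.
- exact: mem1v.
- exact: (subring1 omega_subring).
- exact: memvB.
- exact: (subringB omega_subring).
- exact: memvM.
- exact: (subringM omega_subring).
Qed.

Definition ints E : {pred Omega} := fun x => `[< integer_of E x >].

Fact ints_subring E : subring_closed (ints E).
Proof.
have [O1 OB OM] := integer_of_subring E.
split=> [|x y /asboolP xO /asboolP yO|x y /asboolP xO /asboolP yO]; apply/asboolP => //.
- exact: OB.
- exact: OM.
Qed.

HB.instance Definition _ E := GRing.isSubringClosed.Build Omega (ints E) (ints_subring E).

Definition OE E := {x : Omega | x \in ints E}.
HB.instance Definition _ E := SubChoice.on (OE E).
HB.instance Definition _ E := [SubChoice_isSubComNzRing of OE E by <:].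

Definition toOE E x (ix : integer_of E x) : OE E := exist _ x (introT (asboolP _) ix).

Lemma val_OEP E (a : OE E) : integer_of E (val a).
Proof. by case: a => x /= /asboolP. Qed.

Lemma toOEK E x (ix : integer_of E x) : val (toOE ix) = x. Proof. by []. Qed.

Lemma val_OED E (a b : OE E) : val (a + b) = val a + val b. Proof. by []. Qed.
Lemma val_OEM E (a b : OE E) : val (a * b) = val a * val b. Proof. by []. Qed.
Lemma val_OEX E (a : OE E) n : val (a ^+ n) = val a ^+ n. Proof. exact: rmorphXn. Qed.

Definition OmegaOver E : Type := Omega.
HB.instance Definition _ E := GRing.Zmodule.on (OmegaOver E).
Definition OmegaOver_scale E (a : OE E) (x : OmegaOver E) : OmegaOver E := val a * x.
Fact OmegaOver_scaleA E a b (x : OmegaOver E) :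
  OmegaOver_scale a (OmegaOver_scale b x) = OmegaOver_scale (a * b) x.
Proof. by rewrite /OmegaOver_scale rmorphM mulrA. Qed.
Fact OmegaOver_scale1 E : left_id 1 (@OmegaOver_scale E).
Proof. by move=> x; rewrite /OmegaOver_scale rmorph1 mul1r. Qed.
Fact OmegaOver_scaleDr E : right_distributive (@OmegaOver_scale E) +%R.
Proof. by move=> a x y; rewrite /OmegaOver_scale mulrDr. Qed.
Fact OmegaOver_scaleDl E (x : OmegaOver E) :
  {morph (@OmegaOver_scale E)^~ x : a b / a + b}.
Proof. by move=> a b; rewrite /OmegaOver_scale rmorphD mulrDl. Qed.
HB.instance Definition _ E := GRing.Zmodule_isLmodule.Build (OE E) (OmegaOver E)
  (@OmegaOver_scaleA E) (@OmegaOver_scale1 E) (@OmegaOver_scaleDr E)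
  (@OmegaOver_scaleDl E).

Lemma OmegaOver_scaleE E (a : OE E) (x : OmegaOver E) : a *: x = val a * x.
Proof. by []. Qed.

Lemma integer_ofM E x y : integer_of E x -> integer_of E y -> integer_of E (x * y).
Proof. exact: (subringM (integer_of_subring E)). Qed.

Lemma integer_ofB E x y : integer_of E x -> integer_of E y -> integer_of E (x - y).
Proof. exact: (subringB (integer_of_subring E)). Qed.

Lemma integer_of1 E : integer_of E 1.
Proof. exact: (subring1 (integer_of_subring E)). Qed.

Lemma integer_of0 E : integer_of E 0.
Proof. exact: (subring0 (integer_of_subring E)). Qed.

Lemma integer_ofD E x y : integer_of E x -> integer_of E y -> integer_of E (x + y).
Proof. exact: (subringD (integer_of_subring E)). Qed.

Lemma integer_ofS E E' x : (E <= E')%VS -> integer_of E x -> integer_of E' x.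
Proof. by move=> /subvP sEE' [/sEE' xE ix]. Qed.

Lemma subfield_div E x y : x \in E -> y \in E -> x / y \in E.
Proof. by move=> xE yE; rewrite memvM // memvV. Qed.

Lemma subfield_nat E n : (n%:R : Omega) \in E.
Proof. by rewrite -scaler_nat memvZ // mem1v. Qed.

Lemma unit_integer_of E x : x \in E -> integer_unit O x -> exists2 y, integer_of E y & x * y = 1.
Proof.
move=> xE [ix [y iy xy]]; exists y => //; split=> //.
have x0 : x != 0 by apply/eqP => x0; move/eqP: xy; rewrite x0 mul0r eq_sym oner_eq0.
by have -> : y = x^-1; [apply: (mulfI x0); rewrite xy divff | rewrite memvV].
Qed.

Lemma maxideal_or_unit E x : integer_of E x ->
  maxideal_of E x \/ exists2 y, integer_of E y & x * y = 1.
Proof.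
case=> xE ix; have [ux|nu] := pselect (integer_unit O x); last by left.
by right; apply: unit_integer_of.
Qed.

Lemma p_maxideal_of E : maxideal_of E p%:R.
Proof.
split; first exact: subfield_nat.
apply/omega_maxidealP; split; first exact: (subring_nat omega_subring _).
by exists 1%N, 1; split=> //; [exact: (subring1 omega_subring)|rewrite mulr1 expr1].
Qed.

Lemma maxideal_ofM E x y : maxideal_of E x -> integer_of E y -> maxideal_of E (x * y).
Proof.
case=> xE [ix nux] [yE iy]; split; first exact: memvM.
split; first exact: (subringM omega_subring).
case=> _ [z iz xyz]; apply: nux; split=> //; exists (y * z); rewrite ?mulrA //.
exact: (subringM omega_subring).
Qed.

Lemma maxideal_ofS E E' x : (E <= E')%VS -> maxideal_of E x -> maxideal_of E' x.
Proof. by move=> sEE' [xE mx]; split=> //; apply: subvP xE. Qed.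

Lemma maxideal_of_int E x : maxideal_of E x -> integer_of E x.
Proof. by case=> xE [ix _]. Qed.

Lemma maxideal_factor E x : ~ is_uniformizer E x -> maxideal_of E x ->
  exists y z, [/\ maxideal_of E y, maxideal_of E z & x = y * z].
Proof.
move=> not_unif mx.
have [y my xNy] : exists2 y, maxideal_of E y & ~ exists2 z, integer_of E z & y = x * z.
  apply: contrapT => div_x; apply: not_unif => y; split=> [my|[z iz ->]].
    by apply: contrapT => xNy; apply: div_x; exists y.
  exact: maxideal_ofM.
have [xE _] := mx; have [yE _] := my.
have y0 : y != 0.
  by apply/eqP => y0; apply: xNy; exists 0; rewrite ?mulr0 //; exact: integer_of0.
exists y, (x / y); split=> //; last by rewrite mulrC mulfVK.
have xyE : x / y \in E by apply: subfield_div.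
have ixy : int (x / y).
  have [//|iyx] := omega_total (x / y).
  have [->|x0] := eqVneq x 0; first by rewrite mul0r; apply: (subring0 omega_subring).
  case: xNy; exists (y / x); last by rewrite mulrC mulfVK.
  by split; [apply: subfield_div|rewrite -invf_div].
split=> //; split=> // -[_ [z iz xyz]].
have [|z' iz' xyz'] := unit_integer_of xyE; first by split=> //; exists z.
by case: xNy; exists z' => //; rewrite -[LHS]mulr1 -xyz' mulrA [y * _]mulrC mulfVK.
Qed.

(* If no element generated the maximal ideal, [p] would be a product of
   arbitrarily many elements of the maximal ideal, each of which has a bounded
   power divisible by [p]. *)
Lemma exists_uniformizer E : exists t, is_uniformizer E t.
Proof.
apply: contrapT => no_unif; pose d := \dim {:Omega}.
have p_factor k : exists x z, [/\ maxideal_of E x, int z &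
    p%:R ^+ d = x ^+ d * (p%:R ^+ k * z) :> Omega].
  elim: k => [|k [x [z [mx iz pE]]]].
    exists p%:R, 1; split; [exact: p_maxideal_of|exact: (subring1 omega_subring)|by rewrite !mulr1].
  have [|y [y' [my [_ my'] xE]]] := maxideal_factor _ mx.
    by move=> ux; apply: no_unif; exists x.
  have [z' iz' y'E] := omega_maxideal_power my'.
  exists y, (z' * z); split=> //; first exact: (subringM omega_subring).
  by rewrite pE xE exprMn y'E exprS -!mulrA [z' * (_ * _)]mulrCA.
have [x [z [[_ [ix _]] iz pE]]] := p_factor d.+1.
apply: (omega_p_inv (y := x ^+ d * z)).
  by apply: (subringM omega_subring) => //; apply: (subringX omega_subring).
have pd : p%:R ^+ d != 0 :> Omega by rewrite expf_neq0 // omega_p_neq0.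
by apply: (mulfI pd); rewrite mulr1 [RHS]pE mulrA -exprSr mulrCA.
Qed.

Lemma uniformizer_max E t : is_uniformizer E t -> maxideal_of E t.
Proof. by move=> ut; apply/ut; exists 1; rewrite ?mulr1 //; apply: integer_of1. Qed.

Lemma uniformizer_neq0 E t : is_uniformizer E t -> t != 0.
Proof.
move=> ut; have /ut[y _ pE] := p_maxideal_of E.
by apply: contra omega_p_neq0 => /eqP t0; rewrite pE t0 mul0r.
Qed.

Lemma padic_subfield_integer (x : Omega) : integer_of 1%AS x -> exists a, x = O a.
Proof.
case=> /vlineP[c ->] ic; have [a [b [b0 cE]]] := padic_frac c.
apply: (padic_integrally_closed padic_int_in_inj (a := a) (b := b)) => //.
by rewrite /padic_int_in -scalerAl mul1r scalerA cE mulfVK // tofrac_eq0.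
Qed.

Lemma padic_OE (x : OE 1%AS) : exists a, val x = O a.
Proof. exact: padic_subfield_integer (val_OEP x). Qed.

Lemma padic_OE_cdvr : cdvr (p%:R : OE 1%AS).
Proof.
have Oint a : integer_of 1%AS (O a).
  by split; [rewrite /padic_int_in memvZ // mem1v|apply: integral_id].
pose inOE a := toOE (Oint a).
have inOE_eq (x : OE 1%AS) a : val x = O a -> x = inOE a by move=> xE; apply: val_inj.
have pcd := padic_cdvr p_pr; split.
- move=> x; have [a xE] := padic_OE x; have [[b ab]|[b ab]] := cdvr_divides_or_inverse pcd a.
    left; exists (inOE b); apply: val_inj.
    by rewrite rmorphM rmorph_nat /= xE ab rmorphM rmorph_nat.
  by right; exists (inOE b); apply: val_inj; rewrite rmorphM /= xE -rmorphM ab !rmorph1.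
- move=> x p_x; apply: val_inj; apply: omega_separated => N; have [b ->] := p_x N.
  exists (val b); first by case: (val_OEP b).
  by rewrite rmorphM rmorphXn rmorph_nat.
- move=> x; have [a aE] := choice (fun i => padic_OE (x i)).
  have [l lP] := cdvr_complete pcd a; exists (inOE l) => k; have [b lE] := lP k.
  exists (inOE b); apply: val_inj.
  rewrite rmorphD rmorphM rmorphXn rmorph_nat !toOEK lE rmorphD rmorphM rmorphXn rmorph_nat.
  congr (_ + _); rewrite !rmorph_sum; apply: eq_bigr => i _.
  transitivity (O (a i) * p%:R ^+ i); first by rewrite rmorphM rmorphXn rmorph_nat.
  by rewrite -aE rmorphM rmorphXn rmorph_nat.
- move=> a /(congr1 val); rewrite rmorphM rmorph_nat => /eqP.
  by rewrite mulf_eq0 (negPf omega_p_neq0) => /eqP a0; apply: val_inj.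
- move=> b /(congr1 val); rewrite rmorphM rmorph_nat rmorph1.
  by apply: omega_p_inv; case: (val_OEP b).
Qed.

End IntegersOfOmega.

Section SubfieldBasis.
Variables (F : fieldType) (Omega : fieldExtType F).
Implicit Types E K : {subfield Omega}.

Lemma subfield_basis K E (n := \dim_K E) : (K <= E)%VS ->
  exists X : nat -> Omega, [/\ forall i, (i < n)%N -> X i \in E,
    forall x, x \in E -> exists2 a : nat -> Omega, (forall i, a i \in K) &
      x = \sum_(i < n) a i * X i &
    forall a : nat -> Omega, (forall i, a i \in K) -> \sum_(i < n) a i * X i = 0 ->
      forall i, (i < n)%N -> a i = 0].
Proof.
rewrite -sup_field_module => sKE.
have [X [XE X0] [defE dxE]] := field_module_semisimple sKE.
exists (fun i => X`_i); split=> [i lti|x xE|a aK a0 i lti].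
- by apply: XE; rewrite mem_nth // size_tuple.
- have : x \in (\sum_(i < \dim_K E) K * <[X`_i]>)%VS by rewrite defE.
  move=> /memv_sumP[y yP ->].
  have ex_a i : (i < n)%N ->
      exists a, a \in K /\ forall lti : (i < n)%N, y (Ordinal lti) = a * X`_i.
    move=> lti; have /memv_cosetP[a aK yE] := yP (Ordinal lti) isT.
    by exists a; split=> // lti'; rewrite -yE; congr y; exact: val_inj.
  have [a aP] := bounded_choice 0 ex_a.
  exists (fun i => if (i < n)%N then a i else 0) => [i|].
    by case: ifP => [/aP[]|_] //; exact: mem0v.
  by apply: eq_bigr => -[i lti] _ /=; rewrite lti; have [_ ->] := aP i lti.
have /eqP : a i * X`_i = 0.
  move: (directv_sum_independent dxE) => /(_ (fun i : 'I_n => a i * X`_i)) ind.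
  by apply: (ind _ a0 (Ordinal lti)) => // k _; rewrite memv_mul ?memv_line.
rewrite mulf_eq0 => /orP[/eqP //|/eqP Xi].
by case/negP: X0; rewrite -Xi mem_nth // size_tuple.
Qed.

End SubfieldBasis.

Section IntegralLattice.
Variables (p : nat) (p_pr : prime p) (Omega : fieldExtType (padic p_pr)).
Local Notation O := (@padic_int_in p p_pr Omega).
Local Notation int := (integer O).
Variables (K : {subfield Omega}) (w : OE K) (cd : cdvr w).
Variables (E : {subfield Omega}) (sKE : (K <= E)%VS).
Local Notation n := (\dim_K E).
Local Notation V := (OmegaOver K).
Let B (x : V) := integer_of E (x : Omega).
Let T (x : V) := x = 0.

Lemma cdvr_maxideal_of : maxideal_of K (val w).
Proof.
have [wK iw] := val_OEP w; split=> //; split=> // uw.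
have [y iy wy] := unit_integer_of wK uw.
by apply: (cdvr_nonunit cd (b := toOE iy)); apply: val_inj; rewrite val_OEM toOEK wy rmorph1.
Qed.

Lemma cdvr_val_neq0 : val w != 0.
Proof.
apply/eqP => w0; have wE : w = 0 by apply: val_inj; rewrite w0.
apply: (cdvr_nonunit cd (b := 0)); rewrite mulr0.
by apply/esym/(cdvr_regular cd); rewrite {1}wE mul0r.
Qed.

Lemma integer_of_submod : submod B.
Proof.
split=> [|a x y Bx By]; first exact: integer_of0.
rewrite /B OmegaOver_scaleE; apply: integer_ofD => //; apply: integer_ofM => //.
by apply: integer_ofS sKE _; apply: val_OEP.
Qed.

Lemma integer_of_lattice : lattice_mod w B T.
Proof.
split=> [||x _ /eqP|x _ w_x]; [exact: integer_of_submod|exact: submod_zero| |].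
  by rewrite /T OmegaOver_scaleE mulf_eq0 (negPf cdvr_val_neq0) => /eqP.
apply: omega_separated => N.
have [_ /omega_maxidealP[_ [k [z [k0 iz wk]]]]] := cdvr_maxideal_of.
have [y [_ iy] /eqP] := w_x (k * N)%N; rewrite subr_eq0 => /eqP ->.
exists (z ^+ N * (y : Omega)).
  by apply: (subringM (omega_subring Omega)) => //; apply: subringX (omega_subring Omega) _ _ iz.
by rewrite OmegaOver_scaleE val_OEX exprM wk exprMn mulrA.
Qed.

Lemma integer_of_dependence (y : nat -> V) : (forall i, (i <= n)%N -> B (y i)) ->
  ~ indep_mod T n.+1 y.
Proof.
move=> By indy; have [X [_ span _]] := subfield_basis sKE.
have ex_a i : (i < n.+1)%N -> exists a : nat -> Omega,
    (forall j, a j \in K) /\ y i = \sum_(j < n) a j * X j.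
  by move=> lt_in; have [yE _] := By i lt_in; have [a aK yX] := span _ yE; exists a.
have [a aP] := bounded_choice (fun=> 0) ex_a.
have [k kP] := choice (fun i => omega_denominators (a i) n).
pose d := (\sum_(i < n.+1) k i)%N.
have ex_v i : (i < n.+1)%N -> exists v : nat -> OE K,
    forall j, (j < n)%N -> val (v j) = p%:R ^+ d * a i j.
  move=> lt_in; have ex_vj j : (j < n)%N -> exists v : OE K, val v = p%:R ^+ d * a i j.
    move=> lt_jn; have ia : integer_of K (p%:R ^+ d * a i j).
      have [aK _] := aP i lt_in; split; first by rewrite memvM ?aK // -natrX subfield_nat.
      rewrite /d (bigD1 (Ordinal lt_in)) //= addnC exprD -mulrA.
      apply: (subringM (omega_subring Omega)); last exact: kP.
      exact/(subringX (omega_subring Omega))/(subring_nat (omega_subring Omega)).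
    by exists (toOE ia).
  exact: (bounded_choice 0 ex_vj).
have [v vP] := bounded_choice (fun=> 0) ex_v.
have [c [[i le_in ci] cv]] := cdvr_dependence cd n v.
apply/ci/(indy c) => //; rewrite /T.
have pd : p%:R ^+ d != 0 :> Omega by rewrite expf_neq0 // omega_p_neq0.
apply: (mulfI pd); rewrite mulr0 mulr_sumr.
transitivity (\sum_(i < n.+1) \sum_(j < n) val (c i * v i j) * X j).
  apply: eq_bigr => l _; have [_ yE] := aP l (ltn_ord l).
  rewrite OmegaOver_scaleE yE !mulr_sumr; apply: eq_bigr => j _.
  by rewrite val_OEM (vP _ (ltn_ord l) _ (ltn_ord j)) mulrCA -!mulrA.
by rewrite exchange_big big1 // => j _; rewrite -mulr_suml -(rmorph_sum val) cv // rmorph0 mul0r.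
Qed.

Lemma integer_of_rank : has_rank_mod B T n.
Proof.
split; last exact: integer_of_dependence.
have [X [XE _ ind]] := subfield_basis sKE; have [k kP] := omega_denominators X n.
have pkE (F : {subfield Omega}) : p%:R ^+ k \in F by rewrite -natrX subfield_nat.
exists (fun i => p%:R ^+ k * X i) => [i lt_in|a a0 i lt_in].
  by split; [rewrite memvM ?XE|apply: kP].
have pk : p%:R ^+ k != 0 :> Omega by rewrite expf_neq0 // omega_p_neq0.
apply: val_inj; rewrite rmorph0; apply: (mulfI pk); rewrite mulr0.
apply: (ind (fun i => p%:R ^+ k * val (a i))) => // [j|].
  by apply: memvM; [exact: pkE|case: (val_OEP (a j))].
rewrite -[RHS]a0; apply: eq_bigr => j _.
by rewrite OmegaOver_scaleE mulrCA mulrA.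
Qed.

Lemma integer_of_basis : exists e : nat -> V,
  [/\ forall i, (i < n)%N -> B (e i), indep_mod T n e & generated_mod B T n e].
Proof.
have [//|//|e [_ eB inde gene]] := free_extension cd integer_of_lattice (h := 0)
  (x := fun=> 0) integer_of_rank.
by exists e.
Qed.

End IntegralLattice.

Lemma sum_blocks (R : comNzRingType) (a : nat -> R) t y c n k : t ^+ n = c * y ->
  \sum_(i < k) (\sum_(j < n) a (n * i + j)%N * t ^+ j) * y ^+ i * c ^+ i
  = \sum_(i < n * k) a i * t ^+ i.
Proof.
move=> tn; elim: k => [|k IHk]; first by rewrite muln0 !big_ord0.
rewrite big_ord_recr IHk mulnS addnC big_split_ord /=; congr (_ + _).
rewrite !mulr_suml; apply: eq_bigr => i _; rewrite exprD exprM tn exprMn.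
by ring.
Qed.

Section UniformizerDvr.
Variables (p : nat) (p_pr : prime p) (Omega : fieldExtType (padic p_pr)).
Variable E : {subfield Omega}.
Local Notation O := (@padic_int_in p p_pr Omega).

Lemma OE_p_complete (a : nat -> OE E) : exists l : OE E, forall k, exists b,
  l = \sum_(i < k) a i * p%:R ^+ i + p%:R ^+ k * b.
Proof.
have s1E : (1%AS <= E)%VS := sub1v E; have cd1 := padic_OE_cdvr Omega.
have [e [Be _ gen]] := integer_of_basis cd1 s1E; set n := \dim_1%AS E in Be gen.
have ex_c i : exists c : nat -> OE 1%AS, val (a i) = \sum_(j < n) val (c j) * e j.
  have [c /eqP] := gen _ (val_OEP (a i)); rewrite subr_eq0 => /eqP aE.
  by exists c; rewrite aE.
have [c cP] := choice ex_c.
have [l lP] := choice (fun j => cdvr_complete cd1 (fun i => c i j)).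
have comb (x : nat -> OE 1%AS) : integer_of E (\sum_(j < n) val (x j) * e j).
  exact: (submod_sum x (integer_of_submod s1E) Be).
exists (toOE (comb l)) => k; have [b bP] := choice (fun j => lP j k).
exists (toOE (comb b)); apply: val_inj.
rewrite val_OED val_OEM val_OEX rmorph_nat !toOEK rmorph_sum.
have lE (j : 'I_n) (_ : true) : val (l j) * e j =
    \sum_(i < k) val (c i j) * p%:R ^+ i * e j + p%:R ^+ k * (val (b j) * e j).
  rewrite bP val_OED val_OEM val_OEX rmorph_nat mulrDl -mulrA rmorph_sum mulr_suml.
  by congr (_ + _); apply: eq_bigr => i _; rewrite rmorphM rmorphXn rmorph_nat.
rewrite (eq_bigr _ lE) big_split -mulr_sumr exchange_big; congr (_ + _).
apply: eq_bigr => i _; rewrite rmorphM rmorphXn rmorph_nat /= cP mulr_suml.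
by apply: eq_bigr => j _; rewrite mulrAC.
Qed.

(* Some power [t ^ n] is divisible by [p]: group the terms of a series in [t]
   by blocks of length [n]. *)
Lemma uniformizer_complete (t : OE E) (a : nat -> OE E) : is_uniformizer E (val t) ->
  exists l, forall k, exists b, l = \sum_(i < k) a i * t ^+ i + t ^+ k * b.
Proof.
move=> ut; have mt := uniformizer_max ut.
have [_ /omega_maxidealP[_ [n [y [n0 iy tn]]]]] := mt.
have yE : integer_of E y.
  split=> //; have -> : y = val t ^+ n / p%:R.
    by rewrite tn mulrC mulKf // omega_p_neq0.
  by rewrite -val_OEX subfield_div ?subfield_nat //; case: (val_OEP (t ^+ n)).
have [z zE pz] : exists2 z, integer_of E z & p%:R = val t * z.
  by apply/ut; apply: p_maxideal_of.
have tnE : t ^+ n = p%:R * toOE yE.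
  by apply: val_inj; rewrite val_OEM val_OEX rmorph_nat -tn.
have pE : p%:R = t * toOE zE by apply: val_inj; rewrite val_OEM rmorph_nat pz.
have [l lP] := OE_p_complete
  (fun k => (\sum_(i < n) a (n * k + i)%N * t ^+ i) * toOE yE ^+ k).
exists l => k; have [b lE] := lP k; rewrite (sum_blocks a k tnE) in lE.
have [m nkE] : exists m, (n * k = k + m)%N.
  by exists (n * k - k)%N; rewrite subnKC // leq_pmull.
exists (\sum_(i < m) a (k + i)%N * t ^+ i + toOE zE ^+ k * b).
rewrite lE nkE big_split_ord -addrA mulrDr mulr_sumr; congr (_ + (_ + _)).
  by apply: eq_bigr => i _; rewrite exprD mulrCA.
by rewrite [in LHS]pE exprMn mulrA.
Qed.

Lemma uniformizer_cdvr (t : OE E) : is_uniformizer E (val t) -> cdvr t.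
Proof.
move=> ut; have t0 := uniformizer_neq0 ut; have mt := uniformizer_max ut.
split.
- move=> a; have [/ut[b ib ab]|[b ib ab]] := maxideal_or_unit (val_OEP a); [left|right];
    by exists (toOE ib); apply: val_inj; rewrite val_OEM toOEK ?rmorph1.
- have [_ /omega_maxidealP[_ [n [y [_ iy tn]]]]] := mt.
  move=> a t_a; apply: val_inj; apply: omega_separated => N; have [b ->] := t_a (n * N)%N.
  exists (y ^+ N * val b).
    apply: (subringM (omega_subring Omega)); last by case: (val_OEP b).
    exact: (subringX (omega_subring Omega)).
  by rewrite val_OEM val_OEX exprM tn exprMn mulrA.
- by move=> a; apply: uniformizer_complete.
- move=> a /(congr1 val); rewrite val_OEM rmorph0 => /eqP.
  by rewrite mulf_eq0 (negPf t0) => /eqP a0; apply: val_inj.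
- move=> b /(congr1 val); rewrite val_OEM rmorph1 => tb.
  have [_ [it]] := mt; apply; split=> //; exists (val b) => //.
  by case: (val_OEP b).
Qed.

End UniformizerDvr.

(** * Substitution of power series *)

Section Evaluation.
Variables (S R0 : comNzRingType) (c : {rmorphism R0 -> S}).
Implicit Types (P Q : {poly R0}) (s : S).

Definition pev P s := (map_poly c P).[s].

Lemma pevE P s : pev P s = \sum_(i < size P) c P`_i * s ^+ i.
Proof.
rewrite /pev (@horner_coef_wide _ (size P)) ?size_poly //.
by apply: eq_bigr => i _; rewrite coef_map.
Qed.

Lemma pev_trunc d (g : fps R0) s : pev (fps_trunc d g) s = \sum_(i < d) c (g i) * s ^+ i.
Proof.
rewrite /pev (@horner_coef_wide _ d).
  by apply: eq_bigr => i _; rewrite coef_map coef_fps_trunc ltn_ord.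
by rewrite (leq_trans (size_poly _ _)) // size_poly.
Qed.

Lemma pevB P Q s : pev (P - Q) s = pev P s - pev Q s.
Proof. by rewrite /pev rmorphB hornerD hornerN. Qed.

Lemma pev_comp P Q s : pev (P \Po Q) s = pev P (pev Q s).
Proof. by rewrite /pev map_comp_poly horner_comp. Qed.

Lemma mmap_comp n k (P : {mpoly R0[n]}) (Q : n.-tuple {mpoly R0[k]}) (h : 'I_k -> S) :
  mmap c h (P \mPo Q) = mmap c (fun i => mmap c h (tnth Q i)) P.
Proof.
rewrite comp_mpolyE rmorph_sum; apply: eq_bigr => m _ /=.
rewrite mmapZ rmorph_prod; congr (_ * _); apply: eq_bigr => i _ /=.
by rewrite rmorphXn.
Qed.

End Evaluation.

Section Truncation.
Variable R0 : comNzRingType.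

Lemma mcoeff_mfps_trunc k d (G : mfps k R0) m :
  (mfps_trunc d G)@_m = if (mdeg m < d)%N then G m else 0.
Proof.
rewrite /mfps_trunc raddf_sum /=; under eq_bigr do rewrite mcoeffZ mcoeffX.
case: ifP => [lt_md|ge_md].
  rewrite (bigD1 (BMultinom lt_md)) //= eqxx mulr1 big1 ?addr0 // => m' ne.
  rewrite (_ : (_ == m) = false) ?mulr0 //; apply: contraNF ne => /eqP m'm.
  by apply/eqP/val_inj.
rewrite big1 // => m' _; rewrite (_ : (_ == m) = false) ?mulr0 //.
by apply/eqP => m'm; move: (bmdeg m'); rewrite m'm ge_md.
Qed.

Lemma mfps_truncD k d (G G1 G2 : mfps k R0) : (forall m, G m = G1 m + G2 m) ->
  mfps_trunc d G = mfps_trunc d G1 + mfps_trunc d G2.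
Proof.
move=> GE; apply/mpolyP => m; rewrite mcoeffD !mcoeff_mfps_trunc.
by case: ifP => _; [exact: GE|rewrite addr0].
Qed.

Lemma mfps_truncX k d (i : 'I_k) : (1 < d)%N -> mfps_trunc d (mfpsX R0 i) = 'X_i.
Proof.
move=> d1; apply/mpolyP => m; rewrite mcoeff_mfps_trunc mcoeffX /mfpsX eq_sym.
by case: eqP => [<-|_]; rewrite ?mdeg1 ?d1 ?if_same.
Qed.

Lemma mfps_trunc0 k d : mfps_trunc d (@mfps0 R0 k) = 0.
Proof. by apply/mpolyP => m; rewrite mcoeff_mfps_trunc mcoeff0 if_same. Qed.

Lemma mfpsX_0 k (i : 'I_k) : mfpsX R0 i 0%MM = 0.
Proof. by rewrite /mfpsX; case: eqP => // /(congr1 (@mdeg _)); rewrite mdeg0 mdeg1. Qed.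

Lemma mfps_trunc_fps d (f : fps R0) :
  mfps_trunc d (fun m : 'X_{1..1} => f (mdeg m)) = \sum_(i < d) f i *: 'X_0 ^+ i.
Proof.
apply/mpolyP => m; rewrite mcoeff_mfps_trunc raddf_sum /=.
have coefX i : ('X_0 ^+ i : {mpoly R0[1]})@_m = (i == mdeg m)%:R.
  rewrite mpolyXn mcoeffX; congr (nat_of_bool _)%:R; apply/eqP/eqP => [<-|->].
    by rewrite mdegMn mdeg1 mul1n.
  apply/mnmP => j; rewrite mulmnE mnm1E !ord1 eqxx mul1n mdegE big_ord1.
  by congr (m _); apply: val_inj.
under eq_bigr do rewrite mcoeffZ coefX.
case: ifP => [lt_md|ge_md].
  rewrite (bigD1 (Ordinal lt_md)) //= eqxx mulr1 big1 ?addr0 // => i ne.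
  by rewrite (_ : (_ == _) = false) ?mulr0 //; apply: contraNF ne.
rewrite big1 // => i _; rewrite (_ : (_ == _) = false) ?mulr0 //.
by apply/eqP => im; move: (ltn_ord i); rewrite im ge_md.
Qed.

Definition Xadic d (P : {poly R0}) := forall i, (i < d)%N -> P`_i = 0.
Definition mdeg_adic k d (P : {mpoly R0[k]}) := forall m, (mdeg m < d)%N -> P@_m = 0.

Lemma Xadic_filtration : filtration Xadic.
Proof.
split=> //.
- by move=> d i _; rewrite coef0.
- by move=> d P Q P0 Q0 i lt_id; rewrite coefB P0 // Q0 // subrr.
- move=> a b P Q P0 Q0 i lt_iab; rewrite coefM big1 // => j _.
  have [lt_ja|le_aj] := ltnP j a; first by rewrite P0 // mul0r.
  rewrite Q0 ?mulr0 // ltn_subLR; last by rewrite -ltnS; apply: ltn_ord.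
  by rewrite (leq_trans lt_iab) // leq_add2r.
by move=> d P P0 i lt_id; apply: P0; apply: ltnW.
Qed.

Lemma mdeg_adic_filtration k : filtration (@mdeg_adic k).
Proof.
split=> //.
- by move=> d m _; rewrite mcoeff0.
- by move=> d P Q P0 Q0 m lt_md; rewrite mcoeffB P0 // Q0 // subrr.
- move=> a b P Q P0 Q0 m lt_mab; rewrite mcoeffM big1 // => -[m1 m2] /= /eqP mE.
  have [lt_ma|le_am] := ltnP (mdeg m1) a; first by rewrite P0 // mul0r.
  rewrite Q0 ?mulr0 // -(ltn_add2l (mdeg m1)) -mdegD -mE.
  by rewrite (leq_trans lt_mab) // leq_add2r.
by move=> d P P0 m lt_md; apply: P0; apply: ltnW.
Qed.

Lemma Xadic_trunc_sub d e (g : fps R0) : (e <= d)%N -> Xadic e (fps_trunc d g - fps_trunc e g).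
Proof. by move=> le_ed i lt_ie; rewrite coefB !coef_fps_trunc lt_ie (leq_trans lt_ie) ?subrr. Qed.

Lemma mdeg_adic_trunc_sub k d e (G : mfps k R0) : (e <= d)%N ->
  mdeg_adic e (mfps_trunc d G - mfps_trunc e G).
Proof.
by move=> le_ed m lt_me; rewrite mcoeffB !mcoeff_mfps_trunc lt_me (leq_trans lt_me) ?subrr.
Qed.

Lemma Xadic1 (P : {poly R0}) : P`_0 = 0 -> Xadic 1 P.
Proof. by move=> P0 i; rewrite ltnS leqn0 => /eqP ->. Qed.

Lemma Xadic1_trunc d (g : fps R0) : g 0%N = 0 -> Xadic 1 (fps_trunc d g).
Proof. by move=> g0; apply: Xadic1; rewrite coef_fps_trunc g0 if_same. Qed.

Lemma mdeg_adic1_trunc k d (G : mfps k R0) : G 0%MM = 0 -> mdeg_adic 1 (mfps_trunc d G).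
Proof.
by move=> G0 m; rewrite ltnS leqn0 mdeg_eq0 => /eqP ->; rewrite mcoeff_mfps_trunc G0 if_same.
Qed.

End Truncation.

Section IntegralEvaluation.
Variables (S R0 : comNzRingType) (I : nat -> S -> Prop) (fI : filtration I).
Variable c : {rmorphism R0 -> S}.
Implicit Types (P Q : {poly R0}) (s : S).

Definition integral_coefs (T : Type) (g : T -> R0) := forall t, I 0%N (c (g t)).

Lemma pev_Xadic e P s : integral_coefs (fun i => P`_i) -> Xadic e P -> I 1%N s ->
  I e (pev c P s).
Proof.
move=> cP P0 Is; rewrite pevE; apply: fil_sum => // i _.
have [lt_ie|le_ei] := ltnP i e; first by rewrite P0 // rmorph0 mul0r; apply: fil0.
by apply: filMl => //; apply: fil_le le_ei _ => //; apply: filX1.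
Qed.

Lemma pev_congr e P s s' : integral_coefs (fun i => P`_i) -> I 0%N s -> I 0%N s' ->
  I e (s - s') -> I e (pev c P s - pev c P s').
Proof.
move=> cP Is Is' Iss'; rewrite !pevE -sumrB; apply: fil_sum => // i _.
by rewrite -mulrBr; apply: filMl => //; apply: fil_subX.
Qed.

Lemma pev_int P s : integral_coefs (fun i => P`_i) -> I 0%N s -> I 0%N (pev c P s).
Proof.
move=> cP Is; rewrite pevE; apply: fil_sum => // i _; apply: filMl => //.
exact: filX0.
Qed.

Lemma mmap1_int n (h : 'I_n -> S) m : (forall i, I 0%N (h i)) -> I 0%N (mmap1 h m).
Proof. by move=> Ih; apply: fil_prod0 => // i _; apply: filX0. Qed.

Lemma mmap_int n (P : {mpoly R0[n]}) h : integral_coefs (fun m => P@_m) ->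
  (forall i, I 0%N (h i)) -> I 0%N (mmap c h P).
Proof. by move=> cP Ih; apply: fil_sum => // m _; apply: filMl => //; apply: mmap1_int. Qed.

Lemma mmap_mdeg_adic n e (P : {mpoly R0[n]}) (h : 'I_n -> S) :
    integral_coefs (fun m => P@_m) -> mdeg_adic e P -> (forall i, I 1%N (h i)) ->
  I e (mmap c h P).
Proof.
move=> cP P0 Ih; apply: fil_sum => // m _.
have [lt_me|le_em] := ltnP (mdeg m) e; first by rewrite P0 // rmorph0 mul0r; apply: fil0.
apply: filMl => //; apply: fil_le le_em _ => //; rewrite mdegE /mmap1.
by elim/big_ind2: _ => [|a x b y Ia Ib|i _]; [exact: fil1|exact: filM|exact: filX1].
Qed.

Lemma mmap1_congr n e (h h' : 'I_n -> S) m : (forall i, I 0%N (h i)) ->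
    (forall i, I 0%N (h' i)) -> (forall i, I e (h i - h' i)) ->
  I e (mmap1 h m - mmap1 h' m).
Proof.
move=> Ih Ih' Ihh'; rewrite /mmap1.
elim: (index_enum _) => [|i r IHr]; first by rewrite !big_nil subrr; apply: fil0.
have Iprod : I 0%N (\prod_(j <- r) h j ^+ m j) by apply: fil_prod0 => // j _; apply: filX0.
rewrite !big_cons; set x := h i ^+ m i; set y := h' i ^+ m i; set X := \prod_(j <- r) _.
set Y := \prod_(j <- r) _ in IHr *.
have -> : x * X - y * Y = (x - y) * X + y * (X - Y) by ring.
apply: filD => //; first by apply: filMr => //; apply: fil_subX.
by apply: filMl => //; apply: filX0.
Qed.

Lemma mmap_congr n e (P : {mpoly R0[n]}) (h h' : 'I_n -> S) :
    integral_coefs (fun m => P@_m) -> (forall i, I 0%N (h i)) -> (forall i, I 0%N (h' i)) ->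
    (forall i, I e (h i - h' i)) -> I e (mmap c h P - mmap c h' P).
Proof.
move=> cP Ih Ih' Ihh'; rewrite /mmap -sumrB; apply: fil_sum => // m _.
by rewrite -mulrBr; apply: filMl => //; apply: mmap1_congr.
Qed.

Lemma integral_trunc d (g : fps R0) : integral_coefs g ->
  integral_coefs (fun i => (fps_trunc d g)`_i).
Proof.
by move=> cg i; rewrite coef_fps_trunc; case: ifP => // _; rewrite rmorph0; apply: fil0.
Qed.

Lemma integral_mtrunc k d (G : mfps k R0) : integral_coefs G ->
  integral_coefs (fun m => (mfps_trunc d G)@_m).
Proof.
by move=> cG m; rewrite mcoeff_mfps_trunc; case: ifP => // _; rewrite rmorph0; apply: fil0.
Qed.

Lemma integral_polyM P Q : integral_coefs (fun i => P`_i) -> integral_coefs (fun i => Q`_i) ->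
  integral_coefs (fun i => (P * Q)`_i).
Proof.
move=> cP cQ i; rewrite coefM rmorph_sum; apply: fil_sum => // k _ /=.
by rewrite rmorphM; apply: filMl.
Qed.

Lemma integral_mpolyM k (P Q : {mpoly R0[k]}) : integral_coefs (fun m => P@_m) ->
  integral_coefs (fun m => Q@_m) -> integral_coefs (fun m => (P * Q)@_m).
Proof.
move=> cP cQ m; rewrite mcoeffM rmorph_sum; apply: fil_sum => // i _ /=.
by rewrite rmorphM; apply: filMl.
Qed.

Lemma integral_comp_poly P Q : integral_coefs (fun i => P`_i) ->
  integral_coefs (fun i => Q`_i) -> integral_coefs (fun i => (P \Po Q)`_i).
Proof.
move=> cP cQ i; rewrite comp_polyE coef_sum rmorph_sum; apply: fil_sum => // k _ /=.
rewrite coefZ rmorphM; apply: filMl => //.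
elim: (val k) i => [|l IHl] i.
  by rewrite expr0 coef1 rmorph_nat; apply: fil_nat.
by rewrite exprS; apply: integral_polyM.
Qed.

Lemma integral_comp_mpoly n k (P : {mpoly R0[n]}) (Q : n.-tuple {mpoly R0[k]}) :
    integral_coefs (fun m => P@_m) -> (forall i, integral_coefs (fun m => (tnth Q i)@_m)) ->
  integral_coefs (fun m => (P \mPo Q)@_m).
Proof.
move=> cP cQ m; rewrite comp_mpolyE raddf_sum rmorph_sum; apply: fil_sum => // m1 _ /=.
rewrite mcoeffZ rmorphM; apply: filMl => //.
elim: (index_enum _) m => [|i r IHr] m.
  by rewrite big_nil mcoeff1 rmorph_nat; apply: fil_nat.
rewrite big_cons; apply: integral_mpolyM => // {}m.
elim: (m1 i) m => [|l IHl] m.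
  by rewrite expr0 mcoeff1 rmorph_nat; apply: fil_nat.
by rewrite exprS; apply: integral_mpolyM.
Qed.

Lemma pev_trunc_congr d e (g : fps R0) s s' : integral_coefs g -> I 1%N s -> I 1%N s' ->
    I e (s - s') -> (e <= d)%N ->
  I e (pev c (fps_trunc d g) s - pev c (fps_trunc e g) s').
Proof.
move=> cg Is Is' Iss' le_ed; have cT d' := integral_trunc d' cg.
apply: (fil_trans fI (y := pev c (fps_trunc e g) s)).
  rewrite -pevB; apply: pev_Xadic => //; last exact: Xadic_trunc_sub.
  by move=> i; rewrite coefB rmorphB; apply: filB => //; apply: cT.
by apply: pev_congr => //; [apply: fil_le Is|apply: fil_le Is'].
Qed.

Lemma mmap_trunc_congr k d e (G : mfps k R0) (h h' : 'I_k -> S) : integral_coefs G ->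
    (forall i, I 1%N (h i)) -> (forall i, I 1%N (h' i)) ->
    (forall i, I e (h i - h' i)) -> (e <= d)%N ->
  I e (mmap c h (mfps_trunc d G) - mmap c h' (mfps_trunc e G)).
Proof.
move=> cG Ih Ih' Ihh' le_ed; have cT d' := integral_mtrunc d' cG.
apply: (fil_trans fI (y := mmap c h (mfps_trunc e G))).
  rewrite -mmapB; apply: mmap_mdeg_adic => //; last exact: mdeg_adic_trunc_sub.
  by move=> m; rewrite mcoeffB rmorphB; apply: filB => //; apply: cT.
apply: mmap_congr => // i; [exact: fil_le (Ih i)|exact: fil_le (Ih' i)].
Qed.

End IntegralEvaluation.

Section CompositionCoefficients.
Variable R0 : comNzRingType.

Lemma mfps_comp_trunc n k d (G : mfps n R0) (H : n.-tuple (mfps k R0)) m :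
    (forall i, tnth H i 0%MM = 0) -> (mdeg m < d)%N ->
  (mfps_trunc d G \mPo [tuple of map (mfps_trunc d) H])@_m = mfps_comp G H m.
Proof.
move=> H0 lt_md; have fM := @mdeg_adic_filtration R0 k.
have compE d' : mfps_trunc d' G \mPo [tuple of map (mfps_trunc d') H]
    = mmap (@mpolyC k R0) (fun i => mfps_trunc d' (tnth H i)) (mfps_trunc d' G).
  by rewrite /comp_mpoly; congr (mmap _ _ _); apply/funext => i; rewrite tnth_map.
apply/eqP; rewrite /mfps_comp -subr_eq0 -mcoeffB !compE; apply/eqP.
suff : mdeg_adic (mdeg m).+1 (mmap (@mpolyC k R0) (fun i => mfps_trunc d (tnth H i))
    (mfps_trunc d G) - mmap (@mpolyC k R0) (fun i => mfps_trunc (mdeg m).+1 (tnth H i))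
    (mfps_trunc (mdeg m).+1 G)) by apply.
apply: (mmap_trunc_congr fM) => // i; try exact: mdeg_adic1_trunc.
exact: mdeg_adic_trunc_sub.
Qed.

Lemma fps_comp_trunc d (f g : fps R0) i : g 0%N = 0 -> (i < d)%N ->
  (fps_trunc d f \Po fps_trunc d g)`_i = fps_comp f g i.
Proof.
move=> g0 lt_id; apply/eqP; rewrite /fps_comp -subr_eq0 -coefB; apply/eqP.
suff : Xadic i.+1 ((fps_trunc d f \Po fps_trunc d g) - (fps_trunc i.+1 f \Po fps_trunc i.+1 g)).
  by apply.
apply: (pev_trunc_congr (@Xadic_filtration R0) (c := @polyC R0)) => //; try exact: Xadic1_trunc.
exact: Xadic_trunc_sub.
Qed.

End CompositionCoefficients.

Section EvaluationOfCompositions.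
Variables (S R0 : comNzRingType) (I : nat -> S -> Prop) (fI : filtration I).
Variable c : {rmorphism R0 -> S}.
Local Notation ev d g s := (pev c (fps_trunc d g) s).
Local Notation mev d G h := (mmap c h (mfps_trunc d G)).
Local Notation integral := (integral_coefs I c).

Lemma integral_mfps_comp n k (G : mfps n R0) (H : n.-tuple (mfps k R0)) :
  integral G -> (forall i, integral (tnth H i)) -> integral (mfps_comp G H).
Proof.
move=> cG cH m; apply: (integral_comp_mpoly fI) => [|i]; first exact: integral_mtrunc.
by rewrite tnth_map; apply: integral_mtrunc.
Qed.

Lemma mmap_mfps_comp n k (G : mfps n R0) (H : n.-tuple (mfps k R0)) (h : 'I_k -> S) d :
    integral G -> (forall i, integral (tnth H i)) -> (forall i, tnth H i 0%MM = 0) ->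
    (forall i, I 1%N (h i)) ->
  I d (mev d G (fun i => mev d (tnth H i) h) - mev d (mfps_comp G H) h).
Proof.
move=> cG cH H0 Ih; set Q := mfps_trunc d G \mPo [tuple of map (mfps_trunc d) H].
have -> : mev d G (fun i => mev d (tnth H i) h) = mmap c h Q.
  by rewrite mmap_comp; congr (mmap _ _ _); apply/funext => i; rewrite tnth_map.
have cQ : integral (fun m => Q@_m).
  apply: (integral_comp_mpoly fI) => [|i]; first exact: integral_mtrunc.
  by rewrite tnth_map; apply: integral_mtrunc.
rewrite -mmapB; apply: (mmap_mdeg_adic fI) => // m; last first.
  by move=> lt_md; rewrite mcoeffB mfps_comp_trunc // mcoeff_mfps_trunc lt_md subrr.
rewrite mcoeffB rmorphB; apply: filB => //.
by apply: integral_mtrunc => //; apply: integral_mfps_comp.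
Qed.

Lemma pev_fps_comp (f g : fps R0) s d : integral f -> integral g -> g 0%N = 0 -> I 1%N s ->
  I d (ev d f (ev d g s) - ev d (fps_comp f g) s).
Proof.
move=> cf cg g0 Is; have cT d' h := integral_trunc fI d' (g := h).
have cfg : integral (fps_comp f g) by move=> i; apply: (integral_comp_poly fI); apply: cT.
rewrite -pev_comp -pevB; apply: (pev_Xadic fI) => // i; last first.
  by move=> lt_id; rewrite coefB fps_comp_trunc // coef_fps_trunc lt_id subrr.
rewrite coefB rmorphB; apply: filB => //; last exact: cT.
by apply: (integral_comp_poly fI); apply: cT.
Qed.

Lemma mmap_trunc_fps d (f : fps R0) (s : S) :
  mev d (fun m : 'X_{1..1} => f (mdeg m)) (fun=> s) = ev d f s.
Proof.
rewrite mfps_trunc_fps rmorph_sum pev_trunc; apply: eq_bigr => i _ /=.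
by rewrite mmapZ rmorphXn /= mmapX mmap1U.
Qed.

Lemma mmap_truncX k d (i : 'I_k) (h : 'I_k -> S) : (1 < d)%N -> mev d (mfpsX R0 i) h = h i.
Proof. by move=> d1; rewrite mfps_truncX // mmapX mmap1U. Qed.

Lemma mmap_trunc0 k d (h : 'I_k -> S) : mev d (@mfps0 R0 k) h = 0.
Proof. by rewrite mfps_trunc0 mmap0. Qed.

End EvaluationOfCompositions.

Definition vec2 (T : Type) (x y : T) (i : 'I_2) : T := if i == 0 then x else y.
Definition vec3 (T : Type) (x y z : T) (i : 'I_3) : T :=
  if i == 0 then x else if i == 1 then y else z.

Lemma vec2_all (T : Type) (P : T -> Prop) a b : P a -> P b -> forall i, P (vec2 a b i).
Proof. by move=> Pa Pb i; rewrite /vec2; case: ifP. Qed.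

(** * Formal logarithms *)

Section FormalLog.
Variables (R0 : comNzRingType) (f : fps R0).
Hypotheses (f0 : f 0%N = 0) (f1 : f 1%N = 1).
Local Notation Xadic := (@Xadic R0).
Local Notation cR := (@polyC R0).
Let fX := @Xadic_filtration R0.
Implicit Types (P Q : {poly R0}) (g : fps R0).

Lemma comp_trunc d g P : fps_trunc d g \Po P = \sum_(i < d) g i *: P ^+ i.
Proof.
rewrite -[LHS]/(pev cR (fps_trunc d g) P) pev_trunc.
by apply: eq_bigr => i _; rewrite mul_polyC.
Qed.

Lemma comp_trunc_congr d g P Q : Xadic d (P - Q) ->
  Xadic d ((fps_trunc d g \Po P) - (fps_trunc d g \Po Q)).
Proof. by move=> PQ; apply: (pev_congr fX (c := cR)). Qed.

Lemma comp_trunc_fps_comp d g (k : fps R0) P : k 0%N = 0 -> Xadic 1 P ->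
  Xadic d ((fps_trunc d g \Po (fps_trunc d k \Po P)) - (fps_trunc d (fps_comp g k) \Po P)).
Proof. by move=> k0 P1; apply: (pev_fps_comp fX (c := cR)). Qed.

Lemma trunc_fps_comp d g (k : fps R0) : k 0%N = 0 ->
  Xadic d ((fps_trunc d g \Po fps_trunc d k) - fps_trunc d (fps_comp g k)).
Proof. by move=> k0 i lt_id; rewrite coefB fps_comp_trunc // coef_fps_trunc lt_id subrr. Qed.

Lemma Xadic1_comp d g P : g 0%N = 0 -> Xadic 1 P -> Xadic 1 (fps_trunc d g \Po P).
Proof. by move=> g0 P1; apply: (pev_Xadic fX (c := cR)) => //; apply: Xadic1_trunc. Qed.

Lemma XadicZ d a P : Xadic d P -> Xadic d (a *: P).
Proof. by move=> P0 i lt_id; rewrite coefZ P0 ?mulr0. Qed.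

Lemma Xadic_sub_exp d k P Q : Xadic 1 P -> Xadic 1 Q -> Xadic d (P - Q) ->
  Xadic d.+1 (P ^+ k.+2 - Q ^+ k.+2).
Proof.
move=> P1 Q1 PQ; rewrite subrXX -addn1; apply: (filM fX) => //.
apply: (fil_sum fX) => i _; case: (val i) => [|i'].
  by rewrite expr0 mulr1 subn0; apply: (fil_le fX (e := k.+1)) => //; apply: (filX1 fX).
by rewrite exprS mulrCA; apply: (filMr fX).
Qed.

Lemma log_comp_top d P : (0 < d)%N ->
  (fps_trunc d.+1 f \Po P)`_d = P`_d + (\sum_(k < d.-1) f k.+2 *: P ^+ k.+2)`_d.
Proof.
case: d => // d _; rewrite comp_trunc 2!big_ord_recl /= f0 scale0r add0r.
by rewrite /bump /= f1 scale1r expr1 coefD.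
Qed.

Lemma log_comp_top_sub d P Q : (0 < d)%N -> Xadic 1 P -> Xadic 1 Q -> Xadic d (P - Q) ->
  (fps_trunc d.+1 f \Po P)`_d - (fps_trunc d.+1 f \Po Q)`_d = (P - Q)`_d.
Proof.
move=> d0 P1 Q1 PQ; rewrite !log_comp_top // coefB opprD addrACA -[RHS]addr0; congr (_ + _).
rewrite -coefB -sumrB coef_sum big1 // => k _; rewrite -scalerBr coefZ.
by rewrite (Xadic_sub_exp k P1 Q1 PQ) ?mulr0.
Qed.

Lemma log_injective d P Q : Xadic 1 P -> Xadic 1 Q ->
  Xadic d ((fps_trunc d f \Po P) - (fps_trunc d f \Po Q)) -> Xadic d (P - Q).
Proof.
move=> P1 Q1 logPQ; suff PQ e : (e <= d)%N -> Xadic e (P - Q) by apply: PQ.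
elim: e => [//|[|e] IHe] led; first by move=> i lt_i1; rewrite coefB P1 // Q1 // subrr.
have PQ := IHe (ltnW led); move=> i; rewrite ltnS leq_eqVlt => /orP[/eqP->|]; last exact: PQ.
have trunc_top (Z : {poly R0}) : Xadic 1 Z ->
    (fps_trunc d f \Po Z)`_e.+1 = (fps_trunc e.+2 f \Po Z)`_e.+1.
  move=> Z1; apply/eqP; rewrite -subr_eq0 -coefB; apply/eqP.
  suff : Xadic e.+2 ((fps_trunc d f \Po Z) - (fps_trunc e.+2 f \Po Z)) by apply.
  apply: (pev_trunc_congr fX (c := cR)) => //.
  by rewrite subrr; apply: (fil0 fX).
have := logPQ _ led; rewrite coefB !trunc_top // => top_eq.
by have := log_comp_top_sub (ltn0Sn e) P1 Q1 PQ; rewrite top_eq.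
Qed.

Lemma fps_inv_trunc_size d : (size (fps_inv_trunc f d) <= d)%N.
Proof.
elim: d => [|d IHd] /=; first by rewrite size_poly0.
rewrite (leq_trans (size_polyD _ _)) // geq_max (leq_trans IHd) //=.
by rewrite mul_polyC (leq_trans (size_scale_leq _ _)) // size_polyXn.
Qed.

Lemma fps_inv_truncE d : fps_inv_trunc f d = fps_trunc d (fps_inv f).
Proof.
apply/polyP => i; rewrite coef_fps_trunc /fps_inv.
case: ltnP => [|le_di]; last by rewrite nth_default // (leq_trans (fps_inv_trunc_size _)).
elim: d => // d IHd; rewrite ltnS leq_eqVlt => /orP[/eqP-> //|lt_id].
rewrite [fps_inv_trunc f d.+1]/= coefD coefCM coefXn (ltn_eqF lt_id) mulr0 addr0.
exact: IHd.
Qed.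

Lemma fps_inv0 : fps_inv f 0%N = 0.
Proof.
by rewrite /fps_inv /= comp_trunc big_ord1 f0 scale0r coefX !coef0 subrr add0r mul0r coef0.
Qed.

Lemma fps_comp_inv : fps_comp f (fps_inv f) = (fun i => (i == 1)%N%:R).
Proof.
apply/funext => i; rewrite /fps_comp -fps_inv_truncE; case: i => [|i].
  by rewrite comp_trunc big_ord1 f0 scale0r coef0.
set g := fps_inv_trunc f i.+1; set T := fps_trunc i.+2 f.
have -> : fps_inv_trunc f i.+2 = g + ('X`_i.+1 - (T \Po g)`_i.+1)%:P * 'X^(i.+1) by [].
set c := _ - _.
have g1 : Xadic 1 g by rewrite /g fps_inv_truncE; apply/Xadic1_trunc/fps_inv0.
have cX : Xadic i.+1 (c%:P * 'X^(i.+1)).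
  by move=> k lt_ki; rewrite coefCM coefXn (ltn_eqF lt_ki) mulr0.
have gcX1 : Xadic 1 (g + c%:P * 'X^(i.+1)).
  by apply: (filD fX) => //; apply: (fil_le fX _ cX).
have := log_comp_top_sub (ltn0Sn i) gcX1 g1; rewrite addrAC subrr add0r => /(_ cX) top_sub.
by rewrite -[LHS](subrK (T \Po g)`_i.+1) top_sub coefCM coefXn eqxx mulr1 /c subrK coefX.
Qed.

Definition scale_fps (a : R0) g : fps R0 := fun d => a * g d.

Lemma trunc_scale d a g : fps_trunc d (scale_fps a g) = a *: fps_trunc d g.
Proof.
by apply/polyP => i; rewrite coefZ !coef_fps_trunc; case: ifP; rewrite ?mulr0.
Qed.

Lemma trunc_identity d P : Xadic 1 P ->
  Xadic d ((fps_trunc d (fun i => (i == 1)%N%:R) \Po P) - P).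
Proof.
move=> P1; case: d => [|[|d]] //.
  by move=> i lt_i1; rewrite coefB comp_trunc big_ord1 scale0r coef0 P1 // subrr.
suff -> : fps_trunc d.+2 (fun i => (i == 1)%N%:R) = 'X :> {poly R0}.
  by move=> i _; rewrite comp_polyX subrr coef0.
by apply/polyP => i; rewrite coef_fps_trunc coefX; case: i => [|[|i]] //=; rewrite if_same.
Qed.

Lemma fg_mul0 a : fg_mul f a 0%N = 0.
Proof. by rewrite /fg_mul /fps_comp comp_trunc big_ord1 fps_inv0 scale0r coef0. Qed.

Lemma log_fg_mul a : fps_comp f (fg_mul f a) = scale_fps a f.
Proof.
apply/funext => i; set d := i.+1; set b := fg_mul f a; set Y := fps_trunc d (scale_fps a f).
have af0 : scale_fps a f 0%N = 0 by rewrite /scale_fps f0 mulr0.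
have Y1 : Xadic 1 Y by apply: Xadic1_trunc.
have b_trunc : Xadic d (fps_trunc d b - (fps_trunc d (fps_inv f) \Po Y)).
  by apply: (fil_sym fX); apply: trunc_fps_comp.
have log_inv := comp_trunc_fps_comp (d := d) f fps_inv0 Y1; rewrite fps_comp_inv in log_inv.
have log_b := fil_trans fX (comp_trunc_congr f b_trunc)
  (fil_trans fX log_inv (trunc_identity (d := d) Y1)).
have := log_b i (ltnSn i); rewrite coefB fps_comp_trunc //; last exact: fg_mul0.
by move=> /eqP; rewrite subr_eq0 /Y coef_fps_trunc ltnSn => /eqP.
Qed.

Lemma log_mul d a P : Xadic 1 P ->
  Xadic d ((fps_trunc d f \Po (fps_trunc d (fg_mul f a) \Po P)) - a *: (fps_trunc d f \Po P)).
Proof.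
move=> P1; have := comp_trunc_fps_comp (d := d) f (fg_mul0 a) P1.
by rewrite log_fg_mul trunc_scale linearZ.
Qed.

Lemma mul_mul d a b P : Xadic 1 P ->
  Xadic d ((fps_trunc d (fg_mul f a) \Po (fps_trunc d (fg_mul f b) \Po P))
        - (fps_trunc d (fg_mul f (a * b)) \Po P)).
Proof.
move=> P1; have mul1 c := Xadic1_comp d (fg_mul0 c) P1.
apply: log_injective => //; first exact: Xadic1_comp (fg_mul0 a) (mul1 b).
apply: (fil_trans fX (log_mul (d := d) a (mul1 b))).
have /(XadicZ a) log_b := log_mul (d := d) b P1; rewrite scalerBr scalerA in log_b.
by apply: (fil_trans fX log_b); apply: (fil_sym fX); apply: log_mul.
Qed.

Lemma mul_one d P : Xadic 1 P -> Xadic d ((fps_trunc d (fg_mul f 1) \Po P) - P).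
Proof.
move=> P1; apply: log_injective => //; first exact: Xadic1_comp (fg_mul0 1) P1.
by have := log_mul (d := d) 1 P1; rewrite scale1r.
Qed.

Lemma fg_mul1 a : fg_mul f a 1%N = a.
Proof.
have X1 : Xadic 1 'X by apply: Xadic1; rewrite coefX.
have := log_mul (d := 2) a X1 => /(_ 1%N isT).
rewrite comp_polyXr comp_polyXr coefB coefZ coef_fps_trunc f1 mulr1 => /eqP.
by rewrite subr_eq0 log_comp_top // big_ord0 coef0 addr0 coef_fps_trunc => /eqP.
Qed.

Section Group.
Variable F : mfps 2 R0.
Hypothesis F_group : is_formal_group F.
Hypothesis F_log : is_logarithm F f.
Local Notation FP d P Q := (mmap cR (vec2 P Q) (mfps_trunc d F)).

Lemma formal_group0 : F 0%MM = 0.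
Proof.
have [/(_ 0%MM) F_X0 _ _ _] := F_group; move: F_X0; rewrite /mfps_comp mdeg0.
have -> : mfps_trunc 1 F = (F 0%MM)%:MP.
  apply/mpolyP => m; rewrite mcoeff_mfps_trunc mcoeffC ltnS leqn0 mdeg_eq0 eq_sym.
  by case: eqP => [->|_]; rewrite ?mulr1 ?mulr0.
by rewrite comp_mpolyC mcoeffC eqxx mulr1 mfpsX_0.
Qed.

Lemma Xadic1_group d P Q : Xadic 1 P -> Xadic 1 Q -> Xadic 1 (FP d P Q).
Proof.
move=> P1 Q1; apply: (mmap_mdeg_adic fX) => //; last exact: vec2_all.
exact: mdeg_adic1_trunc formal_group0.
Qed.

Lemma log_comp_mfps d (G : mfps 2 R0) P Q : G 0%MM = 0 -> Xadic 1 P -> Xadic 1 Q ->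
  Xadic d ((fps_trunc d f \Po mmap cR (vec2 P Q) (mfps_trunc d G)) -
           mmap cR (vec2 P Q) (mfps_trunc d (fps_mcomp f G))).
Proof.
move=> G0 P1 Q1; have vec1 := vec2_all P1 Q1.
have := @mmap_mfps_comp _ _ _ fX cR _ _ (fun m : 'X_{1..1} => f (mdeg m))
  [tuple G] (vec2 P Q) d (fun m i => _) (fun i m j => _) _ vec1.
rewrite (_ : (fun i => _) = (fun=> mmap cR (vec2 P Q) (mfps_trunc d G))).
  by rewrite mmap_trunc_fps; apply=> // i; rewrite !ord1.
by apply/funext => i; rewrite !ord1.
Qed.

Lemma log_group d P Q : Xadic 1 P -> Xadic 1 Q ->
  Xadic d ((fps_trunc d f \Po FP d P Q) - ((fps_trunc d f \Po P) + (fps_trunc d f \Po Q))).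
Proof.
move=> P1 Q1; have [le_d1|lt_1d] := leqP d 1.
  apply: (fil_le fX le_d1); apply: (filB fX).
    by apply: Xadic1_comp => //; apply: Xadic1_group.
  by apply: (filD fX); apply: Xadic1_comp.
have logX i := log_comp_mfps (d := d) (mfpsX_0 R0 i) P1 Q1.
have log_X0 := logX 0; have log_X1 := logX 1; rewrite !mmap_truncX // in log_X0 log_X1.
have [_ _ logF] := F_log; have := log_comp_mfps (d := d) formal_group0 P1 Q1.
rewrite (mfps_truncD d logF) mmapD => log_F.
apply: (fil_trans fX log_F); apply: (fil_sym fX); rewrite opprD addrACA.
exact: (filD fX log_X0 log_X1).
Qed.

Lemma group_mul_mul d a b P : Xadic 1 P ->
  Xadic d (FP d (fps_trunc d (fg_mul f a) \Po P) (fps_trunc d (fg_mul f b) \Po P)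
        - (fps_trunc d (fg_mul f (a + b)) \Po P)).
Proof.
move=> P1; have mul1 c := Xadic1_comp d (fg_mul0 c) P1.
apply: log_injective => //; first exact: Xadic1_group.
apply: (fil_trans fX (log_group (d := d) (mul1 a) (mul1 b))).
apply: (fil_sym fX); apply: (fil_trans fX (log_mul _ P1)).
rewrite scalerDl; apply: (fil_sym fX).
by rewrite opprD addrACA; apply: (filD fX); apply: log_mul.
Qed.

Lemma mul_group d a P Q : Xadic 1 P -> Xadic 1 Q ->
  Xadic d ((fps_trunc d (fg_mul f a) \Po FP d P Q)
        - FP d (fps_trunc d (fg_mul f a) \Po P) (fps_trunc d (fg_mul f a) \Po Q)).
Proof.
move=> P1 Q1; have mul1 c (Z : {poly R0}) Z1 := @Xadic1_comp d _ Z (fg_mul0 c) Z1.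
have F1 := Xadic1_group d P1 Q1.
apply: log_injective; [exact: mul1|by apply: Xadic1_group; apply: mul1|].
apply: (fil_trans fX (log_mul (d := d) a F1)).
have /(XadicZ a) log_F := log_group (d := d) P1 Q1; rewrite scalerBr in log_F.
apply: (fil_trans fX log_F); apply: (fil_sym fX).
apply: (fil_trans fX (log_group (d := d) (mul1 a _ P1) (mul1 a _ Q1))).
by rewrite scalerDr opprD addrACA; apply: (filD fX); apply: log_mul.
Qed.

End Group.
End FormalLog.

(** * Honda's integrality theorem *)

Lemma max_power_dvdn q l : (1 < q)%N -> (0 < l)%N ->
  exists v k, l = (q ^ v * k)%N /\ ~~ (q ^ v.+1 %| l)%N.
Proof.
move=> q1; elim/ltn_ind: l => l IHl l0.
case: (boolP (q %| l)%N) => [/dvdnP[l' lE]|q_l]; last by exists 0%N, l; rewrite mul1n expn1.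
have l'0 : (0 < l')%N by case: l' lE l0 => // ->; rewrite mul0n.
have [|v [k [l'E q_l']]] := IHl l' _ l'0; first by rewrite lE ltn_Pmulr.
exists v.+1, k; split; first by rewrite lE l'E expnS; lia.
by rewrite lE expnSr dvdn_pmul2r // ltnW.
Qed.

Record honda_setting (C : fieldType) (OK : C -> Prop) (pi : C) (phi : C -> C) (p q : nat)
    (f u : fps C) : Prop := HondaSetting {
  honda_subring : is_subring OK;
  honda_pi_int : OK pi;
  honda_pi_neq0 : pi != 0;
  honda_phi_pi : phi pi = pi;
  honda_phi_int : forall x, OK x -> OK (phi x);
  honda_prime : prime p;
  honda_q_power : exists e, q = (p ^ e)%N;
  honda_q_gt1 : (1 < q)%N;
  honda_p_mem : ideal_power OK pi 1 p%:R;
  honda_frobenius : forall x, OK x -> ideal_power OK pi 1 (phi x - x ^+ q);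
  honda_log0 : f 0%N = 0;
  honda_log1 : f 1%N = 1;
  honda_type0 : u 0%N = pi;
  honda_type_int : forall i, (0 < i)%N -> OK (u i);
  honda_congruence : forall d, ideal_power OK pi 1 (honda_act q phi u f d) }.

Section HondaIntegrality.
Variables (C : fieldType) (OK : C -> Prop) (pi : C) (phi : {rmorphism C -> C}).
Variables (p q : nat) (f u : fps C) (hs : honda_setting OK pi phi p q f u).
Local Notation I := (ideal_power OK pi).
Local Notation J := (coef_fil I).
Local Notation T := (honda_T q phi).
Let f0 := honda_log0 hs.
Let f1 := honda_log1 hs.
Let pi0 := honda_pi_neq0 hs.
Let q1 := honda_q_gt1 hs.
Let q0 : (0 < q)%N := ltnW q1.
Let uO i i0 : I 0%N (u i) := proj2 (ideal_power0 OK pi (u i)) (honda_type_int hs i0).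
Let fI : filtration I := ideal_power_filtration (honda_subring hs) (honda_pi_int hs).
Let fJ : filtration J := coef_filtration fI.
Let fX := @Xadic_filtration C.
Let OKI x : OK x <-> I 0%N x. Proof. exact: iff_sym (ideal_power0 OK pi x). Qed.

Lemma honda_pi_cancel d x : I d.+1 (pi * x) -> I d x.
Proof. exact: has_order_cancel pi0 (ideal_power_order OK pi0). Qed.

Lemma honda_q_mem : I 1%N q%:R.
Proof.
have [[|e] qE] := honda_q_power hs; first by move: q1; rewrite qE.
rewrite qE expnS natrM; apply: (filMr fI); first exact: (honda_p_mem hs).
exact: fil_nat.
Qed.

Lemma iter_phi_mem i d x : I d x -> I d (iter i phi x).
Proof.
elim: i => // i IHi /IHi[y Oy /= ->]; exists (phi y); first exact: (honda_phi_int hs).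
by rewrite rmorphM rmorphXn /= (honda_phi_pi hs).
Qed.

Lemma iter_honda_T i g d :
  iter i T g d = if (q ^ i %| d)%N then iter i phi (g (d %/ q ^ i)%N) else 0.
Proof.
elim: i d => [|i IHi] d; first by rewrite dvd1n divn1.
rewrite /= /honda_T IHi expnS.
case: (boolP (q %| d)%N) => [q_d|q_d]; last first.
  by case: ifP => // qq_d; rewrite (dvdn_trans _ qq_d) ?dvdn_mulr in q_d.
rewrite dvdn_divRL // [(q ^ i * q)%N]mulnC.
by case: ifP => // _; rewrite ?rmorph0 // -divnMA.
Qed.

Lemma divn_exp_lt i d : (0 < i)%N -> (0 < d)%N -> (d %/ q ^ i < d)%N.
Proof. by move=> i0 d0; rewrite ltn_Pdiv // (leq_ltn_trans i0) // ltn_expl. Qed.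

Lemma iter_honda_T_high i d : (d < i)%N -> iter i T f d = 0.
Proof.
move=> lt_di; rewrite iter_honda_T; case: ifP => // q_d.
case: d lt_di q_d => [|d] lt_di q_d; first by rewrite div0n f0 rmorph0.
have /(leq_trans (ltn_expl i q1)) := dvdn_leq (ltn0Sn d) q_d.
by move=> /ltn_trans /(_ lt_di); rewrite ltnn.
Qed.

Lemma honda_expand N d : (d <= N)%N ->
  I 1%N (pi * f d + \sum_(1 <= i < N.+1) u i * iter i T f d).
Proof.
move=> le_dN; have := honda_congruence hs d.
rewrite /honda_act -(big_mkord xpredT (fun i => u i * iter i T f d)).
rewrite big_nat_recl // -[X in I _ (X + _)]/(u 0%N * f d) (honda_type0 hs).
have -> : \sum_(1 <= i < N.+1) u i * iter i T f d = \sum_(1 <= i < d.+1) u i * iter i T f d.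
  rewrite (big_cat_nat (n := d.+1)) //= [X in _ + X]big_nat_cond [X in _ + X]big1 ?addr0 // => i.
  by rewrite andbT => /andP[lt_di _]; rewrite iter_honda_T_high ?mulr0.
by rewrite [in X in _ -> X]big_add1.
Qed.

Lemma log_denominator j k : ~~ (q ^ j.+1 %| k)%N -> OK (pi ^+ j * f k).
Proof.
elim/ltn_ind: k j => k IHk j q_k; apply/OKI.
have k0 : (0 < k)%N by case: k q_k {IHk} => //; rewrite dvdn0.
have Ipi n : I n (pi ^+ n) by apply: ideal_power_exp (honda_subring hs) _ _.
apply: honda_pi_cancel.
have := filMr fI (honda_expand (leqnn k)) (fil_le fI (leq0n j) (Ipi j)).
set s := \sum_(_ <= i < _) _ => pi_fk.
rewrite (_ : _ * _ = (pi * f k + s) * pi ^+ j - s * pi ^+ j); last by ring.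
apply: filB => //; rewrite /s mulr_suml big_nat_cond; apply: (fil_sum fI) => i.
rewrite andbT => /andP[i0 le_ik]; rewrite iter_honda_T; case: ifP => qi_k; last first.
  by rewrite mulr0 mul0r; apply: fil0.
have [le_ij|lt_ji] := leqP i j; last first.
  by move: q_k; rewrite (dvdn_trans _ qi_k) // dvdn_exp2l.
rewrite -mulrA; apply: (filMl fI); first exact: uO.
have -> : iter i phi (f (k %/ q ^ i)%N) * pi ^+ j =
    pi ^+ i * iter i phi (pi ^+ (j - i) * f (k %/ q ^ i)%N).
  rewrite rmorphM rmorphXn /= (iter_fixed _ (honda_phi_pi hs)).
  by rewrite mulrA -exprD subnKC // mulrC.
apply: (filMr fI); first by apply: (fil_le fI _ (Ipi i)).
apply/iter_phi_mem/OKI/IHk; first exact: divn_exp_lt.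
rewrite -subSn //; apply: contra q_k; rewrite dvdn_divRL // -expnD subnK //.
exact: leqW.
Qed.

Definition poly_T (P : {poly C}) : {poly C} := map_poly phi P \Po 'X^q.

Lemma coef_poly_T P k : (poly_T P)`_k = T (fun i => P`_i) k.
Proof.
by rewrite /poly_T coef_comp_poly_Xn // /honda_T; case: ifP => // _; rewrite coef_map.
Qed.

Lemma coef_iter_poly_T i P k : (iter i poly_T P)`_k = iter i T (fun i => P`_i) k.
Proof.
elim: i k => //= i IHi k; rewrite coef_poly_T; congr (T _ _).
by apply/funext => l.
Qed.

Lemma iter_poly_T_sum i n (c : nat -> C) P :
  iter i poly_T (\sum_(l < n) c l *: P ^+ l) =
  \sum_(l < n) iter i phi (c l) *: (iter i poly_T P) ^+ l.
Proof.
elim: i => //= i ->; rewrite /poly_T rmorph_sum /= rmorph_sum /=; apply: eq_bigr => l _.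
by rewrite map_polyZ /= comp_polyZ rmorphXn /= rmorphXn.
Qed.

Lemma iter_poly_TX i : iter i poly_T 'X = 'X^(q ^ i).
Proof. by elim: i => [|i] //= ->; rewrite /poly_T map_polyXn comp_Xn_poly -exprM -expnS. Qed.

Lemma poly_T_mem P d : J d P -> J d (poly_T P).
Proof.
move=> JP i; rewrite coef_poly_T /honda_T; case: ifP => _; last exact: fil0.
exact: (@iter_phi_mem 1).
Qed.

Lemma iter_poly_T_mem i P d : J d P -> J d (iter i poly_T P).
Proof. by elim: i => //= i IHi /IHi; apply: poly_T_mem. Qed.

Lemma poly_T_frobenius P : J 0%N P -> J 1%N (P ^+ q - poly_T P).
Proof.
elim/poly_ind: P => [|P c IHP] JPc.
  have -> : poly_T 0 = 0 by rewrite /poly_T rmorph0 comp_poly0.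
  by rewrite expr0n eqn0Ngt q0 subrr; apply: (fil0 fJ).
have JP : J 0%N P by move=> i; have := JPc i.+1; rewrite coefD coefMX coefC addr0.
have Ic : I 0%N c by have := JPc 0%N; rewrite coefD coefMX coefC add0r.
apply: (fil_trans fJ (y := (P * 'X) ^+ q + c%:P ^+ q)).
  have [e ->] := honda_q_power hs.
  apply: (fil_exp_prime_powerD fJ) (honda_prime hs) _ _ _.
  - by rewrite -polyC_natr; apply: coef_filC => //; apply: honda_p_mem hs.
  - by apply: (filMr fJ) => //; apply: coef_filX.
  - exact: coef_filC.
have -> : poly_T (P * 'X + c%:P) = poly_T P * 'X^q + (phi c)%:P.
  by rewrite /poly_T rmorphD rmorphM /= map_polyX map_polyC /= comp_polyD comp_polyM
    comp_polyX comp_polyC.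
rewrite opprD addrACA; apply: (filD fJ).
  rewrite exprMn -mulrBl; apply: (filMr fJ); first exact: IHP.
  by apply: (filX0 fJ); apply: coef_filX.
rewrite -polyC_exp -polyCB; apply: coef_filC => //; apply: fil_sym => //.
by apply: (honda_frobenius hs); apply/OKI.
Qed.

Lemma iter_poly_T_frobenius i P : J 0%N P -> J 1%N (iter i poly_T P - P ^+ (q ^ i)).
Proof.
move=> JP; elim: i => [|i IHi]; first by rewrite expr1 subrr; apply: (fil0 fJ).
apply: (fil_trans fJ (y := (iter i poly_T P) ^+ q)).
  by apply: (fil_sym fJ); apply: poly_T_frobenius; apply: iter_poly_T_mem.
rewrite expnSr exprM; apply: (fil_subX fJ) => //; first exact: iter_poly_T_mem.
exact: (filX0 fJ).
Qed.

Lemma log_power_congr i l P Q : J 0%N P -> J 0%N Q -> J 1%N (P - Q) -> (0 < l)%N ->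
  J 1%N (iter i phi (f l) *: (P ^+ l - Q ^+ l)).
Proof.
move=> JP JQ JPQ l0; have [v [k [lE q_l]]] := max_power_dvdn q1 l0.
have Jq : J 1%N q%:R by rewrite -polyC_natr; apply: coef_filC => //; apply: honda_q_mem.
have := fil_sub_exp_power fJ v Jq JP JQ JPQ.
move/(fil_subX fJ k (filX0 fJ _ JP) (filX0 fJ _ JQ)); rewrite -!exprM -lE => JPQl j.
rewrite coefZ; have [z Oz ->] := JPQl j.
have Ipf := iter_phi_mem i (proj1 (OKI _) (log_denominator q_l)).
rewrite rmorphM rmorphXn /= (iter_fixed _ (honda_phi_pi hs)) in Ipf.
rewrite exprSr (_ : _ * _ = pi ^+ v * iter i phi (f l) * (pi * z)); last by ring.
by apply: (filMl fI) => //; exists z; rewrite ?expr1.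
Qed.

Lemma fg_mul_coef a d : (0 < d)%N ->
  fg_mul f a d = a * f d - (fps_trunc d.+1 f \Po fps_trunc d (fg_mul f a))`_d.
Proof.
move=> d0; set b := fg_mul f a; have b0 : b 0%N = 0 by apply: fg_mul0.
have := log_comp_top_sub f0 f1 d0 (Xadic1_trunc d.+1 b0) (Xadic1_trunc d b0)
  (Xadic_trunc_sub b (leqnSn d)).
rewrite coefB !coef_fps_trunc ltnSn ltnn subr0 => <-.
by rewrite fps_comp_trunc // log_fg_mul.
Qed.

Lemma log_comp_fg_mul_trunc a d k : (k < d)%N ->
  (fps_trunc d.+1 f \Po fps_trunc d (fg_mul f a))`_k = a * f k.
Proof.
move=> lt_kd; set b := fg_mul f a; have b0 : b 0%N = 0 by apply: fg_mul0.
rewrite -[RHS]/(scale_fps a f k) -(log_fg_mul f0 f1 a) -(@fps_comp_trunc _ d f b k) //.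
apply/eqP; rewrite -subr_eq0 -coefB; apply/eqP.
suff : Xadic d ((fps_trunc d.+1 f \Po fps_trunc d b) - (fps_trunc d f \Po fps_trunc d b)).
  by apply.
apply: (pev_trunc_congr fX (c := @polyC C)) => //; try exact: Xadic1_trunc.
by rewrite subrr; apply: (fil0 fX).
Qed.

Definition log_comp_coef i d (B : {poly C}) := (\sum_(k < d.+1) iter i T f k *: B ^+ k)`_d.

Lemma log_comp_coef_frobenius i d B : Xadic 1 B ->
  log_comp_coef i d B = (\sum_(l < d.+1) iter i phi (f l) *: (B ^+ (q ^ i)) ^+ l)`_d.
Proof.
move=> B1; set g := fps_trunc d.+1 f.
have -> : \sum_(l < d.+1) iter i phi (f l) *: (B ^+ (q ^ i)) ^+ l = iter i poly_T g \Po B.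
  have -> : g = \sum_(l < d.+1) f l *: 'X ^+ l by rewrite -comp_trunc comp_polyXr.
  rewrite iter_poly_T_sum iter_poly_TX rmorph_sum /=; apply: eq_bigr => l _.
  by rewrite comp_polyZ rmorphXn /= comp_Xn_poly.
apply/esym/eqP; rewrite /log_comp_coef -comp_trunc -subr_eq0 -coefB -comp_polyB; apply/eqP.
suff : Xadic d.+1 ((iter i poly_T g - fps_trunc d.+1 (iter i T f)) \Po B) by apply.
apply: (pev_Xadic fX (c := @polyC C)) => // k lt_kd.
rewrite coefB coef_fps_trunc lt_kd coef_iter_poly_T !iter_honda_T.
case: ifP => // _; last by rewrite subrr.
by rewrite coef_fps_trunc (leq_ltn_trans (leq_div _ _)) ?subrr.
Qed.

Lemma iter_poly_T_log_fg_mul a i d : phi a = a -> (0 < i)%N -> (0 < d)%N ->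
  (\sum_(l < d.+1) iter i phi (f l) *: (iter i poly_T (fps_trunc d (fg_mul f a))) ^+ l)`_d
  = a * iter i T f d.
Proof.
move=> phia i0 d0; rewrite -iter_poly_T_sum -comp_trunc coef_iter_poly_T !iter_honda_T.
case: ifP => q_d; last by rewrite mulr0.
by rewrite log_comp_fg_mul_trunc ?divn_exp_lt // rmorphM /= (iter_fixed _ phia).
Qed.

Lemma honda_comp d B : J 0%N B ->
  I 1%N (pi * log_comp_coef 0 d B + \sum_(1 <= i < d.+1) u i * log_comp_coef i d B).
Proof.
move=> JB; rewrite /log_comp_coef coef_sum mulr_sumr.
under [X in _ + X]eq_bigr do rewrite coef_sum mulr_sumr.
rewrite exchange_big -big_split /=; apply: (fil_sum fI) => k _.
under eq_bigr do rewrite coefZ mulrA.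
rewrite coefZ mulrA -mulr_suml -mulrDl; apply: (filMr fI).
  by apply: honda_expand; rewrite -ltnS.
exact: (filX0 fJ _ JB).
Qed.

Lemma log_comp_coef_fg_mul a i d : phi a = a -> (0 < i)%N -> (0 < d)%N ->
    J 0%N (fps_trunc d (fg_mul f a)) ->
  I 1%N (a * iter i T f d - log_comp_coef i d (fps_trunc d (fg_mul f a))).
Proof.
move=> phia i0 d0 JB; set B := fps_trunc d _ in JB *.
have B1 : Xadic 1 B by apply/Xadic1_trunc/fg_mul0.
rewrite log_comp_coef_frobenius // -(iter_poly_T_log_fg_mul phia i0 d0) -/B -coefB -sumrB.
apply: (fil_sum fJ) => -[[|l] lt_ld] _ /=.
  by rewrite !expr0 subrr; apply: (fil0 fJ).
rewrite -scalerBr; apply: log_power_congr => //; first exact: iter_poly_T_mem.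
  exact: (filX0 fJ).
exact: iter_poly_T_frobenius.
Qed.

Theorem honda_integral a d : OK a -> phi a = a -> OK (fg_mul f a d).
Proof.
move=> Oa phia; elim/ltn_ind: d => d IHd; apply/OKI.
case: (posnP d) => [->|d0]; first by rewrite fg_mul0 //; apply: fil0.
rewrite fg_mul_coef // comp_trunc; set B := fps_trunc d (fg_mul f a).
have JB : J 0%N B.
  move=> i; rewrite coef_fps_trunc; case: ifP => [lt_id|_]; last exact: (fil0 fI).
  exact/OKI/IHd.
apply: honda_pi_cancel.
have low : I 1%N (\sum_(1 <= i < d.+1) u i * (a * iter i T f d - log_comp_coef i d B)).
  rewrite big_nat_cond; apply: (fil_sum fI) => i; rewrite andbT => /andP[i0 _].
  by apply: (filMl fI); [apply: uO|apply: log_comp_coef_fg_mul].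
have := filB fI (filB fI (filMl fI (proj1 (OKI a) Oa) (honda_expand (leqnn d)))
  (honda_comp d JB)) low.
congr (I _ _); under [X in _ - X]eq_bigr do rewrite mulrBr mulrCA.
by rewrite sumrB -mulr_sumr /log_comp_coef /=; ring.
Qed.

Section Height.
Variable h : nat.
Hypotheses (h0 : (0 < h)%N) (u_low : forall i, (0 < i < h)%N -> I 1%N (u i)).

Lemma log_integral_low d : (d < q ^ h)%N -> I 0%N (f d).
Proof.
elim/ltn_ind: d => d IHd lt_dq; apply: honda_pi_cancel.
have := honda_expand (leqnn d); set s := \sum_(_ <= i < _) _ => pi_fd.
rewrite (_ : _ * _ = (pi * f d + s) - s); last by rewrite addrK.
apply: filB => //; rewrite /s big_nat_cond; apply: (fil_sum fI) => i.
rewrite andbT => /andP[i0 le_id]; rewrite iter_honda_T; case: ifP => q_d; last first.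
  by rewrite mulr0; apply: fil0.
case: (posnP d) => [->|d0]; first by rewrite div0n f0 rmorph0 mulr0; apply: fil0.
apply: (filMr fI).
  apply: u_low; rewrite i0 -(ltn_exp2l _ _ q1).
  by apply: leq_ltn_trans lt_dq; apply: dvdn_leq.
apply/iter_phi_mem/IHd; first exact: divn_exp_lt.
by apply: leq_ltn_trans lt_dq; apply: leq_div.
Qed.

Lemma log_height_coef : I 1%N (pi * f (q ^ h)%N + u h).
Proof.
have le_hq : (h <= q ^ h)%N by apply: ltnW; rewrite ltn_expl.
have qh0 : (0 < q ^ h)%N by rewrite expn_gt0 q0.
have := honda_expand (leqnn (q ^ h)); set s := \sum_(_ <= i < _) _ => pi_fq.
suff low : I 1%N (s - u h) by have := filB fI pi_fq low; congr (I _ _); ring.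
rewrite /s (bigD1_seq h) ?mem_index_iota ?h0 ?ltnS ?iota_uniq //=.
have -> : u h * iter h T f (q ^ h)%N = u h.
  by rewrite iter_honda_T dvdnn divnn qh0 f1 rmorph1 mulr1.
rewrite addrAC subrr add0r big_seq_cond; apply: (fil_sum fI) => i.
rewrite mem_index_iota => /andP[/andP[i0 _] ih]; rewrite iter_honda_T.
have [lt_ih|le_hi] := ltnP i h; last first.
  rewrite (_ : (_ %| _)%N = false) ?mulr0; first exact: fil0.
  by apply/negbTE; rewrite gtnNdvd // ltn_exp2l // ltn_neqAle eq_sym ih.
apply: (filMr fI); first by apply: u_low; rewrite i0.
case: ifP => _; last exact: (fil0 fI).
exact/iter_phi_mem/log_integral_low/divn_exp_lt.
Qed.

Lemma log_comp_low n B : (n <= q ^ h)%N -> J 1%N B -> J 1%N (\sum_(k < n) f k *: B ^+ k).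
Proof.
move=> le_nq JB; apply: (fil_sum fJ) => -[[|k] lt_kn] _ /=.
  by rewrite f0 scale0r; apply: (fil0 fJ).
move=> i; rewrite coefZ; apply: (filMl fI).
  exact/log_integral_low/(leq_trans lt_kn).
by apply: (fil_le fI (e := k.+1)) => //; apply: (filX1 fJ).
Qed.

Lemma honda_mul_low d : (d < q ^ h)%N -> I 1%N (fg_mul f pi d).
Proof.
elim/ltn_ind: d => d IHd lt_dq.
case: (posnP d) => [->|d0]; first by rewrite fg_mul0 //; apply: fil0.
rewrite fg_mul_coef // comp_trunc; apply: filB => //.
  have [y Oy ->] := log_integral_low lt_dq.
  by exists y; rewrite // expr0 mul1r expr1.
apply: log_comp_low => // i; rewrite coef_fps_trunc.
by case: ifP => [lt_id|_]; [apply: IHd => //; apply: ltn_trans lt_dq|exact: (fil0 fI)].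
Qed.

Theorem honda_mul_height : exists2 z, OK z & fg_mul f pi (q ^ h)%N = - u h + pi * z.
Proof.
set d := (q ^ h)%N; have d1 : (1 < d)%N by rewrite -(expn0 q) ltn_exp2l.
suff [z Oz zE] : I 1%N (fg_mul f pi d + u h).
  by exists z => //; rewrite -[LHS](addrK (u h)) zE addrC expr1.
rewrite fg_mul_coef ?(ltnW d1) // comp_trunc; set B := fps_trunc d _.
suff tail : I 1%N (\sum_(k < d.+1) f k *: B ^+ k)`_d.
  by have := filB fI log_height_coef tail; congr (I _ _); rewrite -/d; ring.
have JB : J 1%N B.
  move=> i; rewrite coef_fps_trunc; case: ifP => [lt_id|_]; last exact: (fil0 fI).
  exact: honda_mul_low.
rewrite big_ord_recr /= coefD; apply: (filD fI); first exact: (log_comp_low (leqnn _) JB).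
have [z Oz zE] := filX1 fJ d JB d; rewrite coefZ zE.
have pi_fd : I 0%N (pi * f d).
  have := filB fI (filS fI log_height_coef) (uO h0).
  by rewrite addrK.
rewrite (_ : f d * _ = (pi * f d) * (pi ^+ d.-1 * z)); last first.
  by rewrite -{2}(prednK (ltnW d1)) exprS; ring.
apply: (filMl fI) => //; apply: (fil_le fI (e := d.-1)); last by exists z.
by rewrite -ltnS prednK // ltnW.
Qed.

End Height.
End HondaIntegrality.

(** * The points of a formal group as a filtered module *)

Lemma tnth_pair (T : Type) (a b : T) : tnth [tuple a; b] = vec2 a b.
Proof. by apply/funext => -[[|[|//]] lt_i2]. Qed.

Lemma vec2_comp (T U : Type) (g : T -> U) a b : (fun i => g (vec2 a b i)) = vec2 (g a) (g b).
Proof. by apply/funext => i; rewrite /vec2; case: ifP. Qed.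

Lemma vec3_2 (T : Type) (a b c : T) : vec3 a b c (inord 2) = c.
Proof. by rewrite /vec3 -!val_eqE /= inordK. Qed.

Lemma vec3_all (T : Type) (P : T -> Prop) a b c : P a -> P b -> P c -> forall i, P (vec3 a b c i).
Proof. by move=> Pa Pb Pc i; rewrite /vec3; case: ifP => // _; case: ifP. Qed.

Lemma horner_mmap (C : comNzRingType) n (h : 'I_n -> {poly C}) (P : {mpoly C[n]}) x :
  (mmap (@polyC C) h P).[x] = mmap (@idfun C) (fun i => (h i).[x]) P.
Proof.
rewrite /mmap horner_sum; apply: eq_bigr => m _; rewrite hornerCM /mmap1 horner_prod.
by congr (_ * _); apply: eq_bigr => i _; rewrite horner_exp.
Qed.

Section LinearTerms.
Variables (C : comNzRingType) (F : mfps 2 C) (F_group : is_formal_group F).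

Lemma formal_group_trunc2_coef :
  mfps_trunc 2 F = F U_((0 : 'I_2)%R)%MM *: 'X_0 + F U_((1 : 'I_2)%R)%MM *: 'X_1.
Proof.
apply/mpolyP => m; rewrite mcoeff_mfps_trunc mcoeffD !mcoeffZ !mcoeffX.
have [lt_m2|le_2m] := ltnP (mdeg m) 2; last first.
  have ne i : (U_(i)%MM == m) = false by apply/eqP => im; move: le_2m; rewrite -im mdeg1.
  by rewrite !ne !mulr0 addr0.
move: lt_m2; rewrite ltnS leq_eqVlt ltnS leqn0 => /orP[/eqP|]; last first.
  rewrite mdeg_eq0 => /eqP ->; rewrite (formal_group0 F_group).
  have ne (i : 'I_2) : (U_(i)%MM == 0%MM) = false.
    by apply/eqP => /(congr1 (@mdeg _)); rewrite mdeg0 mdeg1.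
  by rewrite !ne !mulr0 addr0.
move=> /eqP /mdeg1P[i /eqP ->].
have U_inj (a b : 'I_2) : (U_(a)%MM == U_(b)%MM) = (a == b).
  by apply/eqP/eqP => [/mnmP/(_ a)|-> //]; rewrite !mnm1E eqxx; case: eqP.
rewrite !U_inj; case: i => [[|[|//]] lt_i2].
  rewrite (_ : Ordinal lt_i2 = 0); last exact: val_inj.
  by rewrite eqxx mulr1 mulr0 addr0.
rewrite (_ : Ordinal lt_i2 = 1); last exact: val_inj.
by rewrite eqxx mulr1 mulr0 add0r.
Qed.

Lemma formal_group_trunc2 : mfps_trunc 2 F = 'X_0 + 'X_1.
Proof.
have coefE (A B : mfps 1 C) : mfps_comp F [tuple A; B] U_((0 : 'I_1)%R)%MM =
    F U_((0 : 'I_2)%R)%MM * A U_((0 : 'I_1)%R)%MM + F U_((1 : 'I_2)%R)%MM * B U_((0 : 'I_1)%R)%MM.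
  rewrite /mfps_comp mdeg1 formal_group_trunc2_coef comp_mpolyD !comp_mpolyZ !comp_mpolyXU.
  rewrite -!tnth_nth !tnth_map tnth_pair /vec2 /=.
  by rewrite mcoeffD !mcoeffZ !mcoeff_mfps_trunc mdeg1.
have [X_unit O_unit _ _] := F_group.
have := X_unit U_((0 : 'I_1)%R)%MM; have := O_unit U_((0 : 'I_1)%R)%MM.
rewrite !coefE /mfpsX /mfps0 eqxx !mulr0 !mulr1 add0r addr0 => F01 F10.
by rewrite formal_group_trunc2_coef F01 F10 !scale1r.
Qed.

End LinearTerms.

Section FormalModule.
Variables (C : fieldType) (R : comNzRingType) (v : {rmorphism R -> C}).
Variables (I : nat -> C -> Prop) (F : mfps 2 C) (f : fps C) (add act : C -> C -> C).
Local Notation ev d g x := ((fps_trunc d g).[x]).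
Local Notation mev d G h := (mmap (@idfun C) h (mfps_trunc d G)).

Record formal_module : Prop := FormalModule {
  fm_fil : filtration I;
  fm_separated : forall x, (forall d, I d x) -> x = 0;
  fm_complete : forall S : nat -> C, (forall d, I d (S d.+1 - S d)) ->
    exists l, forall d, I d (l - S d);
  fm_total : forall x y, I 1%N x -> I 1%N y ->
    (exists2 c, I 0%N c & y = c * x) \/ (exists2 c, I 0%N c & x = c * y);
  fm_coef : forall m, I 0%N (F m);
  fm_group : is_formal_group F;
  fm_log : is_logarithm F f;
  fm_mul : forall a d, I 0%N (fg_mul f (v a) d);
  fm_add : forall d x y, I 1%N x -> I 1%N y -> I d (add x y - mev d F (vec2 x y));
  fm_act : forall d a x, I 1%N x -> I d (act (v a) x - ev d (fg_mul f (v a)) x) }.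

Variable fm : formal_module.
Let fI := fm_fil fm.
Let fJ := coef_filtration fI.
Local Notation J := (coef_fil I).
Let f0 : f 0%N = 0. Proof. by have [] := fm_log fm. Qed.
Let f1 : f 1%N = 1. Proof. by have [] := fm_log fm. Qed.
Let F0 := formal_group0 (fm_group fm).
Let subrr_mem d x : I d (x - x). Proof. by rewrite subrr; apply: fil0. Qed.

Lemma fm_eq x y : (forall d, I d.+2 (x - y)) -> x = y.
Proof.
move=> near_xy; apply/eqP; rewrite -subr_eq0; apply/eqP; apply: (fm_separated fm) => d.
by apply: (fil_le fI (e := d.+2)) => //; rewrite -addn2 leq_addr.
Qed.

Lemma fm_scalar a : I 0%N (v a).
Proof. by rewrite -(fg_mul1 f0 f1 (v a)); apply: fm_mul. Qed.

Lemma horner_pev P x : P.[x] = pev (@idfun C) P x.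
Proof. by rewrite /pev map_poly_id. Qed.

Lemma mul_trunc_int d a : J 0%N (fps_trunc d (fg_mul f (v a))).
Proof. exact: (integral_trunc fI (c := idfun) d (fm_mul fm a)). Qed.

Lemma mul_trunc_mem d a x : I 1%N x -> I 1%N (ev d (fg_mul f (v a)) x).
Proof.
move=> Ix; rewrite horner_pev; apply: (pev_Xadic fI) => //; first exact: mul_trunc_int.
exact/Xadic1_trunc/fg_mul0.
Qed.

Lemma act_mem a x : I 1%N x -> I 1%N (act (v a) x).
Proof.
move=> Ix; rewrite -[act _ x](subrK (ev 1 (fg_mul f (v a)) x)).
by apply: (filD fI); [exact: (fm_act fm)|apply: mul_trunc_mem].
Qed.

Lemma act_eval d a x x' : I 1%N x -> I 1%N x' -> I d (x - x') ->
  I d (act (v a) x - ev d (fg_mul f (v a)) x').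
Proof.
move=> Ix Ix' Ixx'; apply: (fil_trans fI (fm_act fm d a Ix)).
rewrite !horner_pev; apply: (pev_trunc_congr fI (c := idfun)) => //.
exact: (fm_mul fm).
Qed.

Definition integral_no_const k (A : mfps k C) := (forall m, I 0%N (A m)) /\ A 0%MM = 0.

Lemma integral_no_constX k (i : 'I_k) : integral_no_const (mfpsX C i).
Proof. by split; [move=> m; apply: fil_nat|apply: mfpsX_0]. Qed.

Lemma integral_no_const_comp k (A B : mfps k C) : integral_no_const A -> integral_no_const B ->
  integral_no_const (mfps_comp F [tuple A; B]).
Proof.
move=> [IA A0] [IB B0]; split=> [m|].
  apply: (integral_mfps_comp fI (c := idfun)); first exact: (fm_coef fm).
  by move=> i; rewrite tnth_pair; apply: (vec2_all (P := fun A => forall m, I 0%N (A m))).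
rewrite /mfps_comp mdeg0.
have -> : mfps_trunc 1 F = 0; last by rewrite comp_mpoly0 mcoeff0.
apply/mpolyP => m; rewrite mcoeff_mfps_trunc mcoeff0 ltnS leqn0 mdeg_eq0.
by case: eqP => // ->.
Qed.

Lemma mfps_trunc_mem k d (A : mfps k C) h : integral_no_const A -> (forall i, I 1%N (h i)) ->
  I 1%N (mev d A h).
Proof.
move=> [IA A0] Ih; apply: (mmap_mdeg_adic fI) => //; last exact: mdeg_adic1_trunc.
exact: (integral_mtrunc fI (c := idfun) d IA).
Qed.

Lemma add_mem x y : I 1%N x -> I 1%N y -> I 1%N (add x y).
Proof.
move=> Ix Iy; rewrite -[add x y](subrK (mev 1 F (vec2 x y))).
apply: (filD fI); first exact: (fm_add fm).
by apply: mfps_trunc_mem; [split=> //; apply: (fm_coef fm)|apply: vec2_all].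
Qed.

Lemma add_eval d x y x' y' : I 1%N x -> I 1%N y -> I 1%N x' -> I 1%N y' ->
  I d (x - x') -> I d (y - y') -> I d (add x y - mev d F (vec2 x' y')).
Proof.
move=> Ix Iy Ix' Iy' Ixx' Iyy'; apply: (fil_trans fI (fm_add fm d Ix Iy)).
apply: (mmap_trunc_congr fI (c := idfun)) => //; try exact: vec2_all; first exact: (fm_coef fm).
by move=> i; rewrite /vec2; case: ifP.
Qed.

Lemma add_congr d x y x' y' : I 1%N x -> I 1%N y -> I 1%N x' -> I 1%N y' ->
  I d (x - x') -> I d (y - y') -> I d (add x y - add x' y').
Proof.
move=> Ix Iy Ix' Iy' Ixx' Iyy'; apply: (fil_trans fI (add_eval Ix Iy Ix' Iy' Ixx' Iyy')).
by apply: (fil_sym fI); apply: (fm_add fm).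
Qed.

Lemma add_mfps k d (A B : mfps k C) h x y : integral_no_const A -> integral_no_const B ->
    (forall i, I 1%N (h i)) -> I 1%N x -> I 1%N y ->
    I d (x - mev d A h) -> I d (y - mev d B h) ->
  I d (add x y - mev d (mfps_comp F [tuple A; B]) h).
Proof.
move=> intA intB Ih Ix Iy IxA IyB.
apply: (fil_trans fI
  (add_eval Ix Iy (mfps_trunc_mem d intA Ih) (mfps_trunc_mem d intB Ih) IxA IyB)).
have [[IA A0] [IB B0]] := (intA, intB).
have := @mmap_mfps_comp _ _ _ fI idfun _ _ F [tuple A; B] h d (fm_coef fm).
rewrite tnth_pair (vec2_comp (fun A : mfps k C => mev d A h)); apply=> //.
  by move=> i m; move: i; apply: (vec2_all (P := fun A : mfps k C => I 0%N (A m))).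
exact: (vec2_all (P := fun A : mfps k C => A 0%MM = 0)).
Qed.

Lemma addC x y : I 1%N x -> I 1%N y -> add x y = add y x.
Proof.
move=> Ix Iy; apply: fm_eq => d; have [_ _ F_comm _] := fm_group fm.
apply: (fil_trans fI (fm_add fm _ Ix Iy)); apply: (fil_sym fI).
rewrite -(funext F_comm); apply: add_mfps => //; try exact: integral_no_constX.
- exact: vec2_all.
- by rewrite mmap_truncX.
- by rewrite mmap_truncX.
Qed.

Lemma add0 x : I 1%N x -> add 0 x = x.
Proof.
move=> Ix; apply: fm_eq => d; have [_ F_0X _ _] := fm_group fm.
rewrite -[X in _ - X](mmap_truncX (idfun : {rmorphism C -> C}) 0 (fun _ : 'I_1 => x)
  (isT : (1 < d.+2)%N)).
rewrite -(funext F_0X); apply: add_mfps => //; try exact: integral_no_constX.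
- by split=> // m; apply: fil0.
- exact: fil0.
- by rewrite mmap_trunc0.
- by rewrite mmap_truncX.
Qed.

Lemma addA x y z : I 1%N x -> I 1%N y -> I 1%N z -> add x (add y z) = add (add x y) z.
Proof.
move=> Ix Iy Iz; apply: fm_eq => d; have [_ _ _ F_assoc] := fm_group fm.
set h := vec3 x y z; have Ih : forall i, I 1%N (h i) by apply: vec3_all.
pose Y i := mfpsX C (i : 'I_3); have intY i := integral_no_constX i : integral_no_const (Y i).
have evalY i a : h i = a -> I d.+2 (a - mev d.+2 (Y i) h) by move=> <-; rewrite mmap_truncX.
have [Y0 Y1] := (evalY 0 x erefl, evalY 1 y erefl).
have Y2 := evalY (inord 2) z (vec3_2 _ _ _).
have xy := add_mfps (intY _) (intY _) Ih Ix Iy Y0 Y1.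
have yz := add_mfps (intY _) (intY _) Ih Iy Iz Y1 Y2.
have x_yz := add_mfps (intY _) (integral_no_const_comp (intY _) (intY _)) Ih Ix
  (add_mem Iy Iz) Y0 yz.
have xy_z := add_mfps (integral_no_const_comp (intY _) (intY _)) (intY _) Ih
  (add_mem Ix Iy) Iz xy Y2.
rewrite (funext F_assoc) in xy_z.
exact: (fil_trans fI x_yz (fil_sym fI xy_z)).
Qed.

Lemma eval_Xadic d (P Q : {poly C}) x : J 0%N P -> J 0%N Q -> Xadic d (P - Q) -> I 1%N x ->
  I d (P.[x] - Q.[x]).
Proof.
move=> JP JQ PQ Ix; rewrite -hornerN -hornerD horner_pev.
by apply: (pev_Xadic fI) => //; apply: (filB fJ).
Qed.

Lemma comp_mul_int d a P : J 0%N P -> J 0%N (fps_trunc d (fg_mul f (v a)) \Po P).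
Proof.
move=> JP; apply: (pev_int fJ (c := @polyC C)) => // i; apply: coef_filC => //.
exact: mul_trunc_int.
Qed.

Lemma group_poly_int d P Q : J 0%N P -> J 0%N Q ->
  J 0%N (mmap (@polyC C) (vec2 P Q) (mfps_trunc d F)).
Proof.
move=> JP JQ; apply: (mmap_int fJ (c := @polyC C)); last exact: vec2_all.
by move=> m; apply: coef_filC => //; apply: (integral_mtrunc fI (c := idfun) d (fm_coef fm)).
Qed.

Lemma horner_group_poly d P Q x : (mmap (@polyC C) (vec2 P Q) (mfps_trunc d F)).[x] =
  mev d F (vec2 P.[x] Q.[x]).
Proof. by rewrite horner_mmap (vec2_comp (fun P : {poly C} => P.[x])). Qed.

Let X1 : Xadic 1 ('X : {poly C}). Proof. by apply: Xadic1; rewrite coefX. Qed.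
Let JX : J 0%N 'X := coef_filX fI.

Lemma act_addl a b x : I 1%N x -> act (v (a + b)) x = add (act (v a) x) (act (v b) x).
Proof.
move=> Ix; apply: fm_eq => d; set e := d.+2.
have := group_mul_mul f0 f1 (fm_group fm) (fm_log fm) (v a) (v b) X1 (d := e).
rewrite -rmorphD !comp_polyXr => mulD.
have := eval_Xadic (group_poly_int e (mul_trunc_int e a) (mul_trunc_int e b))
  (mul_trunc_int e (a + b)) mulD Ix.
rewrite horner_group_poly => evD; apply: (fil_trans fI (fm_act fm e (a + b) Ix)).
apply: (fil_sym fI); apply: (fil_trans fI _ evD).
apply: add_eval; try exact: act_mem; try exact: mul_trunc_mem; exact: (fm_act fm).
Qed.

Lemma act_mul a b x : I 1%N x -> act (v a) (act (v b) x) = act (v (a * b)) x.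
Proof.
move=> Ix; apply: fm_eq => d; set e := d.+2.
have := mul_mul f0 f1 (v a) (v b) X1 (d := e); rewrite -rmorphM !comp_polyXr => mulM.
have := eval_Xadic (comp_mul_int e a (mul_trunc_int e b)) (mul_trunc_int e (a * b)) mulM Ix.
rewrite horner_comp => evM.
apply: (fil_trans fI _ (fil_trans fI evM (fil_sym fI (fm_act fm e (a * b) Ix)))).
by apply: act_eval; [exact: act_mem|exact: mul_trunc_mem|exact: (fm_act fm)].
Qed.

Lemma act1 x : I 1%N x -> act (v 1) x = x.
Proof.
move=> Ix; apply: fm_eq => d; set e := d.+2.
have := mul_one f0 f1 X1 (d := e); rewrite -(rmorph1 v) comp_polyXr => mul1.
have := eval_Xadic (mul_trunc_int e 1) JX mul1 Ix; rewrite hornerX.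
exact: (fil_trans fI (fm_act fm e 1 Ix)).
Qed.

Lemma fg_mul_zero d : fg_mul f 0 d = 0.
Proof.
rewrite /fg_mul /fps_comp (_ : fps_trunc d.+1 (fun d => 0 * f d) = 0).
  by rewrite comp_poly0r coefC coef_fps_trunc fps_inv0 // if_same.
by apply/polyP => i; rewrite coef_fps_trunc mul0r coef0 if_same.
Qed.

Lemma act0 x : I 1%N x -> act (v 0) x = 0.
Proof.
move=> Ix; apply: fm_eq => d; have := fm_act fm d.+2 0 Ix; rewrite rmorph0.
rewrite (_ : fps_trunc _ (fg_mul f 0) = 0) ?horner0 //.
by apply/polyP => i; rewrite coef_fps_trunc fg_mul_zero coef0 if_same.
Qed.

(* For [y = c x] both sides are values at [x] of power series in one variable. *)
Lemma act_addr_multiple a x c : I 1%N x -> I 1%N (c * x) -> I 0%N c ->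
  act (v a) (add x (c * x)) = add (act (v a) x) (act (v a) (c * x)).
Proof.
move=> Ix Icx Ic; apply: fm_eq => d; set e := d.+2.
have cX1 : Xadic 1 (c%:P * 'X) by apply: Xadic1; rewrite coefMX.
have JcX : J 0%N (c%:P * 'X) by apply: (filMr fJ) => //; apply: coef_filC.
have := eval_Xadic (comp_mul_int e a (group_poly_int e JX JcX))
  (group_poly_int e (comp_mul_int e a JX) (comp_mul_int e a JcX))
  (mul_group f0 f1 (fm_group fm) (fm_log fm) (d := e) (v a) X1 cX1) Ix.
rewrite horner_group_poly !horner_comp horner_group_poly hornerCM hornerX => evF.
apply: (fil_trans fI (y := ev e (fg_mul f (v a)) (mev e F (vec2 x (c * x))))).
  apply: act_eval; [exact: add_mem| |exact: (fm_add fm)].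
  by apply: mfps_trunc_mem; [split=> //; apply: (fm_coef fm)|apply: vec2_all].
apply: (fil_trans fI evF); apply: (fil_sym fI).
by apply: add_eval; try exact: act_mem; try exact: mul_trunc_mem; apply: (fm_act fm).
Qed.

Lemma act_addr a x y : I 1%N x -> I 1%N y ->
  act (v a) (add x y) = add (act (v a) x) (act (v a) y).
Proof.
move=> Ix Iy; have [[c Ic yE]|[c Ic xE]] := fm_total fm Ix Iy.
  by rewrite yE in Iy *; apply: act_addr_multiple.
rewrite addC // [RHS]addC; try exact: act_mem.
by rewrite xE in Ix *; apply: act_addr_multiple.
Qed.

Definition points : {pred C} := fun x => `[< I 1%N x >].
Definition FM of formal_module : Type := {x : C | x \in points}.
HB.instance Definition _ := Choice.on (FM fm).
Local Notation A := (FM fm).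
Definition fmval (x : A) : C := sval x.
Definition toFM x (Ix : I 1%N x) : A := exist _ x (introT (asboolP _) Ix).

Lemma fmvalP x : I 1%N (fmval x). Proof. exact/asboolP/(svalP x). Qed.
Lemma toFMK x (Ix : I 1%N x) : fmval (toFM Ix) = x. Proof. by []. Qed.
Lemma fmval_inj : injective fmval. Proof. exact: val_inj. Qed.

Definition fmadd (x y : A) : A := toFM (add_mem (fmvalP x) (fmvalP y)).
Definition fmscale (a : R) (x : A) : A := toFM (act_mem a (fmvalP x)).

Fact fmaddA : associative fmadd.
Proof. by move=> x y z; apply: fmval_inj; apply: addA; apply: fmvalP. Qed.
Fact fmaddC : commutative fmadd.
Proof. by move=> x y; apply: fmval_inj; apply: addC; apply: fmvalP. Qed.
Fact fmadd0 : left_id (toFM (fil0 fI 1)) fmadd.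
Proof. by move=> x; apply: fmval_inj; apply: add0; apply: fmvalP. Qed.
Fact fmaddN : left_inverse (toFM (fil0 fI 1)) (fmscale (-1)) fmadd.
Proof.
move=> x; apply: fmval_inj.
rewrite /= -[X in add _ X](act1 (fmvalP x)) -act_addl; last exact: fmvalP.
by rewrite addNr; apply: act0; apply: fmvalP.
Qed.
HB.instance Definition _ := GRing.isZmodule.Build A fmaddA fmaddC fmadd0 fmaddN.

Fact fmscaleA a b x : fmscale a (fmscale b x) = fmscale (a * b) x.
Proof. by apply: fmval_inj; apply: act_mul; apply: fmvalP. Qed.
Fact fmscale1 : left_id 1 fmscale.
Proof. by move=> x; apply: fmval_inj; apply: act1; apply: fmvalP. Qed.
Fact fmscaleDr : right_distributive fmscale +%R.
Proof. by move=> a x y; apply: fmval_inj; apply: act_addr; apply: fmvalP. Qed.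
Fact fmscaleDl x : {morph fmscale^~ x : a b / a + b}.
Proof. by move=> a b; apply: fmval_inj; apply: act_addl; apply: fmvalP. Qed.
HB.instance Definition _ := GRing.Zmodule_isLmodule.Build R A
  fmscaleA fmscale1 fmscaleDr fmscaleDl.

Lemma fmvalD (x y : A) : fmval (x + y) = add (fmval x) (fmval y). Proof. by []. Qed.
Lemma fmvalZ a (x : A) : fmval (a *: x) = act (v a) (fmval x). Proof. by []. Qed.
Lemma fmval0 : fmval 0 = 0. Proof. by []. Qed.
Lemma fmval_eq0 x : fmval x = 0 -> x = 0. Proof. by move=> x0; apply: fmval_inj. Qed.

Definition level d (x : A) := I d (fmval x).

Lemma add_approx i x y : (0 < i)%N -> I i x -> I i y -> I (2 * i)%N (add x y - (x + y)).
Proof.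
move=> i0 Ix Iy; set d := (2 * i)%N.
have I1 z : I i z -> I 1%N z by apply: (fil_le fI).
apply: (fil_trans fI (fm_add fm d (I1 _ Ix) (I1 _ Iy))).
have le_2d : (2 <= d)%N by rewrite leq_pmulr.
have -> : mev d F (vec2 x y) - (x + y) = mmap idfun (vec2 x y) (mfps_trunc d F - mfps_trunc 2 F).
  by rewrite (formal_group_trunc2 (fm_group fm)) mmapB mmapD !mmapX !mmap1U.
apply: (mmap_mdeg_adic (filtration_scale fI i)); last by apply: vec2_all; rewrite mul1n.
  move=> m; rewrite mul0n mcoeffB; apply: (filB fI);
    exact: (integral_mtrunc fI (c := idfun) _ (fm_coef fm)).
exact: mdeg_adic_trunc_sub.
Qed.

Lemma act_approx i a x : (0 < i)%N -> I i x -> I (2 * i)%N (act (v a) x - v a * x).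
Proof.
move=> i0 Ix; set d := (2 * i)%N; have Ix1 : I 1%N x by apply: (fil_le fI i0).
apply: (fil_trans fI (fm_act fm d a Ix1)).
have -> : v a * x = ev 2 (fg_mul f (v a)) x.
  by rewrite horner_pev pev_trunc big_ord_recr big_ord1 /= fg_mul0 // fg_mul1 // mul0r add0r.
rewrite -hornerN -hornerD horner_pev; apply: (pev_Xadic (filtration_scale fI i)).
- by move=> k; rewrite mul0n coefB; apply: (filB fI); apply: mul_trunc_int.
- by apply: Xadic_trunc_sub; rewrite leq_pmulr.
- by rewrite mul1n.
Qed.

Lemma level1 x : level 1 x. Proof. exact: fmvalP. Qed.

Lemma level0 d : level d 0. Proof. exact: fil0. Qed.

Lemma level_le d e x : (d <= e)%N -> level e x -> level d x.
Proof. exact: (fil_le fI). Qed.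

Lemma levelD d x y : level d x -> level d y -> level d (x + y).
Proof.
case: d => [_ _|d level_x level_y]; first exact: level_le (leq0n 1) (level1 _).
apply: (fil_near fI (e := (2 * d.+1)%N) _ (filD fI level_x level_y)); first by rewrite leq_pmull.
by apply: (fil_sym fI); apply: add_approx.
Qed.

Lemma levelZ d a x : level d x -> level d (a *: x).
Proof.
case: d => [_|d level_x]; first exact: level_le (leq0n 1) (level1 _).
apply: (fil_near fI (e := (2 * d.+1)%N) _ (filMl fI (fm_scalar a) level_x)).
  by rewrite leq_pmull.
by apply: (fil_sym fI); apply: act_approx.
Qed.

Lemma levelN d x : level d x -> level d (- x).
Proof. by rewrite -scaleN1r; apply: levelZ. Qed.

Lemma levelB d x y : level d x -> level d y -> level d (x - y).
Proof. by move=> level_x level_y; apply: levelD => //; apply: levelN. Qed.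

Lemma level_sum d n (x : 'I_n -> A) : (forall i, level d (x i)) -> level d (\sum_i x i).
Proof. by move=> level_x; elim/big_ind: _ => // [|y z]; [apply: level0|apply: levelD]. Qed.

Lemma level_sub d x y : level d (x - y) <-> I d (fmval x - fmval y).
Proof.
split=> near_xy.
  rewrite -[in fmval x](subrK y x) fmvalD -[X in _ - X](add0 (fmvalP y)).
  by apply: add_congr; try exact: fmvalP; rewrite ?subr0 //; apply: fil0.
rewrite /level fmvalD -[X in I _ X]subr0 -[X in _ - X]fmval0 -[in X in _ - X](subrr y) fmvalD.
by apply: add_congr; try exact: fmvalP.
Qed.

Lemma level_separated x : (forall d, level d x) -> x = 0.
Proof. by move=> level_x; apply: fmval_eq0; apply: (fm_separated fm). Qed.

Lemma level_complete (a : nat -> A) : (forall i, level i (a i)) ->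
  exists l, forall d, level d (l - \sum_(i < d) a i).
Proof.
move=> level_a; have [d|l lP] := fm_complete fm (S := fun d => fmval (\sum_(i < d) a i)).
  by apply/level_sub; rewrite big_ord_recr /= addrAC subrr add0r; apply: level_a.
have Il : I 1%N l.
  by rewrite -(subrK (fmval (\sum_(i < 1) a i)) l); apply: (filD fI) => //; apply: fmvalP.
by exists (toFM Il) => d; apply/level_sub.
Qed.

Lemma solve_by_approximation (T : {additive A -> A}) (Y : A -> Prop) :
    (forall d x, level d x -> level d (T x)) -> (forall x y, Y x -> Y (x - T y)) ->
    (forall i x, (0 < i)%N -> Y x -> level i x ->
       exists2 z, level i z & level i.+1 (x - T z)) ->
  forall x, Y x -> exists y, x = T y.
Proof.
move=> level_T YT step x Yx.
have /choice[st stP] : forall ix : nat * A, exists z,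
    (0 < ix.1)%N -> Y ix.2 -> level ix.1 ix.2 -> level ix.1 z /\ level ix.1.+1 (ix.2 - T z).
  move=> [i y]; case: (pselect [/\ (0 < i)%N, Y y & level i y]) => [[i0 Yy level_y]|bad].
    by have [z level_z near_yz] := step _ _ i0 Yy level_y; exists z.
  by exists 0 => i0 Yy level_y; case: bad.
pose rest := fix rest i := if i is i'.+1 then rest i' - T (st (i'.+1, rest i')) else x.
have restP i : Y (rest i) /\ level i.+1 (rest i).
  elim: i => [|i [Yi level_i]] /=; first by split=> //; apply: level1.
  by split; [apply: YT|have [] := stP (i.+1, rest i) isT Yi level_i].
pose a i := if i is i'.+1 then st (i, rest i') else 0.
have level_a i : level i (a i).
  case: i => [|i]; first exact: level0.
  by have [Yi level_i] := restP i; have [] := stP (i.+1, rest i) isT Yi level_i.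
have [l lP] := level_complete level_a; exists l; apply/eqP; rewrite -subr_eq0; apply/eqP.
have restE d : rest d = x - T (\sum_(i < d.+1) a i).
  elim: d => [|d IHd] /=; first by rewrite big_ord1 raddf0 subr0.
  by rewrite big_ord_recr raddfD opprD addrA -IHd.
apply: level_separated => d; apply: (level_le (leqnSn d)).
have -> : x - T l = rest d - T (l - \sum_(i < d.+1) a i).
  by rewrite restE raddfB opprB addrA subrK.
by apply: levelB; [have [] := restP d|apply: level_T].
Qed.

End FormalModule.

(** * Cyclic groups acting on the points *)

Lemma additive_hilbert90 (C : comNzRingType) (sg : {rmorphism C -> C}) Q (tr x : C) :
    \sum_(i < Q) iter i sg tr = 1 -> iter Q sg tr = tr ->
    \sum_(i < Q) iter i sg x = 0 ->
  let z := \sum_(i < Q) (\sum_(j < i) iter j sg x) * iter i sg tr in x = z - sg z.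
Proof.
move=> tr1 trQ trx z; pose S i := \sum_(j < i) iter j sg x.
have sgS i : sg (S i) = S i.+1 - x.
  rewrite /S rmorph_sum big_ord_recl /= addrC addKr.
  by apply: eq_bigr => j _; rewrite /bump.
have sgz : sg z = \sum_(i < Q) S i.+1 * iter i.+1 sg tr - x * \sum_(i < Q) iter i.+1 sg tr.
  rewrite /z rmorph_sum mulr_sumr -sumrB; apply: eq_bigr => i _ /=.
  by rewrite rmorphM -/(S i) sgS mulrBl.
have shift (G : nat -> C) : G Q = G 0%N -> \sum_(i < Q) G i.+1 = \sum_(i < Q) G i.
  move=> GQ; apply: (addrI (G 0%N)).
  have -> : G 0%N + \sum_(i < Q) G i.+1 = \sum_(i < Q.+1) G i by rewrite big_ord_recl.
  by rewrite big_ord_recr /= GQ addrC.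
rewrite sgz (shift (fun i => S i * iter i sg tr)); last by rewrite /S trx big_ord0 !mul0r.
rewrite (shift (fun i => iter i sg tr)) // tr1 mulr1.
by rewrite opprB addrCA subrr addr0.
Qed.

Record cyclic_action (C R : pzRingType) (v : R -> C) (I : nat -> C -> Prop) (F : mfps 2 C)
    (mul : C -> fps C) (sg : C -> C) (Q : nat) : Prop := CyclicAction {
  cyclic_action_mem : forall d x, I d x -> I d (sg x);
  cyclic_action_coef : forall m, sg (F m) = F m;
  cyclic_action_mul : forall a d, sg (mul (v a) d) = mul (v a) d;
  cyclic_action_order : forall x, I 0%N x -> iter Q sg x = x;
  cyclic_action_trace : exists2 tr, I 0%N tr & \sum_(i < Q) iter i sg tr = 1 }.

Section CyclicAction.
Variables (C : fieldType) (R : comNzRingType) (v : {rmorphism R -> C}).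
Variables (I : nat -> C -> Prop) (F : mfps 2 C) (f : fps C) (add act : C -> C -> C).
Variable fm : formal_module v I F f add act.
Variables (sg : {rmorphism C -> C}) (Q : nat).
Hypothesis sgA : cyclic_action v I F (fg_mul f) sg Q.
Let fI := fm_fil fm.
Let sgI := cyclic_action_mem sgA.
Let sgQ := cyclic_action_order sgA.
Local Notation A := (FM fm).
Implicit Types x y z : A.

Lemma aut_mfps_trunc d h : sg (mmap idfun h (mfps_trunc d F)) =
  mmap idfun (fun i => sg (h i)) (mfps_trunc d F).
Proof.
rewrite /mmap rmorph_sum; apply: eq_bigr => k _ /=; rewrite rmorphM; congr (_ * _).
  rewrite mcoeff_mfps_trunc; case: ifP => // _; last exact: rmorph0.
  exact: (cyclic_action_coef sgA).
by rewrite /mmap1 rmorph_prod; apply: eq_bigr => i _; rewrite rmorphXn.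
Qed.

Lemma aut_add a b : I 1%N a -> I 1%N b -> sg (add a b) = add (sg a) (sg b).
Proof.
move=> Ia Ib; apply: (fm_eq fm) => d.
have := sgI (fm_add fm d.+2 Ia Ib); rewrite rmorphB aut_mfps_trunc (vec2_comp sg) => near.
apply: (fil_trans fI near); apply: (fil_sym fI).
by apply: (fm_add fm); apply: sgI.
Qed.

Lemma aut_act r a : I 1%N a -> sg (act (v r) a) = act (v r) (sg a).
Proof.
move=> Ia; apply: (fm_eq fm) => d.
have := sgI (fm_act fm d.+2 r Ia); rewrite rmorphB.
have -> : sg (fps_trunc d.+2 (fg_mul f (v r))).[a] = (fps_trunc d.+2 (fg_mul f (v r))).[sg a].
  rewrite -horner_map; congr (_.[_]); apply/polyP => i; rewrite coef_map coef_fps_trunc /=.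
  case: ifP => _; [exact: (cyclic_action_mul sgA)|exact: rmorph0].
move=> near; apply: (fil_trans fI near); apply: (fil_sym fI).
by apply: (fm_act fm); apply: sgI.
Qed.

Lemma aut_scalar r : sg (v r) = v r.
Proof.
by have [f0 f1 _] := fm_log fm; have := cyclic_action_mul sgA r 1; rewrite fg_mul1.
Qed.

Definition fm_aut x : A := toFM fm (sgI (fmvalP x)).

Fact fm_aut_linear : linear fm_aut.
Proof.
move=> a x y; apply: fmval_inj; rewrite /fm_aut toFMK !fmvalD !fmvalZ !toFMK.
by rewrite (aut_add (act_mem fm a (fmvalP x)) (fmvalP y)) (aut_act a (fmvalP x)).
Qed.

HB.instance Definition _ := GRing.isLinear.Build R A A *:%R fm_aut fm_aut_linear.
Definition sgL : {linear A -> A} := fm_aut.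

Lemma fmval_sg x : fmval (sgL x) = sg (fmval x). Proof. by []. Qed.

Lemma fmval_iter k x : fmval (iter k sgL x) = iter k sg (fmval x).
Proof. by elim: k => //= k IHk; rewrite IHk. Qed.

Lemma fmval_int x : I 0%N (fmval x).
Proof. by apply: (fil_le fI (e := 1)) => //; apply: fmvalP. Qed.

Lemma sgL_order x : iter Q sgL x = x.
Proof. by apply: fmval_inj; rewrite fmval_iter sgQ //; apply: fmval_int. Qed.

Lemma fixedP x : fixed sgL x <-> sg (fmval x) = fmval x.
Proof. by split=> [/(congr1 (@fmval _ _ _ _ _ _ _ _ _))|sgx] //; apply: fmval_inj. Qed.

Lemma level_sg d x : level d x -> level d (sgL x). Proof. exact: sgI. Qed.

Lemma iter_sg_mem k d a : I d a -> I d (iter k sg a).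
Proof. by elim: k => //= k IHk /IHk; apply: sgI. Qed.

Lemma level_iter d k x : level d x -> level d (iter k sgL x).
Proof. by rewrite /level fmval_iter; apply: iter_sg_mem. Qed.

Lemma sum_approx i n (a : 'I_n -> A) : (0 < i)%N -> (forall k, level i (a k)) ->
  I (2 * i)%N (fmval (\sum_k a k) - \sum_k fmval (a k)).
Proof.
move=> i0; elim: n a => [|n IHn] a level_a; first by rewrite !big_ord0 subrr; apply: fil0.
rewrite !big_ord_recr /=.
set s := \sum_(k < n) _; set t := \sum_(k < n) _.
have near_st : I (2 * i)%N (fmval s - t) by apply: IHn.
apply: (fil_trans fI (y := fmval s + fmval (a ord_max))).
  by apply: (add_approx fm) => //; [apply: level_sum|apply: level_a].
by rewrite opprD addrACA subrr addr0.
Qed.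

Lemma sub_approx i x y : (0 < i)%N -> level i x -> level i y ->
  I (2 * i)%N (fmval (x - y) - (fmval x - fmval y)).
Proof.
move=> i0 level_x level_y; have := add_approx fm i0 (levelB level_x level_y) level_y.
rewrite -fmvalD subrK => /(filN fI); congr (I _ _); ring.
Qed.

Lemma nrm_approx i x : (0 < i)%N -> level i x ->
  I (2 * i)%N (fmval (nrm sgL Q x) - \sum_(k < Q) iter k sg (fmval x)).
Proof.
move=> i0 level_x.
have := @sum_approx i Q (fun k => iter k sgL x) i0 (fun k => level_iter k level_x).
by under [X in _ - X]eq_bigr do rewrite fmval_iter.
Qed.

Let ltS_double i : (0 < i)%N -> (i.+1 <= 2 * i)%N.
Proof. by move=> i0; rewrite mul2n -addnn -addn1 leq_add2l. Qed.

Lemma level_nrm d x : level d x -> level d (nrm sgL Q x).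
Proof. by move=> level_x; apply: level_sum => i; apply: level_iter. Qed.

Lemma nrm_surjective x : fixed sgL x -> exists y, x = nrm sgL Q y.
Proof.
have [tr Itr tr1] := cyclic_action_trace sgA.
apply: (solve_by_approximation (T := nrm sgL Q) (Y := fixed sgL)).
- exact: level_nrm.
- by move=> y z sgy; rewrite /fixed linearB /= sgy (norm_fixed sgL_order).
move=> i y i0 sgy level_y.
have Iz : I i (tr * fmval y) by apply: (filMl fI).
exists (toFM fm (fil_le fI i0 Iz)) => //; set z := toFM _ _.
apply/level_sub; apply: (fil_le fI (ltS_double i0)); apply: (fil_sym fI).
have sumE : \sum_(k < Q) iter k sg (tr * fmval y) = fmval y.
  under eq_bigr do rewrite rmorphM /= (iter_fixed _ (proj1 (fixedP y) sgy)).
  by rewrite -mulr_suml tr1 mul1r.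
by have := nrm_approx i0 (Iz : level i z); rewrite toFMK sumE.
Qed.

(* The trace of [fmval y] is small when the norm of [y] vanishes; removing it
   by means of an element of trace one makes Hilbert 90 applicable. *)
Lemma nrm_kernel_step i y : (0 < i)%N -> nrm sgL Q y = 0 -> level i y ->
  exists2 z, level i z & level i.+1 (y - (sgL z - z)).
Proof.
have [tr Itr tr1] := cyclic_action_trace sgA.
move=> i0 nrm_y level_y; set X := fmval y; pose t := \sum_(k < Q) iter k sg X.
have It : I (2 * i)%N t.
  by have := nrm_approx i0 level_y; rewrite nrm_y fmval0 sub0r => /(filN fI); rewrite opprK.
have sgt : sg t = t by apply: orbit_sum_fixed; apply: sgQ; apply: fmval_int.
pose X' := X - tr * t.
have trX' : \sum_(k < Q) iter k sg X' = 0.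
  under eq_bigr => k _ do rewrite rmorphB rmorphM /= (iter_fixed _ sgt).
  by rewrite sumrB -mulr_suml tr1 mul1r subrr.
have := additive_hilbert90 tr1 (sgQ Itr) trX'; set z := \sum_(k < Q) _ => X'E.
have IX' : I i X'.
  apply: (filB fI) => //; apply: (filMl fI) => //.
  by apply: (fil_le fI (e := (2 * i)%N)) => //; rewrite leq_pmull.
have Iz : I i (- z).
  apply: (filN fI); apply: (fil_sum fI) => k _; apply: (filMr fI).
    by apply: (fil_sum fI) => l _; apply: iter_sg_mem.
  exact: iter_sg_mem.
exists (toFM fm (fil_le fI i0 Iz)) => //; set Z := toFM _ _.
have level_Z : level i Z by [].
apply/level_sub; apply: (fil_le fI (ltS_double i0)); apply: (fil_sym fI).
apply: (fil_trans fI (sub_approx i0 (level_sg level_Z) level_Z)).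
have {}X'E : X' = z - sg z := X'E.
rewrite fmval_sg toFMK rmorphN opprK addrC [- sg z + z]addrC -X'E /X' addrA addNr add0r.
by apply: (filN fI); apply: (filMl fI).
Qed.

Lemma nrm_kernel x : nrm sgL Q x = 0 -> exists y, x = sgL y - y.
Proof.
move=> nrm_x; suff [y ->] : exists y, x = pact sgL ('X - 1) y.
  by exists y; rewrite pactXsub1.
apply: (solve_by_approximation (T := pact sgL ('X - 1)) (Y := fun x => nrm sgL Q x = 0)) nrm_x.
- by move=> d y level_y; rewrite /= pactXsub1; apply: levelB => //; apply: level_sg.
- by move=> y z nrm_y; rewrite linearB /= nrm_y pactXsub1 (norm_sub_sg sgL_order) subrr.
move=> i y i0 nrm_y level_y; have [z level_z near_z] := nrm_kernel_step i0 nrm_y level_y.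
by exists z => //; rewrite /= pactXsub1.
Qed.

Record fixed_basis n (eb : nat -> C) : Prop := FixedBasis {
  fixed_basis_int : forall j, I 0%N (eb j);
  fixed_basis_fixed : forall j, sg (eb j) = eb j;
  fixed_basis_gen : forall a : C, I 0%N a -> sg a = a ->
    exists c : nat -> R, a = \sum_(j < n) v (c j) * eb j;
  fixed_basis_indep : forall c : nat -> R, \sum_(j < n) v (c j) * eb j = 0 ->
    forall j, (j < n)%N -> c j = 0 }.

Section Rank.
Variables (w : R) (cd : cdvr w) (e n : nat) (eb : nat -> C).
Local Notation pi := (v w).
Hypotheses (e0 : (0 < e)%N) (pi0 : pi != 0) (pi_order : has_order I pi e).
Hypothesis ebP : fixed_basis n eb.
Let pi_mem k : I (k * e)%N (pi ^+ k) := has_order_mem fI (has_orderX k pi_order).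

Lemma level_scale_uniformizer d x : (0 < d)%N -> level d x -> level d.+1 (w *: x).
Proof.
move=> d0 level_x; apply: (fil_near fI (x := pi * fmval x) (e := (2 * d)%N)).
- exact: ltS_double.
- apply: (fil_le fI (e := (e + d)%N)); first by rewrite -add1n leq_add2r.
  by apply/pi_order; exists (fmval x).
- by apply: (fil_sym fI); apply: (act_approx fm).
Qed.

Lemma level_power k x : level k.+1 (w ^+ k *: x).
Proof.
elim: k => [|k IHk]; first by rewrite scale1r; apply: level1.
by rewrite exprS -scalerA; apply: level_scale_uniformizer.
Qed.

Lemma fm_scale_separated x : (forall k, exists y, x = w ^+ k *: y) -> x = 0.
Proof.
move=> w_x; apply: level_separated => d; have [y ->] := w_x d.
by apply: (level_le (leqnSn d)); apply: level_power.
Qed.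

Let le_double a : (2 <= a)%N -> ((a + 2) * e <= 2 * (a * e))%N.
Proof. by move=> a2; rewrite mulnA leq_mul2r mul2n -addnn leq_add2l a2 orbT. Qed.

Lemma uniformizer_approx a x : (2 <= a)%N -> level (a * e) x ->
  I ((a + 2) * e)%N (fmval (w *: x) - pi * fmval x).
Proof.
move=> a2 level_x; apply: (fil_le fI (le_double a2)); apply: (act_approx fm) => //.
by rewrite muln_gt0 e0 andbT; apply: leq_trans a2.
Qed.

Lemma level_uniformizer a x : (2 <= a)%N -> level (a * e) x -> level (a.+1 * e) (w *: x).
Proof.
move=> a2 level_x; apply: (fil_near fI (x := pi * fmval x) (e := ((a + 2) * e)%N)).
- by rewrite leq_mul2r addn2 leqnSn orbT.
- by rewrite mulSn; apply/pi_order; exists (fmval x).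
by apply: (fil_sym fI); apply: uniformizer_approx.
Qed.

Lemma level_uniformizer_cancel a x : (2 <= a)%N -> level (a * e) x ->
  level (a.+2 * e) (w *: x) -> level (a.+1 * e) x.
Proof.
move=> a2 level_x level_wx; apply: (has_order_cancel pi0 pi_order); rewrite -mulSn.
apply: (fil_near fI (x := fmval (w *: x)) (e := ((a + 2) * e)%N)) => //.
  by rewrite addn2.
exact: uniformizer_approx.
Qed.

Lemma uniformizer_power_approx k x : level (2 * e) x ->
  level ((k + 2) * e) (w ^+ k *: x) /\
  I ((k + 3) * e)%N (fmval (w ^+ k *: x) - pi ^+ k * fmval x).
Proof.
move=> level_x; elim: k => [|k [level_k near_k]].
  by rewrite scale1r mul1r subrr; split=> //; apply: fil0.
rewrite exprS -scalerA; split; first by apply: level_uniformizer; rewrite ?leq_addl.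
apply: (fil_trans fI (y := pi * fmval (w ^+ k *: x))).
  apply: (fil_le fI (e := ((k + 2 + 2) * e)%N)).
    by rewrite leq_mul2r -addnA addSnnS leqnn orbT.
  by apply: uniformizer_approx; rewrite ?leq_addl.
rewrite [pi ^+ k.+1]exprS -mulrA -mulrBr addSn mulSn; apply/pi_order.
by exists (fmval (w ^+ k *: x) - pi ^+ k * fmval x).
Qed.

(* The logarithm is injective on the elements of level [2 e]. *)
Lemma level2_torsion k x : level (2 * e) x -> w ^+ k *: x = 0 -> level (3 * e) x.
Proof.
move=> level_x wx0; have [_] := uniformizer_power_approx k level_x.
rewrite wx0 fmval0 sub0r => /(filN fI); rewrite opprK mulnDl.
exact: (has_order_cancel (expf_neq0 k pi0) (has_orderX k pi_order)).
Qed.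

Lemma fixed_gen_mem j : I 1%N (pi ^+ 2 * eb j).
Proof.
apply: (fil_le fI (e := (2 * e)%N)); first by rewrite muln_gt0 e0.
by apply: (filMr fI) => //; apply: (fixed_basis_int ebP).
Qed.

Definition fixed_gen j : A := toFM fm (fixed_gen_mem j).

Lemma fixed_gen_level j : level (2 * e) (fixed_gen j).
Proof. by rewrite /level toFMK; apply: (filMr fI) => //; apply: (fixed_basis_int ebP). Qed.

Lemma fixed_gen_fixed j : fixed sgL (fixed_gen j).
Proof.
by apply/fixedP; rewrite toFMK rmorphM rmorphXn /= aut_scalar (fixed_basis_fixed ebP).
Qed.

Lemma sg_pi_cancel k a : sg (pi ^+ k * a) = pi ^+ k * a -> sg a = a.
Proof. by rewrite rmorphM rmorphXn /= aut_scalar => /(mulfI (expf_neq0 k pi0)). Qed.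

Lemma fixed_gen_comb_approx a : I (2 * (2 * e))%N
  (fmval (\sum_(j < n) a j *: fixed_gen j) - pi ^+ 2 * \sum_(j < n) v (a j) * eb j).
Proof.
have e20 : (0 < 2 * e)%N by rewrite muln_gt0 e0.
apply: (fil_trans fI (y := \sum_(j < n) fmval (a j *: fixed_gen j))).
  by apply: sum_approx => // j; apply: levelZ; apply: fixed_gen_level.
rewrite mulr_sumr -sumrB; apply: (fil_sum fI) => j _; rewrite mulrCA.
by have := act_approx fm (a j) e20 (fixed_gen_level j); rewrite fmvalZ toFMK.
Qed.

Lemma fixed_gen_residually_indep : residually_indep w (level (3 * e)) n fixed_gen.
Proof.
move=> a level3 j lt_jn; set s := \sum_(j < n) v (a j) * eb j.
have : I (2 * e + e)%N (pi ^+ 2 * s).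
  rewrite -mulSnr; apply: (fil_near fI (e := (2 * (2 * e))%N) _ level3).
    by rewrite mulnA leq_mul2r orbT.
  exact: fixed_gen_comb_approx.
move/(has_order_cancel (expf_neq0 2 pi0) (has_orderX 2 pi_order)).
rewrite -[e]addn0 => /pi_order[y Iy sE].
have sgy : sg y = y.
  apply: (@sg_pi_cancel 1); rewrite expr1 -sE rmorph_sum; apply: eq_bigr => l _ /=.
  by rewrite rmorphM /= aut_scalar (fixed_basis_fixed ebP).
have [c yE] := fixed_basis_gen ebP Iy sgy.
have indep0 : \sum_(l < n) v (a l - w * c l) * eb l = 0.
  under eq_bigr => l _ do rewrite rmorphB rmorphM /= mulrBl -mulrA.
  by rewrite sumrB -mulr_sumr -yE -sE subrr.
have /eqP := fixed_basis_indep ebP (c := fun l => a l - w * c l) indep0 lt_jn.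
by rewrite subr_eq0 => /eqP ->; exists (c j).
Qed.

Lemma fixed_gen_indep : indep_mod (torsion w (A := A)) n fixed_gen.
Proof.
move=> r [N rN] i lt_in; apply: contrapT => ri.
have [k [r' [rE [j lt_jn ur']]]] := cdvr_primitive cd lt_in ri.
apply: (cdvr_inverseN cd ur'); apply: fixed_gen_residually_indep lt_jn.
apply: (level2_torsion (k := (N + k)%N)).
  by apply: level_sum => l; apply: levelZ; apply: fixed_gen_level.
rewrite exprD -scalerA scaler_sumr -[RHS]rN; congr (_ *: _); apply: eq_bigr => l _.
by rewrite scalerA -rE.
Qed.

Lemma fixed_approximation k y : fixed sgL y -> level ((k + 2) * e) y ->
  exists a : nat -> R, let z := y - \sum_(j < n) (a j * w ^+ k) *: fixed_gen j in
    fixed sgL z /\ level ((k.+1 + 2) * e) z.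
Proof.
move=> sgy level_y; have := level_y; rewrite /level -[((k + 2) * e)%N]addn0.
case/(has_orderX (k + 2) pi_order) => z Iz yE.
have sgz : sg z = z by apply: (@sg_pi_cancel (k + 2)); rewrite -yE; apply/fixedP.
have [a zE] := fixed_basis_gen ebP Iz sgz; exists a; split.
  apply: (submodB (submod_fixed sgL)) => //.
  apply: (submod_sum (fun j => a j * w ^+ k) (submod_fixed sgL)) => j _.
  exact: fixed_gen_fixed.
have k20 : (0 < (k + 2) * e)%N by rewrite muln_gt0 addn2 e0.
have le3 : ((k + 3) * e <= 2 * ((k + 2) * e))%N.
  by apply: leq_trans (le_double (leq_addl k 2)); rewrite leq_mul2r -addnA leq_add2l orbT.
have approx j := uniformizer_power_approx k (fixed_gen_level j).
apply/level_sub; apply: (fil_sym fI); rewrite addSnnS.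
apply: (fil_trans fI (y := \sum_(j < n) fmval ((a j * w ^+ k) *: fixed_gen j))).
  apply: (fil_le fI le3); apply: sum_approx => // j; rewrite -scalerA; apply: levelZ.
  by have [] := approx j.
have -> : fmval y = \sum_(j < n) v (a j) * (pi ^+ k * fmval (fixed_gen j)).
  rewrite yE zE mulr_sumr; apply: eq_bigr => j _.
  by rewrite toFMK exprD; ring.
rewrite -sumrB; apply: (fil_sum fI) => j _; rewrite -scalerA.
have [level_j near_j] := approx j.
apply: (fil_trans fI (fil_le fI le3 (act_approx fm (a j) k20 level_j))).
by rewrite -mulrBr; exact: (filMl fI (fm_scalar fm (a j)) near_j).
Qed.

Lemma fixed_generation x : fixed sgL x -> level (2 * e) x ->
  exists a : nat -> R, x = \sum_(j < n) a j *: fixed_gen j.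
Proof.
move=> sgx level_x; pose approx_at k y := fixed sgL y /\ level ((k + 2) * e) y.
have step k y : approx_at k y -> exists a : nat -> R,
    approx_at k.+1 (y - \sum_(j < n) (a j * w ^+ k) *: fixed_gen j).
  by case=> sgy level_y; apply: fixed_approximation.
have [a aP] := complete_generation cd step (conj sgx level_x : approx_at 0%N x).
exists a; apply/eqP; rewrite -subr_eq0; apply/eqP; apply: level_separated => d.
have [c [_ near_d]] := aP d; set s := \sum_(j < n) c j *: fixed_gen j in near_d.
rewrite -[x - _](addrK (w ^+ d *: s)); apply: levelB.
  by apply: level_le near_d; rewrite (leq_trans _ (leq_pmulr _ e0)) // leq_addr.
by apply: (level_le (leqnSn d)); apply: level_power.
Qed.

Lemma fixed_dependence (y : nat -> A) : (forall i, (i <= n)%N -> fixed sgL (y i)) ->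
  ~ indep_mod (torsion w (A := A)) n.+1 y.
Proof.
move=> sgy ind; pose k := (2 * e)%N.
have ex_r i : (i < n.+1)%N -> exists a : nat -> R,
    w ^+ k *: y i = \sum_(j < n) a j *: fixed_gen j.
  move=> le_in; apply: fixed_generation.
    by apply: (submodZ _ (submod_fixed sgL)); apply: sgy.
  by apply: (level_le (leqnSn _)); apply: level_power.
have [r rP] := bounded_choice (fun=> 0) ex_r.
have [a [[i le_in ai] aP]] := cdvr_dependence cd n r.
apply: ai; apply: (cdvr_regularX cd (k := k)); rewrite mulrC.
apply: (ind (fun i => a i * w ^+ k)) => //; exists 0%N; rewrite scale1r.
transitivity (\sum_(l < n.+1) \sum_(j < n) (a l * r l j) *: fixed_gen j).
  apply: eq_bigr => l _; rewrite -scalerA rP // scaler_sumr.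
  by apply: eq_bigr => j _; rewrite scalerA.
by rewrite exchange_big big1 // => j _; rewrite -scaler_suml aP // scale0r.
Qed.

Lemma fixed_points_rank : has_rank_mod (fixed sgL) (torsion w (A := A)) n.
Proof.
split; last exact: fixed_dependence.
by exists fixed_gen; [move=> i _; apply: fixed_gen_fixed|apply: fixed_gen_indep].
Qed.

End Rank.
End CyclicAction.

(** * Torsion *)

Section TorsionStructure.
Variables (R : comNzRingType) (w : R) (cd : cdvr w) (A : lmodType R).
Variables (q h s : nat) (rho : nat -> R).
Hypotheses (q1 : (1 < q)%N) (s0 : (0 < s)%N) (rhoP : residue_system w q rho).
Hypothesis torsion_kill : forall x : A, torsion w x -> w ^+ s *: x = 0.
Hypothesis fibers : forall y : A, w ^+ s.-1 *: y = 0 ->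
  exists z : nat -> A, representatives (fun x => w *: x = y) eq (q ^ h) z.

Lemma torsion_divisible k (x : A) : (k < s)%N -> w *: x = 0 -> exists y, w ^+ k *: y = x.
Proof.
move=> lt_ks wx; elim: k lt_ks => [|k IHk] lt_ks; first by exists x; rewrite scale1r.
have [y yE] := IHk (ltnW lt_ks); have [|t [tw _ _]] := @fibers y.
  have -> : s.-1 = (s.-1 - k.+1 + k.+1)%N by rewrite subnK // -ltnS prednK.
  by rewrite exprD -scalerA exprS -[in X in _ *: X]scalerA yE wx scaler0.
by exists (t 0%N); rewrite exprSr -scalerA tw // expn_gt0 (ltnW q1).
Qed.

Lemma uniformizer_torsion_basis : exists eta : nat -> A,
  [/\ forall i, (i < h)%N -> w *: eta i = 0, residually_indep w (fun x => x = 0) h eta &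
      generated_mod (fun x => w *: x = 0) (fun x => x = 0) h eta].
Proof.
have [|z [zw zall zinj]] := @fibers 0; first by rewrite scaler0.
have ker_sub : submod (fun x : A => w *: x = 0).
  split=> [|a x y wx wy]; first by rewrite scaler0.
  by rewrite scalerDr scalerA mulrC -scalerA wx wy scaler0 addr0.
have zP : representatives (fun x => w *: x = 0) (fun x y => x - y = 0) (q ^ h) z.
  split=> // [x /zall[i lt_i ->]|i j lt_i lt_j /eqP]; first by exists i; rewrite ?subrr.
  by rewrite subr_eq0 => /eqP; apply: zinj.
have [r [eta [qE eta0 indep gen]]] :=
  class_count cd ker_sub (@submod_zero R A) (fun x wx => wx) rhoP zP q1.
have rh : r = h by apply/eqP; rewrite -(eqn_exp2l _ _ q1) -qE.
by exists eta; rewrite -rh.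
Qed.

Section Lift.
Variables (eta zeta : nat -> A).
Hypothesis eta_indep : residually_indep w (fun x => x = 0) h eta.
Hypothesis eta_gen : generated_mod (fun x => w *: x = 0) (fun x => x = 0) h eta.
Hypothesis zetaE : forall i, (i < h)%N -> w ^+ s.-1 *: zeta i = eta i.

Lemma torsion_lift_span k x : (k <= s)%N -> w ^+ k *: x = 0 ->
  exists b : nat -> R, x = \sum_(i < h) b i *: zeta i.
Proof.
elim: k x => [|k IHk] x le_ks wx.
  exists (fun=> 0); rewrite big1 => [|i _]; last by rewrite scale0r.
  by rewrite -wx scale1r.
have [a aE] : exists a : nat -> R, w ^+ k *: x - \sum_(i < h) a i *: eta i = 0.
  by apply: eta_gen; rewrite scalerA -exprS.
pose c i := a i * w ^+ (s.-1 - k).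
have [|b bE] := IHk (x - \sum_(i < h) c i *: zeta i) (ltnW le_ks).
  rewrite scalerBr -[RHS]aE; congr (_ - _); rewrite scaler_sumr; apply: eq_bigr => i _.
  rewrite -zetaE // !scalerA /c mulrCA -exprD subnKC //.
  by rewrite -ltnS prednK.
exists (fun i => b i + c i); under eq_bigr do rewrite scalerDl.
by rewrite big_split /= -bE subrK.
Qed.

Lemma torsion_lift_rel (b : nat -> R) : \sum_(i < h) b i *: zeta i = 0 ->
  forall i, (i < h)%N -> divides (w ^+ s) (b i).
Proof.
move=> b0; suff rel k : (k <= s)%N -> forall i, (i < h)%N -> divides (w ^+ k) (b i).
  exact: rel.
elim: k => [|k IHk] le_ks i lt_ih; first by exists (b i); rewrite mul1r.
have [c cE] := bounded_choice 0 (IHk (ltnW le_ks)).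
suff /eta_indep/(_ i lt_ih)[d dE] : \sum_(i < h) c i *: eta i = 0.
  by exists d; rewrite cE // dE exprSr mulrA.
have b0' : w ^+ (s.-1 - k) *: \sum_(i < h) b i *: zeta i = 0 by rewrite b0 scaler0.
rewrite -[RHS]b0' scaler_sumr; apply: eq_bigr => j _.
by rewrite -zetaE // cE // !scalerA mulrA -exprD subnK 1?mulrC // -ltnS prednK.
Qed.

End Lift.

Lemma torsion_structure : exists zeta : nat -> A, torsion_basis w h s zeta.
Proof.
have [eta [eta0 indep gen]] := uniformizer_torsion_basis.
have ex_zeta i : (i < h)%N -> exists y : A, w ^+ s.-1 *: y = eta i.
  by move=> /eta0; apply: torsion_divisible; rewrite prednK.
have [zeta zetaE] := bounded_choice 0 ex_zeta.
exists zeta; split=> [i lt_ih|x tx|b b0].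
- by rewrite -(prednK s0) exprS -scalerA zetaE ?eta0.
- exact: (torsion_lift_span gen zetaE (leqnn s) (torsion_kill tx)).
- exact: (torsion_lift_rel indep zetaE).
Qed.

End TorsionStructure.

(** * Elements of trace one *)

Section TraceOne.
Variables (C : comNzRingType) (O : C -> Prop) (t : C) (sg : {rmorphism C -> C}).
Variables (p Q N : nat) (code : C -> 'I_N).
Local Notation I := (ideal_power O t).
Hypotheses (O_subring : is_subring O) (Ot : O t).
Hypothesis I_separated : forall x, (forall d, I d x) -> x = 0.
Hypothesis mem_or_unit : forall x, O x -> I 1%N x \/ exists2 y, O y & x * y = 1.
Hypotheses (I1 : ~ I 1%N 1) (p_pr : prime p) (Ip : I 1%N p%:R).
Hypothesis codeP : forall x y, O x -> O y -> code x = code y -> I 1%N (x - y).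
Hypotheses (sgO : forall x, O x -> O (sg x)) (sgt : sg t = t).
Hypothesis sgQ : forall x, O x -> iter Q sg x = x.
Hypothesis sg_faithful : forall k, (0 < k < Q)%N -> exists2 x, O x & iter k sg x <> x.
Let fI : filtration I := ideal_power_filtration O_subring Ot.
Let OI x : O x <-> I 0%N x. Proof. exact: iff_sym (ideal_power0 O t x). Qed.

Lemma residue_prime x y : O x -> O y -> I 1%N (x * y) -> I 1%N x \/ I 1%N y.
Proof.
move=> Ox Oy Ixy; have [|[x' Ox' xx']] := mem_or_unit Ox; [by left|right].
by rewrite -[y]mul1r -xx' mulrAC; apply: (filMr fI) => //; apply/OI.
Qed.

Lemma residue_frobenius_inj x y : O x -> O y -> I 1%N (x ^+ p - y ^+ p) -> I 1%N (x - y).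
Proof.
move=> Ox Oy Ixy; have Od := subringB O_subring Ox Oy.
have := fil_exp_primeD fI p_pr Ip (proj1 (OI _) Od) (proj1 (OI _) Oy).
rewrite subrK => near.
have Idp : I 1%N ((x - y) ^+ p) by have := filB fI Ixy near; congr (I _ _); ring.
have [//|[z Oz dz]] := mem_or_unit Od; case: I1.
rewrite -(expr1n _ p) -dz exprMn; apply: (filMr fI) => //.
by apply: (filX0 fI); apply/OI.
Qed.

(* The powers [x ^ (p ^ k)] repeat modulo [t], and the Frobenius of the residue
   ring is injective. *)
Lemma residue_perfect x : O x -> exists2 y, O y & I 1%N (x - y ^+ p).
Proof.
move=> Ox; pose u k := x ^+ (p ^ k).
have [a [b [lt_ab uab]]] : exists a b, (a < b)%N /\ code (u a) = code (u b).
  apply: contrapT => no_repeat.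
  have inj : injective (fun k : 'I_N.+1 => code (u k)).
    move=> a b uab; apply: contrapT => ne; apply: no_repeat.
    have [lt_ab|lt_ba|ab] := ltngtP a b; first by exists a, b.
      by exists b, a.
    by case: ne; apply: val_inj.
  by have := leq_card _ inj; rewrite !card_ord ltnn.
have Ou k : O (u k) by apply: (subringX O_subring).
have := codeP (Ou a) (Ou b) uab; rewrite -(subnKC lt_ab) addSnnS.
move: (b - a.+1)%N => c; elim: a {b lt_ab uab} => [|a IHa].
  rewrite add0n /u expn0 expr1 expnSr exprM => near_x; exists (x ^+ (p ^ c)) => //.
  exact: (subringX O_subring).
have uS k : u k.+1 = u k ^+ p by rewrite /u expnSr exprM.
rewrite addSn !uS => near_u; apply: IHa; apply: residue_frobenius_inj near_u; exact: Ou.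
Qed.

Lemma iter_aut_int k x : O x -> O (iter k sg x).
Proof. by elim: k => //= k IHk /IHk; apply: sgO. Qed.

Lemma iter_aut_ideal k d x : I d x -> I d (iter k sg x).
Proof.
move=> [y Oy ->]; exists (iter k sg y); first exact: iter_aut_int.
by rewrite rmorphM rmorphXn /= (iter_fixed _ sgt).
Qed.

(* [O] is generated modulo [t] by [p]-th powers. *)
Lemma inertia_trivial k : (forall x, O x -> I 1%N (iter k sg x - x)) ->
  forall x, O x -> iter k sg x = x.
Proof.
move=> triv x Ox; apply/eqP; rewrite -subr_eq0; apply/eqP; apply: I_separated => d.
apply: (filS fI); elim: d x Ox => [|d IHd] x Ox; first exact: triv.
have [y Oy [z Oz xyE]] := residue_perfect Ox; rewrite expr1 in xyE.
have -> : x = y ^+ p + t * z by rewrite -xyE addrC subrK.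
rewrite rmorphD rmorphXn rmorphM /= (iter_fixed _ sgt) opprD addrACA -mulrBr; apply: (filD fI).
  apply: (fil_sub_exp fI) => //; [apply/OI|apply/OI|apply: IHd] => //.
  exact: iter_aut_int.
rewrite -add1n; apply: (filM fI); last exact: IHd.
by exists 1; rewrite ?mulr1 //; apply: subring1.
Qed.

Lemma residue_separated i j : (i < j < Q)%N ->
  exists2 x, O x & ~ I 1%N (iter i sg x - iter j sg x).
Proof.
move=> /andP[lt_ij lt_jQ]; apply: contrapT => not_sep.
have near x : O x -> I 1%N (iter i sg x - iter j sg x).
  by move=> Ox; apply: contrapT => far_x; apply: not_sep; exists x.
have [|x Ox] := @sg_faithful (j - i).
  by rewrite subn_gt0 lt_ij (leq_ltn_trans (leq_subr _ _)).
apply; apply: inertia_trivial => // y Oy.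
have := iter_aut_ideal (Q - i) (near y Oy).
rewrite rmorphB /= -!iterD subnK; last by rewrite ltnW // (ltn_trans lt_ij).
have -> : (Q - i + j = (j - i) + Q)%N.
  by rewrite addnC addnBA ?(ltnW (ltn_trans lt_ij lt_jQ)) // addnBAC ?(ltnW lt_ij).
by rewrite iterD !sgQ // => /(fil_sym fI).
Qed.

(* Dedekind's argument: distinct characters are independent, modulo [t]. *)
Lemma residue_independence n (a : nat -> C) : (n <= Q)%N -> (forall i, O (a i)) ->
    (forall x, O x -> I 1%N (\sum_(i < n) a i * iter i sg x)) ->
  forall i, (i < n)%N -> I 1%N (a i).
Proof.
elim: n a => // n IHn a lt_nQ Oa rel.
have low i : (i < n)%N -> I 1%N (a i).
  move=> lt_in; have [|y Oy sep] := @residue_separated i n; first by rewrite lt_in.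
  have Od k : O (iter k sg y - iter n sg y) by apply: (subringB O_subring); apply: iter_aut_int.
  suff Iad : I 1%N (a i * (iter i sg y - iter n sg y)).
    by have [] := residue_prime (Oa i) (Od i) Iad.
  apply: (IHn (fun i => a i * (iter i sg y - iter n sg y))) => //; first exact: ltnW.
    by move=> k; apply: (subringM O_subring).
  move=> x Ox; have rel_xy := rel _ (subringM O_subring Ox Oy).
  have rel_x := filMr fI (rel _ Ox) (proj1 (OI _) (iter_aut_int n Oy)).
  have := filB fI rel_xy rel_x; congr (I _ _).
  rewrite !big_ord_recr /= mulrDl rmorphM mulr_suml -!mulrA opprD addrACA subrr addr0.
  by rewrite -sumrB; apply: eq_bigr => k _; rewrite rmorphM /=; ring.
move=> i; rewrite ltnS leq_eqVlt => /orP[/eqP->|]; last exact: low.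
have := rel 1 (subring1 O_subring); under eq_bigr do rewrite rmorph1 mulr1.
rewrite big_ord_recr /= => sum_mem.
rewrite -[a n](addKr (\sum_(k < n) a k)) addrC; apply: (filB fI) => //.
by apply: (fil_sum fI) => k _; apply: low.
Qed.

Lemma exists_trace_one : (0 < Q)%N -> exists2 c, O c & \sum_(i < Q) iter i sg c = 1.
Proof.
move=> Q0; have [x Ox far_x] : exists2 x, O x & ~ I 1%N (\sum_(i < Q) iter i sg x).
  apply: contrapT => all_near; apply: I1.
  apply: (@residue_independence Q (fun=> 1) (leqnn Q) _ _ 0%N) => // [_|x Ox].
    exact: subring1.
  under eq_bigr do rewrite mul1r.
  by apply: contrapT => far_x; apply: all_near; exists x.
set T := \sum_(i < Q) iter i sg x in far_x.
have OT : O T by apply: (subring_sum O_subring) => i _; apply: iter_aut_int.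
have sgT : sg T = T by apply: orbit_sum_fixed; apply: sgQ.
have [//|[y Oy Ty]] := mem_or_unit OT.
have sgy : sg y = y.
  by rewrite -[LHS]mul1r -Ty mulrAC -{1}sgT -rmorphM /= Ty rmorph1 mul1r.
exists (x * y); first exact: (subringM O_subring).
under eq_bigr do rewrite rmorphM /= (iter_fixed _ sgy).
by rewrite -mulr_suml.
Qed.

End TraceOne.

(** * Residue fields *)

Section Residue.
Variables (p : nat) (p_pr : prime p) (Omega : fieldExtType (padic p_pr)).
Local Notation O := (@padic_int_in p p_pr Omega).
Implicit Types E : {subfield Omega}.
Local Notation Z1 := (OE (Omega := Omega) 1%AS).
Local Notation V1 := (OmegaOver (Omega := Omega) 1%AS).

Lemma padic_residue_system : residue_system (p%:R : Z1) p (fun i => i%:R).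
Proof.
split=> // [a _|i j lt_ip lt_jp [b /(congr1 val)]].
  have [al aE] := padic_OE a.
  have lt_alp : (al 1%N < p)%N by rewrite -(padic_res_modn al 1) expn1 ltn_mod prime_gt0.
  have [|be beE] := @padic_divides _ p_pr (al - (al 1%N)%:R).
    by apply: padic_sub_res; rewrite padic_natE expn1 modn_small.
  have ib : integer_of 1%AS (O be).
    by split; [rewrite /padic_int_in memvZ // mem1v|apply: integral_id].
  exists (al 1%N) => //; exists (toOE ib); apply: val_inj.
  rewrite val_OEM rmorphB !rmorph_nat toOEK /= aE.
  have -> : O al - (al 1%N)%:R = O (al - (al 1%N)%:R) by rewrite rmorphB rmorph_nat.
  by rewrite beE rmorphM rmorph_nat.
rewrite rmorphB val_OEM !rmorph_nat => ijE; have [be bE] := padic_OE b.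
have {}ijE : (i%:R : padic_int p_pr) = j%:R + p%:R * be.
  apply: (@padic_int_in_inj p p_pr Omega).
  by rewrite rmorphD rmorphM !rmorph_nat /= -bE -ijE addrC subrK.
have := congr1 (fun a : padic_int p_pr => a 1%N) ijE.
rewrite padic_addE padic_mulE !padic_natE expn1 modnn mul0n mod0n addn0 modn_mod.
by rewrite !modn_small.
Qed.

Lemma maxideal_of_submod E : submod (V := V1) (maxideal_of E).
Proof.
have [t ut] := exists_uniformizer E; split.
  by apply/ut; exists 0; [apply: integer_of0|rewrite mulr0].
move=> a x y /ut[x' ix ->] /ut[y' iy ->]; apply/ut.
exists (val a * x' + y'); last by rewrite OmegaOver_scaleE mulrDr mulrCA.
apply: integer_ofD => //; apply: integer_ofM => //.
exact: integer_ofS (sub1v E) (val_OEP a).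
Qed.

Lemma one_not_maxideal E : ~ maxideal_of E 1.
Proof.
move=> [_ [i1 not_unit]]; apply: not_unit; split=> //.
by exists 1; rewrite ?mulr1.
Qed.

Lemma residue_card_representatives E q : residue_card E q ->
  exists z : nat -> Omega, representatives (integer_of E) (fun x y => maxideal_of E (x - y)) q z.
Proof.
move=> [r [ir rP]]; exists (fun k => if insub k is Some i then r i else 0).
have zE (i : 'I_q) : (if insub (val i) is Some i then r i else 0) = r i by rewrite valK.
split=> [i lt_iq|x /rP[i [xi _]]|i j lt_iq lt_jq].
- by rewrite (zE (Ordinal lt_iq)).
- by exists i => //; rewrite zE.
rewrite (zE (Ordinal lt_iq)) (zE (Ordinal lt_jq)) => rij.
have [k [_ k_uniq]] := rP _ (ir (Ordinal lt_iq)).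
have kj := k_uniq _ rij; have /k_uniq ki : maxideal_of E (r (Ordinal lt_iq) - r (Ordinal lt_iq)).
  by rewrite subrr; have [] := maxideal_of_submod E.
by have := congr1 val (etrans (esym ki) kj).
Qed.

Lemma residue_card_power E q : residue_card E q -> exists k, q = (p ^ k.+1)%N.
Proof.
case/residue_card_representatives => z zP; have sm := maxideal_of_submod E.
have p_max (x : V1) : integer_of E x -> maxideal_of E ((p%:R : Z1) *: x).
  move=> ix; rewrite OmegaOver_scaleE rmorph_nat.
  by apply: maxideal_ofM => //; apply: p_maxideal_of.
have [k [_ [qE _ _ _]]] := class_count (padic_OE_cdvr Omega) (integer_of_submod (sub1v E)) sm
  p_max padic_residue_system zP (prime_gt1 p_pr).
case: k qE => [|k] qE; last by exists k.
have [_ z_all _] := zP; rewrite qE in z_all.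
have [i lt_i1 max1] := z_all 1 (integer_of1 E); have [j lt_j1 max0] := z_all 0 (integer_of0 E).
have ij : i = j by move: lt_i1 lt_j1; rewrite !ltnS !leqn0 => /eqP-> /eqP->.
case: (@one_not_maxideal E); rewrite ij in max1.
by have := submodB sm max1 max0; rewrite opprB addrA subrK subr0.
Qed.

Lemma finite_residues E : exists N (code : Omega -> 'I_N),
  forall x y, integer_of E x -> integer_of E y -> code x = code y -> maxideal_of E (x - y).
Proof.
have [e [ie _ gen]] := integer_of_basis (padic_OE_cdvr Omega) (sub1v E).
set n := (\dim_ _ _)%N in ie gen.
have /choice[c cP] (x : Omega) : exists a : nat -> Z1,
    integer_of E x -> x = \sum_(i < n) val (a i) * e i.
  case: (pselect (integer_of E x)) => [/gen[a /eqP]|not_ix]; last by exists (fun=> 0).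
  by rewrite subr_eq0 => /eqP xE; exists a.
have [_ rho_all _] := padic_residue_system.
have /choice[d dP] (a : Z1) : exists i : 'I_p, divides p%:R (a - i%:R).
  by have [i lt_ip ai] := rho_all a I; exists (Ordinal lt_ip).
pose code x : {ffun 'I_n -> 'I_p} := [ffun i => d (c x (val i))].
exists #|{ffun 'I_n -> 'I_p}|, (fun x => enum_rank (code x)).
move=> x y ix iy /enum_rank_inj /ffunP code_xy.
have -> : x - y = \sum_(i < n) (val (c x i) - val (c y i)) * e i.
  by rewrite {1}(cP x ix) {1}(cP y iy) -sumrB; apply: eq_bigr => i _; rewrite mulrBl.
have sm := maxideal_of_submod E.
elim/big_ind: _ => [|a b|i _]; [by have [] := sm|exact: (submodD sm)|].
have := code_xy i; rewrite !ffunE => dxy; have := dP (c x i); rewrite dxy => near_x.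
have [b] := dividesB near_x (dP (c y i)); rewrite opprB addrA subrK => /(congr1 val).
rewrite rmorphB val_OEM rmorph_nat /= => ->; rewrite -mulrA; apply: maxideal_ofM.
  exact: p_maxideal_of.
by apply: integer_ofM (ie _ (ltn_ord i)); apply: integer_ofS (sub1v E) (val_OEP b).
Qed.

End Residue.

(** * Evaluation on the maximal ideal *)

Section Adic.
Variables (p : nat) (p_pr : prime p) (Omega : fieldExtType (padic p_pr)).
Local Notation O := (@padic_int_in p p_pr Omega).
Variables (E : {subfield Omega}) (t : Omega).
Hypothesis ut : is_uniformizer E t.
Local Notation I := (ideal_power (integer_of E) t).

Lemma maxideal_ofE x : maxideal_of E x <-> I 1%N x.
Proof. exact: iff_trans (ut x) (iff_sym (ideal_power1 _ t x)). Qed.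

Lemma uniformizer_int : integer_of E t.
Proof. exact: maxideal_of_int (uniformizer_max ut). Qed.

Lemma adic_filtration : filtration I.
Proof. exact: (ideal_power_filtration (integer_of_subring E) uniformizer_int). Qed.
Let fI := adic_filtration.

Lemma adic_padic N x : I (\dim {:Omega} * N)%N x -> exists2 z, integer O z & x = p%:R ^+ N * z.
Proof.
move=> [y [_ iy] ->]; have [_ mt] := uniformizer_max ut.
have [z iz zE] := omega_maxideal_power mt.
exists (z ^+ N * y); last by rewrite exprM zE exprMn mulrA.
by apply: (subringM (omega_subring Omega)) => //; apply: (subringX (omega_subring Omega)).
Qed.

Lemma adic_separated x : (forall d, I d x) -> x = 0.
Proof. by move=> Ix; apply: omega_separated => N; apply: adic_padic. Qed.

Lemma uniformizer_dvr : cdvr (toOE uniformizer_int).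
Proof. by apply: uniformizer_cdvr; rewrite toOEK. Qed.

Lemma adic_complete (S : nat -> Omega) : (forall d, I d (S d.+1 - S d)) ->
  exists l, forall d, I d (l - S d).
Proof.
move=> step; have /choice[a aE] d : exists a : OE E, S d.+1 - S d = t ^+ d * val a.
  by have [y iy yE] := step d; exists (toOE iy); rewrite toOEK.
have [l lP] := cdvr_complete uniformizer_dvr a; exists (S 0%N + val l) => d.
have [b lE] := lP d; exists (val b); first exact: val_OEP.
have SE : S d = S 0%N + \sum_(i < d) val (a i) * t ^+ i.
  elim: d {b lE} => [|d IHd]; first by rewrite big_ord0 addr0.
  by rewrite big_ord_recr /= addrA -IHd [X in _ + X]mulrC -aE addrC subrK.
have -> : val l = \sum_(i < d) val (a i) * t ^+ i + t ^+ d * val b.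
  rewrite lE val_OED val_OEM val_OEX toOEK rmorph_sum; congr (_ + _).
  by apply: eq_bigr => i _; rewrite rmorphM rmorphXn.
by rewrite SE addrA [_ + t ^+ d * _]addrC addrK.
Qed.

Lemma adic_lim (S : nat -> Omega) l : (forall d, I d (l - S d)) -> padic_lim O S = l.
Proof.
move=> Sl; apply: padic_lim_eq; [exact: padic_int_in_inj|exact: omega_algebraic|].
move=> N; exists (\dim {:Omega} * N)%N => k le_Nk; apply: adic_padic.
exact: (fil_le fI le_Nk (fil_sym fI (Sl k))).
Qed.

Lemma adic_total x y : I 1%N x -> I 1%N y ->
  (exists2 c, I 0%N c & y = c * x) \/ (exists2 c, I 0%N c & x = c * y).
Proof.
move=> /maxideal_ofE[xE _] /maxideal_ofE[yE _].
have [->|x0] := eqVneq x 0; first by right; exists 0; [apply: (fil0 fI)|rewrite mul0r].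
have [->|y0] := eqVneq y 0; first by left; exists 0; [apply: (fil0 fI)|rewrite mul0r].
have [iy|ix] := omega_total (y / x).
  left; exists (y / x); last by rewrite mulfVK.
  by apply/ideal_power0; split=> //; apply: subfield_div.
right; exists (x / y); last by rewrite mulfVK.
by apply/ideal_power0; split; [apply: subfield_div|rewrite -invf_div].
Qed.

Lemma adic_order c : integer_of E c -> c != 0 ->
  exists2 e, maxideal_of E c -> (0 < e)%N & has_order I c e.
Proof.
move=> ic c0; have cn0 : toOE ic <> 0.
  by move=> /(congr1 val); rewrite toOEK => c00; rewrite c00 eqxx in c0.
have [e [b [/(congr1 val) cE [b' /(congr1 val) bb']]]] := cdvr_factor uniformizer_dvr cn0.
rewrite val_OEM val_OEX !toOEK in cE; rewrite val_OEM rmorph1 in bb'.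
have [ib ib'] := (val_OEP b, val_OEP b').
exists e => [[_ [ci not_unit]]|d x].
  case: e cE => // cE; rewrite mul1r in cE.
  by case: not_unit; split=> //; exists (val b'); [have [] := ib'|rewrite cE].
split=> [[y iy ->]|[y [z iz ->] ->]].
  exists (t ^+ d * (val b' * y)); first by exists (val b' * y) => //; apply: integer_ofM.
  by rewrite cE exprD -!mulrA; congr (_ * _); rewrite mulrCA [val b * _]mulrA bb' mul1r.
exists (val b * z); first exact: integer_ofM.
by rewrite cE exprD -!mulrA; congr (_ * _); rewrite mulrCA.
Qed.

Lemma mfps_eval_approx (F : mfps 2 Omega) d x y : (forall m, integer_of E (F m)) ->
    I 1%N x -> I 1%N y ->
  I d (mfps_eval O F [tuple x; y] - mmap (@idfun Omega) (vec2 x y) (mfps_trunc d F)).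
Proof.
move=> FO Ix Iy; pose S d := mmap (@idfun Omega) (vec2 x y) (mfps_trunc d F).
have [k|l lP] := adic_complete (S := S).
  apply: (mmap_trunc_congr fI) => //; try exact: vec2_all.
    by move=> m; apply/ideal_power0/FO.
  by move=> i; rewrite subrr; apply: fil0.
suff -> : mfps_eval O F [tuple x; y] = l by apply: lP.
rewrite /mfps_eval -(adic_lim lP); congr padic_lim; apply/funext => k.
by rewrite /meval tnth_pair.
Qed.

Lemma fps_eval_approx (g : fps Omega) d x : (forall i, integer_of E (g i)) -> I 1%N x ->
  I d (fps_eval O g x - (fps_trunc d g).[x]).
Proof.
move=> gO Ix; have [k|l lP] := adic_complete (S := fun k => (fps_trunc k g).[x]).
  rewrite !horner_pev; apply: (pev_trunc_congr fI) => //.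
    by move=> i; apply/ideal_power0/gO.
  by rewrite subrr; apply: fil0.
by rewrite /fps_eval (adic_lim lP); apply: (lP d).
Qed.

End Adic.

Lemma uniformizer_unramified p (p_pr : prime p) (Omega : fieldExtType (padic p_pr))
    (E E' : {subfield Omega}) t : unramified E E' -> (E <= E')%VS ->
  is_uniformizer E t -> is_uniformizer E' t.
Proof.
move=> unram sEE' ut x; split=> [/unram[y [z [/ut[y' iy' ->] iz ->]]]|[y iy ->]].
  exists (y' * z); rewrite ?mulrA //; apply: integer_ofM iz.
  exact: integer_ofS iy'.
by apply/unram; exists t, y; split=> //; apply: uniformizer_max.
Qed.

Lemma gal_integer p (p_pr : prime p) (Omega : splittingFieldType (padic p_pr))
    (E : {subfield Omega}) (g : gal_of E) x : integer_of E x -> integer_of E (g x).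
Proof.
move=> [xE [P mP rP]]; split; first exact: memv_gal.
exists P => //; have gP : map_poly g (map_poly (@padic_int_in p p_pr Omega) P) =
    map_poly (@padic_int_in p p_pr Omega) P.
  by apply/polyP => i; rewrite !coef_map /= /padic_int_in linearZ /= rmorph1.
by rewrite -gP fmorph_root.
Qed.

Record honda_data p (p_pr : prime p) (Omega : splittingFieldType (padic p_pr))
    (K0 K : {subfield Omega}) (pi : Omega) (q : nat) (phi : gal_of K)
    (F : mfps 2 Omega) (f u : fps Omega) (h : nat) : Prop := HondaData {
  honda_data_sub : (K0 <= K)%VS;
  honda_data_uniformizer : is_uniformizer K0 pi;
  honda_data_unramified : unramified K0 K;
  honda_data_residue : residue_card K0 q;
  honda_data_frobenius : is_frobenius K0 q phi;
  honda_data_type : is_honda_type K pi u;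
  honda_data_height : type_height K u h;
  honda_data_group : is_honda_group pi q phi u F f }.

Section HondaGroup.
Variables (p : nat) (p_pr : prime p) (Omega : splittingFieldType (padic p_pr)).
Variables (K0 K : {subfield Omega}) (pi : Omega) (q : nat) (phi : gal_of K).
Variables (F : mfps 2 Omega) (f u : fps Omega) (h : nat).
Hypothesis hd : honda_data K0 pi q phi F f u h.
Let sK0K := honda_data_sub hd.
Let upi := honda_data_uniformizer hd.
Let ipi : integer_of K0 pi := uniformizer_int upi.

Lemma honda_uniformizerK : is_uniformizer K pi.
Proof. exact: uniformizer_unramified (honda_data_unramified hd) sK0K upi. Qed.
Let IK := maxideal_ofE honda_uniformizerK.

Lemma honda_data_q_gt1 : (1 < q)%N.
Proof.
have [k ->] := residue_card_power (honda_data_residue hd).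
by rewrite -(expn0 p) ltn_exp2l // prime_gt1.
Qed.

Lemma honda_data_coef k : integer_of K (F k).
Proof. by have [_ FO _ _ _] := honda_data_group hd; apply: FO. Qed.

Lemma honda_data_height_gt0 : (0 < h)%N.
Proof. by have [] := honda_data_height hd. Qed.

Lemma honda_data_setting : honda_setting (integer_of K) pi phi p q f u.
Proof.
have [phi_gal phi_frob] := honda_data_frobenius hd; have [u0 uO] := honda_data_type hd.
have [_ _ [f0 f1 _] _ honda] := honda_data_group hd.
have [k qE] := residue_card_power (honda_data_residue hd).
split=> //.
- exact: integer_of_subring.
- exact: integer_ofS ipi.
- exact: uniformizer_neq0 upi.
- by apply: fixed_gal sK0K phi_gal _; have [] := ipi.
- exact: gal_integer.
- by exists k.+1.
- exact: honda_data_q_gt1.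
- by apply/IK/p_maxideal_of.
- by move=> x /phi_frob /IK.
Qed.

Lemma honda_type_low i : (0 < i < h)%N -> ideal_power (integer_of K) pi 1 (u i).
Proof.
move=> lt_0ih; have [_ _ not_unit] := honda_data_height hd; have [_ uO] := honda_data_type hd.
have /andP[i0 _] := lt_0ih; have [/IK //|[y [_ iy] uy]] := maxideal_or_unit (uO i i0).
case: (not_unit i lt_0ih); have [uK ui] := uO i i0; split=> //; split=> //.
by exists y.
Qed.

Lemma fg_mul_integer a d : integer_of K0 a -> integer_of K (fg_mul f a d).
Proof.
move=> ia; have [phi_gal _] := honda_data_frobenius hd.
apply: (honda_integral honda_data_setting); first exact: integer_ofS ia.
by have [aK _] := ia; apply: fixed_gal sK0K phi_gal aK.
Qed.

Lemma fg_mul_pi_low d : (d < q ^ h)%N -> maxideal_of K (fg_mul f pi d).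
Proof. by move=> lt_dq; apply/IK; apply: (honda_mul_low honda_data_setting honda_type_low). Qed.

Lemma fg_mul_pi_unit : exists2 b, integer_of K b & fg_mul f pi (q ^ h)%N * b = 1.
Proof.
have [h0 [uK u_unit] _] := honda_data_height hd.
have [z iz piE] := honda_mul_height honda_data_setting h0 honda_type_low.
have [max_pi|//] := maxideal_or_unit (fg_mul_integer (q ^ h)%N ipi).
case: (@one_not_maxideal _ _ _ K); have [y iy uy] := unit_integer_of uK u_unit.
have /honda_uniformizerK[c ic cE] := max_pi.
apply/honda_uniformizerK; exists ((z - c) * y).
  by apply: integer_ofM iy; apply: integer_ofB.
by rewrite -uy mulrA mulrBr -cE piE opprD opprK addrA [pi * z + u h]addrC addrK.
Qed.

Section Points.
Variables (M : {subfield Omega}) (sKM : (K <= M)%VS) (t : Omega).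
Hypothesis ut : is_uniformizer M t.
Variables (R : comNzRingType) (v : {rmorphism R -> Omega}).
Hypothesis vO : forall a, integer_of K0 (v a).
Local Notation I := (ideal_power (integer_of M) t).

Lemma honda_formal_module : formal_module v I F f (fg_add F) (fg_act f).
Proof.
have [F_group FO F_log _ _] := honda_data_group hd.
have FM m : integer_of M (F m) by apply: integer_ofS (FO m).
have mulM a d : integer_of M (fg_mul f (v a) d).
  by apply: (integer_ofS sKM); apply: fg_mul_integer; apply: vO.
split=> //; [exact: adic_filtration|exact: adic_separated|exact: adic_complete|exact: adic_total
  | | | |].
- by move=> m; apply/ideal_power0.
- by move=> a d; apply/ideal_power0.
- by move=> d x y; apply: mfps_eval_approx.
- by move=> d a x; apply: fps_eval_approx.
Qed.

Lemma pi_order : exists2 e, (0 < e)%N & has_order I pi e.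
Proof.
have ipiM : integer_of M pi by apply: integer_ofS ipi; apply: subv_trans sKM.
have [e e0 pi_e] := adic_order ut ipiM (uniformizer_neq0 upi).
exists e => //; apply: e0; have [_ [_ not_unit]] := uniformizer_max upi.
by have [piM ii] := ipiM; split.
Qed.

End Points.
End HondaGroup.

Record cyclic_extension p (p_pr : prime p) (Omega : splittingFieldType (padic p_pr))
    (L M : {subfield Omega}) (m : nat) (sigma : gal_of M) : Prop := CyclicExtension {
  cyclic_extension_sub : (L <= M)%VS;
  cyclic_extension_galois : galois L M;
  cyclic_extension_order : #|'Gal(M / L)%g| = (p ^ m)%N;
  cyclic_extension_generator : 'Gal(M / L)%g = <[sigma]>%g }.

Section CyclicExtension.
Variables (p : nat) (p_pr : prime p) (Omega : splittingFieldType (padic p_pr)).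
Variables (L M : {subfield Omega}) (m : nat) (sigma : gal_of M) (t : Omega).
Hypothesis LM : cyclic_extension L m sigma.
Hypotheses (utL : is_uniformizer L t) (utM : is_uniformizer M t).
Local Notation I := (ideal_power (integer_of M) t).

Lemma sigma_fix x : x \in L -> sigma x = x.
Proof.
apply: fixed_gal (cyclic_extension_sub LM) _.
by rewrite (cyclic_extension_generator LM) cycle_id.
Qed.

Lemma sigma_uniformizer : sigma t = t.
Proof. by apply: sigma_fix; have [] := uniformizer_max utL. Qed.

Lemma sigma_mem d x : I d x -> I d (sigma x).
Proof.
move=> [y iy ->]; exists (sigma y); first exact: gal_integer.
by rewrite rmorphM rmorphXn /= sigma_uniformizer.
Qed.

Lemma iter_sigma k x : x \in M -> iter k sigma x = (sigma ^+ k)%g x.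
Proof.
move=> xM; elim: k => [|k IHk]; first by rewrite expg0 gal_id.
by rewrite expgSr galM //= IHk.
Qed.

Lemma sigma_order : #[sigma]%g = (p ^ m)%N.
Proof. by rewrite -(cyclic_extension_order LM) (cyclic_extension_generator LM). Qed.

Lemma iter_sigma_order x : x \in M -> iter (p ^ m) sigma x = x.
Proof. by move=> xM; rewrite iter_sigma // -sigma_order expg_order gal_id. Qed.

Lemma sigma_fixed x : x \in M -> sigma x = x -> x \in L.
Proof.
move=> xM sx; have /galois_fixedField EL := cyclic_extension_galois LM; rewrite -EL.
apply/fixedFieldP => // g; rewrite (cyclic_extension_generator LM) => /cycleP[k ->].
by rewrite -iter_sigma // (iter_fixed _ sx).
Qed.

Lemma sigma_faithful k : (0 < k < p ^ m)%N -> exists2 x, integer_of M x & iter k sigma x <> x.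
Proof.
move=> /andP[k0 lt_kQ]; apply: contrapT => fixes_int.
suff : (sigma ^+ k)%g = 1%g.
  move=> /eqP; rewrite -order_dvdn sigma_order => /(dvdn_leq k0).
  by rewrite leqNgt lt_kQ.
apply/eqP/gal_eqP => x xM; rewrite gal_id -iter_sigma //.
have [d ix] := omega_denominator x; apply: contrapT => moved; apply: fixes_int.
exists (p%:R ^+ d * x).
  by split=> //; apply: memvM => //; rewrite -natrX subfield_nat.
rewrite rmorphM rmorphXn rmorph_nat /=.
by move=> /(mulfI (expf_neq0 d (@omega_p_neq0 _ p_pr Omega))).
Qed.

Lemma sigma_trace_one : exists2 c, I 0%N c & \sum_(i < p ^ m) iter i sigma c = 1.
Proof.
have [N [code codeP]] := finite_residues M; have IM := maxideal_ofE utM.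
suff [c ic cE] : exists2 c, integer_of M c & \sum_(i < p ^ m) iter i sigma c = 1.
  by exists c => //; apply/ideal_power0.
apply: (@exists_trace_one _ (integer_of M) t sigma p (p ^ m) N code) => //.
- exact: integer_of_subring.
- exact: uniformizer_int.
- exact: adic_separated.
- by move=> x ix; have [mx|ux] := maxideal_or_unit ix; [left; apply/IM|right].
- by move=> /IM; apply: one_not_maxideal.
- by apply/IM/p_maxideal_of.
- by move=> x y ix iy /codeP mxy; apply/IM/mxy.
- exact: gal_integer.
- exact: sigma_uniformizer.
- by move=> x [xM _]; apply: iter_sigma_order.
- exact: sigma_faithful.
- by rewrite expn_gt0 prime_gt0.
Qed.

End CyclicExtension.

(** * Distinguished polynomials and evaluation *)

Lemma pevM (S R : comNzRingType) (c : {rmorphism R -> S}) P Q x :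
  pev c (P * Q) x = pev c P x * pev c Q x.
Proof. by rewrite /pev rmorphM hornerM. Qed.

Section WeierstrassSeries.
Variables (R : comNzRingType) (w : R) (cd : cdvr w) (g : fps R) (N : nat).
Hypothesis gN : weierstrass_degree w g N.

Lemma fps_trunc_poly e (D : {poly R}) : (size D <= e)%N -> fps_trunc e (fun i => D`_i) = D.
Proof.
move=> le_De; apply/polyP => i; rewrite coef_fps_trunc; case: ltnP => // le_ei.
by rewrite nth_default // (leq_trans le_De).
Qed.

Lemma Xadic_fps_mul e (a b c : fps R) : (forall d, a d = fps_mul b c d) ->
  Xadic e (fps_trunc e a - fps_trunc e b * fps_trunc e c).
Proof. by move=> aE d lt_de; rewrite coefB coef_fps_trunc lt_de fps_mul_trunc // aE subrr. Qed.

Lemma weierstrass_series : exists (D : {poly R}) (Q Q' : fps R),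
  [/\ distinguished w D N,
      forall e, (N < e)%N -> Xadic e (D - fps_trunc e Q * fps_trunc e g) &
      forall e, (N < e)%N -> Xadic e (fps_trunc e g - fps_trunc e Q' * D)].
Proof.
have [Q [D [distD DE Q0]]] := weierstrass_preparation cd gN; have [_ sD _] := distD.
have QN : weierstrass_degree w Q 0 by split.
have [Q' Q'Q] := triangular_solve QN (fun i => (i == 0)%N%:R).
have gE : g = fps_mul Q' (fun d => D`_d).
  have -> : (fun d => D`_d) = fps_mul Q g by apply/funext.
  by rewrite fps_mulA (_ : fps_mul Q' Q = fun i => (i == 0)%N%:R) ?fps_mul1 //; apply/funext.
exists D, Q, Q'; split=> // e lt_Ne; have TD := @fps_trunc_poly e D; rewrite sD in TD.
  by rewrite -{1}(TD lt_Ne); apply: Xadic_fps_mul.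
by rewrite -{1}(TD lt_Ne) {1}gE; apply: Xadic_fps_mul.
Qed.

End WeierstrassSeries.

Section Ramification.
Variables (C : fieldType) (O : C -> Prop) (t : C).
Hypotheses (O_subring : is_subring O) (Ot : O t) (t0 : t != 0).
Local Notation I := (ideal_power O t).
Hypothesis I1 : ~ I 1%N 1.
Variables (pi : C) (e : nat).
Hypotheses (pi0 : pi != 0) (pi_order : has_order I pi e).
Let fI : filtration I := ideal_power_filtration O_subring Ot.
Let OI x : O x <-> I 0%N x. Proof. exact: iff_sym (ideal_power0 O t x). Qed.

(* In a primitive relation of length [n < e], the first unit coefficient gives
   a term of strictly smallest order. *)
Lemma ramification_le_rank (R : comNzRingType) (v : {rmorphism R -> C}) (w : R) n :
    cdvr w -> v w = pi -> (forall a, O (v a)) ->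
    ~ (forall a : nat -> R, \sum_(i < n.+1) v (a i) * t ^+ i = 0 ->
         forall i, (i < n.+1)%N -> a i = 0) ->
  (e <= n)%N.
Proof.
move=> cd vw vO dep; rewrite leqNgt; apply/negP => lt_ne; apply: dep => a sum0 i lt_in.
apply: contrapT => ai.
have [k [a' [aE [j lt_jn uj]]]] := cdvr_primitive cd lt_in ai.
have {}sum0 : \sum_(i < n.+1) v (a' i) * t ^+ i = 0.
  apply: (mulfI (expf_neq0 k pi0)); rewrite mulr0 mulr_sumr -[RHS]sum0.
  by apply: eq_bigr => l _; rewrite aE // rmorphM rmorphXn /= vw mulrA.
have ex_unit : exists l, `[< has_inverse (a' l) >] by exists j; apply/asboolP.
have := ex_minnP ex_unit => -[l /asboolP[c ac] min_l].
have lt_ln : (l < n.+1)%N by apply: leq_ltn_trans lt_jn; apply/min_l/asboolP.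
have It d : I d (t ^+ d) by apply: ideal_power_exp.
have Il : I l.+1 (v (a' l) * t ^+ l).
  have -> : v (a' l) * t ^+ l = - \sum_(i < n.+1 | i != Ordinal lt_ln) v (a' i) * t ^+ i.
    by move: sum0; rewrite (bigD1 (Ordinal lt_ln)) //= => /eqP; rewrite addr_eq0 => /eqP.
  apply: (filN fI); apply: (fil_sum fI) => r ne_rl.
  have [lt_rl|lt_lr|eq_rl] := ltngtP r l; last by case/eqP: ne_rl; apply: val_inj.
  - have [[d ->]|u_r] := cdvr_divides_or_inverse cd (a' r); last first.
      by have := min_l r (introT (asboolP _) u_r); rewrite leqNgt lt_rl.
    rewrite rmorphM /= vw -mulrA; apply: (filMr fI).
      exact: (fil_le fI (leq_trans lt_ln lt_ne) (has_order_mem fI pi_order)).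
    by apply: (filM fI (a := 0) (b := 0)); [apply/OI|apply: fil_le (It r)].
  - by apply: (filMl fI); [apply/OI|apply: (fil_le fI lt_lr)].
have : I l.+1 (t ^+ l * 1).
  have -> : t ^+ l * 1 = v c * (v (a' l) * t ^+ l).
    by rewrite mulr1 mulrA -rmorphM [c * _]mulrC ac rmorph1 mul1r.
  by apply: (filMl fI) => //; apply/OI.
move=> [y Oy]; rewrite exprSr -mulrA => /(mulfI (expf_neq0 l t0)) yE.
by apply: I1; exists y; rewrite ?expr1.
Qed.

End Ramification.

Section TorsionLevel.
Variables (C : fieldType) (I : nat -> C -> Prop) (fI : filtration I).
Hypothesis I_separated : forall x, (forall d, I d x) -> x = 0.
Variables (pi : C) (e : nat).
Hypotheses (pi0 : pi != 0) (pi_order : has_order I pi e).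

Lemma exists_exact_level x : I 1%N x -> x <> 0 -> exists a, [/\ (0 < a)%N, I a x & ~ I a.+1 x].
Proof.
move=> Ix x0; apply: contrapT => no_level; apply: x0; apply: I_separated.
elim=> [|[|d] IHd] //; first exact: (fil_le fI (leq0n 1) Ix).
by apply: contrapT => not_Id; apply: no_level; exists d.+1.
Qed.

(* In [g x = 0] the linear term [pi x] must be balanced by a term of degree at
   least [N]. *)
Lemma height_le_ramification (g : fps C) N x : (1 < N)%N -> g 0%N = 0 -> g 1%N = pi ->
    (forall i, I 0%N (g i)) -> (forall i, (i < N)%N -> I e (g i)) ->
    I 1%N x -> x <> 0 -> (forall d, I d (\sum_(i < d) g i * x ^+ i)) ->
  (N.-1 <= e)%N.
Proof.
move=> N1 g0 g1 gO g_low Ix x0 gx; have [a [a1 Iax nIax]] := exists_exact_level Ix x0.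
have : (N * a <= e + a)%N.
  rewrite leqNgt; apply/negP => lt_eaN; apply: nIax.
  apply: (has_order_cancel pi0 pi_order); pose d := (e + a).+2.
  have := gx d; rewrite 2!big_ord_recl /= g0 mul0r add0r /bump /= g1 expr1.
  set s := \sum_(i < _) _ => /(fil_le fI (leqnSn _)) pix_s.
  rewrite -[pi * x](addrK s); apply: (filB fI); first by rewrite addnS.
  apply: (fil_sum fI) => i _; rewrite !add1n; have Ixi := filX fI i.+2 Iax.
  have [lt_iN|le_Ni] := ltnP i.+2 N; last first.
    apply: (filMl fI) => //.
    by apply: (fil_le fI _ Ixi); rewrite addnS (leq_trans lt_eaN) // leq_mul2r le_Ni orbT.
  apply: (fil_le fI (e := (e + i.+2 * a)%N)); last by apply: (filM fI) => //; apply: g_low.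
  by rewrite leq_add2l !mulSn -addn1 leq_add2l (leq_trans a1) // leq_addr.
have -> : (N * a = N.-1 * a + a)%N by rewrite -mulSnr prednK // ltnW.
by rewrite leq_add2r; apply: leq_trans; rewrite leq_pmulr.
Qed.

End TorsionLevel.

Lemma height_le_order (C : fieldType) (R : comNzRingType) (v : {rmorphism R -> C})
    (I : nat -> C -> Prop) (F : mfps 2 C) (f : fps C) (add act : C -> C -> C)
    (fm : formal_module v I F f add act) w e N (x : FM fm) : v w != 0 -> has_order I (v w) e ->
    (1 < N)%N -> (forall i, (i < N)%N -> I e (fg_mul f (v w) i)) -> w *: x = 0 -> x <> 0 ->
  (N.-1 <= e)%N.
Proof.
move=> pi0 pi_order N1 low wx x0; have [f0 f1 _] := fm_log fm; have fI := fm_fil fm.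
apply: (height_le_ramification fI (fm_separated fm) pi0 pi_order (g := fg_mul f (v w))
  (x := fmval x)) => //.
- exact: fg_mul0.
- exact: fg_mul1.
- exact: fm_mul fm w.
- exact: fmvalP.
- by move=> /fmval_eq0.
move=> d; have := fm_act fm d w (fmvalP x); rewrite -fmvalZ wx fmval0 sub0r.
by move=> /(filN fI); rewrite opprK horner_poly.
Qed.

(** * Torsion points in the algebraic closure *)

(* What the argument needs of an algebraic closure: its integers, their maximal
   ideal and the [p]-adic neighbourhoods of [0]. *)
Record closure_model (C : fieldType) (I : nat -> C -> Prop) (Kal : fieldType)
    (iota : C -> Kal) (intK maxK : Kal -> Prop) (smallK : nat -> Kal -> Prop) : Prop :=
  ClosureModel {
  closure_int : is_subring intK;
  closure_smallD : forall n x y, smallK n x -> smallK n y -> smallK n (x + y);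
  closure_separated : forall x, (forall n, smallK n x) -> x = 0;
  closure_max_int : forall z, maxK z -> intK z;
  closure_iota_int : forall c, I 0%N c -> intK (iota c);
  closure_iota_small : forall n, exists k, forall d c, (k <= d)%N -> I d c -> smallK n (iota c);
  closure_max_small : forall z n, maxK z -> exists k, forall d a, (k <= d)%N ->
    intK a -> smallK n (z ^+ d * a);
  closure_root_max : forall (D : {poly Kal}) t z N, I 1%N t -> D \is monic -> size D = N.+1 ->
    (forall i, (i < N)%N -> exists2 b, intK b & D`_i = iota t * b) -> root D z -> maxK z }.

Section Closure.
Variables (p : nat) (p_pr : prime p) (Omega : fieldExtType (padic p_pr)).
Variables (Kalg : fieldType) (iota : {rmorphism Omega -> Kalg}).
Local Notation O := (@padic_int_in p p_pr Omega).
Local Notation j := (iota \o O).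

Lemma map_poly_iota (P : {poly padic_int p_pr}) : map_poly j P = map_poly iota (map_poly O P).
Proof. by apply/polyP => i; rewrite !coef_map. Qed.

Lemma iota_padic_inj : injective j.
Proof. by move=> a b /= /fmorph_inj /padic_int_in_inj. Qed.

Lemma integer_iota c : integer j (iota c) <-> integer O c.
Proof.
by split=> -[P mP rP]; exists P => //; move: rP; rewrite map_poly_iota fmorph_root.
Qed.

Lemma maxideal_iota c : maxideal O c -> maxideal j (iota c).
Proof.
move=> [ic not_unit]; split=> [|[_ [y iy cy]]]; first exact/integer_iota.
apply: not_unit; split=> //; have c0 : c != 0.
  by apply/eqP => c0; move/eqP: cy; rewrite c0 rmorph0 mul0r eq_sym oner_eq0.
exists c^-1; last by rewrite mulfV.
apply/integer_iota; rewrite fmorphV -[X in integer _ X]mulr1 -cy mulKf //.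
by rewrite fmorph_eq0.
Qed.

Lemma closure_algebraic (z : Kalg) (P : {poly Omega}) : P != 0 ->
  root (map_poly iota P) z ->
  exists S : {poly padic_int p_pr}, S != 0 /\ root (map_poly j S) z.
Proof.
move=> P0 rP; pose k : {rmorphism padic p_pr -> Kalg} := iota \o in_alg Omega.
have map_j (S : {poly padic_int p_pr}) : map_poly j S = map_poly k (map_poly (@zfrac _ _) S).
  by apply/polyP => i; rewrite !coef_map.
have [S mS rS] : integralOver k z.
  apply: (integral_root _ rP); first by rewrite map_poly_eq0.
  move=> c /(nthP 0)[i _ <-]; rewrite coef_map.
  have [S [S0 rS]] := omega_algebraic P`_i.
  apply/integral_algebraic; exists (map_poly (@zfrac _ _) S).
    by rewrite map_poly_eq0_id0 // zfrac_eq0 lead_coef_eq0.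
  by rewrite -map_j map_poly_iota fmorph_root.
have [S' [c [c0 S'E]]] := padic_poly_denominators S.
have c0' : zfrac c != 0 by rewrite zfrac_eq0.
exists S'; split.
  apply/eqP => S'0; move/eqP: S'E; rewrite S'0 rmorph0 eq_sym scaler_eq0 (negPf c0') /=.
  by apply/negP/monic_neq0.
by rewrite map_j S'E map_polyZ rootE hornerZ (rootP rS) mulr0.
Qed.

Hypothesis alg : padic_algebraic j.
Let int_subring : is_subring (integer j) := integer_subring j.

Definition small N (z : Kalg) := exists2 a, integer j a & z = p%:R ^+ N * a.

Lemma small_iota N c : integer O c -> small N (iota (p%:R ^+ N * c)).
Proof.
move=> ic; exists (iota c); first exact/integer_iota.
by rewrite rmorphM rmorphXn rmorph_nat.
Qed.

Lemma closure_lim (u : nat -> Kalg) l :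
    (forall N, exists k, forall d, (k <= d)%N -> small N (u d - l)) ->
  padic_lim j u = l.
Proof. exact: (padic_lim_eq iota_padic_inj alg). Qed.

Lemma small_power z N : maxideal j z -> exists k, forall e a, (k <= e)%N -> integer j a ->
  small N (z ^+ e * a).
Proof.
move=> mz; have [iz [n [y [_ iy zn]]]] := proj1 (maxidealP iota_padic_inj alg z) mz.
exists (n * N)%N => e a le_e ia; rewrite -(subnKC le_e) exprD exprM zn exprMn.
exists (y ^+ N * z ^+ (e - n * N) * a); last by rewrite !mulrA.
by do 2![apply: (subringM int_subring) => //]; apply: (subringX int_subring).
Qed.

Lemma monic_root_maxideal (D : {poly Kalg}) (t z : Kalg) N : D \is monic -> size D = N.+1 ->
    maxideal j t -> (forall i, (i < N)%N -> exists2 b, integer j b & D`_i = t * b) ->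
  root D z -> maxideal j z.
Proof.
move=> mD sD mt Dlow rD; have N0 := monic_root_degree mD sD rD.
have [it [n [y [n0 iy tn]]]] := proj1 (maxidealP iota_padic_inj alg t) mt.
have iz : integer j z.
  apply: (integral_root_monic mD rD) => c /(nthP 0)[i lt_iD <-].
  rewrite sD ltnS leq_eqVlt in lt_iD; case/orP: lt_iD => [/eqP->|/Dlow[b ib ->]].
    by move/monicP: mD; rewrite lead_coefE sD => ->; apply: subring1 int_subring.
  exact: (subringM int_subring).
have [c ic zN] := monic_root_exp int_subring iz mD sD Dlow rD.
apply/(maxidealP iota_padic_inj alg); split=> //; exists (N * n)%N, (y * c ^+ n).
split; first by rewrite muln_gt0 N0.
  by apply: (subringM int_subring) => //; apply: (subringX int_subring).
by rewrite exprM zN exprMn tn mulrA.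
Qed.

Section Evaluation.
Variables (E : {subfield Omega}) (t : Omega) (ut : is_uniformizer E t).
Local Notation I := (ideal_power (integer_of E) t).

Lemma small_adic n : exists k, forall d c, (k <= d)%N -> I d c -> small n (iota c).
Proof.
exists (\dim {:Omega} * n)%N => d c le_d /(fil_le (adic_filtration ut) le_d).
by case/(adic_padic ut) => z iz ->; apply: small_iota.
Qed.

Lemma closure_modelP : closure_model I iota (integer j) (maxideal j) small.
Proof.
split=> [|n x y [a ia ->] [b ib ->]|x x0|z []|c [y [_ iy] ->]|||D t' z N].
- exact: int_subring.
- by exists (a + b); [apply: (subringD int_subring)|rewrite mulrDr].
- exact: (integer_separated iota_padic_inj alg).
- by [].
- by rewrite mul1r; apply/integer_iota.
- exact: small_adic.
- exact: small_power.
move=> It mD sD; apply: (monic_root_maxideal mD sD); apply: maxideal_iota.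
by have /(maxideal_ofE ut)[] := It.
Qed.

Lemma fps_trunc_iota d (g : fps Omega) z :
  (fps_trunc d (iota \o g)).[z] = pev iota (fps_trunc d g) z.
Proof.
rewrite /pev; congr (_.[_]); apply/polyP => i; rewrite coef_map !coef_fps_trunc /=.
by case: ifP => // _; rewrite rmorph0.
Qed.

Lemma fps_eval_iota (g : fps Omega) x : (forall i, integer_of E (g i)) -> I 1%N x ->
  fps_eval j (iota \o g) (iota x) = iota (fps_eval O g x).
Proof.
move=> gO Ix; apply: closure_lim => n; have [k kP] := small_adic n.
exists k => d le_kd; rewrite fps_trunc_iota /pev horner_map -rmorphB /=.
apply: (kP d) => //; apply: (fil_sym (adic_filtration ut)); exact: fps_eval_approx.
Qed.

End Evaluation.
End Closure.

(** * The fibers of multiplication by the uniformizer *)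

Section Fibers.
Variables (C : fieldType) (R OL : comNzRingType).
Variables (v : {rmorphism R -> C}) (vL : {rmorphism OL -> C}).
Variables (I : nat -> C -> Prop) (F : mfps 2 C) (f : fps C) (add act : C -> C -> C).
Variable fm : formal_module v I F f add act.
Variables (w : R) (t : OL) (cdL : cdvr t) (N s e : nat).
Local Notation A := (FM fm).
Local Notation pi := (v w).
Local Notation mul_trunc d a := (fps_trunc d (fg_mul f (v a))).
Hypotheses (N0 : (0 < N)%N) (s0 : (0 < s)%N) (e0 : (0 < e)%N) (pi0 : pi != 0).
Hypothesis pi_order : has_order I pi e.
Hypotheses (I1 : ~ I 1%N 1) (vLI : forall a, I 0%N (vL a)) (It : I 1%N (vL t)).
Variable aL : nat -> OL.
Hypothesis aLE : forall i, vL (aL i) = fg_mul f pi i.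
Hypothesis aLN : weierstrass_degree t aL N.

Variables (Kal : closedFieldType) (iota : {rmorphism C -> Kal}).
Variables (intK maxK : Kal -> Prop) (smallK : nat -> Kal -> Prop).
Hypothesis cm : closure_model I iota intK maxK smallK.
Hypothesis torsion_points : forall z, maxK z ->
  (forall n, exists k, forall d, (k <= d)%N -> smallK n (pev iota (mul_trunc d (w ^+ s)) z)) ->
  exists x : A, iota (fmval x) = z.

Let fI := fm_fil fm.
Let fmval_int (x : A) : I 0%N (fmval x) := fil_le fI (leq0n 1) (fmvalP x).
Let f0 : f 0%N = 0. Proof. by have [] := fm_log fm. Qed.
Let f1 : f 1%N = 1. Proof. by have [] := fm_log fm. Qed.
Local Notation Iz z := (ideal_power intK z).
Let IzO z c : Iz z 0%N c <-> intK c. Proof. exact: ideal_power0. Qed.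
Let fIz z (mz : maxK z) : filtration (Iz z) :=
  ideal_power_filtration (closure_int cm) (closure_max_int cm mz).
Let Iz1 z : Iz z 1%N z. Proof. exact: ideal_power_exp (closure_int cm) z 1. Qed.

Lemma small_ideal_power z n : maxK z ->
  exists k, forall d c, (k <= d)%N -> Iz z d c -> smallK n c.
Proof.
move=> mz; have [k kP] := closure_max_small cm n mz.
by exists k => d c le_kd [a ia ->]; apply: kP.
Qed.

Lemma mul_trunc_comp d a b : Xadic d ((mul_trunc d a \Po mul_trunc d b) - mul_trunc d (a * b)).
Proof.
have X1 : Xadic 1 ('X : {poly C}) by apply: Xadic1; rewrite coefX.
by have := mul_mul f0 f1 (v a) (v b) X1 (d := d); rewrite !comp_polyXr -rmorphM.
Qed.

Lemma mul_power_approx z d a b c : maxK z -> I 0%N c ->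
    Iz z d (pev iota (mul_trunc d b) z - iota c) ->
  Iz z d (pev iota (mul_trunc d (a * b)) z - pev iota (mul_trunc d a) (iota c)).
Proof.
move=> mz Ic bz; have fz := fIz mz.
have int_iota x (Ix : I 0%N x) : Iz z 0%N (iota x) := proj2 (IzO z _) (closure_iota_int cm Ix).
have int_coefs P : coef_fil I 0%N P -> integral_coefs (Iz z) iota (fun i => P`_i).
  by move=> PI i; exact: (int_iota _ (PI i)).
have int_mul r : coef_fil I 0%N (mul_trunc d r) := mul_trunc_int fm d r.
apply: (fil_trans fz (y := pev iota (mul_trunc d a \Po mul_trunc d b) z)).
  apply: (fil_sym fz); rewrite -pevB.
  apply: (pev_Xadic fz _ (mul_trunc_comp a b) (Iz1 z)); apply: int_coefs.
  apply: (filB (coef_filtration fI)); [exact: (comp_mul_int fm d a (int_mul b))|exact: int_mul].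
rewrite pev_comp; apply: (pev_congr fz (int_coefs _ (int_mul a)) _ (int_iota _ Ic) bz).
exact: (pev_int fz (int_coefs _ (int_mul b)) (proj2 (IzO z z) (closure_max_int cm mz))).
Qed.

Section Fiber.
Variables (y : A) (b : OL).
Hypotheses (bE : vL b = fmval y) (b_low : divides t b) (y_torsion : w ^+ s.-1 *: y = 0).

(* The series [pi](X) - y. *)
Let g i : OL := aL i - (i == 0%N)%:R * b.

Lemma fiber_series_degree : weierstrass_degree t g N.
Proof.
have [aL_low aL_unit] := aLN; split=> [i lt_iN|].
  by apply: dividesB; [apply: aL_low|apply: divides_mull].
by rewrite /g eqn0Ngt N0 mul0r subr0.
Qed.

Let g_trunc d : (0 < d)%N -> fps_trunc d g = fps_trunc d aL - b%:P.
Proof.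
move=> d0; apply/polyP => i; rewrite coefB !coef_fps_trunc coefC /g.
by case: eqP => [->|_]; rewrite ?d0 ?mul1r // mul0r !subr0.
Qed.

Let aL_trunc d : map_poly vL (fps_trunc d aL) = mul_trunc d w.
Proof.
apply/polyP => i; rewrite coef_map !coef_fps_trunc; case: ifP => _; last exact: rmorph0.
exact: aLE.
Qed.

Let pev_g d x : (0 < d)%N -> pev vL (fps_trunc d g) x = (mul_trunc d w).[x] - fmval y.
Proof.
by move=> d0; rewrite g_trunc // pevB /pev map_polyC /= hornerC bE aL_trunc.
Qed.

Let iL : {rmorphism OL -> Kal} := iota \o vL.

Let map_iL (P : {poly OL}) : map_poly iL P = map_poly iota (map_poly vL P).
Proof. by apply/polyP => i; rewrite !coef_map. Qed.

Let pev_iL_g d z : (0 < d)%N ->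
  pev iL (fps_trunc d g) z = pev iota (mul_trunc d w) z - iota (fmval y).
Proof.
move=> d0; rewrite g_trunc // pevB /pev !map_iL map_polyC /= bE aL_trunc.
by rewrite map_polyC hornerC.
Qed.

Lemma fiber_torsion z n : maxK z ->
    (forall d, (N < d)%N -> Iz z d (pev iota (mul_trunc d w) z - iota (fmval y))) ->
  exists k, forall d, (k <= d)%N -> smallK n (pev iota (mul_trunc d (w ^+ s)) z).
Proof.
move=> mz near_y; have [k1 small1] := small_ideal_power n mz.
have [k2 small2] := closure_iota_small cm n.
exists (maxn N.+1 (maxn k1 k2)) => d; rewrite !geq_max => /and3P[lt_Nd le_k1d le_k2d].
have := small1 d _ le_k1d (mul_power_approx (w ^+ s.-1) mz (fmval_int y) (near_y d lt_Nd)).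
rewrite -exprSr prednK // => near_wy.
rewrite -[pev iota _ z](subrK (pev iota (mul_trunc d (w ^+ s.-1)) (iota (fmval y)))).
apply: (closure_smallD cm) => //; rewrite /pev horner_map; apply: (small2 d) => //.
have := fm_act fm d (w ^+ s.-1) (fmvalP y); rewrite -fmvalZ y_torsion fmval0 sub0r.
by move=> /(filN fI); rewrite opprK.
Qed.

Lemma fiber_point z : maxK z ->
    (forall d, (N < d)%N -> Iz z d (pev iota (mul_trunc d w) z - iota (fmval y))) ->
  exists2 x : A, iota (fmval x) = z & w *: x = y.
Proof.
move=> mz near_y; have [|x xz] := torsion_points mz.
  by move=> n; apply: fiber_torsion.
exists x => //; apply: fmval_inj; rewrite fmvalZ.
apply: (fmorph_inj iota); apply/eqP; rewrite -subr_eq0; apply/eqP.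
apply: (closure_separated cm) => n; have [k1 small1] := small_ideal_power n mz.
have [k2 small2] := closure_iota_small cm n.
pose d := maxn N.+1 (maxn k1 k2); have := leqnn d; rewrite {1}/d !geq_max.
move=> /and3P[lt_Nd le_k1d le_k2d].
have near_mul := small1 d _ le_k1d (near_y d lt_Nd); rewrite -xz /pev horner_map /= in near_mul.
have := small2 _ _ le_k2d (fm_act fm d w (fmvalP x)); rewrite rmorphB => near_act.
have := closure_smallD cm near_act near_mul; congr (smallK n _).
by rewrite addrA subrK.
Qed.

Section Roots.
Variables (D : {poly OL}) (Q Q' : fps OL) (z : nat -> A).
Hypotheses (distD : distinguished t D N).
Hypothesis D_multiple : forall d, (N < d)%N -> Xadic d (D - fps_trunc d Q * fps_trunc d g).
Hypothesis g_multiple : forall d, (N < d)%N -> Xadic d (fps_trunc d g - fps_trunc d Q' * D).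
Let D' := map_poly iL D.

Lemma distinguished_map : D' \is monic /\ size D' = N.+1.
Proof.
have [mD sD _] := distD; split; first exact: monic_map.
by rewrite /D' size_map_poly_id0 // (monicP mD) rmorph1 oner_neq0.
Qed.

Lemma root_fiber_point c : root D' c -> exists2 x : A, iota (fmval x) = c & w *: x = y.
Proof.
move=> rc; have [mD' sD'] := distinguished_map; have [_ _ D_low] := distD.
have mc : maxK c.
  apply: (closure_root_max cm It mD' sD' _ rc) => i /D_low[a aE]; exists (iota (vL a)).
    exact: (closure_iota_int cm).
  by rewrite /D' coef_map aE /= !rmorphM.
apply: fiber_point => // d lt_Nd; have d0 : (0 < d)%N by apply: leq_trans lt_Nd.
have := @pev_Xadic _ _ _ (fIz mc) iL d _ c _ (g_multiple lt_Nd) (Iz1 c).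
rewrite pevB pevM pev_iL_g // [pev iL D c](rootP rc) mulr0 subr0; apply.
by move=> i; apply/IzO/(closure_iota_int cm).
Qed.

Lemma fiber_root x : w *: x = y -> pev vL D (fmval x) = 0.
Proof.
move=> wx; apply: (fm_separated fm) => d; pose k := maxn N.+1 d.
have := leqnn k; rewrite {1}/k geq_max => /andP[lt_Nk le_dk].
have := @pev_Xadic _ _ _ fI vL k _ _ (fun _ => vLI _) (D_multiple lt_Nk) (fmvalP x).
rewrite pevB pevM => near; apply: (fil_le fI le_dk).
rewrite -[pev vL D _](subrK (pev vL (fps_trunc k Q) (fmval x) * pev vL (fps_trunc k g) (fmval x))).
apply: (filD fI near); apply: (filMl fI).
  by apply: (pev_int fI) => [i|]; [exact: vLI|exact: fmval_int].
rewrite pev_g ?(leq_trans _ lt_Nk) // -wx fmvalZ; apply: (fil_sym fI).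
exact: (fm_act fm k w (fmvalP x)).
Qed.

Hypothesis root_product : D' = \prod_(i < N) ('X - (iota (fmval (z i)))%:P).

Lemma distinguished_eval c : pev vL D c = \prod_(i < N) (c - fmval (z i)).
Proof.
apply: (fmorph_inj iota); rewrite /pev -horner_map /= -map_iL -/D' root_product horner_prod.
by rewrite rmorph_prod; apply: eq_bigr => i _; rewrite hornerXsubC rmorphB.
Qed.

Lemma fiber_enumerated x : w *: x = y -> exists2 i, (i < N)%N & x = z i.
Proof.
move=> /fiber_root/eqP; rewrite distinguished_eval => /prodf_eq0[i _].
by rewrite subr_eq0 => /eqP xz; exists i => //; apply: fmval_inj.
Qed.

Lemma action_near_fiber x d : I d (pev vL D (fmval x)) -> level d (w *: x - y).
Proof.
move=> Dx; apply/level_sub; rewrite fmvalZ; pose k := maxn N.+1 d.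
have := leqnn k; rewrite {1}/k geq_max => /andP[lt_Nk le_dk].
apply: (fil_trans fI (fil_le fI le_dk (fm_act fm k w (fmvalP x)))).
rewrite -pev_g ?(leq_trans _ lt_Nk) //; set X := fmval x in Dx *.
have := @pev_Xadic _ _ _ fI vL k _ X (fun _ => vLI _) (g_multiple lt_Nk) (fmvalP x).
rewrite pevB pevM => /(fil_le fI le_dk) near.
rewrite -[pev vL (fps_trunc k g) X](subrK (pev vL (fps_trunc k Q') X * pev vL D X)).
apply: (filD fI near); apply: (filMl fI) => //; apply: (pev_int fI) => [i|]; first exact: vLI.
exact: fmval_int.
Qed.

(* At a double root [z i], a translate of [z i] by a point of exact level [2 e]
   would be mapped by [pi] too close to [y]. *)
Lemma fiber_injective i j : (i < N)%N -> (j < N)%N -> w *: z i = y -> z i = z j -> i = j.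
Proof.
move=> lt_iN lt_jN wzi zij; apply: contrapT => ne_ij.
have Ipi2 : I (2 * e)%N (pi ^+ 2) := has_order_mem fI (has_orderX 2 pi_order).
have Ipi2' : I 1%N (pi ^+ 2) by apply: (fil_le fI _ Ipi2); rewrite muln_gt0.
pose x0 := toFM fm Ipi2'; have level_x0 : level (2 * e) x0 by [].
have : level (3 * e) x0; last first.
  rewrite /level toFMK mulSn addnC -[X in I _ X]mulr1 => Ipi3; apply: I1.
  apply: (fil_le fI e0).
  exact: (has_order_cancel (expf_neq0 2 pi0) (has_orderX 2 pi_order) Ipi3).
apply: (level_uniformizer_cancel e0 pi0 pi_order (leqnn 2) level_x0).
pose x := z i + x0; have -> : w *: x0 = w *: x - y by rewrite scalerDr wzi addrAC subrr add0r.
apply: action_near_fiber; rewrite distinguished_eval.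
have int_sub k : I 0%N (fmval x - fmval (z k)).
  by apply: (filB fI); apply: fmval_int.
have near_zi : I (2 * e)%N (fmval x - fmval (z i)).
  by apply/level_sub; rewrite /x addrAC subrr add0r.
have ne_ji : Ordinal lt_jN != Ordinal lt_iN by apply/eqP => /(congr1 val) /= ji; apply: ne_ij.
rewrite (bigD1 (Ordinal lt_iN)) //= (bigD1 (Ordinal lt_jN)) //= -zij mulrA.
have -> : (4 * e = 2 * e + 2 * e)%N by rewrite -mulnDl.
apply: (filMr fI); first exact: (filM fI near_zi near_zi).
exact: (fil_prod0 fI).
Qed.

End Roots.

Lemma fiber_representatives : exists z : nat -> A, representatives (fun x => w *: x = y) eq N z.
Proof.
have [D [Q [Q' [distD DQ gQ']]]] := weierstrass_series cdL fiber_series_degree.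
have [mD' sD'] := distinguished_map distD; set D' := map_poly iL D in mD' sD'.
have [r D'E] := closed_field_poly_normal D'; rewrite (monicP mD') scale1r in D'E.
have sr : size r = N.
  by have := congr1 (fun P : {poly Kal} => size P) D'E; rewrite size_prod_XsubC sD' => -[].
have ex_z i : (i < N)%N -> exists x : A, iota (fmval x) = r`_i /\ w *: x = y.
  move=> lt_iN; have [|x xr wx] := root_fiber_point distD gQ' (c := r`_i); last by exists x.
  by rewrite -/D' D'E root_prod_XsubC mem_nth ?sr.
have [z zP] := bounded_choice 0 ex_z.
have D'z : D' = \prod_(i < N) ('X - (iota (fmval (z i)))%:P).
  rewrite D'E (big_nth 0) big_mkord sr; apply: eq_bigr => i _.
  by have [->] := zP i (ltn_ord i).
exists z; split=> [i /zP[]|x|i j lt_iN lt_jN] //; first exact: (fiber_enumerated DQ D'z).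
by apply: (fiber_injective gQ' D'z) => //; have [] := zP i lt_iN.
Qed.

End Fiber.
End Fibers.

(** * Group rings of cyclic groups *)

Section GroupRingProduct.
Variables (C : nzRingType) (gT : finGroupType) (J : finType) (h : nat).
Implicit Types a b : {ffun gT -> C}.

Lemma gr_mul_monom a c k g : gr_mul a (gr_monom c k) g = a (g * k^-1)%g * c.
Proof.
rewrite ffunE (bigD1 (g * k^-1)%g) //= ffunE invMg invgK -mulgA mulVg mulg1 eqxx.
rewrite big1 ?addr0 // => x ne_x; rewrite ffunE; case: eqP => [xg|_]; last by rewrite mulr0.
by case/eqP: ne_x; rewrite -xg invMg invgK mulgA mulgV mul1g.
Qed.

Lemma gr_mulB a b b' : gr_mul a (b - b') = gr_mul a b - gr_mul a b'.
Proof.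
by apply/ffunP => g; rewrite !ffunE -sumrB; apply: eq_bigr => x _; rewrite !ffunE mulrBr.
Qed.

Lemma gr_mul0 a : gr_mul a 0 = 0.
Proof. by apply/ffunP => g; rewrite !ffunE big1 // => x _; rewrite ffunE mulr0. Qed.

Lemma sum_gr_mul_basis (d : 'I_h -> {ffun gT -> C}) (idx : 'I_h -> J) b i :
    injective idx ->
  \sum_k gr_mul (d k) (gr_basis (idx k) b i) =
    if [pick k | i == idx k] is Some k then gr_mul (d k) b else 0.
Proof.
move=> idx_inj; case: pickP => [l /eqP ->|no_k]; last first.
  by rewrite big1 // => k _; rewrite ffunE no_k gr_mul0.
rewrite (bigD1 l) //= ffunE eqxx big1 ?addr0 // => k ne_kl.
by rewrite ffunE (inj_eq idx_inj) eq_sym (negPf ne_kl) gr_mul0.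
Qed.

End GroupRingProduct.

Section GroupRingPoly.
Variables (R : comNzRingType) (gT : finGroupType) (sigma : gT).
Local Notation V := {ffun gT -> R^o}.
Implicit Types (a : V) (P D : {poly R}).

Definition gr_shift a : V := [ffun g => a (g * sigma^-1)%g].

Fact gr_shift_linear : linear gr_shift.
Proof. by move=> c a b; apply/ffunP => g; rewrite !ffunE. Qed.

HB.instance Definition _ := GRing.isLinear.Build R V V *:%R gr_shift gr_shift_linear.

Definition gr_one : V := [ffun g => (g == 1%g)%:R].

(* The image of [P] under [R['X] -> R[<[sigma]>]], ['X |-> sigma]. *)
Definition gr_poly P : V := pact gr_shift P gr_one.

Lemma iter_gr_shift l a g : iter l gr_shift a g = a (g * (sigma ^+ l)^-1)%g.
Proof.
elim: l g => [|l IH] g; first by rewrite expg0 invg1 mulg1.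
by rewrite /= ffunE IH expgSr invMg mulgA.
Qed.

Lemma gr_polyE n P g : (size P <= n)%N ->
  gr_poly P g = \sum_(l < n) P`_l * (g == sigma ^+ l)%g%:R.
Proof.
move=> le_Pn; rewrite /gr_poly (pact_widen _ _ le_Pn) sum_ffunE; apply: eq_bigr => l _.
rewrite ffunE /= iter_gr_shift ffunE; congr (_ * (nat_of_bool _)%:R).
by rewrite -eq_mulgV1.
Qed.

Lemma gr_poly_support P g : g \notin <[sigma]>%g -> gr_poly P g = 0.
Proof.
move=> not_g; rewrite (gr_polyE _ (leqnn _)) big1 // => l _.
by case: eqP => [gl|_]; [rewrite gl mem_cycle in not_g|rewrite mulr0].
Qed.

Lemma gr_poly_surjective a : (forall g, g \notin <[sigma]>%g -> a g = 0) ->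
  exists P, a = gr_poly P.
Proof.
move=> supp; exists (\poly_(l < #[sigma]%g) a (sigma ^+ l)%g); apply/ffunP => g.
have [/cyclePmin[k lt_k ->]|not_g] := boolP (g \in <[sigma]>%g); last first.
  by rewrite supp ?gr_poly_support.
rewrite (gr_polyE _ (size_poly _ _)).
rewrite (bigD1 (Ordinal lt_k)) //= eqxx mulr1 coef_poly lt_k big1 ?addr0 // => l ne_lk.
rewrite eq_expg_mod_order !modn_small //; case: eqP => [kl|_]; last by rewrite mulr0.
by case/eqP: ne_lk; apply: val_inj.
Qed.

Lemma gr_shift_order a : iter #[sigma]%g gr_shift a = a.
Proof. by apply/ffunP => g; rewrite iter_gr_shift expg_order invg1 mulg1. Qed.

Lemma gr_poly_cyc P D : cyc #[sigma]%g (P - D) -> gr_poly P = gr_poly D.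
Proof.
move=> cycPD; apply/eqP; rewrite -subr_eq0 /gr_poly -pactN -pactD.
by rewrite (pact_cyc gr_shift_order).
Qed.

Lemma gr_poly_mulX D g : gr_poly ('X * D) g = gr_poly D (g * sigma^-1)%g.
Proof. by rewrite mulrC /gr_poly pactMX ffunE. Qed.

Lemma gr_poly_act (A : lmodType R) (sg : {linear A -> A}) (gA : gT -> A) P x :
    (forall l, gA (sigma ^+ l)%g = iter l sg x) ->
  \sum_(g in <[sigma]>%g) gr_poly P g *: gA g = pact sg P x.
Proof.
move=> gAE; rewrite /pact.
transitivity (\sum_(g in <[sigma]>%g) \sum_(l < size P)
   (P`_l * (g == sigma ^+ l)%g%:R) *: gA g).
  by apply: eq_bigr => g _; rewrite (gr_polyE _ (leqnn _)) scaler_suml.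
rewrite exchange_big; apply: eq_bigr => l _ /=.
rewrite (bigD1 (sigma ^+ l)%g) ?mem_cycle //= eqxx mulr1 gAE big1 ?addr0 //.
by move=> g /andP[_ /negPf->]; rewrite mulr0 scale0r.
Qed.

Section Values.
Variables (C : comNzRingType) (v : {rmorphism R -> C}).

Definition gr_val P : {ffun gT -> C} := [ffun g => v (gr_poly P g)].

Lemma gr_val0 : gr_val 0 = 0.
Proof. by apply/ffunP => g; rewrite !ffunE /gr_poly pact0 ffunE rmorph0. Qed.

Lemma gr_valN D : gr_val (- D) = - gr_val D.
Proof. by apply/ffunP => g; rewrite !ffunE /gr_poly pactN ffunE rmorphN. Qed.

Lemma gr_val_scale c D : gr_mul (gr_val D) (gr_monom (v c) 1%g) = gr_val (c *: D).
Proof.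
apply/ffunP => g; rewrite gr_mul_monom invg1 mulg1 !ffunE /gr_poly pactZ ffunE.
by rewrite rmorphM /= mulrC.
Qed.

Lemma gr_val_Xsub1 D :
  gr_mul (gr_val D) (gr_monom 1 sigma - gr_monom 1 1%g) = gr_val (('X - 1) * D).
Proof.
apply/ffunP => g; rewrite gr_mulB [LHS]ffunE [X in _ + X]ffunE !gr_mul_monom !mulr1 !ffunE.
rewrite invg1 mulg1 -gr_poly_mulX -rmorphB; congr (v _).
by rewrite mulrBl mul1r /gr_poly pactD pactN !ffunE.
Qed.

Section Image.
Variable A : C -> Prop.
Hypotheses (v_inj : injective v) (AP : forall x, A x <-> exists r : R, x = v r).

Lemma gr_val_mem P : in_group_ring A <[sigma]>%g (gr_val P).
Proof.
move=> g; split=> [|not_g]; first by apply/AP; exists (gr_poly P g); rewrite ffunE.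
by rewrite ffunE gr_poly_support // rmorph0.
Qed.

Lemma gr_val_surjective (a : {ffun gT -> C}) : in_group_ring A <[sigma]>%g a ->
  exists P, a = gr_val P.
Proof.
move=> Aa; have /choice[b bE] : forall g, exists b, a g = v b.
  by move=> g; apply/AP; have [] := Aa g.
have [|P PE] := gr_poly_surjective (a := [ffun g => b g]).
  move=> g not_g; rewrite ffunE; apply: v_inj; rewrite rmorph0 -bE.
  by have [_ ->] := Aa g.
by exists P; apply/ffunP => g; rewrite ffunE -PE ffunE.
Qed.

Lemma gr_val_surjective_family (J : Type) (c : J -> {ffun gT -> C}) :
  (forall i, in_group_ring A <[sigma]>%g (c i)) ->
  exists Q : J -> {poly R}, forall i, c i = gr_val (Q i).
Proof. by move=> Ac; have /choice[Q QE] := fun i => gr_val_surjective (Ac i); exists Q. Qed.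

End Image.
End Values.
End GroupRingPoly.

(** * Generators and relations *)

Section Indices.
Variables (n h : nat) (hn : (h <= n)%N).

(* The position in [gen_family] of each generator. *)
Definition gen_rank (i : gen_index (n - h) h) : nat :=
  match i with inl k => h + k | inr (inl k) => n + k | inr (inr k) => k end.

Let theta_rank (k : 'I_(n - h)) : (h + k < n)%N.
Proof. by rewrite -ltn_subRL. Qed.

Let omega_rank (k : 'I_h) : (k < n)%N.
Proof. exact: leq_trans hn. Qed.

Lemma gen_rank_lt i : (gen_rank i < n + h)%N.
Proof.
case: i => [k|[k|k]] /=; last by rewrite (leq_trans (ltn_ord k)) // leq_addl.
  by rewrite (leq_trans (theta_rank k)) // leq_addr.
by rewrite ltn_add2l.
Qed.

Lemma gen_rank_inj : injective gen_rank.
Proof.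
move=> [k|[k|k]] [l|[l|l]] /= kl.
- by congr inl; apply: val_inj; apply: (addnI kl).
- by have := theta_rank k; rewrite kl ltnNge leq_addr.
- by have := ltn_ord l; rewrite -kl ltnNge leq_addr.
- by have := theta_rank l; rewrite -kl ltnNge leq_addr.
- by congr (inr (inl _)); apply: val_inj; apply: (addnI kl).
- by have := omega_rank l; rewrite -kl ltnNge leq_addr.
- by have := ltn_ord k; rewrite kl ltnNge leq_addr.
- by have := omega_rank k; rewrite kl ltnNge leq_addr.
by congr (inr (inr _)); apply: val_inj.
Qed.

Lemma extend_by_rank (T : Type) (x0 : T) (x : gen_index (n - h) h -> T) :
  exists y : nat -> T, forall i, y (gen_rank i) = x i.
Proof.
exists (fun k => if [pick i | gen_rank i == k] is Some i then x i else x0) => i.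
by case: pickP => [l /eqP /gen_rank_inj -> //|/(_ i)]; rewrite eqxx.
Qed.

Lemma gen_rank_sum (V : zmodType) (T : nat -> V) :
  \sum_(i : gen_index (n - h) h) T (gen_rank i) = \sum_(k < n + h) T k.
Proof.
have sum_n : \sum_(k < n) T k = \sum_(k < h) T k + \sum_(k < n - h) T (h + k)%N.
  by transitivity (\sum_(k < h + (n - h)) T k); [rewrite subnKC|rewrite big_split_ord].
by rewrite !big_sumType big_split_ord /= sum_n [RHS]addrAC [RHS]addrC; congr (_ + _); rewrite addrC.
Qed.

Lemma gens_rank (T : Type) (g xi : nat -> T) i :
  gens (fun k : 'I_(n - h) => g (h + k)%N) (fun k : 'I_h => xi k) (fun k : 'I_h => g k) i =
    if (gen_rank i < n)%N then g (gen_rank i) else xi (gen_rank i - n)%N.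
Proof.
by case: i => [k|[k|k]] /=; rewrite ?theta_rank ?omega_rank // ltnNge leq_addr addKn.
Qed.

End Indices.

Definition presentation (C : nzRingType) (gT : finGroupType) (add act : C -> C -> C)
    (ga : gT -> C -> C) (G : {set gT}) (A B : C -> Prop) (pi : C) (s : nat) (sigma : gT)
    (r h : nat) (theta : 'I_r -> C) (xi omega : 'I_h -> C) :=
  let lincomb (c : {ffun gen_index r h -> {ffun gT -> C}}) :=
    \big[add/0]_i \big[add/0]_(g in G) act (c i g) (ga g (gens theta xi omega i)) in
  [/\ forall i, B (gens theta xi omega i),
      forall x, B x -> exists2 c : {ffun gen_index r h -> {ffun gT -> C}},
        forall i, in_group_ring A G (c i) & x = lincomb c &
      forall c : {ffun gen_index r h -> {ffun gT -> C}},
        (forall i, in_group_ring A G (c i)) ->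
        (lincomb c = 0 <-> exists2 d : 'I_h -> {ffun gT -> C},
           forall k, in_group_ring A G (d k) &
           c = [ffun i => \sum_(k < h) gr_mul (d k) (gen_rel r pi s sigma k i)])].

Section Presentation.
Variables (R C : comNzRingType) (v : {rmorphism R -> C}) (v_inj : injective v).
Variables (V : lmodType R) (val : V -> C) (add act : C -> C -> C).
Hypotheses (val_inj : injective val) (val0 : val 0 = 0).
Hypothesis valD : forall x y, val (x + y) = add (val x) (val y).
Hypothesis valZ : forall a x, val (a *: x) = act (v a) (val x).
Variables (sg : {linear V -> V}) (gT : finGroupType) (sigma : gT) (ga : gT -> C -> C).
Hypothesis gaE : forall l x, ga (sigma ^+ l)%g (val x) = val (iter l sg x).
Variables (n h s : nat) (w : R) (hn : (h <= n)%N) (A B : C -> Prop).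
Hypotheses (AP : forall x, A x <-> exists a, x = v a) (BP : forall x, B x <-> exists y, x = val y).
Local Notation G := <[sigma]>%g.
Lemma big_val (K : Type) (r : seq K) (P : pred K) (T : K -> V) (x : K -> C) :
    (forall i, P i -> x i = val (T i)) ->
  \big[add/0]_(i <- r | P i) x i = val (\sum_(i <- r | P i) T i).
Proof.
move=> xE; apply: (big_ind2 (fun a b => a = val b)) => // a1 b1 a2 b2 -> ->.
by rewrite valD.
Qed.

Section Generators.
Variables g xi : nat -> V.
Local Notation J := (gen_index (n - h) h).
Local Notation generators := (gens (fun k : 'I_(n - h) => val (g (h + k)%N))
  (fun k : 'I_h => val (xi k)) (fun k : 'I_h => val (g k))).
Local Notation lincomb c :=
  (\big[add/0]_i \big[add/0]_(g in G) act ((c : {ffun J -> {ffun gT -> C}}) i g)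
     (ga g (generators i))).
Local Notation rank := (@gen_rank n h).

Lemma generatorsE i : generators i = val (gen_family n g xi (rank i)).
Proof. by rewrite (gens_rank hn (val \o g) (val \o xi)) /gen_family; case: ifP. Qed.

Lemma lincombE (P : nat -> {poly R}) (c : {ffun J -> {ffun gT -> C}}) :
  (forall i, c i = gr_val sigma v (P (rank i))) -> lincomb c = val (gen_comb sg n h g xi P).
Proof.
move=> cE; rewrite /gen_comb -(gen_rank_sum hn (fun k => pact sg (P k) (gen_family n g xi k))).
apply: big_val => i _; rewrite generatorsE cE; set x := gen_family _ _ _ _.
have /choice[lg lgE] : forall k, exists l, k \in G -> k = (sigma ^+ l)%g.
  by move=> k; have [/cycleP[l ->]|_] := boolP (k \in G); [exists l|exists 0%N].
rewrite -(gr_poly_act (gA := fun k => iter (lg k) sg x) (sigma := sigma)); last first.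
  by move=> l; apply: val_inj; rewrite -!gaE -lgE ?mem_cycle.
apply: big_val => k kG; rewrite valZ ffunE; congr act.
by rewrite {1}(lgE k kG) gaE.
Qed.

Lemma gen_rel_sum (D : nat -> {poly R}) (i : J) :
  \sum_(k < h) gr_mul (gr_val sigma v (D k)) (gen_rel (n - h) (v w) s sigma k i) =
  gr_val sigma v (rel_coef w n h s D (rank i)).
Proof.
under eq_bigr => k _ do rewrite /gen_rel ffunE [X in _ + X]ffunE gr_mulB -rmorphXn.
rewrite sumrB !(sum_gr_mul_basis (fun k => gr_val sigma v (D k))); try by move=> k l [].
rewrite /rel_coef; case: i => [k|[k|k]].
- case: pickP => [? /eqP //|_].
  by rewrite /= ltnNge leq_addr -ltn_subRL ltn_ord subrr gr_val0.
- case: pickP => [l /eqP[<-]|/(_ k)]; last by rewrite eqxx.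
  case: pickP => [? /eqP //|_]; rewrite /= subr0 ltnNge (leq_trans hn) ?leq_addr //=.
  by rewrite ltnNge leq_addr addKn gr_val_scale.
case: pickP => [? /eqP //|_]; case: pickP => [l /eqP[<-]|/(_ k)]; last by rewrite eqxx.
by rewrite /= ltn_ord sub0r gr_val_Xsub1 gr_valN.
Qed.

Hypothesis generates : forall x, exists P, x = gen_comb sg n h g xi P.
Hypothesis relations : forall P, gen_comb sg n h g xi P = 0 ->
  exists D, forall i, (i < n + h)%N -> cyc #[sigma]%g (P i - rel_coef w n h s D i).
Hypothesis rel_coef0 : forall D, gen_comb sg n h g xi (rel_coef w n h s D) = 0.

Lemma lincomb_eq0 (c : {ffun J -> {ffun gT -> C}}) : (forall i, in_group_ring A G (c i)) ->
  lincomb c = 0 <-> exists2 d : 'I_h -> {ffun gT -> C}, forall k, in_group_ring A G (d k) &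
    c = [ffun i => \sum_(k < h) gr_mul (d k) (gen_rel (n - h) (v w) s sigma k i)].
Proof.
move=> /(gr_val_surjective_family v_inj AP)[Q cQ].
have [P PE] := extend_by_rank hn 0 Q.
have cP i : c i = gr_val sigma v (P (rank i)) by rewrite PE.
split=> [|[d /(gr_val_surjective_family v_inj AP)[D' dE] ->]].
  rewrite (lincombE cP) -val0 => /val_inj/relations[D PD].
  exists (fun k => gr_val sigma v (D k)) => [k|]; first exact: gr_val_mem.
  apply/ffunP => i; rewrite [RHS]ffunE gen_rel_sum cP; apply/ffunP => k; rewrite !ffunE.
  by rewrite (gr_poly_cyc (PD _ (gen_rank_lt i))).
pose D k : {poly R} := if insub k is Some l then D' l else 0.
rewrite (@lincombE (rel_coef w n h s D)) ?rel_coef0 // => i; rewrite ffunE -gen_rel_sum.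
by apply: eq_bigr => k _; rewrite dE /D valK.
Qed.

Theorem gen_comb_presentation :
  presentation add act ga G A B (v w) s sigma (fun k : 'I_(n - h) => val (g (h + k)%N))
    (fun k : 'I_h => val (xi k)) (fun k : 'I_h => val (g k)).
Proof.
split=> [i|x /BP[y ->]|c]; last exact: lincomb_eq0.
  by apply/BP; rewrite generatorsE; eexists.
have [P ->] := generates y; exists [ffun i => gr_val sigma v (P (rank i))].
  by move=> i; rewrite ffunE; apply: gr_val_mem.
by rewrite (@lincombE P) // => i; rewrite ffunE.
Qed.

End Generators.

Theorem cyclic_module_presentation p m (zeta : nat -> V) : cdvr w -> prime p ->
    divides w p%:R -> p%:R <> 0 :> R -> (0 < s)%N -> #[sigma]%g = (p ^ m)%N ->
    cyclic_module w sg (p ^ m) n h s zeta ->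
  exists (theta : 'I_(n - h) -> C) (xi omega : 'I_h -> C),
    presentation add act ga G A B (v w) s sigma theta xi omega.
Proof.
move=> cd p_pr w_p p_neq0 s_gt0 sigma_order cm.
have [g [xi nb]] := exists_norm_basis cd p_pr w_p p_neq0 s_gt0 hn cm.
do 3!eexists; apply: gen_comb_presentation.
- exact: (gen_comb_generates cd p_pr w_p p_neq0 cm nb).
- by move=> P; rewrite sigma_order; apply: (relation_generated cd p_pr w_p p_neq0 hn cm nb).
exact: (gen_comb_rel_coef hn nb).
Qed.

End Presentation.

(** * The module of points over an unramified [p]-extension *)

Section AbstractPoints.
Variables (C : fieldType) (R OL : comNzRingType).
Variables (v : {rmorphism R -> C}) (vL : {rmorphism OL -> C}) (w : R) (t : OL).
Variables (I : nat -> C -> Prop) (F : mfps 2 C) (f : fps C) (add act : C -> C -> C).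
Variable fm : formal_module v I F f add act.
Local Notation A := (FM fm).
Local Notation pi := (v w).
Variables (q h s e n : nat) (rho : nat -> R) (aL : nat -> OL).
Hypotheses (cd : cdvr w) (cdL : cdvr t) (rhoP : residue_system w q rho).
Hypotheses (q1 : (1 < q)%N) (h_gt0 : (0 < h)%N) (s_gt0 : (0 < s)%N) (e0 : (0 < e)%N).
Hypotheses (pi0 : pi != 0) (pi_order : has_order I pi e) (I1 : ~ I 1%N 1).
Hypotheses (vLI : forall a, I 0%N (vL a)) (It : I 1%N (vL t)).
Hypothesis aLE : forall i, vL (aL i) = fg_mul f pi i.
Hypothesis aL_degree : weierstrass_degree t aL (q ^ h).
Hypothesis mul_pi_low : forall i, (i < q ^ h)%N -> I e (fg_mul f pi i).

Variables (Kal : closedFieldType) (iota : {rmorphism C -> Kal}).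
Variables (intK maxK : Kal -> Prop) (smallK : nat -> Kal -> Prop).
Hypothesis closure : closure_model I iota intK maxK smallK.
Hypothesis torsion_points : forall z, maxK z ->
  (forall k, exists N, forall d, (N <= d)%N ->
     smallK k (pev iota (fps_trunc d (fg_mul f (v (w ^+ s)))) z)) ->
  exists x : A, iota (fmval x) = z.
Hypothesis torsion_OL : forall x : A, torsion w x ->
  w ^+ s *: x = 0 /\ exists2 b, vL b = fmval x & divides t b.

Lemma uniformizer_fibers (y : A) : w ^+ s.-1 *: y = 0 ->
  exists z : nat -> A, representatives (fun x => w *: x = y) eq (q ^ h) z.
Proof.
move=> wy; have [_ [b bE b_low]] := torsion_OL (ex_intro _ _ wy).
apply: (fiber_representatives cdL _ s_gt0 e0 pi0 pi_order I1 vLI It aLE aL_degree closure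
  torsion_points bE b_low wy).
by rewrite expn_gt0 (ltnW q1).
Qed.

Lemma exists_uniformizer_torsion : exists2 x : A, w *: x = 0 & x <> 0.
Proof.
have [|z [zw _ z_inj]] := @uniformizer_fibers 0; first by rewrite scaler0.
have q_h : (1 < q ^ h)%N by rewrite -(expn0 q) ltn_exp2l.
apply: contrapT => no_torsion.
have z0 i : (i < q ^ h)%N -> z i = 0.
  by move=> /zw wz; apply: contrapT => nz; apply: no_torsion; exists (z i).
by have := z_inj 0%N 1%N (ltnW q_h) q_h; rewrite !z0 ?(ltnW q_h) // => /(_ erefl).
Qed.

Hypothesis le_en : (e <= n)%N.

Lemma height_le_rank : (h <= n)%N.
Proof.
have [x wx x0] := exists_uniformizer_torsion; have q_h : (h < q ^ h)%N by rewrite ltn_expl.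
have := height_le_order pi0 pi_order (leq_ltn_trans h_gt0 q_h) mul_pi_low wx x0.
by move=> le_qe; rewrite -ltnS (leq_trans q_h) // -ltnS -(ltn_predK q_h) !ltnS (leq_trans le_qe).
Qed.

Variables (p m : nat) (sg : {rmorphism C -> C}) (eb : nat -> C).
Hypotheses (p_pr : prime p) (w_p : divides w p%:R) (p_neq0 : p%:R <> 0 :> R).
Hypothesis sgA : cyclic_action v I F (fg_mul f) sg (p ^ m).
Hypotheses (sg_vL : forall a, sg (vL a) = vL a) (ebP : fixed_basis v I sg n eb).

Lemma points_cyclic_module : exists zeta, cyclic_module w (sgL fm sgA) (p ^ m) n h s zeta.
Proof.
have [zeta tb] := torsion_structure cd q1 s_gt0 rhoP
  (fun x tor_x => proj1 (torsion_OL tor_x)) uniformizer_fibers.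
exists zeta; split=> //.
- exact: sgL_order.
- by move=> x; apply: nrm_surjective.
- by move=> x; apply: nrm_kernel.
- by move=> x; apply: (fm_scale_separated e0 pi_order).
- by move=> x /torsion_OL[_ [b bE _]]; apply/fixedP; rewrite -bE sg_vL.
exact: (fixed_points_rank fm sgA cd e0 pi0 pi_order ebP).
Qed.

Variables (gT : finGroupType) (sigma : gT) (ga : gT -> C -> C) (S B : C -> Prop).
Hypotheses (v_inj : injective v) (sigma_order : #[sigma]%g = (p ^ m)%N).
Hypothesis gaE : forall l x, I 1%N x -> ga (sigma ^+ l)%g x = iter l sg x.
Hypotheses (SP : forall x, S x <-> exists a, x = v a) (BP : forall x, B x <-> I 1%N x).

Theorem points_presentation : (h <= n)%N /\
  exists (theta : 'I_(n - h) -> C) (xi omega : 'I_h -> C),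
    presentation add act ga <[sigma]>%g S B pi s sigma theta xi omega.
Proof.
have hn := height_le_rank; split=> //; have [zeta cm] := points_cyclic_module.
apply: (cyclic_module_presentation v_inj (@fmval_inj _ _ _ _ _ _ _ _ fm) _ _ _ _ hn SP _ cd
  p_pr w_p p_neq0 s_gt0 sigma_order cm) => //.
- by move=> l x; rewrite fmval_iter gaE //; apply: fmvalP.
move=> x; split=> [Bx|[y ->]]; last exact: (proj2 (BP _) (fmvalP y)).
by exists (toFM fm (proj1 (BP x) Bx)).
Qed.

End AbstractPoints.

(** * Points over a local field *)

(* An abstract copy [R] of the ring of integers of [E]: computing with the
   subtype [OE E] is slow. *)
Record integer_model p (p_pr : prime p) (Omega : fieldExtType (padic p_pr))
    (E : {subfield Omega}) (R : comNzRingType) (v : {rmorphism R -> Omega}) (w : R) : Prop :=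
  IntegerModel {
  model_inj : injective v;
  model_image : forall x, integer_of E x <-> exists a, x = v a;
  model_uniformizer : is_uniformizer E (v w);
  model_cdvr : cdvr w }.

Section IntegerModel.
Variables (p : nat) (p_pr : prime p) (Omega : fieldExtType (padic p_pr)).
Variables (E : {subfield Omega}) (R : comNzRingType) (v : {rmorphism R -> Omega}) (w : R).

Lemma p_neq0_of_rmorphism : p%:R <> 0 :> R.
Proof. by move=> /(congr1 v); rewrite rmorph_nat rmorph0; apply/eqP/omega_p_neq0. Qed.

Hypothesis model : integer_model E v w.

Lemma model_integer a : integer_of E (v a).
Proof. by apply/(model_image model); exists a. Qed.

Lemma model_dividesP a : divides w a <-> maxideal_of E (v a).
Proof.
split=> [[b ->]|/(model_uniformizer model)[_ /(model_image model)[b ->] ab]].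
  by apply/(model_uniformizer model); exists (v b); [apply: model_integer|rewrite rmorphM].
by exists b; apply: (model_inj model); rewrite rmorphM.
Qed.

Lemma model_residue_system q : residue_card E q -> exists rho, residue_system w q rho.
Proof.
move=> /residue_card_representatives[z [zE z_surj z_inj]].
have [rho rhoE] := bounded_choice 0 (fun i lt_iq => proj1 (model_image model _) (zE i lt_iq)).
exists rho; split=> // [a _|i j lt_iq lt_jq /model_dividesP].
  have [i lt_iq mi] := z_surj _ (model_integer a); exists i => //.
  by apply/model_dividesP; rewrite rmorphB -rhoE.
by rewrite rmorphB -!rhoE //; apply: z_inj.
Qed.

Lemma model_divides_p : divides w p%:R.
Proof. by apply/model_dividesP; rewrite rmorph_nat; apply: p_maxideal_of. Qed.

End IntegerModel.

Record integer_basis p (p_pr : prime p) (Omega : fieldExtType (padic p_pr))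
    (R : comNzRingType) (v : {rmorphism R -> Omega}) (E : {subfield Omega}) n
    (e : nat -> Omega) : Prop := IntegerBasis {
  integer_basis_int : forall i, (i < n)%N -> integer_of E (e i);
  integer_basis_gen : forall x, integer_of E x ->
    exists a : nat -> R, x = \sum_(i < n) v (a i) * e i;
  integer_basis_indep : forall a : nat -> R, \sum_(i < n) v (a i) * e i = 0 ->
    forall i, (i < n)%N -> a i = 0;
  integer_basis_dependence : forall y : nat -> Omega,
    (forall i, (i <= n)%N -> integer_of E (y i)) ->
    ~ (forall a : nat -> R, \sum_(i < n.+1) v (a i) * y i = 0 ->
         forall i, (i < n.+1)%N -> a i = 0) }.

Lemma exists_integer_model p (p_pr : prime p) (Omega : fieldExtType (padic p_pr))
    (E : {subfield Omega}) t : is_uniformizer E t ->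
  exists (R : comNzRingType) (v : {rmorphism R -> Omega}) (w : R),
    [/\ integer_model E v w, v w = t & forall E' : {subfield Omega}, (E <= E')%VS ->
       exists e, integer_basis v E' (\dim_E E') e].
Proof.
move=> ut; pose w := toOE (uniformizer_int ut).
have cd : cdvr w by apply: uniformizer_cdvr; exact: ut.
exists (OE E), (val : {rmorphism OE E -> Omega}), w; split=> // [|E' sEE'].
  split=> // [|x]; first exact: val_inj.
  by split=> [ix|[a ->]]; [exists (toOE ix)|apply: val_OEP].
have [e [eE' e_indep e_gen]] := integer_of_basis cd sEE'.
exists e; split=> // [x ix|y yE' indep].
  by have [a /eqP] := e_gen x ix; rewrite subr_eq0 => /eqP xE; exists a.
exact: (integer_of_dependence cd sEE' yE' indep).
Qed.

Section Points.
Variables (p : nat) (p_pr : prime p) (Omega : splittingFieldType (padic p_pr)).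
Variables (K0 K L M : {subfield Omega}) (R OL : comNzRingType).
Variables (v : {rmorphism R -> Omega}) (w : R) (vL : {rmorphism OL -> Omega}) (t : OL).
Hypotheses (K0_model : integer_model K0 v w) (L_model : integer_model L vL t).
Variables (Kalg : closedFieldType) (iota : {rmorphism Omega -> Kalg}).
Variables (q : nat) (phi : gal_of K) (m : nat) (sigma : gal_of M).
Variables (F : mfps 2 Omega) (f u : fps Omega) (h n s : nat) (e : nat -> Omega).
Local Notation O := (@padic_int_in p p_pr Omega).
Local Notation pi := (v w).
Local Notation I := (ideal_power (integer_of M) (vL t)).
Hypotheses (hd : honda_data K0 pi q phi F f u h) (LM : cyclic_extension L m sigma).
Hypotheses (sKL : (K <= L)%VS) (s_gt0 : (0 < s)%N).
Hypotheses (L_basis : integer_basis v L n e) (utM : is_uniformizer M (vL t)).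
Hypothesis alg : padic_algebraic (iota \o O).
Hypothesis torsion_L : forall z, fg_torsion iota f pi s z ->
  exists2 x, maxideal_of L x & z = iota x.
Hypothesis torsion_M : forall x, maxideal_of M x -> fg_torsion_all iota f pi (iota x) ->
  fg_torsion iota f pi s (iota x).

Let upi := model_uniformizer K0_model.
Let utL := model_uniformizer L_model.
Let cd := model_cdvr K0_model.
Let cdL := model_cdvr L_model.
Let pi0 : pi != 0. Proof. exact: (uniformizer_neq0 upi). Qed.
Let sLM := cyclic_extension_sub LM.
Let sKM : (K <= M)%VS. Proof. exact: (subv_trans sKL sLM). Qed.
Let IM := maxideal_ofE utM.
Let I0 x : I 0%N x <-> integer_of M x. Proof. exact: ideal_power0. Qed.
Let I1 : ~ I 1%N 1. Proof. by move=> /IM; apply: one_not_maxideal. Qed.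

Let mulK a d : integer_of K (fg_mul f (v a) d).
Proof. exact: (fg_mul_integer hd d (model_integer K0_model a)). Qed.

Let mulM a d : integer_of M (fg_mul f (v a) d).
Proof. exact: (integer_ofS sKM (mulK a d)). Qed.

Let fm : formal_module v I F f (fg_add F) (fg_act f).
Proof. exact: (honda_formal_module hd sKM utM (model_integer K0_model)). Qed.
Local Notation A := (FM fm).

Lemma pi_power_torsionP k (x : A) : w ^+ k *: x = 0 <-> fg_torsion iota f pi k (iota (fmval x)).
Proof.
rewrite /fg_torsion -rmorphXn (fps_eval_iota alg utM (mulM _) (fmvalP x)).
split=> [wx|[_ /eqP]]; last first.
  by rewrite fmorph_eq0 => /eqP wx; apply: fmval_eq0; rewrite fmvalZ.
split; last by rewrite -[fps_eval _ _ _](fmvalZ (w ^+ k) x) wx fmval0 rmorph0.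
exact: (maxideal_iota iota (proj2 (proj2 (IM _) (fmvalP x)))).
Qed.

Lemma torsion_in_L (x : A) : torsion w x ->
  w ^+ s *: x = 0 /\ exists2 b, vL b = fmval x & divides t b.
Proof.
move=> [k wkx]; have mx := proj2 (IM _) (fmvalP x).
have tors : fg_torsion iota f pi s (iota (fmval x)).
  apply: torsion_M => //; exists k.+1 => //; apply/pi_power_torsionP.
  by rewrite exprS -scalerA wkx scaler0.
split; first exact: (proj2 (pi_power_torsionP s x) tors).
have [x' mx' /fmorph_inj xx'] := torsion_L tors; rewrite -xx' in mx'.
have [b bE] := proj1 (model_image L_model _) (maxideal_of_int mx').
by exists b => //; apply: (proj2 (model_dividesP L_model b)); rewrite -bE.
Qed.

Lemma sigma_cyclic_action : cyclic_action v I F (fg_mul f) sigma (p ^ m).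
Proof.
split; [by move=> d x; exact: (sigma_mem LM utL)|move=> k|move=> a d|move=> x|].
- exact: (sigma_fix LM (subvP sKL _ (proj1 (honda_data_coef hd k)))).
- exact: (sigma_fix LM (subvP sKL _ (proj1 (mulK a d)))).
- by move=> Ix; apply: (iter_sigma_order LM (proj1 (proj1 (I0 x) Ix))).
exact: (sigma_trace_one LM utL utM).
Qed.

Lemma sigma_fixed_basis : exists eb, fixed_basis v I sigma n eb.
Proof.
pose eb k := if (k < n)%N then e k else 0.
have ebL k : integer_of L (eb k).
  by rewrite /eb; case: ifP => [lt_kn|_]; [apply: (integer_basis_int L_basis)|apply: integer_of0].
have ebE (a : nat -> R) : \sum_(k < n) v (a k) * eb k = \sum_(k < n) v (a k) * e k.
  by apply: eq_bigr => k _; rewrite /eb ltn_ord.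
exists eb; split=> [k|k|x Ix sx|a].
- exact: (proj2 (I0 _) (integer_ofS sLM (ebL k))).
- exact: (sigma_fix LM (proj1 (ebL k))).
- have ix := proj1 (I0 x) Ix; have xL := sigma_fixed LM (proj1 ix) sx.
  have [a xE] := integer_basis_gen L_basis (conj xL (proj2 ix)).
  by exists a; rewrite ebE.
by rewrite ebE; apply: (integer_basis_indep L_basis).
Qed.

Lemma mul_pi_weierstrass : exists aL : fps OL,
  (forall i, vL (aL i) = fg_mul f pi i) /\ weierstrass_degree t aL (q ^ h).
Proof.
have /choice[aL aLE] i : exists a, fg_mul f pi i = vL a.
  exact: (proj1 (model_image L_model _) (integer_ofS sKL (mulK w i))).
exists aL; split=> [i|]; first by rewrite aLE.
split=> [i lt_iq|].
  apply: (proj2 (model_dividesP L_model _)); rewrite -aLE.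
  exact: (maxideal_ofS sKL (fg_mul_pi_low hd lt_iq)).
have [b ib] := fg_mul_pi_unit hd.
have [c ->] := proj1 (model_image L_model _) (integer_ofS sKL ib).
rewrite aLE -rmorphM -(rmorph1 vL) => /(model_inj L_model) ac.
by exists c.
Qed.

Lemma integer_torsion_point z : maxideal (iota \o O) z ->
    (forall k, exists N, forall d, (N <= d)%N ->
       small iota k (pev iota (fps_trunc d (fg_mul f (v (w ^+ s)))) z)) ->
  exists x : A, iota (fmval x) = z.
Proof.
move=> mz mul_z; have [|x mx ->] := torsion_L (z := z); last first.
  by exists (toFM fm (proj1 (IM x) (maxideal_ofS sLM mx))).
split=> //; apply: (closure_lim alg) => k; have [N NP] := mul_z k.
by exists N => d /NP; rewrite subr0 fps_trunc_iota rmorphXn.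
Qed.

Lemma ramification_le_dim r : has_order I pi r -> (r <= n)%N.
Proof.
move=> pi_r; have tM := uniformizer_int utM.
apply: (ramification_le_rank (integer_of_subring M) tM (uniformizer_neq0 utL) I1 pi0 pi_r cd
  erefl) => [a|].
  exact: (integer_ofS (subv_trans (honda_data_sub hd) sKM) (model_integer K0_model a)).
apply: (integer_basis_dependence L_basis) => i _.
by apply: (subringX (integer_of_subring L)); apply: (uniformizer_int utL).
Qed.

Theorem honda_points_presentation : (h <= n)%N /\
  exists (theta : 'I_(n - h) -> Omega) (xi omega : 'I_h -> Omega),
    presentation (fg_add F) (fg_act f) (fun (g : gal_of M) x => g x) <[sigma]>%g
      (integer_of K0) (maxideal_of M) pi s sigma theta xi omega.
Proof.
have [r r0 pi_r] := pi_order hd sKM utM; have [eb ebP] := sigma_fixed_basis.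
have [rho rhoP] := model_residue_system K0_model (honda_data_residue hd).
have [aL [aLE aL_degree]] := mul_pi_weierstrass.
apply: (points_presentation (fm := fm) cd cdL rhoP (honda_data_q_gt1 hd)
  (honda_data_height_gt0 hd) s_gt0 r0 pi0 pi_r I1 _ (proj1 (IM _) (uniformizer_max utM)) aLE
  aL_degree _ (closure_modelP alg utM) integer_torsion_point torsion_in_L
  (ramification_le_dim pi_r) p_pr (model_divides_p K0_model) (p_neq0_of_rmorphism v)
  sigma_cyclic_action _ ebP (model_inj K0_model) (sigma_order LM) _ (model_image K0_model) IM).
- by move=> a; apply: (proj2 (I0 _) (integer_ofS sLM (model_integer L_model a))).
- move=> i lt_iq; have [c ic ->] := proj1 (honda_uniformizerK hd _) (fg_mul_pi_low hd lt_iq).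
  by rewrite -[r]addn0; apply/pi_r; exists c; [exact: (proj2 (I0 _) (integer_ofS sKM ic))|].
- by move=> a; apply: (sigma_fix LM (proj1 (model_integer L_model a))).
by move=> l x Ix; rewrite (iter_sigma _ _ (proj1 (proj2 (IM _) Ix))).
Qed.

End Points.

Theorem mainTheorem1 (p : nat) (p_pr : prime p)
    (Omega : splittingFieldType (padic p_pr))
    (K0 K L M : {subfield Omega})
    (Kalg : closedFieldType) (iota : {rmorphism Omega -> Kalg})
    (pi : Omega) (q : nat) (phi : gal_of K)
    (m : nat) (sigma : gal_of M)
    (F : mfps 2 Omega) (f u : fps Omega) (h s : nat)
    (sK0K : (K0 <= K)%VS) (sKL : (K <= L)%VS) (sLM : (L <= M)%VS)
    (Kalg_algebraic : forall z : Kalg, exists P : {poly Omega},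
       [/\ P != 0, P \is a polyOver K & root (map_poly iota P) z])
    (pi_unif : is_uniformizer K0 pi)
    (K_unram : unramified K0 K)
    (k0_card : residue_card K0 q)
    (phi_frob : is_frobenius K0 q phi)
    (M_unram : unramified L M)
    (M_galois : galois L M)
    (G_order : #|'Gal(M / L)%g| = (p ^ m)%N)
    (G_gen : 'Gal(M / L)%g = <[sigma]>%g)
    (u_type : is_honda_type K pi u)
    (u_height : type_height K u h)
    (F_honda : is_honda_group pi q phi u F f)
    (s_ge1 : (1 <= s)%N)
    (W_L : forall z : Kalg,
       (fg_torsion_all iota f pi z /\ exists2 x, maxideal_of L x & z = iota x)
       <-> fg_torsion iota f pi s z)
    (W_M : forall z : Kalg,
       (fg_torsion_all iota f pi z /\ exists2 x, maxideal_of M x & z = iota x)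
       <-> fg_torsion iota f pi s z) :
  let n := (\dim_K0 L)%N in
  let G := 'Gal(M / L)%g in
  let OK0G := in_group_ring (integer_of K0) G in
  (h <= n)%N /\
  exists (theta : 'I_(n - h) -> Omega) (xi omega : 'I_h -> Omega),
    let gen := gens theta xi omega in
    [/\ forall i, maxideal_of M (gen i),
        forall x, maxideal_of M x ->
          exists2 c : {ffun gen_index (n - h) h -> {ffun gal_of M -> Omega}},
            forall i, OK0G (c i) & x = fg_lincomb G F f c gen
      & forall c : {ffun gen_index (n - h) h -> {ffun gal_of M -> Omega}},
          (forall i, OK0G (c i)) ->
          (fg_lincomb G F f c gen = 0 <->
           exists2 d : 'I_h -> {ffun gal_of M -> Omega},
             forall k, OK0G (d k) &
             c = [ffun i => \sum_(k < h)
                    gr_mul (d k) (gen_rel (n - h) pi s sigma k i)])].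
Proof.
have [R [v [w [K0_model piE K0_basis]]]] := exists_integer_model pi_unif; subst pi.
have [e L_basis] := K0_basis L (subv_trans sK0K sKL).
have [t0 utL] := exists_uniformizer L.
have [OL [vL [t [L_model tE _]]]] := exists_integer_model utL; subst t0.
have utM := uniformizer_unramified M_unram sLM utL.
have alg : padic_algebraic (iota \o @padic_int_in p p_pr Omega).
  by move=> z; have [P [P0 _ rP]] := Kalg_algebraic z; apply: closure_algebraic P0 rP.
have hd : honda_data K0 (v w) q phi F f u h by [].
have LM : cyclic_extension L m sigma by [].
rewrite G_gen.
apply: (honda_points_presentation K0_model L_model hd LM sKL s_ge1 L_basis utM alg).
  by move=> z /W_L[].
by move=> x mx tors; apply/W_M; split=> //; exists x.
Qed.
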